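(* Consider the censoring setting with $n$ i.i.d. copies of $(X,O,Y)$ and target parameter $\tau_0=\mathbb{E}[Y(1)-Y(0)]$. Assume: (Unconfoundedness) $(Y(1),Y(0))$ is independent of $(O,D)$ conditionally on $X$. (Common support) There is a constant $c>0$, independent of $n$, such that $\pi_0(d\mid x)>c$, $g_0(d\mid x)>c$, $\zeta_{\mathrm{T},0}(x)>c$, $\zeta_0(x)>c$ for all $x\in\mathcal{X}$ and $d\in\{0,1\}$. Then the asymptotic variance of any regular estimator of $\tau_0$ is lower bounded by $$V^{\mathrm{cens}}:=\mathbb{E}\left[\Psi^{\mathrm{cens}}(X,O,Y;\mu_{\mathrm{T},0},\nu_0,\pi_0,g_0,\tau_0)^2\right]=\mathbb{E}\left[\left(1-\frac{g_0(1\mid X)}{g_0(0\mid X)}\right)^2\frac{\mathrm{Var}(Y(1)\mid X)}{\pi_0(1\mid X)}+\frac{\mathrm{Var}(\widetilde{Y}\mid X)}{g_0(0\mid X)^2\,\pi_0(1\mid X)}+\bigl(\tau_0(X)-\tau_0\bigr)^2\right].$$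
   Context: Censoring setting. $Y(1),Y(0)\in\mathbb{R}$ are potential outcomes, $X\in\mathcal{X}\subset\mathbb{R}^p$ covariates with density $\zeta_0$, $D\in\{0,1\}$ an unobserved treatment indicator, $O\in\{0,1\}$ an observation indicator; $O=1$ implies $D=1$. Set $\widetilde{Y}=\mathbf{1}[D=1]Y(1)+\mathbf{1}[D=0]Y(0)$ and $Y=\mathbf{1}[O=1]Y(1)+\mathbf{1}[O=0]\widetilde{Y}$. One observes $n$ i.i.d. copies of $(X,O,Y)$. All densities are assumed to exist. $\mathbb{E},\mathbb{P},\mathrm{Var}$ are under the true distribution $P_0$. Notation: $\pi_0(o\mid X)=\mathbb{P}(O=o\mid X)$; $g_0(d\mid X)=\mathbb{P}(D=d\mid X,O=0)$; $\mu_{\mathrm{T},0}(X)=\mathbb{E}[Y(1)\mid X]$; $\mu_{\mathrm{C},0}(X)=\mathbb{E}[Y(0)\mid X]$; $\tau_0(X)=\mu_{\mathrm{T},0}(X)-\mu_{\mathrm{C},0}(X)$; $\nu_0(X)=\mathbb{E}[\widetilde{Y}\mid X,O=0]$; $\zeta_{\mathrm{T},0}$ is the density of the covariates in the treatment group (units receiving treatment $1$). Further, $$\begin{aligned}\Psi^{\mathrm{cens}}(X,O,Y;\mu_{\mathrm{T},0},\nu_0,\pi_0,g_0,\tau_0)=&\ \frac{\mathbf{1}[O=1](Y-\mu_{\mathrm{T},0}(X))}{\pi_0(1\mid X)}-\frac{\mathbf{1}[O=0](Y-\nu_0(X))}{g_0(0\mid X)\pi_0(0\mid X)}+\frac{g_0(1\mid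 X)\mathbf{1}[O=1](Y-\mu_{\mathrm{T},0}(X))}{g_0(0\mid X)\pi_0(1\mid X)}\\&+\mu_{\mathrm{T},0}(X)-\frac{1}{g_0(0\mid X)}\nu_0(X)+\frac{g_0(1\mid X)}{g_0(0\mid X)}\mu_{\mathrm{T},0}(X)-\tau_0.\end{aligned}$$ ''Regular estimator'' is meant in the usual sense of semiparametric efficiency theory, and asymptotic variance refers to the limit distribution of $\sqrt{n}$ times the estimation error.
   Formalization: The second formula for V^cens is false as printed; proved with (1+g_0(1|X)/g_0(0|X))^2 in the first term and Var(Y~|X,O=0)/(g_0(0|X)^2 pi_0(0|X)) as the second. Y(1), Y(0) are taken to have finite second moments. *)

(* Defs.v *)
From HB Require Import structures.
From mathcomp Require Import all_boot all_order all_algebra.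
From mathcomp Require Import all_classical all_reals all_analysis.
Set Implicit Arguments.
Unset Strict Implicit.
Unset Printing Implicit Defensive.
Import Order.TTheory GRing.Theory Num.Theory.
Import numFieldNormedType.Exports.
Local Open Scope classical_set_scope.
Local Open Scope ring_scope.

Section tuple_cons.
Context d (T : measurableType d) (n : nat).

Definition tcons (z : T * n.-tuple T) : n.+1.-tuple T :=
  [the n.+1.-tuple T of z.1 :: z.2].

Let measurable_tcons : measurable_fun [set: T * n.-tuple T] tcons.
Proof. exact: measurable_cons. Qed.

HB.instance Definition _ :=
  isMeasurableFun.Build _ _ _ _ tcons measurable_tcons.
End tuple_cons.

Section tuple_power.
Local Open Scope ereal_scope.
Context d (T : measurableType d) (R : realType).

Section step.
Variables (n : nat) (mu : {sigma_finite_measure set T -> \bar R})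
  (nu : {sigma_finite_measure set (n.-tuple T) -> \bar R}).

Definition tuple_step : set (n.+1.-tuple T) -> \bar R :=
  pushforward (mu \x nu) (@tcons _ T n).

Let tuple_step0 : tuple_step set0 = 0.
Proof. exact: measure0. Qed.

Let tuple_step_ge0 A : 0 <= tuple_step A.
Proof. exact: measure_ge0. Qed.

Let tuple_step_sigma_additive : semi_sigma_additive tuple_step.
Proof.
exact: measure_semi_sigma_additive.
Qed.

HB.instance Definition _ := isMeasure.Build _ _ _ tuple_step
  tuple_step0 tuple_step_ge0 tuple_step_sigma_additive.

Let tuple_step_sigma_finite : sigma_finite setT tuple_step.
Proof.
have /sigma_finiteP[F [FT ndF Foo]] := sigma_finiteT mu.
have /sigma_finiteP[G [GT ndG Goo]] := sigma_finiteT nu.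
pose u (t : n.+1.-tuple T) : T * n.-tuple T := (thead t, [tuple of behead t]).
have mu_ : measurable_fun setT u.
  apply/measurable_fun_pairP; split => /=.
    exact: (measurable_tnth ord0).
  exact: measurable_behead.
have uK : u \o @tcons _ T n = id.
  apply/funext => -[a t]; rewrite /u /= theadE; congr pair.
  exact: val_inj.
exists (fun k => u @^-1` (F k `*` G k)).
  rewrite -preimage_bigcup; apply/esym/seteqP; split => // t _.
  have [i _ Fi] : (\bigcup_i F i) (u t).1 by rewrite -FT.
  have [j _ Gj] : (\bigcup_i G i) (u t).2 by rewrite -GT.
  exists (maxn i j) => //; split.
    by move: Fi; exact/subsetPset/ndF/leq_maxl.
  by move: Gj; exact/subsetPset/ndG/leq_maxr.
move=> k; have [mFk Fkoo] := Foo k; have [mGk Gkoo] := Goo k; split.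
  by rewrite -[X in measurable X]setTI; apply: mu_ => //; exact: measurableX.
rewrite /tuple_step /pushforward -comp_preimage uK preimage_id.
by rewrite product_measure1E// lte_mul_pinfty// ge0_fin_numE.
Qed.

HB.instance Definition _ :=
  Measure_isSigmaFinite.Build _ _ _ tuple_step tuple_step_sigma_finite.
End step.

Fixpoint tuple_measure (mu : {sigma_finite_measure set T -> \bar R}) (n : nat)
    : {sigma_finite_measure set (n.-tuple T) -> \bar R} :=
  match n return {sigma_finite_measure set (n.-tuple T) -> \bar R} with
  | 0%N => \d_ ([tuple] : 0.-tuple T)
  | m.+1 => tuple_step mu (tuple_measure mu m)
  end.

Fixpoint iid (P : probability T R) (n : nat) : probability (n.-tuple T) R :=
  match n return probability (n.-tuple T) R with
  | 0%N => \d_ ([tuple] : 0.-tuple T)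
  | m.+1 => distribution (P \x iid P m) (@tcons _ T m)
  end.
End tuple_power.

Lemma sigma_finite_counting_bool (R : realType) :
  sigma_finite [set: bool] (@counting bool R).
Proof.
exists (fun=> setT); first by apply/seteqP; split => // x _; exists 0%N.
move=> _; split => //; rewrite /counting asboolT ?ltry//.
exact: finite_finset.
Qed.

HB.instance Definition _ (R : realType) :=
  @isSigmaFinite.Build _ _ _ (@counting bool R) (sigma_finite_counting_bool R).

Local Notation mR := measurableTypeR.

Definition lebesgue_tuple (R : realType) (p : nat) :
    {sigma_finite_measure set (p.-tuple (mR R)) -> \bar R} :=
  tuple_measure (@lebesgue_measure R) p.

(* A unit is (X, (O, D), (Y(1), Y(0))); an observation is (X, O, Y). *)
Notation covariates R p := (p.-tuple (measurableTypeR R)) (only parsing).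
Notation full_data R p :=
  (p.-tuple (measurableTypeR R) * (bool * bool) *
   (measurableTypeR R * measurableTypeR R))%type (only parsing).
Notation obs_data R p :=
  (p.-tuple (measurableTypeR R) * bool * measurableTypeR R)%type (only parsing).

Section variables.
Context (R : realType) (p : nat).
Implicit Type w : full_data R p.

Definition covX w : covariates R p := w.1.1.
Definition obsO w : bool := w.1.2.1.
Definition trtD w : bool := w.1.2.2.
Definition OD w : bool * bool := w.1.2.
Definition outY1 w : mR R := w.2.1.
Definition outY0 w : mR R := w.2.2.
Definition potY w : mR R * mR R := w.2.
Definition tildeY w : mR R := if trtD w then outY1 w else outY0 w.
Definition outY w : mR R := if obsO w then outY1 w else tildeY w.
Definition observe w : obs_data R p := (covX w, obsO w, outY w).

Let measurable_observe : measurable_fun [set: full_data R p] observe.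
Proof.
have mif (b : full_data R p -> bool) (f g : full_data R p -> mR R) :
    measurable_fun setT b -> measurable_fun setT f -> measurable_fun setT g ->
    measurable_fun setT (fun w => if b w then f w else g w).
  by move=> mb mf mg; exact: measurable_fun_ifT.
have m11 : measurable_fun setT (fun w : full_data R p => w.1.2).
  exact: (measurableT_comp measurable_snd measurable_fst).
apply/measurable_fun_pairP; split => /=.
  apply/measurable_fun_pairP; split => /=.
    exact: (measurableT_comp measurable_fst measurable_fst).
  exact: (measurableT_comp measurable_fst m11).
apply: (mif).
- exact: (measurableT_comp measurable_fst m11).
- exact: (measurableT_comp measurable_fst measurable_snd).
- apply: (mif).
  + exact: (measurableT_comp measurable_snd m11).
  + exact: (measurableT_comp measurable_fst measurable_snd).
  + exact: (measurableT_comp measurable_snd measurable_snd).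
Qed.

HB.instance Definition _ :=
  isMeasurableFun.Build _ _ _ _ observe measurable_observe.

Definition obs_law (Q : probability (full_data R p) R) :
  probability (obs_data R p) R := distribution Q observe.

End variables.

Section conditioning.
Local Open Scope ereal_scope.
Context (R : realType) (p : nat) (Q : probability (full_data R p) R).

(* [m] is a version of x |-> E[f | X = x, E]; it is determined up to a set of
   x that is null for the law of X given the event [E]. *)
Definition cond_exp (E : set (full_data R p)) (f : full_data R p -> R)
    (m : covariates R p -> R) : Prop :=
  [/\ measurable_fun [set: covariates R p] m,
      Q.-integrable E (fun w => (f w)%:E),
      Q.-integrable E (fun w => (m (covX w))%:E) &
      forall A : set (covariates R p), measurable A ->
        \int[Q]_(w in E `&` @covX R p @^-1` A) (f w)%:E =
        \int[Q]_(w in E `&` @covX R p @^-1` A) (m (covX w))%:E].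

Definition cond_prob (E B : set (full_data R p)) (m : covariates R p -> R) :
  Prop := cond_exp E (\1_B) m.

(* Independence of (Y(1), Y(0)) and (O, D) given X.  Versions of conditional
   probabilities exist and are unique almost everywhere, so the choice of [a]
   and [b] is immaterial. *)
Definition unconfounded : Prop :=
  forall (A : set (measurableTypeR R * measurableTypeR R)%type)
         (B : set (bool * bool)%type),
    measurable A -> measurable B ->
    exists a b : covariates R p -> R,
      [/\ cond_prob setT (@potY R p @^-1` A) a,
          cond_prob setT (@OD R p @^-1` B) b &
          cond_prob setT (@potY R p @^-1` A `&` @OD R p @^-1` B) (a \* b)%R].

Definition covariate_density (Xs : set (covariates R p))
    (zeta : covariates R p -> R) : Prop :=
  measurable_fun Xs zeta /\
  forall A : set (covariates R p), measurable A ->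
    Q (@covX R p @^-1` A) = \int[lebesgue_tuple R p]_(x in Xs `&` A) (zeta x)%:E.

(* The law of X given D = 1, cleared of its denominator. *)
Definition treated_density (Xs : set (covariates R p))
    (zetaT : covariates R p -> R) : Prop :=
  measurable_fun Xs zetaT /\
  forall A : set (covariates R p), measurable A ->
    Q ([set w | trtD w] `&` @covX R p @^-1` A) =
    Q [set w | trtD w] *
    \int[lebesgue_tuple R p]_(x in Xs `&` A) (zetaT x)%:E.

Definition obs_reference : set (obs_data R p) -> \bar R :=
  lebesgue_tuple R p \x @counting bool R \x @lebesgue_measure R.

Definition obs_density (q : obs_data R p -> R) : Prop :=
  [/\ measurable_fun [set: obs_data R p] q, (forall z, (0 <= q z)%R) &
      forall A : set (obs_data R p), measurable A ->
        obs_law Q A = \int[obs_reference]_(z in A) (q z)%:E].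

End conditioning.

Section model.
Context (R : realType) (p : nat).

Record censoring_setting (Xs : set (covariates R p))
    (Q : probability (full_data R p) R) (zeta zetaT : covariates R p -> R)
    (pi g : bool -> covariates R p -> R) : Prop := {
  observed_treated : Q [set w | obsO w && ~~ trtD w] = 0%E;
  square_integrable1 : Q.-integrable setT (fun w => (outY1 w ^+ 2)%:E);
  square_integrable0 : Q.-integrable setT (fun w => (outY0 w ^+ 2)%:E);
  has_obs_density : exists q, obs_density Q q;
  zetaP : covariate_density Q Xs zeta;
  zetaTP : treated_density Q Xs zetaT;
  piP : forall o, cond_prob Q setT [set w | obsO w = o] (pi o);
  gP : forall d, cond_prob Q [set w | obsO w = false]
                             [set w | trtD w = d] (g d) }.

Definition common_support (Xs : set (covariates R p))
    (zeta zetaT : covariates R p -> R) (pi g : bool -> covariates R p -> R)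
    (c : R) : Prop :=
  0 < c /\
  forall x, Xs x -> forall d : bool,
    [/\ c < pi d x, c < g d x, c < zetaT x & c < zeta x].

(* The treatment probability [g] among the units with O = 0 is a parameter of
   the model and not one of its unknowns: D is never observed, and the law of
   (X, O, Y) identifies the average treatment effect only when [g] is given. *)
Definition censoring_model (Xs : set (covariates R p))
    (g : bool -> covariates R p -> R) (Q : probability (full_data R p) R) :
    Prop :=
  exists zeta zetaT pi c,
    [/\ censoring_setting Xs Q zeta zetaT pi g, unconfounded Q &
        common_support Xs zeta zetaT pi g c].

Definition ate (Q : probability (full_data R p) R) : R :=
  fine 'E_Q[fun w => outY1 w - outY0 w].

(* A one-sided smooth submodel through [P0]: a path t |-> [Q t] in the model,
   t >= 0 small, whose observed-data densities are differentiable in quadratic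
   mean at t = 0 with score [s].  The moment bound is the usual one for
   mean-type targets: without it [ate (Q t)] need not be differentiable at
   t = 0, and no estimator would be regular. *)
Record smooth_submodel (Xs : set (covariates R p))
    (g : bool -> covariates R p -> R) (P0 : probability (full_data R p) R)
    (Q : R -> probability (full_data R p) R) : Prop := {
  submodel_truth : forall A, measurable A -> Q 0 A = P0 A;
  submodel_in : \forall t \near 0^'+, censoring_model Xs g (Q t);
  submodel_moments : exists M : R, \forall t \near 0^'+,
    (\int[Q t]_w (outY1 w ^+ 2 + outY0 w ^+ 2)%:E <= M%:E)%E;
  submodel_dqm : exists (q : R -> obs_data R p -> R) (s : obs_data R p -> R),
    [/\ obs_density (Q 0) (q 0),
        \forall t \near 0^'+, obs_density (Q t) (q t),
        measurable_fun [set: obs_data R p] s &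
        (\int[@obs_reference R p]_z
           (((Num.sqrt (q t z) - Num.sqrt (q 0 z)) / t
             - s z * Num.sqrt (q 0 z) / 2) ^+ 2)%:E)%E
          @[t --> 0^'+] --> 0%E] }.

(* [T n] is the estimator computed from n i.i.d. observations; [L] is its limit
   distribution, the same along every smooth submodel [Q], when the
   observations are drawn from [Q (1 / sqrt n)]. *)
Definition regular_estimator (Xs : set (covariates R p))
    (g : bool -> covariates R p -> R) (P0 : probability (full_data R p) R)
    (T : forall n : nat, n.-tuple (obs_data R p) -> R)
    (L : probability (measurableTypeR R) R) : Prop :=
  (forall n, measurable_fun [set: n.-tuple (obs_data R p)] (T n)) /\
  forall Q : R -> probability (full_data R p) R,
    smooth_submodel Xs g P0 Q ->
    forall f : R -> R, continuous f -> (exists M, forall x, `|f x| <= M) ->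
      (let Qn := Q (Num.sqrt n%:R)^-1%R in
       \int[iid (obs_law Qn) n]_z
         (f (Num.sqrt n%:R * (T n z - ate Qn)))%:E)%E
        @[n --> \oo] --> (\int[L]_x (f x)%:E)%E.

Definition Psi_cens (muT nu : covariates R p -> R)
    (pi g : bool -> covariates R p -> R) (tau : R) (z : obs_data R p) : R :=
  let x := z.1.1 in let o := z.1.2 in let y : R := z.2 in
  (o%:R * (y - muT x)) / pi true x
  - ((~~ o)%:R * (y - nu x)) / (g false x * pi false x)
  + (g true x * o%:R * (y - muT x)) / (g false x * pi true x)
  + muT x - (g false x)^-1 * nu x + g true x / g false x * muT x - tau.

(* The residuals Y - muT(X), on O = 1, have total weight
   (1 + g1/g0) / pi1 in [Psi_cens], and the residuals Y - nu(X), on O = 0, have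
   weight 1 / (g0 pi0).  Hence the coefficient (1 + g1/g0)^2 / pi1 of
   [varT x] = Var(Y(1) | X = x) and the coefficient 1 / (g0^2 pi0) of
   [vartilde x] = Var(tilde Y | X = x, O = 0); with 1 - g1/g0 or with pi1 in the
   second term this would not be the conditional variance decomposition of
   [Psi_cens]. *)
Definition var_decomp (muT muC varT vartilde : covariates R p -> R)
    (pi g : bool -> covariates R p -> R) (tau : R) (x : covariates R p) : R :=
  (1 + g true x / g false x) ^+ 2 * varT x / pi true x
  + vartilde x / (g false x ^+ 2 * pi false x)
  + (muT x - muC x - tau) ^+ 2.

End model.

(* Main.v *)
(* A Hammersley-Chapman-Robbins argument replaces the convolution theorem. For a
   bounded function [h] of the observation let [s] be its projection onto the
   scores that leave the law of O given X unchanged. Two one-sided paths run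
   through the true law inside the model, with scores [eps s + b] and [b]. The
   common drift [b] is needed because the law of the outcome given X, O = 0 must
   dominate g(1|X) times that of Y(1), which a two-sided perturbation may
   violate; it moves the law of Y(0) towards that of Y(1). At t = 1 / sqrt n the
   chi-square divergence between the [n]-fold products along the two paths is
   asymptotically at most exp(eps^2 E[s^2]) - 1. The treatment effect is the mean
   of the outcome weighted by a function of (X, O) that does not vary along the
   paths, so sqrt n times the difference of the two effects is exactly
   eps E[Psi h]. By regularity the limit law [L] is the same along both paths, so
   [L] and its translate by eps E[Psi h] are this close; comparing means and
   letting eps tend to 0 gives E[Psi h]^2 <= Var(L) E[s^2] <= Var(L) E[h^2], and
   truncations of Psi are substituted for [h]. The variance formula holds because
   Y - E[Y | X, O] is orthogonal to the functions of (X, O). *)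
Require Import Defs.
From HB Require Import structures.
From mathcomp Require Import all_boot all_order all_algebra finmap.
From mathcomp Require Import all_classical all_reals all_analysis.
From mathcomp Require Import measurable_realfun ring lra.
Set Implicit Arguments.
Unset Strict Implicit.
Unset Printing Implicit Defensive.
Import Order.TTheory GRing.Theory Num.Theory.
Import numFieldNormedType.Exports.
Local Open Scope classical_set_scope.
Local Open Scope ring_scope.

(** Independence given X is used and re-established only through integral identities: indicators of
    events in (O, D) are exchanged for weights in front of functions of (X, Y(1), Y(0)), see
    [transfers]. Conditional probabilities are versions, bounded on [Xs] only, so they are replaced
    by clamped weights that are bounded away from 0 everywhere. Each path law must be a law of the
    full data, not merely of (X, O, Y). It keeps (O, D) given X, tilts the law of X and draws Y(1)
    and Y(0) independently given X; the density of Y(0) is solved from the mixture e1 f(Y(1)) + e0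
    f(Y(0)) = f(Y | O = 0), the one place where small t alone does not ensure nonnegativity. Since
    the values of a score bounded by S differ by at most 2 S and e0 >= c, a drift of speed M = 2 S /
    c suffices. The divergence is taken between the two paths and not with respect to the true law,
    so the shared drift drops out and no expansion of likelihoods is needed: scores are bounded, the
    likelihood ratio of one observation lies in [0, 3], and its second moment is elementary. *)

(** * Nonnegative integrals, image measures and orthogonality *)

Section ge0_measurable_ind.
Local Open Scope ereal_scope.
Context d (T : measurableType d) (R : realType).
Variable K : (T -> \bar R) -> Prop.
Hypothesis K_indic : forall A, measurable A -> K (fun x => (\1_A x)%:E).
Hypothesis K_scale : forall (k : R) (f : T -> \bar R), (0 <= k)%R -> measurable_fun setT f ->
  (forall x, 0 <= f x) -> K f -> K (fun x => k%:E * f x).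
Hypothesis K_add : forall f g : T -> \bar R, measurable_fun setT f -> measurable_fun setT g ->
  (forall x, 0 <= f x) -> (forall x, 0 <= g x) -> K f -> K g ->
  K (fun x => f x + g x).
Hypothesis K_lim : forall (f : (T -> \bar R)^nat),
  (forall n, measurable_fun setT (f n)) -> (forall n x, 0 <= f n x) ->
  (forall x, nondecreasing_seq (f ^~ x)) -> (forall n, K (f n)) ->
  K (fun x => limn (f ^~ x)).

Import HBNNSimple.

(** Approximation from below by simple functions: each is a finite nonnegative combination of
    indicators of its fibres, and [K_lim] passes to the increasing limit. *)
Lemma ge0_measurable_ind f : measurable_fun setT f -> (forall x, 0 <= f x) -> K f.
Proof.
move=> mf f0; pose h := nnsfun_approx measurableT mf.
have -> : f = fun x => limn (fun n => (h n x)%:E).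
  apply/funext => x; apply/esym/cvg_lim => //.
  exact: (@cvg_nnsfun_approx _ _ _ _ measurableT _ mf (fun x _ => f0 x)).
apply: K_lim => [n|n x|x m n mn|n].
- exact/measurable_EFinP.
- by rewrite lee_fin.
- by rewrite lee_fin; exact/lefP/nd_nnsfun_approx.
(* The coefficients are written [|y|] because the induction on the list of values forgets that each
   [y] is a value of the nonnegative [h n]. *)
have -> : (fun x => (h n x)%:E) =
    (fun x => \sum_(y <- fset_set (range (h n)))
      (`|y|%R)%:E * (\1_(h n @^-1` [set y]) x)%:E).
  apply/funext => x; rewrite {1}fimfunE -fsumEFin// fsbig_finite//=.
  apply: eq_bigr => y _; rewrite EFinM.
  rewrite indicE; case: (boolP (x \in _)) => [/set_mem /= <-|_]; last by rewrite !mule0.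
  by rewrite ger0_norm.
elim: (_ (fset_set _)) => [|y s IH].
  have -> : (fun x : T => \sum_(i <- [::]) (`|i|%R)%:E * (\1_(h n @^-1` [set i]) x)%:E)
      = (fun x => (\1_set0 x)%:E :> \bar R).
    by apply/funext => x; rewrite big_nil indicE in_set0.
  exact: K_indic.
have m1 (z : R) : measurable_fun [set: T] (fun x => (\1_(h n @^-1` [set z]) x)%:E : \bar R).
  by apply/measurable_EFinP; exact: measurable_indic.
rewrite (_ : (fun x => _) = (fun x => (`|y|%R)%:E * (\1_(h n @^-1` [set y]) x)%:E +
  \sum_(i <- s) (`|i|%R)%:E * (\1_(h n @^-1` [set i]) x)%:E)); last first.
  by apply/funext => x; rewrite big_cons.
apply: K_add => //.
- by apply: emeasurable_funM.
- by apply: emeasurable_sum => i; apply: emeasurable_funM.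
- by move=> x; apply: sume_ge0 => i _; apply: mule_ge0.
- by apply: K_scale => //; exact: K_indic.
Qed.
End ge0_measurable_ind.

Section transport.
Local Open Scope ereal_scope.
Context d1 d2 d (T1 : measurableType d1) (T2 : measurableType d2)
  (S : measurableType d) (R : realType).
Variables (m1 : {measure set T1 -> \bar R}) (m2 : {measure set T2 -> \bar R}).
Variables (u : T1 -> \bar R) (v : T2 -> \bar R).
Variables (phi : T1 -> S) (psi : T2 -> S).
Hypotheses (mphi : measurable_fun setT phi) (mpsi : measurable_fun setT psi).
Hypotheses (mu : measurable_fun setT u) (mv : measurable_fun setT v).
Hypotheses (u0 : forall x, 0 <= u x) (v0 : forall x, 0 <= v x).
Hypothesis uv : forall A, measurable A ->
  \int[m1]_(x in phi @^-1` A) u x = \int[m2]_(x in psi @^-1` A) v x.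

(** [uv] says that the measures with densities [u] and [v] have the same image under [phi] and
    [psi]; this is the claim for indicators, and [ge0_measurable_ind] extends it. Changes of
    density, conditional independence and tilts of the covariate law all go through this
    identity. *)
Lemma ge0_transport F : measurable_fun setT F -> (forall s, 0 <= F s) ->
  \int[m1]_x (F (phi x) * u x) = \int[m2]_x (F (psi x) * v x).
Proof.
move=> mF F0; move: mF F0.
have mc1 (f : S -> \bar R) : measurable_fun setT f -> measurable_fun setT (fun x => f (phi x) * u x).
  by move=> mf; apply: emeasurable_funM => //; exact: measurableT_comp.
have mc2 (f : S -> \bar R) : measurable_fun setT f -> measurable_fun setT (fun x => f (psi x) * v x).
  by move=> mf; apply: emeasurable_funM => //; exact: measurableT_comp.
move: F; apply: ge0_measurable_ind.
- move=> A mA.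
  transitivity (\int[m1]_(x in phi @^-1` A) u x).
    by rewrite [RHS]integral_mkcond epatch_indic; apply: eq_integral => x _; rewrite muleC.
  rewrite uv// [LHS]integral_mkcond epatch_indic.
  by apply: eq_integral => x _; rewrite muleC.
- move=> k f k0 mf f0 Kf.
  under eq_integral do rewrite -muleA.
  under [RHS]eq_integral do rewrite -muleA.
  rewrite !ge0_integralZl_EFin ?Kf//; try by [exact: mc1|exact: mc2].
  + by move=> x _; rewrite mule_ge0.
  + by move=> x _; rewrite mule_ge0.
- move=> f g mf mg f0 g0 Kf Kg.
  under eq_integral do rewrite ge0_muleDl//.
  under [RHS]eq_integral do rewrite ge0_muleDl//.
  rewrite !ge0_integralD//; try by [exact: mc1|exact: mc2|move=> x _; rewrite mule_ge0].
  by rewrite Kf Kg.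
- move=> f mf f0 nf Kf.
  (* The case [b = +oo] needs care: if the limit of [a] is 0 then every [a n] is 0, and otherwise
     [a n] is eventually positive, so that both sides are [+oo]. *)
  have lE (a : (\bar R)^nat) (b : \bar R) : nondecreasing_seq a -> (forall n, 0 <= a n) -> 0 <= b ->
      limn a * b = limn (fun n => a n * b).
    move=> na a0 b0; apply/esym/cvg_lim => //.
    move: b0; case: b => [b b0| _|//].
      apply: cvgeZr => //; exact: ereal_nondecreasing_is_cvgn.
    have [al|al] := eqVneq (limn a) 0.
      have a0' n : a n = 0.
        apply/eqP; rewrite eq_le a0 andbT -al.
        rewrite (cvg_lim _ (ereal_nondecreasing_cvgn na))//.
        by apply: ereal_sup_ubound; exists n.
      rewrite al mul0e (_ : (fun n => a n * +oo) = cst 0); first exact: cvg_cst.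
      by apply/funext => n; rewrite a0' mul0e.
    have lgt : 0 < limn a.
      rewrite lt_neqAle eq_sym al/= lime_ge//; first exact: ereal_nondecreasing_is_cvgn.
      exact: nearW.
    have [N aN] : exists N, 0 < a N.
      apply: contrapT => /forallNP aN; move: lgt; rewrite ltNge => /negP; apply.
      apply: lime_le; first exact: ereal_nondecreasing_is_cvgn.
      by apply: nearW => n; rewrite leNgt; apply/negP; exact: aN.
    rewrite gt0_muley//; apply: cvg_near_cst; exists N => // n /= Nn.
    by rewrite gt0_muley// (lt_le_trans aN)// na.
  transitivity (limn (fun n => \int[m1]_x (f n (phi x) * u x))).
    rewrite -monotone_convergence//.
    + by apply: eq_integral => x _; rewrite lE.
    + by move=> n; exact: mc1.
    + by move=> n x _; rewrite mule_ge0.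
    + by move=> x _ a b ab; rewrite lee_wpmul2r// nf.
  transitivity (limn (fun n => \int[m2]_x (f n (psi x) * v x))); last first.
    rewrite -monotone_convergence//.
    + by apply: eq_integral => x _; rewrite lE.
    + by move=> n; exact: mc2.
    + by move=> n x _; rewrite mule_ge0.
    + by move=> x _ a b ab; rewrite lee_wpmul2r// nf.
  by congr (limn _); apply/funext => n; exact: Kf.
Qed.
End transport.

Section density_measure.
Local Open Scope ereal_scope.
Context d (T : measurableType d) (R : realType) (mu : {measure set T -> \bar R}).
Variable g : T -> \bar R.
Hypotheses (mg : measurable_fun setT g) (g0 : forall x, 0 <= g x).

(** The two proofs are arguments so that the measure structure declared below can be inferred from
    the expression itself. *)
Definition mdensity (_ : measurable_fun setT g) (_ : forall x, 0 <= g x)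
  : set T -> \bar R := fun A => \int[mu]_(x in A) g x.

Local Notation nu := (mdensity mg g0).

Let nu_set0 : nu set0 = 0. Proof. exact: integral_set0. Qed.
Let nu_ge0 A : 0 <= nu A. Proof. by apply: integral_ge0. Qed.
Let nu_sigma_additive : semi_sigma_additive nu.
Proof. exact: semi_sigma_additive_nng_induced. Qed.

HB.instance Definition _ := isMeasure.Build _ _ _ nu nu_set0 nu_ge0
  nu_sigma_additive.
End density_measure.

Section density_integral.
Local Open Scope ereal_scope.
Context d (T : measurableType d) (R : realType).
Variables (nu mu : {measure set T -> \bar R}) (g : T -> \bar R).
Hypotheses (mg : measurable_fun setT g) (g0 : forall x, 0 <= g x).
Hypothesis nuE : forall A, measurable A -> nu A = \int[mu]_(x in A) g x.

Lemma ge0_integral_density (F : T -> \bar R) : measurable_fun setT F ->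
  (forall x, 0 <= F x) -> \int[nu]_x F x = \int[mu]_x (F x * g x).
Proof.
move=> mF F0.
have /= := @ge0_transport _ _ _ _ _ _ _ nu mu (cst 1) g id id.
move=> /(_ (@measurable_id _ _ _) (@measurable_id _ _ _)).
move=> /(_ (@measurable_cst _ _ _ _ _ _) mg (fun=> lee01) g0).
move=> <-//; first by apply: eq_integral => x _; rewrite mule1.
by move=> A mA; rewrite !preimage_id integral_cst// mul1e nuE.
Qed.
End density_integral.

Section transport_rectangle.
Local Open Scope ereal_scope.
Context d1 d2 d3 d4 (T1 : measurableType d1) (T2 : measurableType d2)
  (S1 : measurableType d3) (S2 : measurableType d4) (R : realType).
Variables (m1 : {measure set T1 -> \bar R}) (m2 : {measure set T2 -> \bar R}).
Variables (u : T1 -> \bar R) (v : T2 -> \bar R).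
Variables (phi : T1 -> S1 * S2) (psi : T2 -> S1 * S2).
Hypotheses (mphi : measurable_fun setT phi) (mpsi : measurable_fun setT psi).
Hypotheses (mu : measurable_fun setT u) (mv : measurable_fun setT v).
Hypotheses (u0 : forall x, 0 <= u x) (v0 : forall x, 0 <= v x).
Hypothesis uoo : \int[m1]_x u x < +oo.
Hypothesis uv : forall A B, measurable A -> measurable B ->
  \int[m1]_(x in phi @^-1` (A `*` B)) u x = \int[m2]_(x in psi @^-1` (A `*` B)) v x.

(** Uniqueness of measures: rectangles are stable under intersection and generate the product
    sigma-algebra, the whole space is one of them, and [uoo] makes its mass finite. *)
Lemma transport_rectangle A : measurable A ->
  \int[m1]_(x in phi @^-1` A) u x = \int[m2]_(x in psi @^-1` A) v x.
Proof.
pose n1 : {measure set (S1 * S2) -> \bar R} := pushforward (mdensity m1 mu u0) phi.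
pose n2 : {measure set (S1 * S2) -> \bar R} := pushforward (mdensity m2 mv v0) psi.
pose G : set (set (S1 * S2)) := [set C | exists A, measurable A /\
  exists B, measurable B /\ C = A `*` B].
move=> mA; change (n1 mphi A = n2 mpsi A); apply: (@measure_unique _ _ _ G (fun=> setT) _ _ _ _ (n1 mphi) (n2 mpsi)) => //.
- rewrite measurable_prod_measurableType //; congr (<<s _ >>).
  rewrite predeqE; split => [[C mC [B mB <-]]|[C [mC [B [mB ->]]]]].
    by exists C; split => //; exists B.
  by exists C => //; exists B.
- move=> /= _ _ [X1 [mX1 [X2 [mX2 ->]]]] [Y1 [mY1 [Y2 [mY2 ->]]]].
  rewrite -setXI; exists (X1 `&` Y1); split; first exact: measurableI.
  by exists (X2 `&` Y2); split => //; exact: measurableI.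
- by move=> _; exists setT; split => //; exists setT; split => //; rewrite setXTT.
- by apply/seteqP; split => // x _; exists 0%N.
- by move=> _ [X1 [mX1 [X2 [mX2 ->]]]]; exact: uv.
Qed.
End transport_rectangle.

Section orthogonality.
Context d d' (T : measurableType d) (S : measurableType d') (R : realType).
Variables (mu : {measure set T -> \bar R}) (phi : T -> S) (k : T -> R).
Hypotheses (mphi : measurable_fun setT phi) (ik : mu.-integrable setT (EFin \o k)).
Hypothesis k0 : forall A, measurable A -> (\int[mu]_(x in phi @^-1` A) (k x)%:E = 0)%E.

(** By [k0], the positive and negative parts of [k] define measures with the same image under [phi].
    For a signed [F], the four products of positive and negative parts are dominated by
    [|F (phi x) * k x|], so they are integrable even when [F] is unbounded. *)
Lemma integral_orthogonal (F : S -> R) : measurable_fun setT F ->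
  mu.-integrable setT (fun x => (F (phi x) * k x)%:E) ->
  (\int[mu]_x (F (phi x) * k x)%:E = 0)%E.
Proof.
move=> mF iFk.
have mk : measurable_fun setT k by apply/measurable_EFinP; exact: measurable_int ik.
pose kp x := Num.max (k x) 0; pose kn x := Num.max (- k x) 0.
have kE x : k x = kp x - kn x.
  by rewrite /kp /kn; case: (leP (k x) 0) => h; case: (leP (- k x) 0) => h'; lra.
have kp0 x : 0 <= kp x by rewrite le_max lexx orbT.
have kn0 x : 0 <= kn x by rewrite le_max lexx orbT.
have kple x : kp x <= `|k x| by rewrite ge_max ler_norm normr_ge0.
have knle x : kn x <= `|k x| by rewrite ge_max -normrN ler_norm normr_ge0.
have mkp : measurable_fun setT kp by apply: measurable_maxr.
have mkn : measurable_fun setT kn.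
  by apply: measurable_maxr => //; exact: measurableT_comp.
have uv A : measurable A -> (\int[mu]_(x in phi @^-1` A) (kp x)%:E =
    \int[mu]_(x in phi @^-1` A) (kn x)%:E)%E.
  move=> mA; have mpA : measurable (phi @^-1` A).
    by rewrite -[X in measurable X]setTI; exact: mphi.
  have ip (h : T -> R) : measurable_fun setT h -> (forall x, 0 <= h x) ->
      (forall x, h x <= `|k x|) -> mu.-integrable (phi @^-1` A) (EFin \o h).
    move=> mh h0 hk; apply: (@integrableS _ _ _ _ setT) => //.
    apply: le_integrable ik => //; first exact/measurable_EFinP.
    by move=> x _ /=; rewrite lee_fin ger0_norm// (le_trans (hk x)).
  have := k0 mA; under eq_integral do rewrite kE EFinB.
  rewrite integralB_EFin//; [|exact: ip|exact: ip] => /eqP.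
  rewrite sube_eq//; first by rewrite add0e => /eqP.
  exact: (integrable_fin_num mpA (ip _ mkp kp0 kple)).
have mE (h : T -> R) : measurable_fun setT h -> measurable_fun setT (fun x => (h x)%:E).
  by move=> mh; exact/measurable_EFinP.
have Fuv (f : S -> R) : measurable_fun setT f -> (forall s, 0 <= f s) ->
    (\int[mu]_x (f (phi x) * kp x)%:E = \int[mu]_x (f (phi x) * kn x)%:E)%E.
  move=> mf f0.
  under eq_integral do rewrite EFinM.
  under [RHS]eq_integral do rewrite EFinM.
  apply: (@ge0_transport _ _ _ _ _ _ _ mu mu (EFin \o kp) (EFin \o kn) phi phi
    mphi mphi _ _ _ _ uv (EFin \o f)).
  - exact: mE.
  - exact: mE.
  - by move=> x; rewrite lee_fin.
  - by move=> x; rewrite lee_fin.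
  - exact/measurable_EFinP.
  - by move=> s; rewrite lee_fin.
pose Fp x := Num.max (F x) 0; pose Fn x := Num.max (- F x) 0.
have FE x : F x = Fp x - Fn x.
  by rewrite /Fp /Fn; case: (leP (F x) 0) => h; case: (leP (- F x) 0) => h'; lra.
have Fp0 x : 0 <= Fp x by rewrite le_max lexx orbT.
have Fn0 x : 0 <= Fn x by rewrite le_max lexx orbT.
have Fple x : Fp x <= `|F x| by rewrite ge_max ler_norm normr_ge0.
have Fnle x : Fn x <= `|F x| by rewrite ge_max -normrN ler_norm normr_ge0.
have mFp : measurable_fun setT Fp by apply: measurable_maxr.
have mFn : measurable_fun setT Fn.
  by apply: measurable_maxr => //; exact: measurableT_comp.
have iP (f : S -> R) (h : T -> R) : measurable_fun setT f -> measurable_fun setT h ->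
    (forall x, 0 <= f x) -> (forall x, 0 <= h x) ->
    (forall x, f x <= `|F x|) -> (forall x, h x <= `|k x|) ->
    mu.-integrable setT (EFin \o (fun x => f (phi x) * h x)).
  move=> mf mh f0 h0 fF hk; apply: le_integrable iFk => //.
    by apply/measurable_EFinP/measurable_funM => //; exact: measurableT_comp.
  move=> x _ /=; rewrite lee_fin ger0_norm ?mulr_ge0// normrM.
  exact: ler_pM.
have i1 := iP _ _ mFp mkp Fp0 kp0 Fple kple.
have i2 := iP _ _ mFp mkn Fp0 kn0 Fple knle.
have i3 := iP _ _ mFn mkp Fn0 kp0 Fnle kple.
have i4 := iP _ _ mFn mkn Fn0 kn0 Fnle knle.
have -> : (\int[mu]_x (F (phi x) * k x)%:E =
  \int[mu]_x (((Fp (phi x) * kp x) - (Fp (phi x) * kn x))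
   - ((Fn (phi x) * kp x) - (Fn (phi x) * kn x)))%:E)%E.
  by apply: eq_integral => x _; rewrite FE kE; congr (_%:E); lra.
have ib (f g : T -> R) : mu.-integrable setT (EFin \o f) ->
  mu.-integrable setT (EFin \o g) -> mu.-integrable setT (EFin \o (fun x => f x - g x)).
  by move=> fi gi; exact: (integrableB measurableT fi gi).
have BE (f g : T -> R) : mu.-integrable setT (EFin \o f) ->
    mu.-integrable setT (EFin \o g) ->
    (\int[mu]_x (f x - g x)%:E = \int[mu]_x (f x)%:E - \int[mu]_x (g x)%:E)%E.
  by move=> fi gi; rewrite -integralB_EFin.
rewrite (BE _ _ (ib _ _ i1 i2) (ib _ _ i3 i4)) (BE _ _ i1 i2) (BE _ _ i3 i4).
rewrite !Fuv// !subee ?sube0//.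
- exact: (integrable_fin_num measurableT i4).
- exact: (integrable_fin_num measurableT i2).
Qed.
End orthogonality.

Section measurable_composition.
Context d d1 d2 (T : measurableType d) (T1 : measurableType d1)
  (T2 : measurableType d2).

Lemma measurable_fun_mk_pair (f : T -> T1) (g : T -> T2) :
  measurable_fun setT f -> measurable_fun setT g ->
  measurable_fun setT (fun x => (f x, g x)).
Proof. by move=> mf mg; apply/measurable_fun_pairP; split. Qed.
End measurable_composition.

Lemma measurable_fun_inv d (T : measurableType d) (R : realType) (f : T -> R) :
  measurable_fun setT f -> measurable_fun setT (fun x => (f x)^-1).
Proof.
move=> mf; suff mi : measurable_fun [set: R] (@GRing.inv R).
  exact: (measurableT_comp mi mf).
rewrite -(setvU [set (0 : R)]); apply/measurable_funU => //.
  exact: measurableC.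
split; last exact: measurable_fun_set1.
apply: open_continuous_measurable_fun.
  by rewrite openC; exact: closed_eq.
by move=> x; rewrite inE /= => /eqP x0; exact: inv_continuous.
Qed.

(** * Real-valued and square-integrable functions *)

Section real_integral.
Context d (T : measurableType d) (R : realType).
Variable mu : {measure set T -> \bar R}.
Implicit Types f g : T -> R.

Definition rintegrable f := mu.-integrable setT (EFin \o f).
Definition sq_integrable f := measurable_fun setT f /\ rintegrable (fun x => f x ^+ 2).

Lemma rintegrable_measurable f : rintegrable f -> measurable_fun setT f.
Proof. by move=> /measurable_int /measurable_EFinP. Qed.

Lemma rintegrableD f g : rintegrable f -> rintegrable g ->
  rintegrable (fun x => f x + g x).
Proof. by move=> fi gi; exact: (integrableD measurableT fi gi). Qed.

Lemma rintegrableB f g : rintegrable f -> rintegrable g ->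
  rintegrable (fun x => f x - g x).
Proof. by move=> fi gi; exact: (integrableB measurableT fi gi). Qed.

Lemma rintegrableZ (k : R) f : rintegrable f -> rintegrable (fun x => k * f x).
Proof. by move=> fi; exact: (integrableZl measurableT k fi). Qed.

Lemma le_rintegrable f g : measurable_fun setT f ->
  (forall x, `|f x| <= g x) -> rintegrable g -> rintegrable f.
Proof.
move=> mf fg; apply: le_integrable => //; first exact/measurable_EFinP.
by move=> x _ /=; rewrite lee_fin (le_trans (fg x))// ler_norm.
Qed.

Lemma rintegrableM_bounded (B : R) f g : measurable_fun setT f ->
  (forall x, `|f x| <= B) -> rintegrable g -> rintegrable (fun x => f x * g x).
Proof.
move=> mf fB ig; apply: (@le_rintegrable _ (fun x => B * `|g x|)).
- by apply: measurable_funM => //; exact: rintegrable_measurable.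
- by move=> x; rewrite normrM ler_wpM2r.
- by apply: rintegrableZ; exact: integrable_norm.
Qed.

Lemma sq_integrableM f g : sq_integrable f -> sq_integrable g ->
  rintegrable (fun x => f x * g x).
Proof.
move=> [mf fi] [mg gi]; apply: (@le_rintegrable _ (fun x => f x ^+ 2 + g x ^+ 2)).
- exact: measurable_funM.
- move=> x; have := sqr_ge0 (f x - g x); have := sqr_ge0 (f x + g x).
  by rewrite ler_norml => *; apply/andP; split; nra.
- exact: rintegrableD.
Qed.

Lemma sq_integrableD f g : sq_integrable f -> sq_integrable g ->
  sq_integrable (fun x => f x + g x).
Proof.
move=> [mf fi] [mg gi]; split; first exact: measurable_funD.
apply: (@le_rintegrable _ (fun x => 2 * (f x ^+ 2 + g x ^+ 2))).
- by apply: measurable_funX; exact: measurable_funD.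
- by move=> x; rewrite ger0_norm ?sqr_ge0//; have := sqr_ge0 (f x - g x); nra.
- exact/rintegrableZ/rintegrableD.
Qed.

Lemma sq_integrableM_bounded (B : R) f g : measurable_fun setT f ->
  (forall x, `|f x| <= B) -> sq_integrable g -> sq_integrable (fun x => f x * g x).
Proof.
move=> mf fB [mg gi]; split; first exact: measurable_funM.
under eq_fun do rewrite exprMn.
apply: (@rintegrableM_bounded (B ^+ 2)) => //; first exact: measurable_funX.
by move=> x; rewrite normrX lerXn2r// nnegrE (le_trans (normr_ge0 _) (fB x)).
Qed.

Lemma sq_integrableZ (k : R) f : sq_integrable f -> sq_integrable (fun x => k * f x).
Proof. by apply: (@sq_integrableM_bounded `|k|). Qed.

Lemma sq_integrableB f g : sq_integrable f -> sq_integrable g ->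
  sq_integrable (fun x => f x - g x).
Proof.
move=> fi gi; have := sq_integrableD fi (sq_integrableZ (-1) gi).
by under eq_fun do rewrite mulN1r.
Qed.

Lemma REintegralE f : rintegrable f -> (\int[mu]_x (f x)%:E)%E = (\int[mu]_x f x)%:E.
Proof. by move=> fi; rewrite fineK//; exact: (integrable_fin_num measurableT fi). Qed.

Lemma RintegralDE f g : rintegrable f -> rintegrable g ->
  \int[mu]_x (f x + g x) = \int[mu]_x f x + \int[mu]_x g x.
Proof. by move=> fi gi; rewrite RintegralD. Qed.

Lemma RintegralBE f g : rintegrable f -> rintegrable g ->
  \int[mu]_x (f x - g x) = \int[mu]_x f x - \int[mu]_x g x.
Proof. by move=> fi gi; rewrite RintegralB. Qed.

Lemma RintegralZE (k : R) f : rintegrable f ->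
  \int[mu]_x (k * f x) = k * \int[mu]_x f x.
Proof. by move=> fi; rewrite RintegralZl. Qed.

Lemma Rintegral_le f g : rintegrable f -> rintegrable g -> (forall x, f x <= g x) ->
  \int[mu]_x f x <= \int[mu]_x g x.
Proof. by move=> fi gi fg; apply: le_Rintegral. Qed.

Lemma eq_RintegralT f g : f =1 g -> \int[mu]_x f x = \int[mu]_x g x.
Proof. by move=> fg; apply: eq_Rintegral => x _. Qed.

(** Nonnegativity of the quadratic form [a^2 A - 2 a b B + b^2 C], evaluated at [a = C] and
    [b = B]. *)
Lemma cauchy_schwarz f g : sq_integrable f -> sq_integrable g ->
  (\int[mu]_x (f x * g x)) ^+ 2 <=
  (\int[mu]_x (f x ^+ 2)) * (\int[mu]_x (g x ^+ 2)).
Proof.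
move=> f2 g2; have fg := sq_integrableM f2 g2.
case: f2 => mf f2; case: g2 => mg g2.
set A := \int[mu]_x (f x ^+ 2); set C := \int[mu]_x (g x ^+ 2).
set B := \int[mu]_x (f x * g x).
have poly (a b : R) : 0 <= a ^+ 2 * A - 2 * (a * b) * B + b ^+ 2 * C.
  rewrite -!RintegralZE// -RintegralBE//; [|exact: rintegrableZ|exact: rintegrableZ].
  rewrite -RintegralDE//; [|by apply: rintegrableB; exact: rintegrableZ|exact: rintegrableZ].
  apply: Rintegral_ge0 => x _.
  by rewrite [leRHS](_ : _ = (a * f x - b * g x) ^+ 2) ?sqr_ge0//; ring.
have A0 : 0 <= A by apply: Rintegral_ge0 => x _; exact: sqr_ge0.
have C0 : 0 <= C by apply: Rintegral_ge0 => x _; exact: sqr_ge0.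
have [CE|CN] := eqVneq C 0.
  (* When [C = 0], these coefficients reduce the form to [- B^2]. *)
  have := poly B ((A + 1) / 2); rewrite CE !mulr0 addr0.
  by nra.
have := poly C B => h.
have : 0 <= C * (A * C - B ^+ 2) by nra.
by rewrite pmulr_rge0 ?subr_ge0// lt_neqAle eq_sym CN.
Qed.
End real_integral.

Section finite_real_integral.
Context d (T : measurableType d) (R : realType) (P : probability T R).
Implicit Types f g : T -> R.

Lemma rintegrable_cst (k : R) : rintegrable P (cst k).
Proof. exact: finite_measure_integrable_cst. Qed.

Lemma rintegrable_bounded (B : R) f : measurable_fun setT f ->
  (forall x, `|f x| <= B) -> rintegrable P f.
Proof.
by move=> mf fB; exact: (le_rintegrable mf fB (rintegrable_cst B)).
Qed.

Lemma sq_integrable_bounded (B : R) f : measurable_fun setT f ->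
  (forall x, `|f x| <= B) -> sq_integrable P f.
Proof.
move=> mf fB; split=> //; apply: (@rintegrable_bounded (B ^+ 2)).
  exact: measurable_funX.
by move=> x; rewrite normrX lerXn2r// nnegrE (le_trans (normr_ge0 _) (fB x)).
Qed.

Lemma sq_integrable_rintegrable f : sq_integrable P f -> rintegrable P f.
Proof.
move=> f2; have := sq_integrableM f2 (@sq_integrable_bounded 1 (cst 1) _ _).
under eq_fun do rewrite mulr1.
by apply => // x /=; rewrite normr1.
Qed.

Lemma Rintegral_cstE (k : R) : \int[P]_x k = k.
Proof.
rewrite Rintegral_cst// -[RHS]mulr1; congr (k * _).
by rewrite -[1]/(fine 1%E); congr fine; exact: probability_setT.
Qed.
End finite_real_integral.

(** * The Hammersley-Chapman-Robbins inequality *)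

Section iid_likelihood.
Context d (T : measurableType d) (R : realType) (P : probability T R).

Definition likelihood (r : T -> R) n (z : n.-tuple T) : R := \prod_(i < n) r (tnth z i).

Lemma likelihood_cons (r : T -> R) n (x : T) (z : n.-tuple T) :
  likelihood r (tcons (x, z)) = r x * likelihood r z.
Proof.
rewrite /likelihood big_ord_recl tnth0; congr (_ * _).
by apply: eq_bigr => i _; rewrite tnthS.
Qed.

Lemma measurable_likelihood (r : T -> R) n : measurable_fun setT r ->
  measurable_fun setT (likelihood r (n := n)).
Proof.
move=> mr; apply: measurable_prod => i _.
by apply: measurableT_comp => //; exact: measurable_tnth.
Qed.

Lemma likelihood_ge0 (r : T -> R) n z : (forall x, 0 <= r x) ->
  0 <= likelihood r (n := n) z.
Proof. by move=> r0; apply: prodr_ge0. Qed.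

Local Open Scope ereal_scope.

Lemma ge0_integral_iidS (Q : probability T R) n (F : n.+1.-tuple T -> \bar R) :
  measurable_fun setT F -> (forall z, 0 <= F z) ->
  \int[iid Q n.+1]_z F z = \int[Q]_x \int[iid Q n]_z F (tcons (x, z)).
Proof.
move=> mF F0; rewrite /= ge0_integral_distribution//.
rewrite fubini_tonelli1//; last by move=> x; exact: F0.
apply: (measurableT_comp mF).
exact: (@measurable_funPT _ _ _ _ (@tcons _ T n)).
Qed.

(** Induction on [n] with Tonelli: the tail of the sample changes law by the induction hypothesis,
    then its head by the density of one observation. *)
Lemma ge0_integral_iid_likelihood (Q : probability T R) (r : T -> R) n
    (F : n.-tuple T -> \bar R) :
  measurable_fun setT r -> (forall x, (0 <= r x)%R) ->
  (forall A, measurable A -> Q A = \int[P]_(x in A) (r x)%:E) ->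
  measurable_fun setT F -> (forall z, 0 <= F z) ->
  \int[iid Q n]_z F z = \int[iid P n]_z (F z * (likelihood r z)%:E).
Proof.
move=> mr r0 QP; elim: n F => [|n IH] F mF F0.
  by apply: eq_integral => z _; rewrite /likelihood big_ord0 mule1.
have mtc : measurable_fun setT (@tcons _ T n).
  exact: (@measurable_funPT _ _ _ _ (@tcons _ T n)).
have mFt : measurable_fun setT (fun x => F (tcons x)).
  exact: (measurableT_comp mF mtc).
have mL m : measurable_fun setT (fun z : m.-tuple T => (likelihood r z)%:E).
  by apply/measurable_EFinP; exact: measurable_likelihood.
have mFL : measurable_fun setT (fun x : T * n.-tuple T =>
    F (tcons x) * (likelihood r x.2)%:E).
  apply: emeasurable_funM => //.
  by apply: (measurableT_comp (mL n)); exact: measurable_snd.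
rewrite !ge0_integral_iidS//; last 2 first.
- by apply: emeasurable_funM => //; exact: mL.
- by move=> z; rewrite mule_ge0// lee_fin likelihood_ge0.
transitivity (\int[Q]_x \int[iid P n]_z (F (tcons (x, z)) * (likelihood r z)%:E)).
  apply: eq_integral => x _; apply: IH => //.
  by apply: (measurableT_comp mFt); exact: measurable_pair1.
have mr' : measurable_fun setT (EFin \o r) by exact/measurable_EFinP.
have r0' x : 0 <= (EFin \o r) x by rewrite lee_fin.
have FL0 x z : 0 <= F (tcons (x, z)) * (likelihood r z)%:E.
  by rewrite mule_ge0// lee_fin likelihood_ge0.
rewrite (@ge0_integral_density _ _ _ Q P _ mr' r0' QP); last 2 first.
- by apply: (measurable_fun_fubini_tonelli_F (m2 := iid P n) _ mFL) => -[x z]; exact: FL0.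
- by move=> x; apply: integral_ge0.
apply: eq_integral => x _; rewrite muleC -ge0_integralZl//.
- by apply: eq_integral => z _; rewrite likelihood_cons EFinM muleCA.
- by apply: (measurableT_comp mFL); exact: measurable_pair1.
Qed.

Lemma ge0_integral_iid_prod (r : T -> R) n :
  measurable_fun setT r -> (forall x, (0 <= r x)%R) ->
  \int[P]_x (r x)%:E < +oo ->
  \int[iid P n]_z (likelihood r z)%:E = (\int[P]_x (r x)%:E) ^+ n.
Proof.
move=> mr r0 roo; elim: n => [|n IH].
  under eq_integral do rewrite /likelihood big_ord0.
  by rewrite integral_cst//= probability_setT mul1e.
rewrite ge0_integral_iidS//.
- under eq_integral do under eq_integral do rewrite likelihood_cons EFinM.
  under eq_integral.
    move=> x _; rewrite ge0_integralZl//; last 3 first.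
    + by apply/measurable_EFinP; exact: measurable_likelihood.
    + by move=> z _; rewrite lee_fin likelihood_ge0.
    + by rewrite lee_fin.
    rewrite IH; over.
  rewrite ge0_integralZr ?expeS//.
  + exact/measurable_EFinP.
  + by move=> x _; rewrite lee_fin.
  + by rewrite expe_ge0// integral_ge0// => x _; rewrite lee_fin.
- by apply/measurable_EFinP; exact: measurable_likelihood.
- by move=> z; rewrite lee_fin likelihood_ge0.
Qed.
End iid_likelihood.

(** With [L] the likelihood ratio of the sample, the difference of the means is the integral of
    [F (L - 1)] under the law of the sample from [P]. Cauchy-Schwarz bounds its square, and [L] has
    mean 1 and second moment the [n]-th power of that of [r]. The bound [C] on [r] provides
    integrability. *)
Lemma chapman_robbins d (T : measurableType d) (R : realType)
    (P Q : probability T R) (r : T -> R) (n : nat) (F : n.-tuple T -> R) (B C : R) :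
  measurable_fun setT r -> (forall x, 0 <= r x <= C) ->
  (forall A, measurable A -> Q A = \int[P]_(x in A) (r x)%:E)%E ->
  measurable_fun setT F -> (forall z, `|F z| <= B) ->
  (\int[iid Q n]_z F z - \int[iid P n]_z F z) ^+ 2 <=
  (\int[iid P n]_z (F z ^+ 2)) * ((\int[P]_x (r x ^+ 2)) ^+ n - 1).
Proof.
move=> mr rC QP mF FB.
have r0 x : 0 <= r x by have /andP[] := rC x.
have C0 : 0 <= C by have /andP[h1 h2] := rC point; exact: le_trans h1 h2.
pose L := likelihood r (n := n).
have L0 z : 0 <= L z by apply: likelihood_ge0 => x; have [] := andP (rC x).
have LC z : `|L z| <= C ^+ n.
  rewrite ger0_norm// -[n in leRHS]card_ord -prodr_const.
  by apply: ler_prod => i _; exact: rC.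
have mL : measurable_fun setT L by exact: measurable_likelihood.
have iF (S : probability (n.-tuple T) R) : rintegrable S F.
  exact: rintegrable_bounded FB.
have iL : rintegrable (iid P n) L by exact: rintegrable_bounded LC.
have iFL : rintegrable (iid P n) (fun z => F z * L z).
  exact: (rintegrableM_bounded mF FB).
have QL (G : n.-tuple T -> R) : measurable_fun setT G -> (forall z, 0 <= G z) ->
    \int[iid Q n]_z G z = \int[iid P n]_z (G z * L z).
  move=> mG G0; rewrite /Rintegral; congr fine.
  rewrite (ge0_integral_iid_likelihood mr r0 QP)//.
  exact/measurable_EFinP.
have L1 : \int[iid P n]_z L z = 1.
  rewrite -(Rintegral_cstE (iid Q n) 1) QL//.
  by apply: eq_RintegralT => z; rewrite mul1r.
(* The change of law is available for nonnegative functions; adding [B] to [F] reduces to that case,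
   and [L1] removes the constant again. *)
have FQ : \int[iid Q n]_z F z = \int[iid P n]_z (F z * L z).
  have FB0 z : 0 <= F z + B by have := FB z; rewrite ler_norml; lra.
  have := QL (fun z => F z + B) (measurable_funD mF (measurable_cst _)) FB0.
  rewrite RintegralDE//; last exact: rintegrable_cst.
  rewrite Rintegral_cstE (_ : \int[iid P n]_z ((F z + B) * L z) =
     \int[iid P n]_z (F z * L z + B * L z)); last first.
    by apply: eq_RintegralT => z; rewrite mulrDl.
  rewrite RintegralDE//; last exact: rintegrableZ.
  by rewrite RintegralZE// L1 mulr1 => /addIr.
have L2 : \int[iid P n]_z (L z ^+ 2) = (\int[P]_x (r x ^+ 2)) ^+ n.
  have r2 : rintegrable P (fun x => r x ^+ 2).
    apply: (@rintegrable_bounded _ _ _ _ (C ^+ 2)); first exact: measurable_funX.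
    by move=> x; rewrite ger0_norm ?sqr_ge0// lerXn2r// ?nnegrE//; have /andP[] := rC x.
  have -> : (fun z => L z ^+ 2) = likelihood (fun x => r x ^+ 2) (n := n).
    by apply/funext => z; rewrite /L /likelihood prodrXl.
  rewrite /Rintegral ge0_integral_iid_prod//.
  - by rewrite (REintegralE r2) -EFin_expe.
  - exact: measurable_funX.
  - by move=> x; exact: sqr_ge0.
  - by rewrite (REintegralE r2) ltry.
have sL1 : sq_integrable (iid P n) (fun z => L z - 1).
  apply: (@sq_integrable_bounded _ _ _ _ (C ^+ n + 1)).
    by apply: measurable_funB.
  by move=> z; rewrite (le_trans (ler_normB _ _))// normr1 lerD2r.
have sF : sq_integrable (iid P n) F by exact: sq_integrable_bounded FB.
have -> : \int[iid Q n]_z F z - \int[iid P n]_z F z = \int[iid P n]_z (F z * (L z - 1)).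
  rewrite FQ -RintegralBE//; apply: eq_RintegralT => z; ring.
apply: (le_trans (cauchy_schwarz sF sL1)); rewrite le_eqVlt; apply/orP; left.
apply/eqP; congr (_ * _); rewrite -L2.
have iL2 : rintegrable (iid P n) (fun z => L z ^+ 2).
  apply: (@rintegrable_bounded _ _ _ _ ((C ^+ n) ^+ 2)); first exact: measurable_funX.
  by move=> z; rewrite normrX lerXn2r// ?nnegrE ?exprn_ge0.
transitivity (\int[iid P n]_z (L z ^+ 2 - (2 * L z - 1))).
  by apply: eq_RintegralT => z; ring.
rewrite RintegralBE//; last first.
  by apply: rintegrableB; [exact: rintegrableZ|exact: rintegrable_cst].
rewrite RintegralBE//; [|exact: rintegrableZ|exact: rintegrable_cst].
by rewrite RintegralZE// L1 Rintegral_cstE; ring.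
Qed.

(** * From shift inequalities to the variance of the limit law *)

Section clip.
Context (R : realType).
Implicit Types K y a : R.

(** A bounded, continuous and 1-Lipschitz stand-in for the identity: regularity gives convergence
    only against bounded continuous functions. *)
Definition clip K y : R := Num.max (- K) (Num.min K y).

Lemma clip_continuous K : continuous (clip K).
Proof.
move=> y; apply: (@continuous_max _ _ (cst (- K)) (fun y => Num.min K y)).
  exact: cvg_cst.
by apply: (@continuous_min _ _ (cst K) id); [exact: cvg_cst|exact: cvg_id].
Qed.

Lemma normr_clip K y : 0 <= K -> `|clip K y| <= K.
Proof.
rewrite /clip ler_norml => K0; apply/andP; split; first by rewrite le_max lexx.
by rewrite ge_max ge_min lexx andbT; lra.
Qed.

Lemma sqr_clip_le K y : 0 <= K -> clip K y ^+ 2 <= y ^+ 2.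
Proof.
rewrite /clip => K0; case: (leP K y) => h.
  by rewrite max_r; [nra|lra].
by case: (leP (- K) y) => h'; nra.
Qed.

Lemma clip_id K y : `|y| <= K -> clip K y = y.
Proof. by rewrite ler_norml /clip => /andP[h1 h2]; rewrite min_r// max_r. Qed.

Lemma clip_lipschitz K y a : `|clip K (y + a) - clip K y| <= `|a|.
Proof.
have [K0|K0] := leP 0 K; last first.
  have E z : clip K z = - K by rewrite /clip max_l// ge_min; apply/orP; left; lra.
  by rewrite !E subrr normr0.
rewrite ler_norml /clip; have := ler_norm a; have := ler_norm (- a); rewrite normrN.
move: `|a| => b ab1 ab2.
case: (leP K (y + a)) => h1; case: (leP K y) => h2.
- by rewrite !max_r; lra.
- by rewrite (max_r (y := K)); [case: (leP (- K) y) => h3; lra|lra].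
- by rewrite (max_r (y := K)); [case: (leP (- K) (y + a)) => h3; lra|lra].
- by case: (leP (- K) y) => h3; case: (leP (- K) (y + a)) => h4; lra.
Qed.
End clip.

Section location_bound.
Context (R : realType) (L : probability (measurableTypeR R) R).

(** The hypothesis is applied to the functions [clip n (x - m)]. Their mean increment under the
    shift by [a] tends to [a] by dominated convergence, while their second moments stay below that
    of [x - m]. *)
Lemma shift_variance_bound (m a w : R) :
  rintegrable L (fun x : R => (x - m) ^+ 2) -> 0 <= w ->
  (forall f : R -> R, continuous f -> (exists M, forall x, `|f x| <= M) ->
    (\int[L]_x f (x + a) - \int[L]_x f x) ^+ 2 <= (\int[L]_x (f x ^+ 2)) * w) ->
  a ^+ 2 <= (\int[L]_x ((x - m) ^+ 2)) * w.
Proof.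
move=> im w0 H.
pose f (n : nat) (x : R) := clip n%:R (x - m).
have fc n : continuous (f n).
  move=> x; apply: (@continuous_comp _ _ _ (fun x => x - m) (clip n%:R)).
    by apply: cvgB; [exact: cvg_id|exact: cvg_cst].
  exact: clip_continuous.
have mf n : measurable_fun setT (f n) by exact: continuous_measurable_fun.
have mfa n : measurable_fun setT (fun x : R => f n (x + a)).
  apply: (measurableT_comp (mf n)); exact: measurable_funD.
have fb n x : `|f n x| <= n%:R by exact: normr_clip.
have if1 n : rintegrable L (f n) by exact: (rintegrable_bounded L (mf n) (fb n)).
have if2 n : rintegrable L (fun x => f n (x + a)).
  exact: (rintegrable_bounded L (mfa n) (fun x => fb n (x + a))).
pose D n : R := \int[L]_x (f n (x + a) - f n x).
have Dle n : D n ^+ 2 <= (\int[L]_x ((x - m) ^+ 2)) * w.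
  rewrite /D RintegralBE//; apply: (le_trans (H _ (fc n) _)); first by exists n%:R.
  rewrite ler_wpM2r//; apply: Rintegral_le => //.
    by have [] := sq_integrable_bounded L (mf n) (fb n).
  by move=> x; exact: sqr_clip_le.
have Dcvg : D n @[n --> \oo] --> a.
  have ia : rintegrable L (fun=> a) by exact: rintegrable_cst.
  have -> : a = \int[L]_x a by rewrite Rintegral_cstE.
  apply: fine_cvg; rewrite fineK; last exact: (integrable_fin_num measurableT ia).
  apply: (@dominated_cvg _ _ _ _ _ measurableT _ _ (cst `|a|%:E)) => //.
  - by move=> n; apply/measurable_EFinP; exact: measurable_funB (mfa n) (mf n).
  - move=> x _; apply: cvg_near_cst.
    near=> n; congr (_%:E).
    (* From this size of [n] on, neither argument is clipped and the increment is exactly [a]. *)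
    have nx : `|x - m| + `|a| <= n%:R by near: n; exact: nbhs_infty_ger.
    rewrite /f (_ : x + a - m = x - m + a); last by ring.
    rewrite !clip_id; first by ring.
      by rewrite (le_trans _ nx)// lerDl.
    by rewrite (le_trans _ nx)// ler_normD.
  - exact: (rintegrable_cst L `|a|).
  - move=> n x _; rewrite lee_fin /f (_ : x + a - m = x - m + a); last by ring.
    exact: clip_lipschitz.
have D2 : D n ^+ 2 @[n --> \oo] --> a ^+ 2 by exact: cvgM.
apply: (ler_cvg_to D2 (cvg_cst _)); exact: nearW.
Unshelve. all: by end_near. Qed.

(* [J] bounds the Fisher information; the perturbation [1 + e] leaves room for
   the normalisation of the chi-square distance at finite [n]. *)
Lemma variance_lower_bound (a J : R) : 0 <= J ->
  (forall e : R, 0 < e <= 1 ->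
    forall f : R -> R, continuous f -> (exists M, forall x, `|f x| <= M) ->
    (\int[L]_x f (x + e * a) - \int[L]_x f x) ^+ 2 <=
    (\int[L]_x (f x ^+ 2)) * (expR (e ^+ 2 * J * (1 + e)) - 1)) ->
  ('V_L[idfun] < +oo)%E -> a ^+ 2 <= fine 'V_L[idfun] * J.
Proof.
move=> J0 H; rewrite /variance unlock/= unlock /=; set m := fine _.
set V := (X in (X < +oo)%E).
have V0 : (0 <= V)%E.
  by apply: integral_ge0 => x _; rewrite lee_fin /= -expr2 sqr_ge0.
move=> Voo.
have im : rintegrable L (fun x : R => (x - m) ^+ 2).
  apply/integrableP; split.
    by apply/measurable_EFinP/measurable_funX/measurable_funB.
  apply: le_lt_trans Voo; rewrite le_eqVlt; apply/orP; left; apply/eqP.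
  by apply: eq_integral => x _ /=; rewrite ger0_norm ?sqr_ge0.
rewrite [X in fine X](_ : _ = (\int[L]_x ((x - m) ^+ 2))%:E); last first.
  by rewrite -REintegralE.
rewrite /=; set v := \int[L]_x _.
have v0 : 0 <= v by apply: Rintegral_ge0 => x _; exact: sqr_ge0.
(* With [expR u <= 1 / (1 - u)] the shift bound becomes [(e a)^2 (1 - u) <= v u]; division by [e^2]
   leaves [v J] up to an error of order [e]. The condition [2 e J < 1] guarantees [u < 1]. *)
have key e : 0 < e <= 1 -> 2 * e * J < 1 -> a ^+ 2 <= v * J + e * (v * J + 2 * J * a ^+ 2).
  move=> /andP[e0 e1] eJ.
  set u := e ^+ 2 * J * (1 + e).
  have u0 : 0 <= u by rewrite !mulr_ge0 ?sqr_ge0//; lra.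
  have ue : u <= e * (2 * e * J).
    have : 0 <= e ^+ 2 * J * (1 - e) by rewrite !mulr_ge0 ?sqr_ge0//; lra.
    by rewrite /u; nra.
  have X0 : 0 <= 2 * e * J by rewrite !mulr_ge0//; lra.
  have u1 : u < 1.
    apply: (le_lt_trans ue); apply: le_lt_trans eJ.
    by rewrite -[leRHS]mul1r ler_wpM2r.
  have eu : expR u <= (1 - u)^-1.
    rewrite -[leLHS]invrK -expRN lef_pV2 ?posrE ?expR_gt0 ?subr_gt0//.
    by have := expR_ge1Dx (- u).
  have := @shift_variance_bound m (e * a) (expR u - 1) im _ (H e _).
  rewrite subr_ge0 e0 e1 -/v => /(_ _ isT).
  have e1u : 1 <= expR u by have := expR_ge1Dx u; lra.
  move=> /(_ e1u) h.
  have h2 : (e * a) ^+ 2 <= v * ((1 - u)^-1 - 1).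
    by apply: (le_trans h); rewrite ler_wpM2l// lerD2r.
  have h3 : (e * a) ^+ 2 * (1 - u) <= v * u.
    have : (e * a) ^+ 2 * (1 - u) <= v * ((1 - u)^-1 - 1) * (1 - u).
      by rewrite ler_wpM2r//; lra.
    have u1' : 1 - u != 0 by rewrite gt_eqF// subr_gt0.
    by rewrite -mulrA mulrBl mulVf// mul1r opprB addrCA subrr addr0.
  have h4 : e ^+ 2 * (a ^+ 2 * (1 - u)) <= e ^+ 2 * (v * J * (1 + e)).
    by rewrite (_ : _ * _ = (e * a) ^+ 2 * (1 - u)); [rewrite (le_trans h3)//; rewrite /u; lra|ring].
  rewrite ler_pM2l ?exprn_gt0// in h4.
  have : a ^+ 2 * u <= a ^+ 2 * (e * (2 * J)).
    by rewrite ler_wpM2l ?sqr_ge0//; nra.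
  nra.
apply/ler_addgt0Pr => eta eta0.
set C := v * J + 2 * J * a ^+ 2.
have C0 : 0 <= C.
  by apply: addr_ge0; [exact: mulr_ge0|apply: mulr_ge0; [lra|exact: sqr_ge0]].
(* The second bound keeps [2 e J] below 1, the third keeps the error [e C] below [eta]; the added
   ones avoid division by 0. *)
pose e := Num.min (Num.min 1 ((2 * J + 1)^-1 / 2)) (eta / (C + 1)).
have e0 : 0 < e by rewrite !lt_min ltr01 !divr_gt0 ?invr_gt0//; lra.
have e1 : e <= 1 by rewrite !ge_min lexx.
have e2 : e * (2 * J + 1) <= 2^-1.
  rewrite -ler_pdivlMr; last by lra.
  by rewrite mulrC !ge_min lexx !orbT.
have e3 : e * (C + 1) <= eta.
  rewrite -ler_pdivlMr; last by lra.
  by rewrite !ge_min lexx !orbT.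
have := key e; rewrite e0 e1 => /(_ isT) k.
apply: (le_trans (k _)); first by nra.
rewrite lerD2l -/C; nra.
Qed.
End location_bound.

(** * Conditional expectations and overlap *)

Section projections.
Context (R : realType) (p : nat).
Local Notation full := (full_data R p).

Lemma measurable_covX : measurable_fun [set: full] (@covX R p).
Proof. exact: (measurableT_comp measurable_fst measurable_fst). Qed.

Lemma measurable_OD : measurable_fun [set: full] (@OD R p).
Proof. exact: (measurableT_comp measurable_snd measurable_fst). Qed.

Lemma measurable_obsO : measurable_fun [set: full] (@obsO R p).
Proof. exact: (measurableT_comp measurable_fst measurable_OD). Qed.

Lemma measurable_trtD : measurable_fun [set: full] (@trtD R p).
Proof. exact: (measurableT_comp measurable_snd measurable_OD). Qed.

Lemma measurable_potY : measurable_fun [set: full] (@potY R p).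
Proof. exact: measurable_snd. Qed.

Lemma measurable_outY1 : measurable_fun [set: full] (@outY1 R p : full -> R).
Proof. exact: (measurableT_comp measurable_fst measurable_snd). Qed.

Lemma measurable_outY0 : measurable_fun [set: full] (@outY0 R p : full -> R).
Proof. exact: (measurableT_comp measurable_snd measurable_snd). Qed.

Lemma measurable_observeT : measurable_fun [set: full] (@observe R p).
Proof. exact: (@measurable_funPT _ _ _ _ (@observe R p)). Qed.

Lemma measurable_bool_natr d (T : measurableType d) (b : T -> bool) :
  measurable_fun setT b -> measurable_fun setT (fun x => (b x)%:R : R).
Proof.
move=> mb; have : measurable_fun [set: bool] (fun b => b%:R : R) by [].
by move=> /measurableT_comp; apply.
Qed.

Lemma measurable_bool_set d (T : measurableType d) (b : T -> bool) :
  measurable_fun setT b -> measurable [set x | b x].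
Proof.
move=> mb; have : measurable (b @^-1` [set true]).
  by rewrite -[X in measurable X]setTI; exact: mb.
by congr measurable; apply/seteqP; split => x.
Qed.

Lemma indic_bool d (T : measurableType d) (b : T -> bool) x :
  \1_[set x | b x] x = (b x)%:R :> R.
Proof. by rewrite indicE; congr (_%:R); congr nat_of_bool; apply/idP/idP; rewrite inE. Qed.

Lemma indic_eqb d (T : measurableType d) (f : T -> bool) o x :
  \1_[set x | f x = o] x = (f x == o)%:R :> R.
Proof.
rewrite indicE; congr (_%:R); congr nat_of_bool.
by apply/idP/idP => [/set_mem /eqP|/eqP h]//; rewrite inE.
Qed.

Lemma measurable_eqb_set d (T : measurableType d) (f : T -> bool) o :
  measurable_fun setT f -> measurable [set x | f x = o].
Proof.
by move=> mf; rewrite -[X in measurable X]setTI; apply: (mf measurableT [set o]).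
Qed.

End projections.

Section conditional_expectation.
Context (R : realType) (p : nat) (Q : probability (full_data R p) R).
Local Notation full := (full_data R p).
Local Notation X := (@covX R p).
Implicit Types (f : full -> R) (m : covariates R p -> R) (E : set full).

Lemma Rintegral_setE E f : measurable E ->
  (\int[Q]_(w in E) (f w)%:E = \int[Q]_w (\1_E w * f w)%:E)%E.
Proof.
move=> mE; rewrite integral_mkcond; apply: eq_integral => w _.
by rewrite epatch_indic /= EFinM muleC.
Qed.

(** The indicator of [E] moves the conditioning event into the integrand, which becomes a residual
    with zero integral over every set determined by [X]. This is the hypothesis of
    [integral_orthogonal]. *)
Lemma cond_exp_residual E f m : measurable E -> cond_exp Q E f m ->
  rintegrable Q (fun w => \1_E w * (f w - m (X w))) /\
  (forall A, measurable A ->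
   \int[Q]_(w in X @^-1` A) (\1_E w * (f w - m (X w)))%:E = 0)%E.
Proof.
move=> mE [mm fi mi H].
have iE (h : full -> R) : Q.-integrable E (EFin \o h) ->
    rintegrable Q (fun w => \1_E w * h w).
  move=> /(integrable_mkcond _ mE); congr (_.-integrable _ _).
  by apply/funext => w; rewrite epatch_indic /= EFinM muleC.
have fi1 := iE _ fi; have mi1 := iE _ mi.
split.
  have := rintegrableB fi1 mi1.
  by congr rintegrable; apply/funext => w; rewrite mulrBr.
move=> A mA; have mXA : measurable (X @^-1` A).
  by rewrite -[X in measurable X]setTI; exact: measurable_covX.
have iS (h : full -> R) : rintegrable Q h -> Q.-integrable (X @^-1` A) (EFin \o h).
  by move=> hi; apply: integrableS hi.
under eq_integral do rewrite mulrBr EFinB.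
rewrite integralB_EFin//; [|exact: iS|exact: iS].
have setE (h : full -> R) : (\int[Q]_(w in E `&` X @^-1` A) (h w)%:E =
    \int[Q]_(w in X @^-1` A) (\1_E w * h w)%:E)%E.
  rewrite setIC integral_mkcondr; apply: eq_integral => w _.
  by rewrite epatch_indic /= EFinM muleC.
rewrite -!setE H// subee// setE.
exact: (integrable_fin_num mXA (iS _ mi1)).
Qed.

Lemma cond_exp_orthogonal E f m (F : covariates R p -> R) : measurable E ->
  cond_exp Q E f m -> measurable_fun setT F ->
  rintegrable Q (fun w => F (X w) * (\1_E w * (f w - m (X w)))) ->
  \int[Q]_w (F (X w) * (\1_E w * (f w - m (X w)))) = 0.
Proof.
move=> mE /(cond_exp_residual mE)[ik k0] mF iF.
by rewrite /Rintegral (integral_orthogonal _ ik k0 mF iF)//; exact: measurable_covX.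
Qed.

(** Tested against the sign of [g], the integrand becomes [|\1_E g(X)|], whose integral is therefore
    0. *)
Lemma ae_eq0_of_null E (g : covariates R p -> R) : measurable E ->
  measurable_fun setT g -> rintegrable Q (fun w => \1_E w * g (X w)) ->
  (forall A, measurable A -> \int[Q]_(w in X @^-1` A) (\1_E w * g (X w))%:E = 0)%E ->
  {ae Q, forall w, E w -> g (X w) = 0}.
Proof.
move=> mE mg ig g0.
pose F x : R := Num.sg (g x).
have mF : measurable_fun setT F.
  have mlt (h : covariates R p -> R) : measurable_fun setT h ->
      measurable_fun setT (fun x => (0 < h x)%R%:R : R).
    move=> mh; apply: (@measurable_bool_natr R _ _ (fun x => 0 < h x)).
    by apply: measurable_fun_ltr.
  have -> : F = fun x => (0 < g x)%R%:R - (0 < - g x)%R%:R.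
    apply/funext => x; rewrite /F oppr_gt0.
    by case: sgrP => _; rewrite ?subr0 ?sub0r ?subrr.
  by apply: measurable_funB; apply: mlt => //; exact: measurableT_comp.
have FB x : `|F x| <= 1 by rewrite /F normr_sg lern1 leq_b1.
have iF : rintegrable Q (fun w => F (X w) * (\1_E w * g (X w))).
  apply: (@rintegrableM_bounded _ _ _ _ 1) => //.
  by apply: (measurableT_comp mF); exact: measurable_covX.
have := integral_orthogonal (@measurable_covX R p) ig g0 mF iF.
have FE w : F (X w) * (\1_E w * g (X w)) = `|\1_E w * g (X w)|.
  by rewrite normrM mulrCA -normrEsg ger0_norm.
under eq_integral do rewrite FE -abse_EFin.
move=> /(ae_eq_integral_abs _ measurableT _).
have /measurable_EFinP mE' := rintegrable_measurable ig.
move=> /(_ mE'); apply: filterS => w /(_ I)/= [] /eqP.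
rewrite indicE mulf_eq0 => /orP[|/eqP//]; case: (boolP (w \in E)) => [|/negP].
  by rewrite oner_eq0.
by move=> wE _ /mem_set.
Qed.
End conditional_expectation.

Section conditional_expectation_versions.
Context (R : realType) (p : nat) (Q : probability (full_data R p) R).
Local Notation full := (full_data R p).
Local Notation X := (@covX R p).
Implicit Types (f : full -> R) (m : covariates R p -> R) (E : set full).

(** The difference of the two residuals is [\1_E (m - m')(X)], where [f] has cancelled, so
    [ae_eq0_of_null] applies to it. *)
Lemma cond_exp_unique E f m m' : measurable E ->
  cond_exp Q E f m -> cond_exp Q E f m' ->
  {ae Q, forall w, E w -> m (X w) = m' (X w)}.
Proof.
move=> mE fm fm'; have [mm _ _ _] := fm; have [mm' _ _ _] := fm'.
have [i1 z1] := cond_exp_residual mE fm; have [i2 z2] := cond_exp_residual mE fm'.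
have DE w : \1_E w * (m (X w) - m' (X w)) =
    \1_E w * (f w - m' (X w)) - \1_E w * (f w - m (X w)) by ring.
have : {ae Q, forall w, E w -> (fun x => m x - m' x) (X w) = 0}.
  apply: (@ae_eq0_of_null _ _ _ E (fun x => m x - m' x)) => //; first exact: measurable_funB.
    have := rintegrableB i2 i1.
    by congr rintegrable; apply/funext => w; rewrite DE.
  move=> A mA; under eq_integral do rewrite DE EFinB.
  have mXA : measurable (X @^-1` A).
    by rewrite -[X in measurable X]setTI; exact: measurable_covX.
  have iS (h : full -> R) : rintegrable Q h -> Q.-integrable (X @^-1` A) (EFin \o h).
    by move=> hi; apply: integrableS hi.
  by rewrite integralB_EFin//; [rewrite z1// z2// sube0|exact: iS|exact: iS].
by apply: filterS => w h Ew; apply/eqP; rewrite -subr_eq0; apply/eqP/h.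
Qed.

(** Used to pass from the given versions of the conditional probabilities to their clamped forms
    and, along the paths, back to the prescribed [g]. *)
Lemma cond_exp_ae_version E f m m' : measurable E -> cond_exp Q E f m ->
  measurable_fun setT m' -> {ae Q, forall w, E w -> m (X w) = m' (X w)} ->
  cond_exp Q E f m'.
Proof.
move=> mE [mm fi mi H] mm' mE'.
have mXc (h : covariates R p -> R) (D : set full) : measurable_fun setT h ->
    measurable_fun D (fun w => (h (X w))%:E).
  move=> mh; apply: measurable_funTS; apply/measurable_EFinP.
  by apply: (measurableT_comp mh); exact: measurable_covX.
split => //.
- apply/integrableP; split; first exact: mXc.
  move/integrableP : mi => [_]; apply: le_lt_trans.
  rewrite le_eqVlt; apply/orP; left; apply/eqP; apply: ae_eq_integral => //.
  + by apply: measurableT_comp => //; exact: mXc.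
  + by apply: measurableT_comp => //; exact: mXc.
  + by move: mE'; apply: filterS => w h Ew; rewrite h.
- move=> A mA; rewrite H//.
  have mXA : measurable (X @^-1` A).
    by rewrite -[X in measurable X]setTI; exact: measurable_covX.
  apply: ae_eq_integral => //.
  + exact: measurableI.
  + exact: mXc.
  + exact: mXc.
  + by move: mE'; apply: filterS => w h [Ew _]; rewrite h.
Qed.

Lemma cond_expD E f g m m' : measurable E -> cond_exp Q E f m -> cond_exp Q E g m' ->
  cond_exp Q E (fun w => f w + g w) (fun x => m x + m' x).
Proof.
move=> mE [mm fi mi Hf] [mm' gi mi' Hg]; split.
- exact: measurable_funD.
- exact: (integrableD mE fi gi).
- exact: (integrableD mE mi mi').
- move=> A mA; have mXA : measurable (X @^-1` A).
    by rewrite -[X in measurable X]setTI; exact: measurable_covX.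
  have iS (h : full -> R) : Q.-integrable E (EFin \o h) ->
      Q.-integrable (E `&` X @^-1` A) (EFin \o h).
    by move=> hi; apply: integrableS hi => //; exact: measurableI.
  have mEA := measurableI _ _ mE mXA.
  under eq_integral do rewrite EFinD.
  rewrite integralD_EFin//; [|exact: iS|exact: iS].
  under [RHS]eq_integral do rewrite EFinD.
  by rewrite integralD_EFin//; [rewrite Hf// Hg|exact: iS|exact: iS].
Qed.

Lemma cond_exp_of_covariates E m : measurable E -> measurable_fun setT m ->
  Q.-integrable E (fun w => (m (X w))%:E) -> cond_exp Q E (fun w => m (X w)) m.
Proof. by move=> mE mm mi; split. Qed.

Lemma cond_exp_ext E f g m : cond_exp Q E f m -> f =1 g -> cond_exp Q E g m.
Proof. by move=> fm /funext <-. Qed.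

Lemma integrable_of_rintegrable E f : measurable E -> rintegrable Q f ->
  Q.-integrable E (EFin \o f).
Proof. by move=> mE; apply: integrableS. Qed.

Lemma integrable_of_bounded (B : R) E f : measurable E -> measurable_fun setT f ->
  (forall w, `|f w| <= B) -> Q.-integrable E (EFin \o f).
Proof.
by move=> mE mf fB; apply: integrable_of_rintegrable => //; exact: rintegrable_bounded fB.
Qed.
End conditional_expectation_versions.

(** * Conditional independence as an exchange of indicators and weights *)

Section unconfounded_transfer.
Context (R : realType) (p : nat) (Q : probability (full_data R p) R).
Local Notation full := (full_data R p).
Local Notation X := (@covX R p).

Definition covpot (w : full) := (X w, potY w).

Lemma measurable_covpot : measurable_fun setT covpot.
Proof. by apply: measurable_fun_mk_pair; [exact: measurable_covX|exact: measurable_potY]. Qed.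

(** Both sides integrate [G] against images under [covpot] of finite measures, so it suffices to
    compare rectangles of sets [A] and [C]. There both equal the integral of [a(X) b(X)] over [X] in
    [A], with [a] a version of the conditional probability that the potential outcomes lie in [C]:
    one by unconfoundedness, the other because the residual of [a] is orthogonal to the bounded
    function [\1_A b] of [X]. *)
Lemma unconfounded_transfer (B : set (bool * bool)) (b : covariates R p -> R) :
  measurable B -> unconfounded Q -> cond_prob Q setT (@OD R p @^-1` B) b ->
  (forall x, 0 <= b x <= 1) ->
  forall G : covariates R p * (measurableTypeR R * measurableTypeR R) -> \bar R,
  measurable_fun setT G -> (forall z, (0 <= G z)%E) ->
  (\int[Q]_w ((\1_(@OD R p @^-1` B) w)%:E * G (covpot w)) =
   \int[Q]_w ((b (X w))%:E * G (covpot w)))%E.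
Proof.
move=> mB uQ bB b01 G mG G0.
have mOB : measurable (@OD R p @^-1` B).
  by rewrite -[X in measurable X]setTI; exact: measurable_OD.
have [mb _ _ Hb] := bB.
have mbX : measurable_fun setT (fun w => b (X w)).
  by apply: (measurableT_comp mb); exact: measurable_covX.
have bX1 w : `|b (X w)| <= 1 by have /andP[? ?] := b01 (X w); rewrite ger0_norm.
under eq_integral do rewrite muleC.
under [RHS]eq_integral do rewrite muleC.
apply: (@ge0_transport _ _ _ _ _ _ _ Q Q (fun w => (\1_(@OD R p @^-1` B) w)%:E)
  (fun w => (b (X w))%:E) covpot covpot measurable_covpot measurable_covpot) => //.
- by apply/measurable_EFinP.
- by apply/measurable_EFinP.
- by move=> w; rewrite lee_fin; have /andP[] := b01 (X w).
apply: transport_rectangle => //.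
- exact: measurable_covpot.
- exact: measurable_covpot.
- by apply/measurable_EFinP.
- by apply/measurable_EFinP.
- by move=> w; rewrite lee_fin; have /andP[] := b01 (X w).
- rewrite integral_indic// setIT; apply: le_lt_trans (ltry 1); exact: probability_le1.
move=> A C mA mC.
have [a [b' [aC b'B abCB]]] := uQ _ _ mC mB.
have mpC : measurable (@potY R p @^-1` C).
  by rewrite -[X in measurable X]setTI; exact: measurable_potY.
have mXA : measurable (X @^-1` A).
  by rewrite -[X in measurable X]setTI; exact: measurable_covX.
(* The version supplied by unconfoundedness need not be [b]; the two agree almost everywhere. *)
have bb' := cond_exp_unique measurableT b'B bB.
have [ma ai aiX Ha] := aC.
have [mab _ abi Hab] := abCB.
have -> : covpot @^-1` (A `*` C) = @potY R p @^-1` C `&` X @^-1` A.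
  by apply/seteqP; split => w [].
transitivity (\int[Q]_(w in X @^-1` A) (a (X w) * b (X w))%:E)%E.
  transitivity (\int[Q]_(w in X @^-1` A)
      (\1_(@potY R p @^-1` C `&` @OD R p @^-1` B) w)%:E)%E.
    rewrite [in LHS]setIC [LHS]integral_mkcondr; apply: eq_integral => w _.
    by rewrite epatch_indic/= -EFinM indicI/= mulrC.
  have := Hab _ mA; rewrite setTI => ->.
  apply: ae_eq_integral => //.
  + apply: measurable_funTS; apply/measurable_EFinP; apply: (measurableT_comp mab).
    exact: measurable_covX.
  + apply: measurable_funTS; apply/measurable_EFinP; apply: measurable_funM => //.
    by apply: (measurableT_comp ma); exact: measurable_covX.
  + by move: bb'; apply: filterS => w h _ /=; rewrite h.
have ibr : rintegrable Q (fun w => \1_setT w * (\1_(@potY R p @^-1` C) w - a (X w))).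
  by have [] := cond_exp_residual measurableT aC.
pose F x : R := \1_A x * b x.
have mF : measurable_fun setT F by apply: measurable_funM => //; exact: measurable_indic.
have FB w : `|F (X w)| <= 1.
  by rewrite /F normrM ger0_norm// indicE; case: (_ \in _); rewrite ?mul1r ?mul0r.
have mFX : measurable_fun setT (fun w => F (X w)).
  by apply: (measurableT_comp mF); exact: measurable_covX.
have H0 := cond_exp_orthogonal measurableT aC mF (rintegrableM_bounded mFX FB ibr).
have i1 : rintegrable Q (fun w => F (X w) * \1_(@potY R p @^-1` C) w).
  apply: (rintegrableM_bounded mFX FB); apply: (@rintegrable_bounded _ _ _ _ 1) => //.
  by move=> w; rewrite indicE; case: (_ \in _); rewrite ?normr1 ?normr0.
have i2 : rintegrable Q (fun w => F (X w) * a (X w)).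
  by apply: (rintegrableM_bounded mFX FB).
have H1 : \int[Q]_w (F (X w) * \1_(@potY R p @^-1` C) w) = \int[Q]_w (F (X w) * a (X w)).
  apply/eqP; rewrite -subr_eq0 -RintegralBE// -H0; apply/eqP.
  by apply: eq_RintegralT => w; rewrite (_ : \1_setT w = 1) ?indicT//; ring.
have H2 : (\int[Q]_w (F (X w) * \1_(@potY R p @^-1` C) w)%:E =
    \int[Q]_w (F (X w) * a (X w))%:E)%E by rewrite !REintegralE// H1.
have indXA w : \1_(X @^-1` A) w = \1_A (X w) :> R by [].
rewrite [LHS]integral_mkcond [RHS]integral_mkcond.
transitivity (\int[Q]_w (F (X w) * a (X w))%:E)%E.
  by apply: eq_integral => w _; rewrite epatch_indic/= -EFinM indXA /F; congr (_%:E); ring.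
rewrite -H2; apply: eq_integral => w _.
by rewrite epatch_indic/= -EFinM indicI/= indXA /F; congr (_%:E); ring.
Qed.
End unconfounded_transfer.

Section clamp.
Context (R : realType) (T : Type).
Implicit Types (c : R) (m : bool -> T -> R).

(* A version of a conditional probability of a binary variable which is a
   probability bounded away from 0 and 1 everywhere, not only almost surely. *)
Definition clamp c m (b : bool) (x : T) : R :=
  let q := Num.max c (Num.min (1 - c) (m true x)) in if b then q else 1 - q.

Lemma clamp_ge c m b x : 2 * c < 1 -> c <= clamp c m b x.
Proof.
rewrite /clamp => c1; case: b; first by rewrite le_max lexx.
rewrite lerBrDr addrC -lerBrDr ge_max ge_min lexx /= andbT; lra.
Qed.

Lemma clamp_sum c m x : clamp c m true x + clamp c m false x = 1.
Proof. by rewrite /clamp addrC subrK. Qed.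

Lemma clamp_id c m x : (forall b, c < m b x) -> m true x + m false x = 1 ->
  forall b, m b x = clamp c m b x.
Proof.
move=> mc m1; have h1 := mc true; have h0 := mc false; rewrite /clamp.
by rewrite min_r ?max_r; [case; lra|lra|lra].
Qed.

End clamp.

Lemma measurable_clamp d (T : measurableType d) (R : realType) c (m : bool -> T -> R) b :
  measurable_fun setT (m true) -> measurable_fun setT (clamp c m b).
Proof.
move=> mm; have mq : measurable_fun setT (fun x => Num.max c (Num.min (1 - c) (m true x))).
  by apply: measurable_maxr => //; exact: measurable_minr.
by case: b => //; exact: measurable_funB.
Qed.

(** The bounds hold at every point, so that the weights may be inverted without almost-everywhere
    provisos. *)
Record overlap_weights (R : realType) (T : Type) (c : R) (m : bool -> T -> R) : Prop := {
  ow_ge : forall b x, c <= m b x;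
  ow_sum : forall x, m true x + m false x = 1 }.

Lemma ow_le1 (R : realType) (T : Type) (c : R) (m : bool -> T -> R) b x :
  0 < c -> overlap_weights c m -> m b x <= 1.
Proof.
move=> c0 [mc ms]; have h1 := mc true x; have h0 := mc false x; have := ms x.
by case: b => ?; lra.
Qed.

Section transfer.
Context (R : realType) (p : nat) (Q : probability (full_data R p) R).
Local Notation full := (full_data R p).
Local Notation X := (@covX R p).

Lemma measurable_obsO_set o : measurable [set w : full | obsO w = o].
Proof. by apply: measurable_eqb_set; exact: measurable_obsO. Qed.

Lemma measurable_trtD_set o : measurable [set w : full | trtD w = o].
Proof. by apply: measurable_eqb_set; exact: measurable_trtD. Qed.

(** The integral that gives the law of [X] runs over the intersection of [Xs] with the set, which is
    empty for the complement of [Xs]. *)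
Lemma ae_covariates_in_support (Xs : set (covariates R p)) zeta : measurable Xs ->
  covariate_density Q Xs zeta -> {ae Q, forall w, Xs (X w)}.
Proof.
move=> mXs [_ H]; have := H _ (measurableC mXs); rewrite setICr integral_set0 => H0.
exists (X @^-1` (~` Xs)); split => //.
by rewrite -[X in measurable X]setTI; apply: measurable_covX => //; exact: measurableC.
Qed.

Lemma cond_prob_bool_sum E (b : full -> bool) (m : bool -> covariates R p -> R) :
  measurable E -> (forall o, cond_prob Q E [set w | b w = o] (m o)) ->
  {ae Q, forall w, E w -> m true (X w) + m false (X w) = 1}.
Proof.
move=> mE Hm.
have h1 : cond_exp Q E (fun w => 1 : R) (fun x => m true x + m false x).
  apply: cond_exp_ext (cond_expD mE (Hm true) (Hm false)) _ => w.
  rewrite !indic_eqb.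
  by case: (b w); rewrite ?addr0 ?add0r.
have h2 : cond_exp Q E (fun w => 1 : R) (fun=> 1).
  apply: cond_exp_of_covariates => //.
  by apply: (@integrable_of_bounded _ _ _ 1) => // w; rewrite normr1.
exact: cond_exp_unique h1 h2.
Qed.

Lemma ae_nonempty (B : Prop) : {ae Q, forall w, B} -> B.
Proof.
move=> [N [mN N0 sN]]; apply: contrapT => nB.
have : (Q setT <= Q N)%E by apply: le_measure; rewrite ?inE//; move=> w _; apply: sN.
rewrite N0 (_ : Q setT = 1%E); last exact: probability_setT.
by rewrite lee_fin ler10.
Qed.

(* On the stratum [O = o], and on the whole population, [X] has the same null
   sets. *)
Lemma ae_of_stratum (o : bool) (pi : covariates R p -> R) c (N : set (covariates R p)) :
  0 < c -> measurable N -> cond_prob Q setT [set w | obsO w = o] pi ->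
  (forall x, c <= pi x) ->
  {ae Q, forall w, obsO w = o -> N (X w)} -> {ae Q, forall w, N (X w)}.
Proof.
move=> c0 mN [mpi _ ipi Hpi] cpi HN.
have mC := measurableC mN.
have mXC : measurable (X @^-1` (~` N)).
  by rewrite -[X in measurable X]setTI; exact: measurable_covX.
have := Hpi _ mC; rewrite setTI => H.
have z : (\int[Q]_(w in X @^-1` (~` N)) (\1_[set w | obsO w = o] w)%:E = 0)%E.
  rewrite integral_indic//; last exact: measurable_obsO_set.
  apply: measure_negligible; first by apply: measurableI => //; exact: measurable_obsO_set.
  by apply: negligibleS HN => w [/= Ow nN] h; exact/nN/h.
have cle : (c%:E * Q (X @^-1` (~` N)) <= \int[Q]_(w in X @^-1` (~` N)) (pi (X w))%:E)%E.
  rewrite -integral_cst//; apply: ge0_le_integral => //.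
  - by move=> w _; rewrite lee_fin ltW.
  - apply: measurable_funTS; apply/measurable_EFinP; apply: (measurableT_comp mpi).
    exact: measurable_covX.
  - by move=> w _; rewrite lee_fin.
exists (X @^-1` (~` N)); split => //.
apply/eqP; rewrite eq_le measure_ge0 andbT.
by rewrite -(@lee_pmul2l _ c%:E)// mule0 (le_trans cle)// -H z.
Qed.
End transfer.

Section transfer_model.
Context (R : realType) (p : nat).
Local Notation full := (full_data R p).
Local Notation X := (@covX R p).
Local Notation cov := (covariates R p).
Local Notation pot := (measurableTypeR R * measurableTypeR R)%type.

(* What conditional independence is used for: the indicators of [O = o] and of
   [O = 0, D = d] may be replaced by their conditional probabilities given [X]
   in front of any function of [(X, (Y(1), Y(0)))]. *)
Record transfers (Q : probability full R) (pi e : bool -> cov -> R) : Prop := {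
  tr_treated : Q [set w | obsO w && ~~ trtD w] = 0%E;
  tr_obs : forall o (G : cov * pot -> \bar R), measurable_fun setT G ->
    (forall z, (0 <= G z)%E) ->
    (\int[Q]_w ((obsO w == o)%:R%:E * G (covpot w)) =
     \int[Q]_w ((pi o (X w))%:E * G (covpot w)))%E;
  tr_trt : forall d (G : cov * pot -> \bar R), measurable_fun setT G ->
    (forall z, (0 <= G z)%E) ->
    (\int[Q]_w ((~~ obsO w && (trtD w == d))%:R%:E * G (covpot w)) =
     \int[Q]_w ((pi false (X w) * e d (X w))%:E * G (covpot w)))%E }.

Lemma measurable_eq_set d (T : measurableType d) (f g : T -> R) :
  measurable_fun setT f -> measurable_fun setT g -> measurable [set x | f x = g x].
Proof.
move=> mf mg; have : measurable ((fun x => f x - g x) @^-1` [set 0]).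
  rewrite -[X in measurable X]setTI; apply: (measurable_funB mf mg) => //.
congr measurable; apply/seteqP; split => x /= h; last by rewrite h subrr.
by apply/eqP; rewrite -subr_eq0 h.
Qed.

Section clean.
Variables (Xs : set cov) (Q : probability full R) (zeta zetaT : cov -> R).
Variables (pi g : bool -> cov -> R) (c : R).
Hypotheses (mXs : measurable Xs) (hs : censoring_setting Xs Q zeta zetaT pi g).
Hypotheses (hu : unconfounded Q) (hc : common_support Xs zeta zetaT pi g c).

Let mpi o : measurable_fun setT (pi o). Proof. by case: (Defs.piP hs o). Qed.
Let mg o : measurable_fun setT (g o). Proof. by case: (gP hs o). Qed.

Lemma ae_pi_gt : {ae Q, forall w, forall o, c < pi o (X w) /\ c < g o (X w)}.
Proof.
have := ae_covariates_in_support mXs (zetaP hs).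
by apply: filterS => w Xw o; have [_ /(_ _ Xw o)[]] := hc.
Qed.

Lemma ae_pi_clamp : {ae Q, forall w, forall o, pi o (X w) = clamp c pi o (X w)}.
Proof.
have := cond_prob_bool_sum measurableT (Defs.piP hs); have := ae_pi_gt.
by apply: filterS2 => w h1 h2 o; apply: clamp_id; [move=> b; have [] := h1 b|exact: h2].
Qed.

(** At almost every value of [X] two weights larger than [c] have sum 1. The conclusion does not
    mention the point, so the existence of one such point suffices. *)
Lemma overlap_half : 2 * c < 1.
Proof.
have := cond_prob_bool_sum measurableT (Defs.piP hs); have := ae_pi_gt.
move=> h1 h2; apply: (@ae_nonempty _ _ Q); apply: filterS2 h1 h2 => w h1 /(_ I).
have [+ _] := h1 true; have [+ _] := h1 false; lra.
Qed.

Let c0 : 0 < c. Proof. by case: hc. Qed.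

Lemma overlap_clamp (m : bool -> cov -> R) : overlap_weights c (clamp c m).
Proof.
split=> [b x|x]; last exact: clamp_sum.
exact/clamp_ge/overlap_half.
Qed.

Lemma cond_prob_pi_clamp o : cond_prob Q setT [set w | obsO w = o] (clamp c pi o).
Proof.
apply: (cond_exp_ae_version measurableT (Defs.piP hs o)).
  by apply: measurable_clamp; exact: mpi.
by have := ae_pi_clamp; apply: filterS => w + _; exact.
Qed.

(** The version [g] is determined only on the stratum O = 0; since the weight of that stratum is at
    least [c], a property of [X] that holds almost surely there holds almost surely on the whole
    population. *)
Lemma ae_g_clamp : {ae Q, forall w, forall d, g d (X w) = clamp c g d (X w)}.
Proof.
have h d : {ae Q, forall w, g d (X w) = clamp c g d (X w)}.
  apply: (@ae_of_stratum _ _ Q false (clamp c pi false) c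
    [set x | g d x = clamp c g d x]) => //.
  - by apply: measurable_eq_set => //; apply: measurable_clamp; exact: mg.
  - exact: cond_prob_pi_clamp.
  - by move=> x; exact/clamp_ge/overlap_half.
  have := cond_prob_bool_sum (measurable_obsO_set false) (gP hs); have := ae_pi_gt.
  apply: filterS2 => w h1 h2 Ow; apply: clamp_id; last exact: h2.
  by move=> b; have [] := h1 b.
by have := h true; have := h false; apply: filterS2 => w ? ? [].
Qed.

Lemma cond_prob_g_clamp d :
  cond_prob Q [set w | obsO w = false] [set w | trtD w = d] (clamp c g d).
Proof.
apply: (cond_exp_ae_version (measurable_obsO_set false) (gP hs d)).
  by apply: measurable_clamp; exact: mg.
by have := ae_g_clamp; apply: filterS => w + _; exact.
Qed.

Lemma clamp_bounded (m : bool -> cov -> R) b x : `|clamp c m b x| <= 1.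
Proof.
have ow := overlap_clamp m.
by rewrite ger0_norm; [exact: ow_le1 ow|exact: le_trans (ltW c0) (ow_ge ow _ _)].
Qed.

(** Chain rule: the clamped [g] is the conditional probability of D = d on the event O = 0, and the
    residual of the clamped [pi false] is orthogonal to the bounded function [\1_A g] of [X]. *)
Lemma cond_prob_stratum_clamp d :
  cond_prob Q setT ([set w | obsO w = false] `&` [set w | trtD w = d])
    (fun x => clamp c pi false x * clamp c g d x).
Proof.
have mE := measurable_obsO_set false : measurable [set w : full | obsO w = false].
have mp := measurable_clamp c false (mpi true).
have mgc := measurable_clamp c d (mg true).
have mpX : measurable_fun setT (fun w => clamp c pi false (X w)).
  by apply: (measurableT_comp mp); exact: measurable_covX.
have mgX : measurable_fun setT (fun w => clamp c g d (X w)).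
  by apply: (measurableT_comp mgc); exact: measurable_covX.
have mI : measurable ([set w : full | obsO w = false] `&` [set w | trtD w = d]).
  by apply: measurableI => //; exact: measurable_trtD_set.
split.
- exact: measurable_funM.
- by apply: integrable_indic.
- apply: (@integrable_of_bounded _ _ _ 1) => //; first exact: measurable_funM.
  by move=> w; rewrite normrM mulr_ile1// clamp_bounded.
move=> A mA; rewrite setTI.
have mXA : measurable (X @^-1` A).
  by rewrite -[X in measurable X]setTI; exact: measurable_covX.
have [_ _ _ Hg] := cond_prob_g_clamp d.
transitivity (\int[Q]_(w in [set w | obsO w = false] `&` X @^-1` A)
    (\1_[set w | trtD w = d] w)%:E)%E.
  rewrite !integral_indic//; first by congr (Q _); rewrite setIAC [RHS]setIC.
  - exact: measurableI.
  - exact: measurable_trtD_set.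
rewrite Hg// setIC integral_mkcondr.
rewrite [LHS]integral_mkcond [RHS]integral_mkcond.
pose F x : R := \1_A x * clamp c g d x.
have mF : measurable_fun setT F by apply: measurable_funM => //; exact: measurable_indic.
have mFX : measurable_fun setT (fun w => F (X w)).
  by apply: (measurableT_comp mF); exact: measurable_covX.
have FB x : `|F x| <= 1.
  rewrite /F normrM mulr_ile1 ?clamp_bounded// indicE.
  by case: (_ \in _); rewrite ?normr1 ?normr0.
have [ik _] := cond_exp_residual measurableT (cond_prob_pi_clamp false).
have := cond_exp_orthogonal measurableT (cond_prob_pi_clamp false) mF
  (rintegrableM_bounded mFX (fun w => FB (X w)) ik).
have i1 : rintegrable Q (fun w => F (X w) * \1_[set w | obsO w = false] w).
  apply: (rintegrableM_bounded mFX (fun w => FB (X w))).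
  exact: integrable_indic.
have i2 : rintegrable Q (fun w => F (X w) * clamp c pi false (X w)).
  apply: (rintegrableM_bounded mFX (fun w => FB (X w))).
  by apply: (@rintegrable_bounded _ _ _ _ 1) => // w; exact: clamp_bounded.
rewrite (_ : \int[Q]_w _ = \int[Q]_w (F (X w) * \1_[set w | obsO w = false] w
   - F (X w) * clamp c pi false (X w))); last first.
  by apply: eq_RintegralT => w; rewrite (_ : \1_setT w = 1) ?indicT//; ring.
rewrite RintegralBE// => /eqP; rewrite subr_eq0 => /eqP H.
have H2 : (\int[Q]_w (F (X w) * \1_[set w | obsO w = false] w)%:E =
   \int[Q]_w (F (X w) * clamp c pi false (X w))%:E)%E by rewrite !REintegralE// H.
transitivity (\int[Q]_w (F (X w) * \1_[set w | obsO w = false] w)%:E)%E.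
  apply: eq_integral => w _; rewrite epatch_indic/= epatch_indic/= -!EFinM /F.
  by congr (_%:E); rewrite (_ : \1_(X @^-1` A) w = \1_A (X w))//; ring.
rewrite H2; apply: eq_integral => w _; rewrite epatch_indic/= -!EFinM /F.
by congr (_%:E); rewrite (_ : \1_(X @^-1` A) w = \1_A (X w))//; ring.
Qed.

(** [unconfounded_transfer] for the events O = o and (O, D) = (0, d), whose conditional
    probabilities given X have just been expressed by the clamped weights. *)
Lemma transfers_clamp : transfers Q (clamp c pi) (clamp c g).
Proof.
have p01 b (m : bool -> cov -> R) x : 0 <= clamp c m b x <= 1.
  have ow := overlap_clamp m.
  by rewrite (ow_le1 _ _ c0 ow) (le_trans (ltW c0) (ow_ge ow _ _)).
have mo o : measurable [set x : bool * bool | x.1 = o].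
  by apply: measurable_eqb_set; exact: measurable_fst.
have mt o : measurable [set x : bool * bool | x.2 = o].
  by apply: measurable_eqb_set; exact: measurable_snd.
split; first exact: observed_treated hs.
- move=> o G mG G0.
  rewrite -(@unconfounded_transfer _ _ Q [set x | x.1 = o])//.
  + by apply: eq_integral => w _; rewrite -indic_eqb.
  + exact: cond_prob_pi_clamp.
- move=> d G mG G0.
  rewrite -(@unconfounded_transfer _ _ Q ([set x | x.1 = false] `&` [set x | x.2 = d])
     (fun x => clamp c pi false x * clamp c g d x))//.
  + apply: eq_integral => w _; congr (_%:E * _)%E.
    have -> : @OD R p @^-1` ([set x | x.1 = false] `&` [set x | x.2 = d]) =
      [set w : full | obsO w = false] `&` [set w | trtD w = d] by [].
    rewrite indicI/= !indic_eqb eqbF_neg.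
    by case: (obsO w); case: (trtD w == d); rewrite ?mulr0 ?mulr1 ?mul0r.
  + exact: measurableI.
  + exact: cond_prob_stratum_clamp.
  + move=> x; have /andP[a0 a1] := p01 false pi x; have /andP[b0 b1] := p01 d g x.
    by rewrite mulr_ge0//= mulr_ile1.
Qed.
End clean.
End transfer_model.

(** * Conditional densities of the outcome *)

Section sigma_finite_product.
Local Open Scope ereal_scope.
Context d1 d2 (T1 : measurableType d1) (T2 : measurableType d2) (R : realType).
Variables (m1 : {sigma_finite_measure set T1 -> \bar R})
  (m2 : {sigma_finite_measure set T2 -> \bar R}).

(* An alias of [m1 \x m2] carrying a sigma-finite structure; the canonical
   instance of [\x] only knows products of probabilities. *)
Definition sigma_product : set (T1 * T2) -> \bar R := m1 \x m2.

HB.instance Definition _ := Measure.on sigma_product.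

Let sigma_product_sigma_finite : sigma_finite setT sigma_product.
Proof.
have /sigma_finiteP[F [FT ndF Foo]] := sigma_finiteT m1.
have /sigma_finiteP[G [GT ndG Goo]] := sigma_finiteT m2.
exists (fun n => F n `*` G n) => [|k].
  apply/esym/seteqP; split => // -[x y] _.
  have [i _ Fi] : (\bigcup_i F i) x by rewrite -FT.
  have [j _ Gj] : (\bigcup_i G i) y by rewrite -GT.
  exists (maxn i j) => //; split => /=.
    by move: x Fi; exact/subsetPset/ndF/leq_maxl.
  by move: y Gj; exact/subsetPset/ndG/leq_maxr.
have [mF Fk] := Foo k; have [mG Gk] := Goo k; split; first exact: measurableX.
by rewrite /sigma_product product_measure1E// lte_mul_pinfty// ge0_fin_numE.
Qed.

HB.instance Definition _ :=
  Measure_isSigmaFinite.Build _ _ _ sigma_product sigma_product_sigma_finite.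
End sigma_finite_product.

Section conditional_density.
Local Open Scope ereal_scope.
Context d1 d2 (S : measurableType d1) (Y : measurableType d2) (R : realType).
Variables (nu : {sigma_finite_measure set S -> \bar R})
  (lam : {sigma_finite_measure set Y -> \bar R}).
Variable q : S * Y -> R.
Hypotheses (mq : measurable_fun setT q) (q0 : forall z, (0 <= q z)%R).
Hypothesis qoo : \int[nu \x lam]_z (q z)%:E < +oo.

Definition marginal (s : S) : \bar R := \int[lam]_y (q (s, y))%:E.

(* With the conventions [fine +oo = 0] and [x / 0 = 0], this vanishes
   identically where the marginal is 0 or infinite. *)
Definition cden (z : S * Y) : R := (q z / fine (marginal z.1))%R.

Let qE : measurable_fun setT (fun z => (q z)%:E). Proof. exact/measurable_EFinP. Qed.

Let marginal_ge0 s : 0 <= marginal s.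
Proof. by apply: integral_ge0 => y _; rewrite lee_fin. Qed.

Lemma measurable_marginal : measurable_fun setT marginal.
Proof.
by apply: (measurable_fun_fubini_tonelli_F (m2 := lam) _ qE) => z; rewrite lee_fin.
Qed.

Lemma measurable_cden : measurable_fun setT cden.
Proof.
apply: measurable_funM => //; apply: measurable_fun_inv.
have mf : measurable_fun setT (fun s => fine (marginal s)).
  by apply: measurableT_comp => //; exact: measurable_marginal.
exact: (measurableT_comp mf measurable_fst).
Qed.

Lemma cden_ge0 z : (0 <= cden z)%R.
Proof. by rewrite divr_ge0// fine_ge0. Qed.

Let mqs s : measurable_fun setT (fun y => (q (s, y))%:E).
Proof. by apply: (measurableT_comp qE); exact: measurable_pair1. Qed.

(** The integral is 1 where the marginal is positive and finite and 0 elsewhere, so the inequality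
    is valid at every [s]. *)
Lemma integral_cden_le1 s : \int[lam]_y (cden (s, y))%:E <= 1.
Proof.
rewrite /cden/=; have [->|mN] := eqVneq (fine (marginal s)) 0%R.
  by under eq_integral do rewrite invr0 mulr0; rewrite integral0 lee01.
have mfin : marginal s \is a fin_num.
  by move: mN; case: (marginal s) => //=; rewrite eqxx.
under eq_integral do rewrite mulrC EFinM.
rewrite ge0_integralZl//; last 2 first.
- by move=> y _; rewrite lee_fin.
- by rewrite lee_fin invr_ge0 fine_ge0.
by rewrite -/(marginal s) -{2}(fineK mfin) -EFinM mulVf.
Qed.

(** Tonelli reduces the identity to almost every [s], where the marginal is finite because [q] is
    integrable. If it is positive, [q] is [cden] times the marginal; if it is 0, [q (s, y)] vanishes
    for almost every [y]. *)
Lemma disintegration (G : S * Y -> \bar R) : measurable_fun setT G ->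
  (forall z, 0 <= G z) ->
  \int[nu \x lam]_z (G z * (q z)%:E) =
  \int[nu \x lam]_z ((\int[lam]_y (G (z.1, y) * (cden (z.1, y))%:E)) * (q z)%:E).
Proof.
move=> mG G0.
have mGq : measurable_fun setT (fun z => G z * (q z)%:E) by exact: emeasurable_funM.
have mGk : measurable_fun setT (fun z => G z * (cden z)%:E).
  by apply: emeasurable_funM => //; apply/measurable_EFinP; exact: measurable_cden.
have Gk0 z : 0 <= G z * (cden z)%:E by rewrite mule_ge0// lee_fin cden_ge0.
have mH : measurable_fun setT (fun s => \int[lam]_y (G (s, y) * (cden (s, y))%:E)).
  exact: (measurable_fun_fubini_tonelli_F (m2 := lam) _ mGk).
have mHz : measurable_fun setT
    (fun z : S * Y => \int[lam]_y (G (z.1, y) * (cden (z.1, y))%:E)).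
  exact: (measurableT_comp mH measurable_fst).
have H0 s : 0 <= \int[lam]_y (G (s, y) * (cden (s, y))%:E) by exact: integral_ge0.
rewrite fubini_tonelli1//; last by move=> z; rewrite mule_ge0// lee_fin.
rewrite [RHS]fubini_tonelli1; last 2 first.
- exact: emeasurable_funM.
- by move=> z; rewrite mule_ge0// lee_fin.
have moo : {ae nu, forall s, marginal s < +oo}.
  have : nu.-integrable setT marginal.
    apply/integrableP; split; first exact: measurable_marginal.
    under eq_integral do rewrite gee0_abs//.
    rewrite (_ : \int[nu]_s marginal s = \int[nu \x lam]_z (q z)%:E)//.
    by rewrite fubini_tonelli1// => z; rewrite lee_fin.
  move/(integrable_ae measurableT); apply: filterS => s /(_ I).
  by rewrite ge0_fin_numE.
apply: ae_eq_integral => //.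
- by apply: (measurable_fun_fubini_tonelli_F (m2 := lam) _ mGq) => z; rewrite mule_ge0// lee_fin.
- apply: (measurable_fun_fubini_tonelli_F (m2 := lam)) => [|z].
    exact: emeasurable_funM.
  by rewrite mule_ge0// lee_fin.
move: moo; apply: filterS => s ms _.
have mfin : marginal s \is a fin_num by rewrite ge0_fin_numE.
have mGs : measurable_fun setT (fun y => G (s, y)).
  by apply: (measurableT_comp mG); exact: measurable_pair1.
rewrite /fubini_F/= ge0_integralZl//; last by move=> y _; rewrite lee_fin.
rewrite -/(marginal s) muleC -ge0_integralZl//; last first.
  by apply: (measurableT_comp mGk); exact: measurable_pair1.
have [m0|mN] := eqVneq (marginal s) 0.
  rewrite m0; under [RHS]eq_integral do rewrite mul0e.
  rewrite integral0.
  have : ae_eq lam setT (fun y => (q (s, y))%:E) (cst 0).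
    apply/ae_eq_integral_abs => //; rewrite -[RHS]m0.
    by apply: eq_integral => y _; rewrite gee0_abs ?lee_fin.
  move=> q0s; rewrite -[RHS](integral0 lam setT); apply: ae_eq_integral => //.
    exact: emeasurable_funM.
  by move: q0s; apply: filterS => y h _; rewrite h ?mule0.
apply: eq_integral => y _; rewrite muleCA; congr (_ * _).
rewrite /cden/= -{1}(fineK mfin) -EFinM mulrC -mulrA mulVf ?mulr1//.
by apply: contra_neq mN => h; rewrite -(fineK mfin) h.
Qed.
End conditional_density.

Section counting_bool.
Local Open Scope ereal_scope.
Context (R : realType).

(* An alias of [@counting bool R] that carries its own sigma-finite structure. *)
Definition counting_bool : set bool -> \bar R := @counting bool R.

HB.instance Definition _ := Measure.on counting_bool.
HB.instance Definition _ :=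
  Measure_isSigmaFinite.Build _ _ _ counting_bool (sigma_finite_counting_bool R).
End counting_bool.

(** The reference measure again, convertible to [obs_reference] but assembled from the sigma-finite
    aliases so that Tonelli applies. *)
Definition obs_ref (R : realType) (p : nat) : {sigma_finite_measure set (obs_data R p) -> \bar R} :=
  sigma_product (sigma_product (lebesgue_tuple R p) (counting_bool R)) (@lebesgue_measure R).

Lemma obs_referenceE (R : realType) (p : nat) :
  @obs_reference R p = (obs_ref R p : set _ -> \bar R).
Proof. by []. Qed.

Lemma integral_obs_density (R : realType) (p : nat) (Q : probability (full_data R p) R)
    (q : obs_data R p -> R) : obs_density Q q ->
  forall F : obs_data R p -> \bar R, measurable_fun setT F -> (forall z, (0 <= F z)%E) ->
  (\int[Q]_w F (observe w) = \int[obs_ref R p]_z (F z * (q z)%:E))%E.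
Proof.
move=> [mq q0 Hq] F mF F0.
rewrite -(@ge0_integral_distribution _ _ _ _ _ Q (@observe R p))//.
have mqE : measurable_fun setT (fun z => (q z)%:E) by exact/measurable_EFinP.
have q0E z : (0 <= (q z)%:E)%E by rewrite lee_fin.
exact: (@ge0_integral_density _ _ _ (obs_law Q) (obs_ref R p) _ mqE q0E Hq F mF F0).
Qed.

Section outcome_densities.
Local Open Scope ereal_scope.
Context (R : realType) (p : nat) (Q : probability (full_data R p) R).
Local Notation full := (full_data R p).
Local Notation obs := (obs_data R p).
Local Notation cov := (covariates R p).
Local Notation X := (@covX R p).
Local Notation lam := (@lebesgue_measure R).
Variables (c : R) (pi e : bool -> cov -> R) (q : obs -> R).
Hypotheses (c0 : (0 < c)%R) (opi : overlap_weights c pi) (oe : overlap_weights c e).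
Hypotheses (mpi : forall o, measurable_fun setT (pi o)).
Hypotheses (me : forall o, measurable_fun setT (e o)).
Hypotheses (tQ : transfers Q pi e) (dq : obs_density Q q).

Let mq : measurable_fun setT q. Proof. by case: dq. Qed.
Let q0 z : (0 <= q z)%R. Proof. by case: dq. Qed.

(** A version of the conditional density of Y given (X, O), explicit because the observed law has a
    density. *)
Definition ydens : obs -> R := cden lam q.

Lemma measurable_ydens : measurable_fun setT ydens.
Proof. exact: measurable_cden. Qed.

Lemma ydens_ge0 z : (0 <= ydens z)%R.
Proof. exact: cden_ge0. Qed.

(** A version of E[G(X, Y) | X = x, O = o] for nonnegative [G]. *)
Definition ymean (o : bool) (G : cov * measurableTypeR R -> \bar R) (x : cov) : \bar R :=
  \int[lam]_y (G (x, y) * (ydens (x, o, y))%:E).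

Let mdens o : measurable_fun setT
  (fun z : cov * measurableTypeR R => (ydens (z.1, o, z.2))%:E).
Proof.
apply/measurable_EFinP; apply: (measurableT_comp measurable_ydens).
apply: measurable_fun_mk_pair; last exact: measurable_snd.
by apply: measurable_fun_mk_pair => //; exact: measurable_fst.
Qed.

Lemma ymean_ge0 o G x : (forall z, 0 <= G z) -> 0 <= ymean o G x.
Proof. by move=> G0; apply: integral_ge0 => y _; rewrite mule_ge0// lee_fin ydens_ge0. Qed.

Lemma measurable_ymean o G : measurable_fun setT G -> (forall z, 0 <= G z) ->
  measurable_fun setT (ymean o G).
Proof.
move=> mG G0.
apply: (@measurable_fun_fubini_tonelli_F _ _ _ _ _ lam
  (fun z => G z * (ydens (z.1, o, z.2))%:E)).
  exact: emeasurable_funM.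
by move=> z; rewrite mule_ge0// lee_fin ydens_ge0.
Qed.

Lemma ymeanZ o (h : cov -> R) G x : measurable_fun setT G -> (forall z, 0 <= G z) ->
  (0 <= h x)%R -> ymean o (fun z => (h z.1)%:E * G z) x = (h x)%:E * ymean o G x.
Proof.
move=> mG G0 h0; rewrite /ymean -ge0_integralZl//.
- by apply: eq_integral => y _; rewrite muleA.
- have mGd : measurable_fun setT (fun z => G z * (ydens (z.1, o, z.2))%:E).
    exact: emeasurable_funM.
  by apply: (measurableT_comp mGd); exact: measurable_pair1.
- by move=> y _; rewrite mule_ge0// lee_fin ydens_ge0.
Qed.

Lemma ymean1_le1 o x : ymean o (cst 1) x <= 1.
Proof.
apply: le_trans (integral_cden_le1 lam mq q0 (x, o)).
by rewrite le_eqVlt; apply/orP; left; apply/eqP; apply: eq_integral => y _; rewrite mul1e.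
Qed.

Lemma obs_disintegration (G : obs -> \bar R) : measurable_fun setT G ->
  (forall z, 0 <= G z) ->
  \int[Q]_w G (observe w) = \int[Q]_w ymean (obsO w) (fun z => G (z.1, obsO w, z.2)) (X w).
Proof.
move=> mG G0; have [_ _ Hq] := dq.
have mqE : measurable_fun setT (fun z => (q z)%:E) by exact/measurable_EFinP.
have q0E z : 0 <= (q z)%:E by rewrite lee_fin.
have qoo : \int[obs_ref R p]_z (q z)%:E < +oo.
  have := Hq _ measurableT; rewrite obs_referenceE => <-.
  by apply: le_lt_trans (ltry 1); exact: probability_le1.
have mGd : measurable_fun setT (fun z => G z * (ydens z)%:E).
  by apply: emeasurable_funM => //; apply/measurable_EFinP; exact: measurable_ydens.
have mH : measurable_fun setT
    (fun s : cov * bool => \int[lam]_y (G (s, y) * (ydens (s, y))%:E)).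
  apply: (measurable_fun_fubini_tonelli_F (m2 := lam) _ mGd) => z.
  by rewrite mule_ge0// lee_fin ydens_ge0.
have mHz : measurable_fun setT
    (fun z : obs => \int[lam]_y (G (z.1, y) * (ydens (z.1, y))%:E)).
  exact: (measurableT_comp mH measurable_fst).
have Hz0 (z : obs) : 0 <= \int[lam]_y (G (z.1, y) * (ydens (z.1, y))%:E).
  by apply: integral_ge0 => y _; rewrite mule_ge0// lee_fin ydens_ge0.
rewrite (integral_obs_density dq mG G0).
rewrite (disintegration (nu := sigma_product (lebesgue_tuple R p) (counting_bool R)) mq q0 qoo mG G0).
by rewrite -(integral_obs_density dq mHz Hz0).
Qed.

(** Disintegration leaves the indicator of O = o in front of a function of [X] alone, and [tr_obs]
    turns that indicator into [pi o]. *)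
Lemma integral_stratum_ymean o G : measurable_fun setT G -> (forall z, 0 <= G z) ->
  \int[Q]_w ((obsO w == o)%:R%:E * G (X w, outY w)) =
  \int[Q]_w ((pi o (X w))%:E * ymean o G (X w)).
Proof.
move=> mG G0.
have mb : measurable_fun [set: obs] (fun z => (z.1.2 == o)%:R%:E : \bar R).
  apply/measurable_EFinP; apply: measurable_bool_natr.
  have : measurable_fun [set: bool] (fun b => b == o) by [].
  move=> /measurableT_comp; apply.
  exact: (measurableT_comp measurable_snd measurable_fst).
have mGo : measurable_fun [set: obs] (fun z => (z.1.2 == o)%:R%:E * G (z.1.1, z.2)).
  apply: emeasurable_funM => //; apply: (measurableT_comp mG).
  apply: measurable_fun_mk_pair; last exact: measurable_snd.
  exact: (measurableT_comp measurable_fst measurable_fst).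
have := @obs_disintegration (fun z => (z.1.2 == o)%:R%:E * G (z.1.1, z.2)) mGo _.
move=> ->; last by move=> z; rewrite mule_ge0// lee_fin.
have mK : measurable_fun setT (fun z : cov * (measurableTypeR R * measurableTypeR R) =>
    ymean o G z.1).
  by apply: (measurableT_comp (measurable_ymean o mG G0)); exact: measurable_fst.
rewrite -(tr_obs tQ o mK (fun z => ymean_ge0 o z.1 G0)).
apply: eq_integral => w _ /=; case: eqP => [->|_].
  by rewrite mul1e /ymean; apply: eq_integral => y _; rewrite /= mul1e.
by rewrite mul0e /ymean; under eq_integral do rewrite !mul0e; rewrite integral0.
Qed.

Let mGX1 (G : cov * measurableTypeR R -> \bar R) : measurable_fun setT G ->
  measurable_fun setT
    (fun z : cov * (measurableTypeR R * measurableTypeR R) => G (z.1, z.2.1)).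
Proof.
move=> mG; apply: (measurableT_comp mG); apply: measurable_fun_mk_pair.
  exact: measurable_fst.
exact: (measurableT_comp measurable_fst measurable_snd).
Qed.

Let mGX0 (G : cov * measurableTypeR R -> \bar R) : measurable_fun setT G ->
  measurable_fun setT
    (fun z : cov * (measurableTypeR R * measurableTypeR R) => G (z.1, z.2.2)).
Proof.
move=> mG; apply: (measurableT_comp mG); apply: measurable_fun_mk_pair.
  exact: measurable_fst.
exact: (measurableT_comp measurable_snd measurable_snd).
Qed.

Let pi_gt0 o x : (0 < pi o x)%R. Proof. exact: lt_le_trans c0 (ow_ge opi o x). Qed.
Let e_gt0 o x : (0 < e o x)%R. Proof. exact: lt_le_trans c0 (ow_ge oe o x). Qed.

Let mEX (h : cov -> R) : measurable_fun setT h ->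
  measurable_fun setT (fun z : cov * measurableTypeR R => (h z.1)%:E).
Proof.
by move=> mh; apply/measurable_EFinP; apply: (measurableT_comp mh); exact: measurable_fst.
Qed.

(** Since Y = Y(1) on O = 1, the weight [1 / pi true] cancels the factor [pi true] that arises on
    both sides, from [tr_obs] for Y(1) and from [integral_stratum_ymean] for Y. *)
Lemma integral_outY1 G : measurable_fun setT G -> (forall z, 0 <= G z) ->
  \int[Q]_w G (X w, outY1 w) = \int[Q]_w ymean true G (X w).
Proof.
move=> mG G0.
pose G' z : \bar R := ((pi true z.1)^-1)%:E * G z.
have mG' : measurable_fun setT G'.
  by apply: emeasurable_funM => //; exact: (mEX (measurable_fun_inv (mpi true))).
have G'0 z : 0 <= G' z by rewrite mule_ge0// lee_fin invr_ge0 ltW.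
have piK z x : (pi true x)%:E * (((pi true x)^-1)%:E * z) = z.
  by rewrite muleA -EFinM mulfV ?mul1e// gt_eqF.
have := integral_stratum_ymean true mG' G'0.
rewrite (_ : \int[Q]_w ((obsO w == true)%:R%:E * G' (X w, outY w)) =
    \int[Q]_w ((obsO w == true)%:R%:E * G' ((covpot w).1, (covpot w).2.1))); last first.
  by apply: eq_integral => w _; rewrite /outY; case: (obsO w); rewrite ?mul0e.
rewrite (tr_obs tQ true (mGX1 mG') (fun z => G'0 _)).
rewrite (eq_integral (fun w => G (X w, outY1 w))); last first.
  by move=> w _; rewrite /G' piK.
move=> ->; apply: eq_integral => w _.
rewrite (_ : ymean true G' (X w) = ((pi true (X w))^-1)%:E * ymean true G (X w)) ?piK//.
by apply: (@ymeanZ true (fun x => (pi true x)^-1)%R) => //; rewrite invr_ge0 ltW.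
Qed.

(** On O = 0 the outcome is Y(1) or Y(0) according to D, so its conditional law is their mixture
    with weights [e]. This relation restricts the observed law and at the same time determines the
    conditional law of Y(0). *)
Lemma integral_outY0 G : measurable_fun setT G -> (forall z, 0 <= G z) ->
  \int[Q]_w ymean false G (X w) =
  \int[Q]_w ((e true (X w))%:E * ymean true G (X w)) +
  \int[Q]_w ((e false (X w))%:E * G (X w, outY0 w)).
Proof.
move=> mG G0.
pose G' z : \bar R := ((pi false z.1)^-1)%:E * G z.
have mG' : measurable_fun setT G'.
  by apply: emeasurable_funM => //; exact: (mEX (measurable_fun_inv (mpi false))).
have G'0 z : 0 <= G' z by rewrite mule_ge0// lee_fin invr_ge0 ltW.
have piK z x : (pi false x)%:E * (((pi false x)^-1)%:E * z) = z.
  by rewrite muleA -EFinM mulfV ?mul1e// gt_eqF.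
have := integral_stratum_ymean false mG' G'0.
rewrite [RHS](eq_integral (fun w => ymean false G (X w))); last first.
  move=> w _.
  rewrite (_ : ymean false G' (X w) = ((pi false (X w))^-1)%:E * ymean false G (X w)) ?piK//.
  by apply: (@ymeanZ false (fun x => (pi false x)^-1)%R) => //; rewrite invr_ge0 ltW.
move=> <-.
have mB d : measurable_fun [set: full] (fun w => (~~ obsO w && (trtD w == d))%:R%:E : \bar R).
  apply/measurable_EFinP; apply: measurable_bool_natr.
  have : measurable_fun [set: bool * bool] (fun b => ~~ b.1 && (b.2 == d)).
    apply: measurable_and.
      by apply: measurableT_comp => //; exact: measurable_fst.
    have : measurable_fun [set: bool] (fun b => b == d) by [].
    by move=> /measurableT_comp; apply; exact: measurable_snd.
  by move=> /measurableT_comp; apply; exact: measurable_OD.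
have mc1 (F : cov * (measurableTypeR R * measurableTypeR R) -> \bar R) :
    measurable_fun setT F -> measurable_fun setT (fun w => F (covpot w)).
  by move=> mF; apply: (measurableT_comp mF); exact: measurable_covpot.
transitivity (\int[Q]_w
  ((~~ obsO w && (trtD w == true))%:R%:E * G' ((covpot w).1, (covpot w).2.1) +
   (~~ obsO w && (trtD w == false))%:R%:E * G' ((covpot w).1, (covpot w).2.2))).
  apply: eq_integral => w _; rewrite /outY /tildeY.
  by case: (obsO w); case: (trtD w); rewrite /= ?mul0e ?add0e ?mul1e ?adde0.
rewrite ge0_integralD//; last 4 first.
- by move=> w _; rewrite mule_ge0// lee_fin.
- by apply: emeasurable_funM => //; exact: (mc1 _ (mGX1 mG')).
- by move=> w _; rewrite mule_ge0// lee_fin.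
- by apply: emeasurable_funM => //; exact: (mc1 _ (mGX0 mG')).
rewrite (tr_trt tQ true (mGX1 mG') (fun z => G'0 _)).
rewrite (tr_trt tQ false (mGX0 mG') (fun z => G'0 _)); congr (_ + _).
- have me1 : measurable_fun setT (fun z => (e true z.1)%:E * G z).
    by apply: emeasurable_funM => //; exact: (mEX (me true)).
  have e10 z : 0 <= (e true z.1)%:E * G z by rewrite mule_ge0// lee_fin ltW.
  transitivity (\int[Q]_w ((e true (X w))%:E * G (X w, outY1 w))).
    apply: eq_integral => w _; rewrite /G'/= (mulrC (pi false _)) EFinM -muleA.
    by rewrite piK.
  rewrite (integral_outY1 me1 e10); apply: eq_integral => w _.
  by apply: (@ymeanZ true (e true)) => //; rewrite ltW.
- by apply: eq_integral => w _; rewrite /G'/= (mulrC (pi false _)) EFinM -muleA piK.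
Qed.

(** [ymean1_le1] gives one inequality everywhere, and the nonnegative deficit weighted by [pi o] has
    integral 0. As [pi o] is positive at every point, equality holds for both values of [o] at
    almost every value of [X]. *)
Lemma ae_ymean1 : {ae Q, forall w, forall o, ymean o (cst 1) (X w) = 1}.
Proof.
have h o : {ae Q, forall w, ymean o (cst 1) (X w) = 1}.
  have m1 := @measurable_cst _ _ (cov * measurableTypeR R)%type _ setT (1 : \bar R).
  have mK := measurable_ymean o m1 (fun=> lee01).
  pose D w : \bar R := (pi o (X w))%:E * (1 - ymean o (cst 1) (X w)).
  have K0 x : 0 <= ymean o (cst 1) x by apply: ymean_ge0.
  have Kfin x : ymean o (cst 1) x \is a fin_num.
    by rewrite ge0_fin_numE// (le_lt_trans (ymean1_le1 o x))// ltry.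
  have sK x : 0 <= 1 - ymean o (cst 1) x by rewrite sube_ge0 ?ymean1_le1// Kfin.
  have D0 w : 0 <= D w by rewrite /D mule_ge0// lee_fin ltW.
  have mX (h : cov -> \bar R) : measurable_fun setT h -> measurable_fun setT (fun w => h (X w)).
    by move=> mh; apply: (measurableT_comp mh); exact: measurable_covX.
  have mpE : measurable_fun setT (fun x => (pi o x)%:E) by exact/measurable_EFinP.
  have mD : measurable_fun setT D.
    apply: emeasurable_funM; first exact: (mX _ mpE).
    by apply: emeasurable_funB; [exact: measurable_cst|exact: (mX _ mK)].
  have : \int[Q]_w D w + \int[Q]_w ((pi o (X w))%:E * ymean o (cst 1) (X w)) =
         \int[Q]_w (pi o (X w))%:E.
    rewrite -ge0_integralD//; last 2 first.
    - by move=> w _; rewrite mule_ge0 ?lee_fin ?(ltW (pi_gt0 _ _)).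
    - by apply: emeasurable_funM; [exact: (mX _ mpE)|exact: (mX _ mK)].
    apply: eq_integral => w _; rewrite /D -ge0_muleDr ?subeK ?mule1//.
  rewrite -integral_stratum_ymean//.
  rewrite (_ : \int[Q]_w (pi o (X w))%:E = \int[Q]_w ((pi o (X w))%:E * cst 1 (covpot w))); last first.
    by apply: eq_integral => w _; rewrite mule1.
  rewrite -(tr_obs tQ o (@measurable_cst _ _ _ _ _ 1) (fun=> lee01)) => H.
  have fin1 : \int[Q]_w ((obsO w == o)%:R%:E * cst 1 (covpot w)) \is a fin_num.
    rewrite ge0_fin_numE; last by apply: integral_ge0 => w _; rewrite mule1 lee_fin.
    apply: (@le_lt_trans _ _ (\int[Q]_w 1)); last first.
      by rewrite integral_cst//= mul1e; apply: le_lt_trans (ltry 1); exact: probability_le1.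
    apply: ge0_le_integral => //.
    - by move=> w _; rewrite mule1 lee_fin.
    - apply/measurable_EFinP => /=; under eq_fun do rewrite mulr1.
      apply: measurable_bool_natr.
      have : measurable_fun [set: bool] (fun b => b == o) by [].
      by move=> /measurableT_comp; apply; exact: measurable_obsO.
    - by move=> w _; rewrite mule1 lee_fin; case: eqP.
  have D00 : \int[Q]_w D w = 0.
    by rewrite -[LHS](addeK _ fin1) H subee.
  have : ae_eq Q setT D (cst 0).
    apply/ae_eq_integral_abs => //; rewrite -[RHS]D00.
    by apply: eq_integral => w _; rewrite gee0_abs.
  apply: filterS => w /(_ I) /eqP; rewrite /D mule_eq0 eqe gt_eqF//= => /eqP.
  move: (Kfin (X w)); case: (ymean o (cst 1) (X w)) => //= r _ [] /eqP.
  by rewrite subr_eq0 => /eqP ->.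
by have := h true; have := h false; apply: filterS2 => w ? ? [].
Qed.

(** The mixture relation is tested on the set where the inequality fails: the contribution of Y(0)
    is nonnegative, so the integral of the positive part of the difference is at most 0. *)
Lemma ae_mixture_ge : {ae Q, forall w, {ae lam, forall y,
  (e true (X w) * ydens (X w, true, y) <= ydens (X w, false, y))%R}}.
Proof.
pose d z : R := (e true z.1 * ydens (z.1, true, z.2) - ydens (z.1, false, z.2))%R.
have mde o : measurable_fun setT (fun z : cov * measurableTypeR R => ydens (z.1, o, z.2)).
  by apply/measurable_EFinP; exact: mdens.
have mez : measurable_fun setT (fun z : cov * measurableTypeR R => e true z.1).
  by apply: (measurableT_comp (me true)); exact: measurable_fst.
have md : measurable_fun setT d.
  by apply: measurable_funB => //; exact: measurable_funM.
(* [N] is the indicator of the set of violations and [D] below is the positive part of [d]; the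
   relation between their integrals is stated as a sum, which avoids subtracting integrals that
   might be infinite. *)
pose N z : \bar R := (0 < d z)%R%:R%:E.
have mN : measurable_fun setT N.
  apply/measurable_EFinP; apply: measurable_bool_natr.
  exact: measurable_fun_ltr.
have N0 z : 0 <= N z by rewrite lee_fin.
pose D z : \bar R := N z * (d z)%:E.
have D0 z : 0 <= D z.
  by rewrite /D /N; case: ltP => h; rewrite ?mul0e ?mul1e// lee_fin ltW.
have mD : measurable_fun setT D by apply: emeasurable_funM => //; exact/measurable_EFinP.
pose k x := \int[lam]_y D (x, y).
have mk : measurable_fun setT k.
  exact: (measurable_fun_fubini_tonelli_F (m2 := lam) _ mD).
have mX (h : cov -> \bar R) : measurable_fun setT h -> measurable_fun setT (fun w => h (X w)).
  by move=> mh; apply: (measurableT_comp mh); exact: measurable_covX.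
have k0 x : 0 <= k x by apply: integral_ge0.
have ms (F : cov * measurableTypeR R -> \bar R) x : measurable_fun setT F ->
    measurable_fun setT (fun y => F (x, y)).
  by move=> mF; apply: (measurableT_comp mF); exact: measurable_pair1.
have kE x : k x + ymean false N x = (e true x)%:E * ymean true N x.
  rewrite /k /ymean -ge0_integralZl//; last 3 first.
  - apply: emeasurable_funM; first exact: ms.
    exact: (ms (fun z => (ydens (z.1, true, z.2))%:E)).
  - by move=> y _; rewrite mule_ge0// lee_fin ydens_ge0.
  - by rewrite lee_fin ltW.
  rewrite -ge0_integralD.
  - apply: eq_integral => y _; rewrite /D /N /d/= -!EFinM -EFinD; congr (_%:E); ring.
  - exact: measurableT.
  - by move=> y _; exact: D0.
  - exact: ms.
  - by move=> y _; rewrite mule_ge0// lee_fin ydens_ge0.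
  - apply: emeasurable_funM; first exact: ms.
    exact: (ms (fun z => (ydens (z.1, false, z.2))%:E)).
have mNy := measurable_ymean false mN N0.
have mNy1 := measurable_ymean true mN N0.
have Ny0 o x : 0 <= ymean o N x by apply: ymean_ge0.
have meE : measurable_fun setT (fun x => (e true x)%:E) by exact/measurable_EFinP.
have I1 : \int[Q]_w k (X w) + \int[Q]_w ymean false N (X w) =
    \int[Q]_w ((e true (X w))%:E * ymean true N (X w)).
  rewrite -ge0_integralD.
  - by apply: eq_integral => w _; rewrite kE.
  - exact: measurableT.
  - by move=> w _; exact: k0.
  - exact: (mX _ mk).
  - by move=> w _; exact: Ny0.
  - exact: (mX _ mNy).
have N1 o x : ymean o N x <= 1.
  apply: (le_trans _ (ymean1_le1 o x)); apply: ge0_le_integral => //.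
  - by move=> y _; rewrite mule_ge0// lee_fin ydens_ge0.
  - apply: emeasurable_funM; first exact: ms.
    exact: (ms (fun z => (ydens (z.1, o, z.2))%:E)).
  - apply: emeasurable_funM => //.
    exact: (ms (fun z => (ydens (z.1, o, z.2))%:E)).
  - move=> y _; rewrite lee_wpmul2r// ?lee_fin ?ydens_ge0// /N.
    by case: ltP => _; rewrite /= ?lee_fin ?ler01.
have fin0 : \int[Q]_w ymean false N (X w) \is a fin_num.
  rewrite ge0_fin_numE; last exact: integral_ge0.
  apply: (@le_lt_trans _ _ (\int[Q]_w 1)); last first.
    by rewrite integral_cst//= mul1e; apply: le_lt_trans (ltry 1); exact: probability_le1.
  apply: ge0_le_integral; [exact: measurableT|by move=> w _; exact: Ny0|exact: (mX _ mNy)|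
    exact: measurable_cst|by move=> w _; exact: N1].
have kint0 : \int[Q]_w k (X w) = 0.
  apply/eqP; rewrite eq_le; apply/andP; split; last exact: integral_ge0.
  have : \int[Q]_w k (X w) + \int[Q]_w ymean false N (X w) <=
      0 + \int[Q]_w ymean false N (X w).
    rewrite I1 add0e (integral_outY0 mN N0) leeDl//; apply: integral_ge0 => w _.
    by rewrite mule_ge0// lee_fin ltW.
  by rewrite leeD2rE.
have : ae_eq Q setT (fun w => k (X w)) (cst 0).
  apply/(ae_eq_integral_abs _ measurableT (mX _ mk)).
  by rewrite -[RHS]kint0; apply: eq_integral => w _; rewrite gee0_abs.
apply: filterS => w /(_ I) kw.
have : ae_eq lam setT (fun y => D (X w, y)) (cst 0).
  apply/ae_eq_integral_abs => //; first exact: ms.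
  by rewrite -[RHS]kw; apply: eq_integral => y _; rewrite gee0_abs.
apply: filterS => y /(_ I); rewrite /D /N; case: ltP => [dp|dn _].
  by rewrite mul1e => -[] dz; move: dp; rewrite dz ltxx.
by rewrite -subr_le0.
Qed.
End outcome_densities.

Section density_probability.
Local Open Scope ereal_scope.
Context d (T : measurableType d) (R : realType) (mu : {measure set T -> \bar R}).
Variable g : T -> \bar R.
Hypotheses (mg : measurable_fun setT g) (g0 : forall x, 0 <= g x).
Hypothesis g1 : \int[mu]_x g x = 1.

Let mdensity_setT : mdensity mu mg g0 setT = 1. Proof. exact: g1. Qed.

HB.instance Definition _ :=
  Measure_isProbability.Build _ _ _ (mdensity mu mg g0) mdensity_setT.

Lemma density_probability : exists Q : probability T R,
  forall A, measurable A -> Q A = \int[mu]_(x in A) g x.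
Proof. by exists (mdensity mu mg g0). Qed.
End density_probability.

Section signed_transport.
Local Open Scope ereal_scope.
Context d1 d2 d (T1 : measurableType d1) (T2 : measurableType d2)
  (S : measurableType d) (R : realType).
Variables (m1 : {measure set T1 -> \bar R}) (m2 : {measure set T2 -> \bar R}).
Variables (phi : T1 -> S) (psi : T2 -> S) (u : T2 -> R).
Hypotheses (mphi : measurable_fun setT phi) (u0 : forall x, (0 <= u x)%R).
Hypothesis H : forall F : S -> \bar R, measurable_fun setT F -> (forall s, 0 <= F s) ->
  \int[m1]_x F (phi x) = \int[m2]_x (F (psi x) * (u x)%:E).

Lemma signed_transport (F : S -> R) : measurable_fun setT F ->
  rintegrable m2 (fun x => F (psi x) * u x)%R ->
  rintegrable m1 (fun x => F (phi x)) /\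
  (\int[m1]_x F (phi x))%R = (\int[m2]_x (F (psi x) * u x))%R.
Proof.
move=> mF iF; split.
  apply/integrableP; split.
    by apply/measurable_EFinP; exact: (measurableT_comp mF mphi).
  have mnF : measurable_fun setT (fun s => `|F s|%:E).
    by apply/measurable_EFinP; exact: measurableT_comp.
  have := H mnF (fun s => normr_ge0 (F s)); rewrite /= => ->.
  have := integrable_norm iF; move/integrableP => [_].
  apply: le_lt_trans; rewrite le_eqVlt; apply/orP; left; apply/eqP.
  apply: eq_integral => x _ /=; rewrite -EFinM normrM; congr (_%:E).
  by rewrite (ger0_norm (u0 x)) [RHS]ger0_norm// mulr_ge0.
rewrite /Rintegral; congr fine; rewrite integralE [RHS]integralE.
have mp (F' : S -> R) : measurable_fun setT F' ->
    measurable_fun setT (fun s => (Num.max (F' s) 0)%:E).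
  by move=> mF'; apply/measurable_EFinP; exact: measurable_maxr.
have p0 (F' : S -> R) s : 0 <= (Num.max (F' s) 0)%:E by rewrite lee_fin le_max lexx orbT.
congr (_ - _).
- transitivity (\int[m1]_x (Num.max (F (phi x)) 0)%:E).
    by apply: eq_integral => x _; rewrite funeposE/= -EFin_max.
  rewrite (H (mp _ mF) (p0 _)); apply: eq_integral => x _.
  by rewrite funeposE/= -EFin_max -EFinM; congr (_%:E); rewrite maxr_pMl// mul0r.
- have mnF : measurable_fun setT (fun s => - F s)%R by exact: measurableT_comp.
  transitivity (\int[m1]_x (Num.max (- F (phi x)) 0)%:E).
    by apply: eq_integral => x _; rewrite funenegE/= -?EFinN -EFin_max.
  rewrite (H (mp _ mnF) (p0 _)); apply: eq_integral => x _.
  rewrite funenegE/= -?EFinN -EFin_max -EFinM; congr (_%:E).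
  by rewrite maxr_pMl// mul0r mulNr.
Qed.
End signed_transport.

(** * The model recovered from the transfer identities *)

Section transfers_consequences.
Local Open Scope ereal_scope.
Context (R : realType) (p : nat) (Q : probability (full_data R p) R).
Local Notation full := (full_data R p).
Local Notation cov := (covariates R p).
Local Notation pot := (measurableTypeR R * measurableTypeR R)%type.
Local Notation X := (@covX R p).
Variables (c : R) (pi e : bool -> cov -> R).
Hypotheses (c0 : (0 < c)%R) (opi : overlap_weights c pi) (oe : overlap_weights c e).
Hypotheses (mpi : forall o, measurable_fun setT (pi o)).
Hypotheses (me : forall o, measurable_fun setT (e o)).
Hypotheses (tQ : transfers Q pi e).

Lemma weight_gt0 (m : bool -> cov -> R) o x : overlap_weights c m -> (0 < m o x)%R.
Proof. by move=> om; exact: lt_le_trans c0 (ow_ge om o x). Qed.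

Lemma weight_norm_le1 (m : bool -> cov -> R) o x : overlap_weights c m -> (`|m o x| <= 1)%R.
Proof. by move=> om; rewrite gtr0_norm ?(weight_gt0 _ _ om)//; exact: ow_le1 om. Qed.

Lemma measurable_fun_covX d (T : measurableType d) (h : cov -> T) :
  measurable_fun setT h -> measurable_fun setT (fun w : full => h (X w)).
Proof. by move=> mh; apply: (measurableT_comp mh); exact: measurable_covX. Qed.

Lemma measurable_fun_covpot d (T : measurableType d) (h : cov * pot -> T) :
  measurable_fun setT h -> measurable_fun setT (fun w : full => h (covpot w)).
Proof. by move=> mh; apply: (measurableT_comp mh); exact: measurable_covpot. Qed.

Lemma measurable_eqb_fun d (T : measurableType d) (f : T -> bool) (o : bool) :
  measurable_fun setT f -> measurable_fun setT (fun x => (f x == o)%:R%:E : \bar R).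
Proof.
move=> mf; apply/measurable_EFinP; apply: measurable_bool_natr.
have : measurable_fun [set: bool] (fun b => b == o) by [].
by move=> /measurableT_comp; apply.
Qed.

Lemma measurable_stratum d : measurable_fun setT
  (fun w : full => (~~ obsO w && (trtD w == d))%:R%:E : \bar R).
Proof.
apply/measurable_EFinP; apply: measurable_bool_natr.
have : measurable_fun [set: bool * bool] (fun b => ~~ b.1 && (b.2 == d)).
  apply: measurable_and.
    by apply: measurableT_comp => //; exact: measurable_fst.
  have : measurable_fun [set: bool] (fun b => b == d) by [].
  by move=> /measurableT_comp; apply; exact: measurable_snd.
by move=> /measurableT_comp; apply; exact: measurable_OD.
Qed.

Lemma ae_treated : {ae Q, forall w, obsO w -> trtD w}.
Proof.
exists [set w | obsO w && ~~ trtD w]; split.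
- apply: measurable_bool_set; apply: measurable_and; first exact: measurable_obsO.
  by apply: measurableT_comp => //; exact: measurable_trtD.
- exact: tr_treated tQ.
- by move=> w /= /not_implyP[Ow /negP Dw]; rewrite Ow Dw.
Qed.

(** The conditional probability that (O, D) lies in [B] given X = x. The value (1, 0) has no term
    because O = 1 forces D = 1 almost surely. *)
Definition OD_weight (B : set (bool * bool)) (x : cov) : R :=
  (\1_B (true, true) * pi true x + \1_B (false, true) * (pi false x * e true x)
   + \1_B (false, false) * (pi false x * e false x))%R.

Lemma OD_weight_bounds B x : (0 <= OD_weight B x <= 1)%R.
Proof.
have p1 := weight_gt0 true x opi; have p0 := weight_gt0 false x opi.
have e1 := weight_gt0 true x oe; have e0 := weight_gt0 false x oe.
have sp := ow_sum opi x; have se := ow_sum oe x.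
have E : (1 = pi true x + pi false x * e true x + pi false x * e false x)%R.
  by rewrite -addrA -mulrDr se mulr1 sp.
have i01 (z : bool * bool) : (0 <= (\1_B z : R) <= 1)%R.
  by rewrite indicE; case: (_ \in _); rewrite ?lexx ?ler01.
have h1 : (0 <= pi false x * e true x)%R by rewrite mulr_ge0// ltW.
have h0 : (0 <= pi false x * e false x)%R by rewrite mulr_ge0// ltW.
have le (z : bool * bool) (v : R) : (0 <= v)%R -> (0 <= \1_B z * v <= v)%R.
  by move=> v0; have /andP[a b] := i01 z; rewrite mulr_ge0//= ler_piMl.
rewrite /OD_weight; have /andP[a1 b1] := le (true, true) _ (ltW p1).
have /andP[a2 b2] := le (false, true) _ h1; have /andP[a3 b3] := le (false, false) _ h0.
by apply/andP; split; lra.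
Qed.

Lemma measurable_OD_weight B : measurable_fun setT (OD_weight B).
Proof.
have mP d : measurable_fun setT (fun x => pi false x * e d x)%R by exact: measurable_funM.
by apply: measurable_funD; [apply: measurable_funD|]; exact: measurable_funM.
Qed.

(** Almost surely (O, D) takes one of the three values with a term in [OD_weight], and the indicator
    of each of them is handled by [tr_obs] or [tr_trt]. *)
Lemma transfers_OD (B : set (bool * bool)) (G : cov * pot -> \bar R) : measurable B ->
  measurable_fun setT G -> (forall z, 0 <= G z) ->
  \int[Q]_w ((\1_B (OD w))%:E * G (covpot w)) =
  \int[Q]_w ((OD_weight B (X w))%:E * G (covpot w)).
Proof.
move=> mB mG G0.
have mGc := measurable_fun_covpot mG.
have m1 := measurable_eqb_fun true (@measurable_obsO R p).
have mcst (k : R) (f : full -> \bar R) : measurable_fun setT f ->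
  measurable_fun setT (fun w => k%:E * f w) by move=> mf; exact: emeasurable_funM.
have i0 z : (0 <= (\1_B z : R))%R by rewrite indicE.
have ge0 (k : R) (b : bool) w : (0 <= k)%R -> 0 <= k%:E * (b%:R%:E * G (covpot w)).
  by move=> k0; rewrite !mule_ge0// lee_fin.
have wpos (k : R) h w : (0 <= k)%R -> (0 <= h (X w))%R -> 0 <= k%:E * ((h (X w))%:E * G (covpot w)).
  by move=> k0 h0; rewrite !mule_ge0// lee_fin.
have mw (h : cov -> R) : measurable_fun setT h ->
    measurable_fun setT (fun w => (h (X w))%:E * G (covpot w)).
  move=> mh; apply: emeasurable_funM => //; apply/measurable_EFinP.
  exact: measurable_fun_covX.
have mb1 : measurable_fun setT (fun w => (obsO w == true)%:R%:E * G (covpot w)).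
  exact: emeasurable_funM.
have mb2 d : measurable_fun setT
    (fun w => (~~ obsO w && (trtD w == d))%:R%:E * G (covpot w)).
  by apply: emeasurable_funM => //; exact: measurable_stratum.
pose k1 : R := \1_B (true, true); pose k2 : R := \1_B (false, true).
pose k3 : R := \1_B (false, false).
have p0 o x : (0 <= pi o x)%R by rewrite ltW// weight_gt0.
have pe0 d x : (0 <= pi false x * e d x)%R by rewrite mulr_ge0// ltW// weight_gt0.
have mpe d : measurable_fun setT (fun x => pi false x * e d x)%R by exact: measurable_funM.
transitivity (\int[Q]_w
  ((k1%:E * ((obsO w == true)%:R%:E * G (covpot w)) +
    k2%:E * ((~~ obsO w && (trtD w == true))%:R%:E * G (covpot w))) +
   k3%:E * ((~~ obsO w && (trtD w == false))%:R%:E * G (covpot w)))).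
  apply: ae_eq_integral => //.
  - apply: emeasurable_funM => //; apply/measurable_EFinP.
    apply: (measurableT_comp (measurable_indic mB)); exact: measurable_OD.
  - by apply: emeasurable_funD; [apply: emeasurable_funD|]; exact: mcst.
  - have := ae_treated; apply: filterS => -[xod y]; case: xod => x od; case: od => o d; rewrite /OD/obsO/trtD/= => h _.
    move: h; case: o; case: d => //= h; rewrite ?mul1e ?mul0e ?mule0 ?adde0 ?add0e//.
    by have := h isT.
rewrite ge0_integralD; [|exact: measurableT|by move=> w _; rewrite adde_ge0// ge0|
  by apply: emeasurable_funD; exact: mcst|by move=> w _; rewrite ge0|exact: mcst].
rewrite ge0_integralD; [|exact: measurableT|by move=> w _; rewrite ge0|exact: mcst|
  by move=> w _; rewrite ge0|exact: mcst].
rewrite !ge0_integralZl_EFin//; try by [move=> w _; rewrite mule_ge0// lee_fin].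
rewrite (tr_obs tQ)// !(tr_trt tQ)//.
transitivity (\int[Q]_w
  ((k1%:E * ((pi true (X w))%:E * G (covpot w)) +
    k2%:E * ((pi false (X w) * e true (X w))%:E * G (covpot w))) +
   k3%:E * ((pi false (X w) * e false (X w))%:E * G (covpot w)))).
  rewrite ge0_integralD; [|exact: measurableT|
    by move=> w _; apply: adde_ge0; [exact: (wpos k1 (pi true))|
      exact: (wpos k2 (fun x => pi false x * e true x)%R)]|
    by apply: emeasurable_funD; [exact: (mcst _ _ (mw _ (mpi true)))|
      exact: (mcst _ _ (mw _ (mpe true)))]|
    by move=> w _; apply: (wpos k3 (fun x => pi false x * e false x)%R)|
    exact: (mcst _ _ (mw _ (mpe false)))].
  rewrite ge0_integralD; [|exact: measurableT|by move=> w _; exact: (wpos k1 (pi true))|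
    exact: (mcst _ _ (mw _ (mpi true)))|
    by move=> w _; apply: (wpos k2 (fun x => pi false x * e true x)%R)|
    exact: (mcst _ _ (mw _ (mpe true)))].
  rewrite !ge0_integralZl_EFin//; try by [exact: (mw _ (mpi true))|
    exact: (mw _ (mpe true))|exact: (mw _ (mpe false))|
    move=> w _; rewrite mule_ge0// lee_fin].
apply: eq_integral => w _; rewrite /OD_weight -/k1 -/k2 -/k3.
have h1 : (0 <= k1 * pi true (X w))%R by rewrite mulr_ge0.
have h2 : (0 <= k2 * (pi false (X w) * e true (X w)))%R by rewrite mulr_ge0.
have h3 : (0 <= k3 * (pi false (X w) * e false (X w)))%R by rewrite mulr_ge0.
rewrite EFinD ge0_muleDl ?lee_fin ?addr_ge0// EFinD ge0_muleDl ?lee_fin//.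
by rewrite !(EFinM k1, EFinM k2, EFinM k3) !muleA.
Qed.

(** Together with the next lemma, a converse to [transfers_clamp]: testing the identities on
    functions of [X] alone returns the conditional probabilities. *)
Lemma cond_prob_of_transfers o : cond_prob Q setT [set w | obsO w = o] (pi o).
Proof.
split => //.
- by apply: integrable_indic => //; exact: measurable_obsO_set.
- apply: (@integrable_of_bounded _ _ _ 1) => //; first exact: measurable_fun_covX.
  by move=> w; exact: weight_norm_le1.
move=> A mA; rewrite setTI.
have mG : measurable_fun setT (fun z : cov * pot => (\1_A z.1)%:E : \bar R).
  apply/measurable_EFinP; apply: (measurableT_comp (measurable_indic mA)).
  exact: measurable_fst.
have G0 (z : cov * pot) : 0 <= (\1_A z.1)%:E :> \bar R by rewrite lee_fin indicE.
rewrite [LHS]integral_mkcond [RHS]integral_mkcond.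
transitivity (\int[Q]_w ((obsO w == o)%:R%:E * (\1_A (covpot w).1)%:E)).
  by apply: eq_integral => w _; rewrite epatch_indic/= indic_eqb.
rewrite (tr_obs tQ o mG G0); apply: eq_integral => w _.
by rewrite epatch_indic/= muleC.
Qed.

Lemma cond_prob_stratum_of_transfers d :
  cond_prob Q [set w | obsO w = false] [set w | trtD w = d] (e d).
Proof.
have mE := @measurable_obsO_set R p false.
split => //.
- by apply: integrable_of_rintegrable => //; apply: integrable_indic => //; exact: measurable_trtD_set.
- apply: (@integrable_of_bounded _ _ _ 1) => //; first exact: measurable_fun_covX.
  by move=> w; exact: weight_norm_le1.
move=> A mA.
have mG : measurable_fun setT (fun z : cov * pot => (\1_A z.1)%:E : \bar R).
  apply/measurable_EFinP; apply: (measurableT_comp (measurable_indic mA)).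
  exact: measurable_fst.
have mG' : measurable_fun setT (fun z : cov * pot => (e d z.1)%:E * (\1_A z.1)%:E : \bar R).
  apply: emeasurable_funM => //; apply/measurable_EFinP.
  by apply: (measurableT_comp (me d)); exact: measurable_fst.
have e0 x : 0 <= (e d x)%:E by rewrite lee_fin ltW// weight_gt0.
have G0 (z : cov * pot) : 0 <= (\1_A z.1)%:E :> \bar R by rewrite lee_fin indicE.
have G'0 (z : cov * pot) : 0 <= (e d z.1)%:E * (\1_A z.1)%:E by rewrite mule_ge0.
have H1 := tr_trt tQ d mG G0.
have H2 := tr_obs tQ false mG' G'0.
rewrite [LHS]integral_mkcond [RHS]integral_mkcond.
transitivity (\int[Q]_w ((~~ obsO w && (trtD w == d))%:R%:E * (\1_A (covpot w).1)%:E)).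
  apply: eq_integral => w _; rewrite epatch_indic/= indicI/= !indic_eqb eqbF_neg.
  rewrite -!EFinM; congr (_%:E); rewrite (_ : \1_(X @^-1` A) w = \1_A (X w))//.
  by case: (obsO w); case: (trtD w == d); rewrite /= ?mul0r ?mul1r ?mulr0.
rewrite H1; transitivity (\int[Q]_w
    ((obsO w == false)%:R%:E * ((e d (covpot w).1)%:E * (\1_A (covpot w).1)%:E))).
  rewrite H2.
  by apply: eq_integral => w _; rewrite EFinM muleA.
apply: eq_integral => w _; rewrite epatch_indic/= indicI/= !indic_eqb.
by rewrite -!EFinM; congr (_%:E); rewrite (_ : \1_(X @^-1` A) w = \1_A (X w))//; ring.
Qed.

(** Used to place the path laws in the model. The hypothesis supplies conditional probabilities of
    the potential outcomes given X, which are explicit for those laws; [transfers_OD] then makes the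
    joint conditional probability a product. *)
Lemma unconfounded_of_transfers :
  (forall A : set pot, measurable A -> exists a : cov -> R,
    [/\ measurable_fun setT a, forall x, (0 <= a x <= 1)%R &
     forall F : cov -> \bar R, measurable_fun setT F -> (forall x, 0 <= F x) ->
     \int[Q]_w (F (X w) * (\1_A (potY w))%:E) = \int[Q]_w (F (X w) * (a (X w))%:E)]) ->
  unconfounded Q.
Proof.
move=> Ha A B mA mB; have [a [ma a01 HA]] := Ha A mA.
have mpA : measurable (@potY R p @^-1` A).
  by rewrite -[X in measurable X]setTI; exact: measurable_potY.
have mOB : measurable (@OD R p @^-1` B).
  by rewrite -[X in measurable X]setTI; exact: measurable_OD.
have mb := measurable_OD_weight B.
have b01 := OD_weight_bounds B.
have nle (h : cov -> R) x : (0 <= h x <= 1)%R -> (`|h x| <= 1)%R.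
  by move=> /andP[? ?]; rewrite ger0_norm.
have ib (h : cov -> R) : measurable_fun setT h -> (forall x, (0 <= h x <= 1)%R) ->
    Q.-integrable setT (fun w => (h (X w))%:E).
  move=> mh h01; apply: (@integrable_of_bounded _ _ _ 1) => //.
    exact: measurable_fun_covX.
  by move=> w; exact: nle.
have mG (F : cov -> \bar R) : measurable_fun setT F ->
    measurable_fun setT (fun z : cov * pot => F z.1).
  by move=> mF; apply: (measurableT_comp mF); exact: measurable_fst.
have mC (C : set cov) : measurable C -> measurable_fun setT (fun x => (\1_C x)%:E : \bar R).
  by move=> mC; apply/measurable_EFinP; exact: measurable_indic.
have mAp : measurable_fun setT (fun z : cov * pot => (\1_A z.2)%:E : \bar R).
  apply/measurable_EFinP; apply: (measurableT_comp (measurable_indic mA)).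
  exact: measurable_snd.
exists a, (OD_weight B); split; split => //.
- exact: integrable_indic.
- exact: ib.
- move=> C mCC; rewrite setTI [LHS]integral_mkcond [RHS]integral_mkcond.
  have C0 (x : cov) : 0 <= (\1_C x)%:E :> \bar R by rewrite lee_fin indicE.
  transitivity (\int[Q]_w ((\1_C (X w))%:E * (\1_A (potY w))%:E)).
    by apply: eq_integral => w _; rewrite epatch_indic/= muleC.
  by rewrite (HA _ (mC C mCC) C0); apply: eq_integral => w _; rewrite epatch_indic/= muleC.
- exact: integrable_indic.
- exact: ib.
- move=> C mCC; rewrite setTI [LHS]integral_mkcond [RHS]integral_mkcond.
  transitivity (\int[Q]_w ((\1_B (OD w))%:E * (\1_C (covpot w).1)%:E)).
    by apply: eq_integral => w _; rewrite epatch_indic.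
  rewrite (transfers_OD mB (mG _ (mC C mCC)))//.
  by apply: eq_integral => w _; rewrite epatch_indic.
- exact: measurable_funM.
- by apply: integrable_indic => //; exact: measurableI.
- apply: (ib (a \* OD_weight B)%R); first exact: measurable_funM.
  move=> x /=; have /andP[a0 a1] := a01 x; have /andP[b0 b1] := b01 x.
  by rewrite mulr_ge0//= mulr_ile1.
- move=> C mCC; rewrite setTI [LHS]integral_mkcond [RHS]integral_mkcond.
  transitivity (\int[Q]_w ((\1_B (OD w))%:E *
      ((\1_C (covpot w).1)%:E * (\1_A (covpot w).2)%:E))).
    apply: eq_integral => w _; rewrite epatch_indic/= indicI/= -!EFinM.
    by congr (_%:E); rewrite (_ : \1_(X @^-1` C) w = \1_C (X w))// mulrC mulrA; ring.
  rewrite (transfers_OD (G := fun z => (\1_C z.1)%:E * (\1_A z.2)%:E) mB); last 2 first.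
  + by apply: emeasurable_funM => //; exact: (mG _ (mC C mCC)).
  + by move=> z; rewrite mule_ge0// lee_fin.
  transitivity (\int[Q]_w (((OD_weight B (X w))%:E * (\1_C (X w))%:E) * (\1_A (potY w))%:E)).
    by apply: eq_integral => w _; rewrite muleA.
  rewrite (HA (fun x => (OD_weight B x)%:E * (\1_C x)%:E)); last 2 first.
  + by apply: emeasurable_funM; [exact/measurable_EFinP|exact: mC].
  + by move=> x; rewrite mule_ge0// lee_fin//; have /andP[] := b01 x.
  apply: eq_integral => w _; rewrite epatch_indic/= -!EFinM.
  by congr (_%:E); rewrite (_ : \1_(X @^-1` C) w = \1_C (X w))//; ring.
Qed.
End transfers_consequences.

(** * Full-data laws with conditionally independent potential outcomes *)

Section coupling.
Local Open Scope ereal_scope.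
Context (R : realType) (p : nat) (P : probability (full_data R p) R).
Local Notation full := (full_data R p).
Local Notation cov := (covariates R p).
Local Notation mR := (measurableTypeR R).
Local Notation pot := (mR * mR)%type.
Local Notation X := (@covX R p).
Local Notation lam := (@lebesgue_measure R).
Variables (den : cov -> R) (F1 F0 : cov * mR -> R).
Hypotheses (mden : measurable_fun setT den) (den0 : forall x, (0 <= den x)%R).
Hypotheses (mF1 : measurable_fun setT F1) (F10 : forall z, (0 <= F1 z)%R).
Hypotheses (mF0 : measurable_fun setT F0) (F00 : forall z, (0 <= F0 z)%R).
Hypothesis den1 : \int[P]_w (den (X w))%:E = 1.
Hypothesis ae1 : {ae P, forall w, \int[lam]_y (F1 (X w, y))%:E = 1}.
Hypothesis ae0 : {ae P, forall w, \int[lam]_y (F0 (X w, y))%:E = 1}.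

Local Notation lam2 := (sigma_product lam lam).

(** A path law needs some joint law of Y(1) and Y(0) given X. Under unconfoundedness the observed
    law and the treatment effect depend on its two marginals only, so the product of [F1] and [F0]
    is taken. *)
Definition kap (H : cov * pot -> \bar R) (x : cov) : \bar R :=
  \int[lam2]_y (H (x, y) * (F1 (x, y.1) * F0 (x, y.2))%:E).

Let FF (z : cov * pot) : R := (F1 (z.1, z.2.1) * F0 (z.1, z.2.2))%R.

Let FF0 z : (0 <= FF z)%R. Proof. exact: mulr_ge0. Qed.

Let mFF : measurable_fun setT FF.
Proof.
apply: measurable_funM.
  apply: (measurableT_comp mF1); apply: measurable_fun_mk_pair; first exact: measurable_fst.
  exact: (measurableT_comp measurable_fst measurable_snd).
apply: (measurableT_comp mF0); apply: measurable_fun_mk_pair; first exact: measurable_fst.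
exact: (measurableT_comp measurable_snd measurable_snd).
Qed.

Let mFFE : measurable_fun setT (fun z => (FF z)%:E).
Proof. exact/measurable_EFinP. Qed.

Lemma measurable_kap H : measurable_fun setT H -> (forall z, 0 <= H z) ->
  measurable_fun setT (kap H).
Proof.
move=> mH H0; apply: (@measurable_fun_fubini_tonelli_F _ _ _ _ _ lam2
  (fun z => H z * (FF z)%:E)); first exact: emeasurable_funM.
by move=> z; rewrite mule_ge0// lee_fin.
Qed.

Lemma kap_ge0 H x : (forall z, 0 <= H z) -> 0 <= kap H x.
Proof.
move=> H0; apply: integral_ge0 => y _; rewrite mule_ge0// lee_fin.
exact: (FF0 (x, y)).
Qed.

Let tonelli_lam2 (f : pot -> \bar R) : measurable_fun setT f -> (forall y, 0 <= f y) ->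
  \int[lam2]_y f y = \int[lam]_y1 \int[lam]_y0 f (y1, y0).
Proof. by move=> mf f0; rewrite /sigma_product fubini_tonelli1. Qed.

Let msec d1 d2 (S : measurableType d1) (Y : measurableType d2) (h : S * Y -> \bar R) x :
  measurable_fun setT h -> measurable_fun setT (fun y => h (x, y)).
Proof. by move=> mh; apply: (measurableT_comp mh); exact: measurable_pair1. Qed.

Lemma ae_kap1 (G : cov * mR -> \bar R) : measurable_fun setT G -> (forall z, 0 <= G z) ->
  {ae P, forall w, kap (fun z => G (z.1, z.2.1)) (X w) =
    \int[lam]_y (G (X w, y) * (F1 (X w, y))%:E)}.
Proof.
move=> mG G0; move: ae0; apply: filterS => w h; set x := X w in h *.
have mF1E : measurable_fun setT (fun z => (F1 z)%:E) by exact/measurable_EFinP.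
have mF0E : measurable_fun setT (fun z => (F0 z)%:E) by exact/measurable_EFinP.
rewrite /kap tonelli_lam2; last 2 first.
- have mfs : measurable_fun setT (fun y : pot => G (x, y.1)).
    exact: (measurableT_comp (msec x mG) measurable_fst).
  exact: (emeasurable_funM mfs (msec x mFFE)).
- by move=> y; rewrite mule_ge0// lee_fin; exact: (FF0 (x, y)).
apply: eq_integral => y1 _ /=.
under eq_integral do rewrite EFinM muleA.
rewrite ge0_integralZl ?h ?mule1//.
- exact: (msec x mF0E).
- by move=> y _; rewrite lee_fin.
- by rewrite mule_ge0// lee_fin.
Qed.

Lemma ae_kap0 (G : cov * mR -> \bar R) : measurable_fun setT G -> (forall z, 0 <= G z) ->
  {ae P, forall w, kap (fun z => G (z.1, z.2.2)) (X w) =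
    \int[lam]_y (G (X w, y) * (F0 (X w, y))%:E)}.
Proof.
move=> mG G0; move: ae1; apply: filterS => w h; set x := X w in h *.
have mF1E : measurable_fun setT (fun z => (F1 z)%:E) by exact/measurable_EFinP.
have mF0E : measurable_fun setT (fun z => (F0 z)%:E) by exact/measurable_EFinP.
rewrite /kap tonelli_lam2; last 2 first.
- have mfs : measurable_fun setT (fun y : pot => G (x, y.2)).
    exact: (measurableT_comp (msec x mG) measurable_snd).
  exact: (emeasurable_funM mfs (msec x mFFE)).
- by move=> y; rewrite mule_ge0// lee_fin; exact: (FF0 (x, y)).
have mGF : measurable_fun setT (fun y => G (x, y) * (F0 (x, y))%:E).
  exact: (emeasurable_funM (msec x mG) (msec x mF0E)).
transitivity (\int[lam]_y1 ((F1 (x, y1))%:E *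
    \int[lam]_y0 (G (x, y0) * (F0 (x, y0))%:E))).
  apply: eq_integral => y1 _ /=; rewrite -ge0_integralZl//.
  - by apply: eq_integral => y0 _; rewrite EFinM muleCA.
  - by move=> y _; rewrite mule_ge0// lee_fin.
  - by rewrite lee_fin.
rewrite ge0_integralZr ?h ?mul1e//.
- exact: (msec x mF1E).
- by move=> y _; rewrite lee_fin.
- by apply: integral_ge0 => y _; rewrite mule_ge0// lee_fin.
Qed.

Lemma ae_kap_cst : {ae P, forall w, kap (cst 1) (X w) = 1}.
Proof.
have := @ae_kap1 (cst 1) (@measurable_cst _ _ _ _ _ _) (fun=> lee01); move: ae1.
apply: filterS2 => w h /= h'; rewrite [LHS]h'.
by apply: etrans h; apply: eq_integral => y _; rewrite mul1e.
Qed.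

(** [Q] has density [den F1 F0] with respect to the product of the law of (X, (O, D)) under [P] and
    Lebesgue measure on the plane. Hence (O, D) keeps its conditional law given X, and the potential
    outcomes depend on it through [X] only. *)
Lemma coupling_law : exists Q : probability full R,
  forall (F : cov * (bool * bool) -> \bar R) (H : cov * pot -> \bar R),
    measurable_fun setT F -> (forall z, 0 <= F z) ->
    measurable_fun setT H -> (forall z, 0 <= H z) ->
    \int[Q]_w (F w.1 * H (covpot w)) =
    \int[P]_w (F w.1 * ((den (X w))%:E * kap H (X w))).
Proof.
pose fstm : {mfun full >-> (cov * (bool * bool))%type} := mfun_Sub (mem_set measurable_fst).
pose nu : probability (cov * (bool * bool))%type R := distribution P fstm.
pose base : {measure set full -> \bar R} := nu \x lam2.
pose g (w : full) : \bar R := (den (X w) * FF (covpot w))%:E.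
have g0 w : 0 <= g w by rewrite lee_fin mulr_ge0.
have mg : measurable_fun setT g.
  apply/measurable_EFinP; apply: measurable_funM; first exact: measurable_fun_covX.
  exact: measurable_fun_covpot.
have key (F : cov * (bool * bool) -> \bar R) (H : cov * pot -> \bar R) :
    measurable_fun setT F -> (forall z, 0 <= F z) ->
    measurable_fun setT H -> (forall z, 0 <= H z) ->
    \int[base]_w (F w.1 * H (covpot w) * g w) =
    \int[P]_w (F w.1 * ((den (X w))%:E * kap H (X w))).
  move=> mF F0' mH H0.
  have mFf : measurable_fun setT (fun w : full => F w.1).
    exact: (measurableT_comp mF measurable_fst).
  rewrite /base fubini_tonelli1; last 2 first.
  - apply: emeasurable_funM => //; apply: emeasurable_funM => //.
    exact: measurable_fun_covpot.
  - by move=> w; rewrite mule_ge0// mule_ge0.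
  have E z : fubini_F lam2 (fun w : full => F w.1 * H (covpot w) * g w) z =
      F z * ((den z.1)%:E * kap H z.1).
    rewrite /fubini_F/= /kap -ge0_integralZl; last 4 first.
    - exact: measurableT.
    - exact: (emeasurable_funM (msec z.1 mH) (msec z.1 mFFE)).
    - by move=> y _; rewrite mule_ge0// lee_fin; exact: (FF0 (z.1, y)).
    - by rewrite lee_fin.
    rewrite -ge0_integralZl; last 4 first.
    - exact: measurableT.
    - apply: emeasurable_funM => //.
      exact: (emeasurable_funM (msec z.1 mH) (msec z.1 mFFE)).
    - move=> y _; rewrite mule_ge0// ?lee_fin// mule_ge0// lee_fin.
      exact: (FF0 (z.1, y)).
    - exact: F0'.
    apply: eq_integral => y _; rewrite /g /FF /= EFinM -!muleA; congr (_ * _).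
    by rewrite muleCA.
  under eq_integral do rewrite E.
  rewrite /nu ge0_integral_distribution//.
  - apply: emeasurable_funM => //; apply: emeasurable_funM.
      apply/measurable_EFinP; exact: (measurableT_comp mden measurable_fst).
    exact: (measurableT_comp (measurable_kap mH H0) measurable_fst).
  - by move=> z; rewrite mule_ge0// mule_ge0 ?lee_fin// kap_ge0.
have g1 : \int[base]_w g w = 1.
  have c1 := @key (cst 1) (cst 1) (@measurable_cst _ _ _ _ _ _) (fun=> lee01)
    (@measurable_cst _ _ _ _ _ _) (fun=> lee01).
  under eq_integral do rewrite -[g _]mul1e -[X in X * g _](mule1 1).
  have mdX : measurable_fun setT (fun w => (den (X w))%:E).
    by apply/measurable_EFinP; exact: measurable_fun_covX.
  have mkX : measurable_fun setT (fun w => kap (cst 1) (X w)).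
    apply: measurable_fun_covX.
    exact: (measurable_kap (@measurable_cst _ _ _ _ _ _) (fun=> lee01)).
  rewrite c1; apply: etrans den1; apply: ae_eq_integral.
  - exact: measurableT.
  - rewrite (_ : (fun w => _) = (fun w => (den (X w))%:E * kap (cst 1) (X w))).
      exact: emeasurable_funM.
    by apply/funext => w; exact: mul1e.
  - exact: mdX.
  - by have := ae_kap_cst; apply: filterS => w -> _; rewrite mule1 mul1e.
have [Q HQ] := density_probability mg g0 g1.
exists Q => F H mF F0' mH H0; rewrite -key//.
rewrite (ge0_integral_density mg g0 HQ)//.
- apply: emeasurable_funM; first exact: (measurableT_comp mF measurable_fst).
  exact: measurable_fun_covpot.
- by move=> w; rewrite mule_ge0.
Qed.
End coupling.

(** * One-sided paths in the model *)

Section path_law.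
Local Open Scope ereal_scope.
Context (R : realType) (p : nat) (P : probability (full_data R p) R).
Local Notation full := (full_data R p).
Local Notation obs := (obs_data R p).
Local Notation cov := (covariates R p).
Local Notation mR := (measurableTypeR R).
Local Notation pot := (mR * mR)%type.
Local Notation X := (@covX R p).
Local Notation lam := (@lebesgue_measure R).
Variables (c : R) (pi e : bool -> cov -> R) (q : obs -> R).
Hypotheses (c0 : (0 < c)%R) (opi : overlap_weights c pi) (oe : overlap_weights c e).
Hypotheses (mpi : forall o, measurable_fun setT (pi o)).
Hypotheses (me : forall o, measurable_fun setT (e o)).
Hypotheses (tP : transfers P pi e) (dq : obs_density P q).

Variables (S M t : R) (s : obs -> R) (alpha : cov -> R).
Hypotheses (ms : measurable_fun setT s) (malpha : measurable_fun setT alpha).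
Hypotheses (sS : forall z, (`|s z| <= S)%R) (alphaS : forall x, (`|alpha x| <= S)%R).
(** The score has the same conditional mean [alpha(X)] on O = 0 and on O = 1, which keeps the law of
    O given X fixed. Adding [S] makes the integrand nonnegative, as [ymean] requires. *)
Hypothesis s_centered : {ae P, forall w, forall o,
  ymean q o (fun z => (S + s (z.1, o, z.2))%:E) (X w) = (S + alpha (X w))%:E}.
Hypothesis alpha_centered : (\int[P]_w alpha (X w))%R = 0%R.
Hypotheses (SM : (2 * S <= M * c)%R) (t0 : (0 < t)%R) (tSM : (t * (S + M / c) <= 2^-1)%R).

Local Notation f := (ydens q).
Let f1 (z : cov * mR) : R := f (z.1, true, z.2).
Let fm (z : cov * mR) : R := f (z.1, false, z.2).

(* The path moves the density of [Y(0)] towards that of [Y(1)] at speed [M], so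
   that it stays nonnegative where it vanishes and that of [Y(1)] does not. *)
Definition mixing (z : obs) : R :=
  if z.1.2 then 0%R
  else (M * (Num.min (f (z.1.1, true, z.2) / f (z.1.1, false, z.2)) c^-1 - 1))%R.

Definition path_score (z : obs) : R := (s z + mixing z)%R.

Let x0 : cov. Proof. exact: point. Qed.

Let c1 : (c <= 1)%R.
Proof. by apply: le_trans (ow_ge opi true x0) _; exact: ow_le1 opi. Qed.

Let S0 : (0 <= S)%R. Proof. exact: le_trans (normr_ge0 _) (alphaS x0). Qed.

Let M0 : (0 <= M)%R.
Proof. by rewrite -(pmulr_lge0 M c0); apply: le_trans SM; rewrite mulr_ge0. Qed.

Let cV : (1 <= c^-1)%R. Proof. by rewrite invf_ge1. Qed.

Let MMc : (M <= M / c)%R. Proof. by rewrite ler_peMr. Qed.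

Let mf o : measurable_fun setT (fun z : cov * mR => f (z.1, o, z.2)).
Proof.
apply: (measurableT_comp (measurable_ydens dq)).
apply: measurable_fun_mk_pair; last exact: measurable_snd.
by apply: measurable_fun_mk_pair => //; exact: measurable_fst.
Qed.

Let mf1 : measurable_fun setT f1. Proof. exact: mf. Qed.
Let mfm : measurable_fun setT fm. Proof. exact: mf. Qed.
Let f10 z : (0 <= f1 z)%R. Proof. exact: (ydens_ge0 dq). Qed.
Let fm0 z : (0 <= fm z)%R. Proof. exact: (ydens_ge0 dq). Qed.

Let mso o : measurable_fun setT (fun z : cov * mR => s (z.1, o, z.2)).
Proof.
apply: (measurableT_comp ms).
apply: measurable_fun_mk_pair; last exact: measurable_snd.
by apply: measurable_fun_mk_pair => //; exact: measurable_fst.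
Qed.

Lemma measurable_mixing : measurable_fun setT mixing.
Proof.
have mfo o : measurable_fun setT (fun z : obs => f (z.1.1, o, z.2)).
  apply: (measurableT_comp (measurable_ydens dq)).
  apply: measurable_fun_mk_pair; last exact: measurable_snd.
  apply: measurable_fun_mk_pair => //.
  exact: (measurableT_comp measurable_fst measurable_fst).
apply: measurable_fun_ifT.
- exact: (measurableT_comp measurable_snd measurable_fst).
- exact: measurable_cst.
- apply: measurable_funM => //; apply: measurable_funB => //.
  apply: measurable_minr => //; apply: measurable_funM => //.
  exact: measurable_fun_inv.
Qed.

Lemma mixing_bounded z : (`|mixing z| <= M / c)%R.
Proof.
rewrite /mixing; case: ifP => _.
  by rewrite normr0 divr_ge0// ltW.
rewrite normrM (ger0_norm M0) ler_wpM2l//.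
have r0 : (0 <= f (z.1.1, true, z.2) / f (z.1.1, false, z.2))%R.
  by rewrite divr_ge0// (ydens_ge0 dq).
have m0 : (0 <= Num.min (f (z.1.1, true, z.2) / f (z.1.1, false, z.2)) c^-1)%R.
  by rewrite le_min r0 invr_ge0 ltW.
have m1 : (Num.min (f (z.1.1, true, z.2) / f (z.1.1, false, z.2)) c^-1 <= c^-1)%R.
  by rewrite ge_min lexx orbT.
have := cV; rewrite ler_norml => *; apply/andP; split; lra.
Qed.

Lemma measurable_path_score : measurable_fun setT path_score.
Proof. by apply: measurable_funD => //; exact: measurable_mixing. Qed.

Lemma path_score_bounded z : (`|path_score z| <= S + M / c)%R.
Proof. by rewrite (le_trans (ler_normD _ _))// lerD// mixing_bounded. Qed.

Let tS : (t * S <= 2^-1)%R.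
Proof.
apply: le_trans tSM; rewrite ler_wpM2l ?(ltW t0)// lerDl.
by rewrite divr_ge0// ltW.
Qed.

Let tSM' : (t * S + t * M <= 2^-1)%R.
Proof. by rewrite -mulrDr; apply: le_trans tSM; rewrite ler_wpM2l ?(ltW t0)// lerD2l. Qed.

Let bnd (a B : R) : (`|a| <= B)%R -> (t * B <= 2^-1)%R -> (- (2^-1) <= t * a <= 2^-1)%R.
Proof.
move=> aB tB; rewrite -ler_norml normrM (gtr0_norm t0); apply: le_trans tB.
by rewrite ler_wpM2l// ltW.
Qed.

Lemma path_density_bounds z : (2^-1 <= 1 + t * path_score z <= 3 / 2)%R.
Proof.
have /andP[h1 h2] := bnd (path_score_bounded z) tSM.
by apply/andP; split; lra.
Qed.

(** The density of the covariate law along the path with respect to the true one: only the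
    conditional mean [alpha] of the score moves it. *)
Definition path_den (x : cov) : R := (1 + t * alpha x)%R.

Lemma path_den_bounds x : (2^-1 <= path_den x <= 3 / 2)%R.
Proof.
have /andP[h1 h2] := bnd (alphaS x) tS.
by rewrite /path_den; apply/andP; split; lra.
Qed.

Let den_gt0 x : (0 < path_den x)%R.
Proof. by have /andP[h _] := path_den_bounds x; lra. Qed.

Lemma measurable_path_den : measurable_fun setT path_den.
Proof. by apply: measurable_funD => //; exact: measurable_funM. Qed.

(** Unnormalised conditional densities along the path of Y(1), of Y given O = 0, and of Y(0), each
    of mass [path_den] at almost every covariate. [N0] solves [e true N1 + e false N0 = Nm]; the
    maximum with 0 makes it nonnegative at every point and is inactive wherever the mixture
    inequality for [f1] and [fm] holds. *)
Let N1 (z : cov * mR) : R := ((1 + t * s (z.1, true, z.2)) * f1 z)%R.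
Let Nm (z : cov * mR) : R := ((1 + t * s (z.1, false, z.2) - t * M) * fm z + t * M * f1 z)%R.
Let N0 (z : cov * mR) : R := Num.max 0%R ((Nm z - e true z.1 * N1 z) / e false z.1)%R.

Let ts z : (- (t * S) <= t * s z <= t * S)%R.
Proof. by rewrite -ler_norml normrM (gtr0_norm t0) ler_wpM2l// ltW. Qed.

Let N10 z : (0 <= N1 z)%R.
Proof. by rewrite mulr_ge0//; have /andP[h1 h2] := ts (z.1, true, z.2); have := tS; lra. Qed.

Let Nm0 z : (0 <= Nm z)%R.
Proof.
apply: addr_ge0; apply: mulr_ge0 => //; last by rewrite mulr_ge0// ltW.
by have /andP[h1 h2] := ts (z.1, false, z.2); have := tSM'; lra.
Qed.

Let N00 z : (0 <= N0 z)%R. Proof. by rewrite le_max lexx. Qed.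

Let mN1 : measurable_fun setT N1.
Proof.
by apply: measurable_funM => //; apply: measurable_funD => //; apply: measurable_funM.
Qed.

Let mNm : measurable_fun setT Nm.
Proof.
apply: measurable_funD; last exact: measurable_funM.
apply: measurable_funM => //; apply: measurable_funB => //.
by apply: measurable_funD => //; apply: measurable_funM.
Qed.

Let mz1 d (h : cov -> R) (Y : measurableType d) : measurable_fun setT h ->
  measurable_fun setT (fun z : cov * Y => h z.1).
Proof. by move=> mh; exact: (measurableT_comp mh measurable_fst). Qed.

Let mN0 : measurable_fun setT N0.
Proof.
apply: measurable_maxr => //; apply: measurable_funM.
  apply: measurable_funB => //; apply: measurable_funM => //; exact: mz1.
by apply: measurable_fun_inv; exact: mz1.
Qed.

Let e_gt0 d x : (0 < e d x)%R. Proof. exact: lt_le_trans c0 (ow_ge oe d x). Qed.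

(* Nonnegativity of the density of [Y(0)] along the path. *)
Let mixture_ge z : (e true z.1 * f1 z <= fm z)%R -> (e true z.1 * N1 z <= Nm z)%R.
Proof.
move=> h; rewrite -subr_ge0 /Nm /N1.
set s1 := s (z.1, true, z.2); set s0 := s (z.1, false, z.2).
(* [fm] is split into [e true f1] and its nonnegative excess. In front of [f1] the drift contributes
   [M (1 - e true)], at least [M c] and so at least [2 S], which outweighs [e true (s0 - s1)]. *)
have -> : ((1 + t * s0 - t * M) * fm z + t * M * f1 z -
    e true z.1 * ((1 + t * s1) * f1 z) =
  (1 + t * s0 - t * M) * (fm z - e true z.1 * f1 z) +
  t * f1 z * (e true z.1 * (s0 - s1) + M * (1 - e true z.1)))%R by ring.
apply: addr_ge0.
  apply: mulr_ge0; last by rewrite subr_ge0.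
  by have /andP[h1 h2] := ts (z.1, false, z.2); have := tSM'; rewrite -/s0 in h1 h2 *; lra.
apply: mulr_ge0; first by rewrite mulr_ge0// ltW.
have -> : (1 - e true z.1 = e false z.1)%R by have := ow_sum oe z.1; lra.
have he0 := ow_ge oe false z.1.
have he1 : (e true z.1 <= 1)%R by exact: ow_le1 oe.
have he1' : (0 <= e true z.1)%R by rewrite ltW.
have h1 : (M * c <= M * e false z.1)%R by rewrite ler_wpM2l.
have h2 : (- (2 * S) <= s0 - s1)%R.
  have := sS (z.1, true, z.2); have := sS (z.1, false, z.2).
  by rewrite -/s0 -/s1 !ler_norml => /andP[? ?] /andP[? ?]; lra.
have h3 : (- (2 * S) <= e true z.1 * (s0 - s1))%R.
  have a1 : (e true z.1 * - (2 * S) <= e true z.1 * (s0 - s1))%R by rewrite ler_wpM2l.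
  have a2 : (- (2 * S) <= e true z.1 * - (2 * S))%R.
    by rewrite mulrN lerN2 ler_piMl// mulr_ge0.
  exact: le_trans a2 a1.
by have := SM; lra.
Qed.

Let N0E z : (e true z.1 * f1 z <= fm z)%R ->
  (e true z.1 * N1 z + e false z.1 * N0 z = Nm z)%R.
Proof.
move=> h; rewrite /N0 max_r; last first.
  by rewrite divr_ge0 ?(ltW (e_gt0 _ _))// subr_ge0 mixture_ge.
by field; rewrite gt_eqF.
Qed.

(** Here the drift becomes part of the score: [M (f1 - fm)] is [fm] times [mixing]. *)
Let tilted_mixture z : (e true z.1 * f1 z <= fm z)%R ->
  (Nm z = (1 + t * path_score (z.1, false, z.2)) * fm z)%R.
Proof.
move=> h; rewrite /Nm /path_score /mixing/= -/(f1 z) -/(fm z).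
(* Where [fm] vanishes so does [f1], and both sides are 0 whatever the quotient in [mixing]. *)
have [fz|fz] := eqVneq (fm z) 0%R.
  have f1z : f1 z = 0%R.
    apply/eqP; rewrite eq_le f10 andbT -(pmulr_rle0 _ (e_gt0 true z.1)).
    by rewrite fz in h.
  by rewrite fz f1z; ring.
have fp : (0 < fm z)%R by rewrite lt_neqAle eq_sym fz fm0.
rewrite min_l; last first.
  rewrite ler_pdivrMr// -ler_pdivrMl ?invr_gt0// invrK.
  by apply: le_trans h; rewrite ler_wpM2r// (ow_ge oe).
by field.
Qed.

Let tilted_treated z : (N1 z = (1 + t * path_score (z.1, true, z.2)) * f1 z)%R.
Proof. by rewrite /N1 /path_score /mixing/= addr0. Qed.

Let msec d1 d2 (A : measurableType d1) (B : measurableType d2) (h : A * B -> R) x :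
  measurable_fun setT h -> measurable_fun setT (fun y => (h (x, y))%:E).
Proof.
by move=> mh; apply/measurable_EFinP; apply: (measurableT_comp mh); exact: measurable_pair1.
Qed.

Let intD (a b : mR -> R) : measurable_fun setT a -> measurable_fun setT b ->
  (forall y, (0 <= a y)%R) -> (forall y, (0 <= b y)%R) ->
  \int[lam]_y (a y + b y)%:E = \int[lam]_y (a y)%:E + \int[lam]_y (b y)%:E.
Proof.
move=> ma mb a0 b0; under eq_integral do rewrite EFinD.
rewrite ge0_integralD//; [by move=> y _; rewrite lee_fin|exact/measurable_EFinP|
  by move=> y _; rewrite lee_fin|exact/measurable_EFinP].
Qed.

Let intZ (k : R) (a : mR -> R) : measurable_fun setT a -> (forall y, (0 <= a y)%R) ->
  (0 <= k)%R -> \int[lam]_y (k * a y)%:E = k%:E * \int[lam]_y (a y)%:E.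
Proof.
move=> ma a0 k0; under eq_integral do rewrite EFinM.
by rewrite ge0_integralZl_EFin//; [move=> y _; rewrite lee_fin|exact/measurable_EFinP].
Qed.

Let msecR d1 d2 (A : measurableType d1) (B : measurableType d2) (h : A * B -> R) x :
  measurable_fun setT h -> measurable_fun setT (fun y => h (x, y)).
Proof. by move=> mh; apply: (measurableT_comp mh); exact: measurable_pair1. Qed.

Let sS0 z : (0 <= S + s z)%R.
Proof. by have := sS z; rewrite ler_norml => /andP[? ?]; lra. Qed.

Let ae_tilted o : {ae P, forall w,
  \int[lam]_y (f (X w, o, y))%:E = 1 /\
  \int[lam]_y ((S + s (X w, o, y)) * f (X w, o, y))%:E = (S + alpha (X w))%:E}.
Proof.
have := ae_ymean1 c0 opi mpi tP dq; move: s_centered; apply: filterS2 => w h1 h2.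
split; first by rewrite -(h2 o); apply: eq_integral => y _; rewrite mul1e.
by rewrite -(h1 o); apply: eq_integral => y _; rewrite EFinM.
Qed.

Let ae_N1 : {ae P, forall w, \int[lam]_y (N1 (X w, y))%:E = (path_den (X w))%:E}.
Proof.
have := ae_tilted true; apply: filterS => w [h1 h2]; set x := X w in h1 h2 *.
have mfx : measurable_fun setT (fun y : mR => f (x, true, y)) := msecR x (mf true).
have mfs : measurable_fun setT (fun y : mR => (S + s (x, true, y)) * f (x, true, y))%R.
  by apply: measurable_funM => //; apply: measurable_funD => //; exact: (msecR x (mso true)).
transitivity (\int[lam]_y ((1 - t * S) * f (x, true, y) +
    t * ((S + s (x, true, y)) * f (x, true, y)))%:E).
  by apply: eq_integral => y _; rewrite /N1 /f1/=; congr (_%:E); ring.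
have tS1 : (0 <= 1 - t * S)%R by have := tS; lra.
have fx0 (y : mR) : (0 <= f (x, true, y))%R by exact: (ydens_ge0 dq).
have fs0 (y : mR) : (0 <= (S + s (x, true, y)) * f (x, true, y))%R by rewrite mulr_ge0.
rewrite intD; [|exact: measurable_funM|exact: measurable_funM|
  by move=> y; rewrite mulr_ge0|by move=> y; rewrite mulr_ge0// ltW].
rewrite intZ// intZ// ?(ltW t0)// h1 h2 mule1 -EFinM -EFinD /path_den.
by congr (_%:E); ring.
Qed.

Let ae_Nm : {ae P, forall w, \int[lam]_y (Nm (X w, y))%:E = (path_den (X w))%:E}.
Proof.
have := ae_tilted false; have := ae_tilted true; apply: filterS2 => w [g1 _] [h1 h2].
set x := X w in g1 h1 h2 *.
have mfx o : measurable_fun setT (fun y : mR => f (x, o, y)) := msecR x (mf o).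
have mfs : measurable_fun setT (fun y : mR => (S + s (x, false, y)) * f (x, false, y))%R.
  by apply: measurable_funM => //; apply: measurable_funD => //; exact: (msecR x (mso false)).
transitivity (\int[lam]_y (((1 - t * S - t * M) * f (x, false, y) +
    t * ((S + s (x, false, y)) * f (x, false, y))) + t * M * f (x, true, y))%:E).
  by apply: eq_integral => y _; rewrite /Nm /f1 /fm/=; congr (_%:E); ring.
have tS1 : (0 <= 1 - t * S - t * M)%R by have := tSM'; lra.
have fx0 o (y : mR) : (0 <= f (x, o, y))%R by exact: (ydens_ge0 dq).
have fs0 (y : mR) : (0 <= (S + s (x, false, y)) * f (x, false, y))%R by rewrite mulr_ge0.
have tM0 : (0 <= t * M)%R by rewrite mulr_ge0// ltW.
rewrite intD; [|by apply: measurable_funD; exact: measurable_funM|exact: measurable_funM|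
  by move=> y; rewrite addr_ge0// mulr_ge0// ltW|by move=> y; rewrite mulr_ge0].
rewrite intD; [|exact: measurable_funM|exact: measurable_funM|
  by move=> y; rewrite mulr_ge0|by move=> y; rewrite mulr_ge0// ltW].
rewrite intZ// intZ// ?(ltW t0)// intZ// g1 h1 h2 !mule1 -EFinM -!EFinD /path_den.
by congr (_%:E); ring.
Qed.

(** Integrating [e true N1 + e false N0 = Nm] with the two masses already known gives a linear
    equation for the mass of [N0]. It excludes the value [+oo], and [e true + e false = 1] with
    [e false > 0] solves it. *)
Let ae_N0 : {ae P, forall w, \int[lam]_y (N0 (X w, y))%:E = (path_den (X w))%:E}.
Proof.
have := ae_mixture_ge c0 opi oe mpi me tP dq; have := ae_Nm; have := ae_N1.
apply: filterS3 => w h1 hm hge; set x := X w in h1 hm hge *.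
have H : (e true x)%:E * (path_den x)%:E + (e false x)%:E * \int[lam]_y (N0 (x, y))%:E =
    (path_den x)%:E.
  rewrite -{1}h1 -hm -intZ; [|exact: (msecR x mN1)|by []|by rewrite ltW].
  rewrite -intZ; [|exact: (msecR x mN0)|by []|by rewrite ltW].
  rewrite -intD; last 4 first.
  - by apply: measurable_funM => //; exact: (msecR x mN1).
  - by apply: measurable_funM => //; exact: (msecR x mN0).
  - by move=> y; rewrite mulr_ge0// ltW.
  - by move=> y; rewrite mulr_ge0// ltW.
  apply: ae_eq_integral => //.
  - apply/measurable_EFinP; apply: measurable_funD; apply: measurable_funM => //.
      exact: (msecR x mN1).
    exact: (msecR x mN0).
  - exact: msec.
  - by move: hge; apply: filterS => y hy _; rewrite (N0E (z := (x, y))).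
have e0 := e_gt0 false x.
move: H; set J := \int[lam]_y (N0 (x, y))%:E.
have : 0 <= J by apply: integral_ge0 => y _; rewrite lee_fin.
case: J => [r _|_|//].
- rewrite -!EFinM -EFinD => -[H]; congr (_%:E).
  have E1 : (e true x = 1 - e false x)%R by have := ow_sum oe x; lra.
  have : (e false x * (r - path_den x) = 0)%R by rewrite E1 in H; lra.
  move/eqP; rewrite mulf_eq0 gt_eqF//= => /eqP; lra.
- by rewrite gt0_muley ?lte_fin// -EFinM addey.
Qed.

Let F1 (z : cov * mR) : R := (N1 z / path_den z.1)%R.
Let F0 (z : cov * mR) : R := (N0 z / path_den z.1)%R.

Let mV : measurable_fun setT (fun z : cov * mR => (path_den z.1)^-1)%R.
Proof. by apply: measurable_fun_inv; apply: mz1; exact: measurable_path_den. Qed.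

Let mF1 : measurable_fun setT F1. Proof. exact: measurable_funM. Qed.
Let mF0 : measurable_fun setT F0. Proof. exact: measurable_funM. Qed.
Let F10 z : (0 <= F1 z)%R. Proof. by rewrite divr_ge0// ltW. Qed.
Let F00 z : (0 <= F0 z)%R. Proof. by rewrite divr_ge0// ltW. Qed.

Let ae_norm (N : cov * mR -> R) : measurable_fun setT N -> (forall z, (0 <= N z)%R) ->
  {ae P, forall w, \int[lam]_y (N (X w, y))%:E = (path_den (X w))%:E} ->
  {ae P, forall w, \int[lam]_y (N (X w, y) / path_den (X w))%:E = 1}.
Proof.
move=> mN N_0; apply: filterS => w h.
under eq_integral do rewrite mulrC.
rewrite intZ ?h//; [|exact: msecR|by rewrite invr_ge0 ltW].
by rewrite -EFinM mulVf// gt_eqF.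
Qed.

Lemma integral_path_den : \int[P]_w (path_den (X w))%:E = 1.
Proof.
have ia : rintegrable P (fun w => alpha (X w)).
  by apply: (@rintegrable_bounded _ _ _ _ S) => //; exact: measurable_fun_covX.
have it := rintegrableZ t ia.
rewrite (_ : \int[P]_w (path_den (X w))%:E = \int[P]_w (cst 1 w + t * alpha (X w))%:E)//.
rewrite REintegralE; last by apply: rintegrableD => //; exact: rintegrable_cst.
rewrite RintegralDE//; last exact: rintegrable_cst.
by rewrite Rintegral_cstE RintegralZE// alpha_centered mulr0 addr0.
Qed.

(** The unnormalised counterpart of [ymean]: the factor [path_den] from the law of [X] cancels the
    normalisation of the conditional densities, so the computations below need no quotient. *)
Let J (N : cov * mR -> R) (G : cov * mR -> \bar R) (x : cov) : \bar R :=
  \int[lam]_y (G (x, y) * (N (x, y))%:E).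

Let J_ge0 (N : cov * mR -> R) (G : cov * mR -> \bar R) x : (forall z, (0 <= N z)%R) -> (forall z, 0 <= G z) -> 0 <= J N G x.
Proof. by move=> N_0 G0; apply: integral_ge0 => y _; rewrite mule_ge0// lee_fin. Qed.

Let measurable_J (N : cov * mR -> R) (G : cov * mR -> \bar R) : measurable_fun setT N -> (forall z, (0 <= N z)%R) ->
  measurable_fun setT G -> (forall z, 0 <= G z) -> measurable_fun setT (J N G).
Proof.
move=> mN N_0 mG G0.
apply: (@measurable_fun_fubini_tonelli_F _ _ _ _ _ lam (fun z => G z * (N z)%:E)).
  by apply: emeasurable_funM => //; exact/measurable_EFinP.
by move=> z; rewrite mule_ge0// lee_fin.
Qed.

Let msecE (G : cov * mR -> \bar R) x : measurable_fun setT G ->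
  measurable_fun setT (fun y => G (x, y)).
Proof. by move=> mG; apply: (measurableT_comp mG); exact: measurable_pair1. Qed.

Let den_J (N : cov * mR -> R) G x : measurable_fun setT N -> (forall z, (0 <= N z)%R) ->
  measurable_fun setT G -> (forall z, 0 <= G z) ->
  (path_den x)%:E * \int[lam]_y (G (x, y) * (N (x, y) / path_den x)%:E) = J N G x.
Proof.
move=> mN N_0 mG G0; rewrite /J -ge0_integralZl.
- apply: eq_integral => y _; rewrite muleCA -EFinM mulrCA mulfV ?mulr1//.
  by rewrite gt_eqF.
- exact: measurableT.
- apply: emeasurable_funM; first exact: msecE.
  by apply/measurable_EFinP; apply: measurable_funM => //; exact: msecR.
- by move=> y _; rewrite mule_ge0// lee_fin divr_ge0// ltW.
- by rewrite lee_fin ltW.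
Qed.

Let mfst d1 (A : measurableType d1) (h : cov -> \bar R) : measurable_fun setT h ->
  measurable_fun setT (fun z : cov * A => h z.1).
Proof. by move=> mh; exact: (measurableT_comp mh measurable_fst). Qed.

Let J_add (N N' N'' : cov * mR -> R) (G : cov * mR -> \bar R) (a b : R) x :
  measurable_fun setT N -> (forall z, (0 <= N z)%R) ->
  measurable_fun setT N' -> (forall z, (0 <= N' z)%R) -> (0 <= a)%R -> (0 <= b)%R ->
  measurable_fun setT N'' ->
  {ae lam, forall y, (a * N (x, y) + b * N' (x, y) = N'' (x, y))%R} ->
  measurable_fun setT G -> (forall z, 0 <= G z) ->
  a%:E * J N G x + b%:E * J N' G x = J N'' G x.
Proof.
move=> mN N_0 mN' N'_0 a0 b0 mN'' hae mG G0; rewrite /J.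
have mGN (K : cov * mR -> R) : measurable_fun setT K ->
    measurable_fun setT (fun y => G (x, y) * (K (x, y))%:E).
  by move=> mK; apply: emeasurable_funM; [exact: msecE|exact: msec].
have GN0 (K : cov * mR -> R) : (forall z, (0 <= K z)%R) -> forall y, 0 <= G (x, y) * (K (x, y))%:E.
  by move=> K0 y; rewrite mule_ge0// lee_fin.
have kGN0 (k : R) (K : cov * mR -> R) : (0 <= k)%R -> (forall z, (0 <= K z)%R) ->
    forall y, 0 <= k%:E * (G (x, y) * (K (x, y))%:E).
  by move=> k0 K0 y; rewrite mule_ge0// GN0.
have mkGN (k : R) (K : cov * mR -> R) : measurable_fun setT K ->
    measurable_fun setT (fun y => k%:E * (G (x, y) * (K (x, y))%:E)).
  by move=> mK; apply: emeasurable_funM; [exact: measurable_cst|exact: mGN].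
rewrite -!ge0_integralZl_EFin//; [|by move=> y _; exact: GN0|exact: mGN|
  by move=> y _; exact: GN0|exact: mGN].
rewrite -ge0_integralD; [|exact: measurableT|by move=> y _; exact: kGN0|exact: mkGN|
  by move=> y _; exact: kGN0|exact: mkGN].
apply: ae_eq_integral.
- exact: measurableT.
- by apply: emeasurable_funD; exact: mkGN.
- exact: mGN.
- move: hae; apply: filterS => y <- _.
  by rewrite !(muleCA _ (G (x, y))) -!EFinM EFinD ge0_muleDr// lee_fin mulr_ge0.
Qed.

Let J_le (N N' : cov * mR -> R) (G : cov * mR -> \bar R) x :
  measurable_fun setT N -> (forall z, (0 <= N z)%R) -> measurable_fun setT N' ->
  (forall z, (N z <= N' z)%R) ->
  measurable_fun setT G -> (forall z, 0 <= G z) -> J N G x <= J N' G x.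
Proof.
move=> mN N_0 mN' NN' mG G0; apply: ge0_le_integral.
- exact: measurableT.
- by move=> y _; rewrite mule_ge0// lee_fin.
- by apply: emeasurable_funM; [exact: msecE|exact: msec].
- by apply: emeasurable_funM; [exact: msecE|exact: msec].
- by move=> y _; rewrite lee_wpmul2l// lee_fin.
Qed.

Let N1_le z : (N1 z <= 2 * f1 z)%R.
Proof.
by rewrite ler_wpM2r//; have /andP[h1 h2] := ts (z.1, true, z.2); have := tS; lra.
Qed.

(** For the moment bound: [N0] is at most [Nm / e false], where [Nm <= 2 (fm + f1)] for small [t]
    and [e false >= c]. *)
Let N0_le z : (N0 z <= 2 / c * fm z + 2 / c * f1 z)%R.
Proof.
have c20 : (0 <= 2 / c)%R by rewrite divr_ge0// ltW.
rewrite ge_max -mulrDr; apply/andP; split; first by rewrite mulr_ge0// addr_ge0.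
rewrite ler_pdivrMr//.
apply: (@le_trans _ _ (Nm z)); first by rewrite gerBl mulr_ge0// ltW.
have NmB : (Nm z <= 2 * (fm z + f1 z))%R.
  rewrite /Nm mulrDr lerD// ler_wpM2r//.
    by have /andP[h1 h2] := ts (z.1, false, z.2); have := tSM'; have := mulr_ge0 (ltW t0) M0; lra.
  by have := tSM'; have := mulr_ge0 (ltW t0) S0; lra.
apply: le_trans NmB _; rewrite mulrAC ler_wpM2r ?addr_ge0//.
by rewrite -mulrA ler_peMr// mulrC ler_pdivlMr// mul1r (ow_ge oe).
Qed.

(** The coefficients of the second moments of Y(1) and Y(0) that come out of [N1_le] and [N0_le];
    both are at most [8 / c] because [c <= 1]. *)
Let moment_constant : (2 + (2 / c + 2 / c) <= 8 / c)%R /\ (2 / c <= 8 / c)%R.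
Proof. by have := cV; split; lra. Qed.

(** [Q] is the coupling law of [path_den] and the normalised densities [N1 / path_den] and
    [N0 / path_den]. The weights survive because (O, D) keeps its law given X, and the observed law
    comes out as the tilt by [path_score] because [N0] was defined from the mixture. *)
Lemma path_law_exists : exists Q : probability full R,
  [/\ transfers Q pi e, unconfounded Q,
   forall F : cov * (bool * bool) -> \bar R, measurable_fun setT F -> (forall z, 0 <= F z) ->
     \int[Q]_w F w.1 = \int[P]_w (F w.1 * (path_den (X w))%:E),
   forall G : obs -> \bar R, measurable_fun setT G -> (forall z, 0 <= G z) ->
     \int[Q]_w G (observe w) =
     \int[P]_w (G (observe w) * (1 + t * path_score (observe w))%:E) &
   \int[Q]_w (outY1 w ^+ 2 + outY0 w ^+ 2)%:E <=
     (8 / c)%:E * \int[P]_w (outY1 w ^+ 2 + outY0 w ^+ 2)%:E].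
Proof.
have mden := measurable_path_den.
have den0 x : (0 <= path_den x)%R by rewrite ltW.
have ae1 := ae_norm mN1 N10 ae_N1; have ae0 := ae_norm mN0 N00 ae_N0.
have [Q HQ] := coupling_law mden den0 mF1 F10 mF0 F00 integral_path_den ae1 ae0.
have mK := @measurable_kap _ _ F1 F0 mF1 F10 mF0 F00.
have K0 := @kap_ge0 _ _ F1 F0 F10 F00.
have mdenE : measurable_fun setT (fun x => (path_den x)%:E) by exact/measurable_EFinP.
have den0E x : 0 <= (path_den x)%:E by rewrite lee_fin.
have mfull (F : cov * (bool * bool) -> \bar R) : measurable_fun setT F ->
    measurable_fun setT (fun w : full => F w.1).
  by move=> mF; exact: (measurableT_comp mF measurable_fst).
have HQX (F : cov * (bool * bool) -> \bar R) : measurable_fun setT F ->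
    (forall z, 0 <= F z) -> \int[Q]_w F w.1 = \int[P]_w (F w.1 * (path_den (X w))%:E).
  move=> mF F_0.
  have := HQ F (cst 1) mF F_0 (@measurable_cst _ _ _ _ _ _) (fun=> lee01).
  rewrite (eq_integral (fun w => F w.1)); last by move=> w _; rewrite mule1.
  move=> ->; apply: ae_eq_integral.
  - exact: measurableT.
  - apply: emeasurable_funM; first exact: (mfull _ mF).
    apply: emeasurable_funM; first exact: (measurable_fun_covX mdenE).
    apply: measurable_fun_covX; exact: (mK _ (@measurable_cst _ _ _ _ _ _) (fun=> lee01)).
  - by apply: emeasurable_funM; [exact: (mfull _ mF)|exact: (measurable_fun_covX mdenE)].
  - have := ae_kap_cst mF1 F10 mF0 F00 ae1 ae0.
    by apply: filterS => w -> _; rewrite mule1.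
have HQG (h : cov * pot -> \bar R) (N : cov * mR -> R) (F : cov * (bool * bool) -> \bar R)
    (G : cov * mR -> \bar R) : measurable_fun setT N -> (forall z, (0 <= N z)%R) ->
    measurable_fun setT h -> (forall z, 0 <= h z) ->
    {ae P, forall w, kap F1 F0 h (X w) =
      \int[lam]_y (G (X w, y) * (N (X w, y) / path_den (X w))%:E)} ->
    measurable_fun setT F -> (forall z, 0 <= F z) ->
    measurable_fun setT G -> (forall z, 0 <= G z) ->
    \int[Q]_w (F w.1 * h (covpot w)) = \int[P]_w (F w.1 * J N G (X w)).
  move=> mN N_0 mh h0 hae mF F_0 mG G0; rewrite HQ//; apply: ae_eq_integral.
  - exact: measurableT.
  - apply: emeasurable_funM; first exact: (mfull _ mF).
    apply: emeasurable_funM; first exact: (measurable_fun_covX mdenE).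
    by apply: measurable_fun_covX; exact: mK.
  - apply: emeasurable_funM; first exact: (mfull _ mF).
    by apply: measurable_fun_covX; exact: measurable_J.
  - by move: hae; apply: filterS => w -> _; rewrite den_J.
have HQ1 (F : cov * (bool * bool) -> \bar R) (G : cov * mR -> \bar R) :
    measurable_fun setT F -> (forall z, 0 <= F z) ->
    measurable_fun setT G -> (forall z, 0 <= G z) ->
    \int[Q]_w (F w.1 * G (X w, outY1 w)) = \int[P]_w (F w.1 * J N1 G (X w)).
  move=> mF F_0 mG G0; apply: (HQG (fun z => G (z.1, z.2.1)) N1 F G) => //.
  - apply: (measurableT_comp mG); apply: measurable_fun_mk_pair; first exact: measurable_fst.
    exact: (measurableT_comp measurable_fst measurable_snd).
  - exact: (ae_kap1 mF1 F10 mF0 F00 ae0 mG G0).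
have HQ0 (F : cov * (bool * bool) -> \bar R) (G : cov * mR -> \bar R) :
    measurable_fun setT F -> (forall z, 0 <= F z) ->
    measurable_fun setT G -> (forall z, 0 <= G z) ->
    \int[Q]_w (F w.1 * G (X w, outY0 w)) = \int[P]_w (F w.1 * J N0 G (X w)).
  move=> mF F_0 mG G0; apply: (HQG (fun z => G (z.1, z.2.2)) N0 F G) => //.
  - apply: (measurableT_comp mG); apply: measurable_fun_mk_pair; first exact: measurable_fst.
    exact: (measurableT_comp measurable_snd measurable_snd).
  - exact: (ae_kap0 mF1 F10 mF0 F00 ae1 mG G0).
have mO o : measurable_fun setT (fun z : cov * (bool * bool) => (z.2.1 == o)%:R%:E : \bar R).
  apply: measurable_eqb_fun; exact: (measurableT_comp measurable_fst measurable_snd).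
have mOD d : measurable_fun setT
    (fun z : cov * (bool * bool) => (~~ z.2.1 && (z.2.2 == d))%:R%:E : \bar R).
  apply/measurable_EFinP; apply: measurable_bool_natr; apply: measurable_and.
    apply: measurableT_comp => //; exact: (measurableT_comp measurable_fst measurable_snd).
  have : measurable_fun [set: bool] (fun b => b == d) by [].
  move=> /measurableT_comp; apply; exact: (measurableT_comp measurable_snd measurable_snd).
have w0 o x : 0 <= (pi o x)%:E by rewrite lee_fin (le_trans (ltW c0))// (ow_ge opi).
have v0 o x : 0 <= (e o x)%:E by rewrite lee_fin (le_trans (ltW c0))// (ow_ge oe).
have mw o : measurable_fun setT (fun x => (pi o x)%:E) by exact/measurable_EFinP.
have mv o : measurable_fun setT (fun x => (e o x)%:E) by exact/measurable_EFinP.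
(* [HQ] rewrites an integral under [Q] as one under [P] in which the potential outcomes have been
   integrated out. The indicator then stands in front of a function of [X], where the identities for
   [P] apply, and [HQ] is used backwards. *)
have tQ : transfers Q pi e.
  split.
  - have mb : measurable_fun setT (fun z : cov * (bool * bool) => (z.2.1 && ~~ z.2.2)%:R%:E : \bar R).
      apply/measurable_EFinP; apply: measurable_bool_natr; apply: measurable_and.
        exact: (measurableT_comp measurable_fst measurable_snd).
      apply: measurableT_comp => //; exact: (measurableT_comp measurable_snd measurable_snd).
    have mset : measurable [set w : full | obsO w && ~~ trtD w].
      apply: measurable_bool_set; apply: measurable_and; first exact: measurable_obsO.
      by apply: measurableT_comp => //; exact: measurable_trtD.
    transitivity (\int[Q]_w ((w.1.2.1 && ~~ w.1.2.2)%:R%:E : \bar R)).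
      rewrite -[LHS]mul1e -integral_cst// integral_mkcond; apply: eq_integral => w _.
      by rewrite epatch_indic/= mul1e indic_bool.
    rewrite (HQX (fun z => (z.2.1 && ~~ z.2.2)%:R%:E) mb)//.
    rewrite -[RHS](integral0 P setT); apply: ae_eq_integral.
    + exact: measurableT.
    + by apply: emeasurable_funM; [exact: (mfull _ mb)|exact: (measurable_fun_covX mdenE)].
    + exact: measurable_cst.
    + have := ae_treated tP; apply: filterS => w h _; move: h.
      by rewrite /obsO /trtD; case: w.1.2.1 => /= [->//|_]; rewrite mul0e.
  - move=> o G mG G0.
    have mdk : measurable_fun setT (fun z : cov * pot => (path_den z.1)%:E * kap F1 F0 G z.1).
      exact: (emeasurable_funM (mfst mdenE) (mfst (mK _ mG G0))).
    rewrite (HQ (fun z => (z.2.1 == o)%:R%:E) G (mO o))//.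
    have h0 (z : cov * pot) : 0 <= (path_den z.1)%:E * kap F1 F0 G z.1.
      by rewrite mule_ge0// K0.
    rewrite (tr_obs tP o mdk h0).
    by rewrite (HQ (fun z => (pi o z.1)%:E) G (mfst (mw o)))// => z; exact: w0.
  - move=> d G mG G0.
    have mdk : measurable_fun setT (fun z : cov * pot => (path_den z.1)%:E * kap F1 F0 G z.1).
      exact: (emeasurable_funM (mfst mdenE) (mfst (mK _ mG G0))).
    rewrite (HQ (fun z => (~~ z.2.1 && (z.2.2 == d))%:R%:E) G (mOD d))//.
    have h0 (z : cov * pot) : 0 <= (path_den z.1)%:E * kap F1 F0 G z.1.
      by rewrite mule_ge0// K0.
    rewrite (tr_trt tP d mdk h0).
    rewrite (HQ (fun z => (pi false z.1 * e d z.1)%:E) G)// => [|z].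
      by apply: (@mfst _ _ (fun x => (pi false x * e d x)%:E)); apply/measurable_EFinP; exact: measurable_funM.
    by rewrite EFinM mule_ge0.
exists Q; split => //.
- apply: (unconfounded_of_transfers c0 opi oe mpi me tQ) => A mA.
  have mAz : measurable_fun setT (fun z : cov * pot => (\1_A z.2)%:E : \bar R).
    apply/measurable_EFinP; apply: (measurableT_comp (measurable_indic mA)).
    exact: measurable_snd.
  have A0 (z : cov * pot) : 0 <= (\1_A z.2)%:E :> \bar R by rewrite lee_fin indicE.
  (* The kernel has total mass 1 only almost everywhere; the minimum with 1 gives a version bounded
     at every point. *)
  pose a x := fine (mine (kap F1 F0 (fun z => (\1_A z.2)%:E) x) 1).
  have k0 x : 0 <= kap F1 F0 (fun z => (\1_A z.2)%:E) x by exact: K0.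
  have aE x : (a x)%:E = mine (kap F1 F0 (fun z => (\1_A z.2)%:E) x) 1.
    rewrite /a fineK// ge0_fin_numE; last by rewrite le_min k0 lee01.
    by rewrite (le_lt_trans _ (ltry 1))// ge_min lexx orbT.
  have ma : measurable_fun setT a.
    apply: measurableT_comp; first exact: (fine_measurable measurableT).
    apply: measurable_mine; last exact: measurable_cst.
    exact: (mK _ mAz A0).
  exists a; split => //.
    by move=> x; rewrite -!lee_fin aE le_min k0 lee01 ge_min lexx orbT.
  move=> F mF F_0.
  have maE : measurable_fun setT (fun x => (a x)%:E) by exact/measurable_EFinP.
  have := HQ (fun z => F z.1) (fun z => (\1_A z.2)%:E) (mfst mF) (fun z => F_0 _) mAz A0.
  rewrite /= => ->.
  rewrite (HQX (fun z => F z.1 * (a z.1)%:E)); last 2 first.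
  + by apply: emeasurable_funM; [exact: (mfst mF)|exact: (mfst maE)].
  + by move=> z; rewrite mule_ge0// aE le_min k0 lee01.
  apply: ae_eq_integral.
  + exact: measurableT.
  + apply: emeasurable_funM; first exact: (measurable_fun_covX mF).
    apply: emeasurable_funM; first exact: (measurable_fun_covX mdenE).
    exact: (measurable_fun_covX (mK _ mAz A0)).
  + apply: emeasurable_funM; last exact: (measurable_fun_covX mdenE).
    by apply: emeasurable_funM; [exact: (measurable_fun_covX mF)|exact: (measurable_fun_covX maE)].
  + have := ae_kap_cst mF1 F10 mF0 F00 ae1 ae0; apply: filterS => w h _.
    rewrite -muleA; congr (_ * _); rewrite muleC; congr (_ * _); rewrite aE min_l//.
    rewrite -[leRHS]h /kap; apply: ge0_le_integral.
    * exact: measurableT.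
    * move=> y _; apply: mule_ge0; first exact: A0.
      by rewrite lee_fin mulr_ge0.
    * apply: emeasurable_funM.
        by apply/measurable_EFinP; exact: measurable_indic.
      apply/measurable_EFinP; apply: measurable_funM.
        by apply: (measurableT_comp (msecR (X w) mF1)); exact: measurable_fst.
      by apply: (measurableT_comp (msecR (X w) mF0)); exact: measurable_snd.
    * apply: emeasurable_funM; first exact: measurable_cst.
      apply/measurable_EFinP; apply: measurable_funM.
        by apply: (measurableT_comp (msecR (X w) mF1)); exact: measurable_fst.
      by apply: (measurableT_comp (msecR (X w) mF0)); exact: measurable_snd.
    * move=> y _; apply: lee_wpmul2r; first by rewrite lee_fin mulr_ge0.
      by rewrite lee_fin /= /indic; case: (_ \in _).
- move=> G mG G0.
  pose g o (z : cov * mR) := G (z.1, o, z.2).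
  have mg o : measurable_fun setT (g o).
    apply: (measurableT_comp mG); apply: measurable_fun_mk_pair; last exact: measurable_snd.
    by apply: measurable_fun_mk_pair; [exact: measurable_fst|exact: measurable_cst].
  have g0 o z : 0 <= g o z by exact: G0.
  have mJ (N : cov * mR -> R) o : measurable_fun setT N -> (forall z, (0 <= N z)%R) ->
      measurable_fun setT (J N (g o)).
    by move=> mN N_0; exact: measurable_J.
  have mJp (N : cov * mR -> R) o : measurable_fun setT N -> (forall z, (0 <= N z)%R) ->
      measurable_fun setT (fun w : full => J N (g o) (X w)).
    by move=> mN N_0; apply: measurable_fun_covX; exact: mJ.
  have mOw o : measurable_fun setT (fun w : full => (obsO w == o)%:R%:E : \bar R).
    exact: (mfull _ (mO o)).
  have mODw d : measurable_fun setT
      (fun w : full => (~~ obsO w && (trtD w == d))%:R%:E : \bar R).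
    exact: (mfull _ (mOD d)).
  have mXY o d (Y : full -> mR) : measurable_fun setT Y ->
      measurable_fun setT (fun w : full => (~~ obsO w && (trtD w == d))%:R%:E * g o (X w, Y w)).
    move=> mY; apply: emeasurable_funM; first exact: mODw.
    by apply: (measurableT_comp (mg o)); apply: measurable_fun_mk_pair => //; exact: measurable_covX.
  have mXY1 : measurable_fun setT (fun w : full => (obsO w == true)%:R%:E * g true (X w, outY1 w)).
    apply: emeasurable_funM; first exact: mOw.
    apply: (measurableT_comp (mg true)); apply: measurable_fun_mk_pair; first exact: measurable_covX.
    exact: measurable_outY1.
  (* The common value of both sides uses [N1] on O = 1 and [Nm] on O = 0. The right-hand side
     reaches it by disintegration and the tilt formulas, the left-hand side by separating Y(1) from
     Y(0) and recombining [e true N1 + e false N0] into [Nm]. *)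
  transitivity (\int[P]_w ((obsO w == true)%:R%:E * J N1 (g true) (X w) +
      (obsO w == false)%:R%:E * J Nm (g false) (X w))); last first.
    pose Gu (z : obs) := G z * (1 + t * path_score z)%:E.
    have mGu : measurable_fun setT Gu.
      apply: emeasurable_funM => //; apply/measurable_EFinP; apply: measurable_funD => //.
      by apply: measurable_funM => //; exact: measurable_path_score.
    have Gu0 z : 0 <= Gu z.
      rewrite mule_ge0// lee_fin.
      by have /andP[h _] := path_density_bounds z; apply: le_trans h.
    have mGuo o : measurable_fun setT (fun z : cov * mR => Gu (z.1, o, z.2)).
      apply: (measurableT_comp mGu); apply: measurable_fun_mk_pair; last exact: measurable_snd.
      by apply: measurable_fun_mk_pair; [exact: measurable_fst|exact: measurable_cst].
    rewrite (obs_disintegration dq mGu Gu0).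
    apply: ae_eq_integral.
    + exact: measurableT.
    + by apply: emeasurable_funD; apply: emeasurable_funM; [exact: mOw|exact: mJp|exact: mOw|exact: mJp].
    + apply: (eq_measurable_fun (fun w => (obsO w == true)%:R%:E *
          ymean q true (fun z => Gu (z.1, true, z.2)) (X w) +
          (obsO w == false)%:R%:E * ymean q false (fun z => Gu (z.1, false, z.2)) (X w))).
        by move=> w _; case: (obsO w); rewrite /= mul1e mul0e ?adde0 ?add0e.
      by apply: emeasurable_funD; apply: emeasurable_funM;
        [exact: mOw|exact: (measurable_fun_covX (measurable_ymean dq true (mGuo true) (fun=> Gu0 _)))|
         exact: mOw|exact: (measurable_fun_covX (measurable_ymean dq false (mGuo false) (fun=> Gu0 _)))].
    + have := ae_mixture_ge c0 opi oe mpi me tP dq; apply: filterS => w hw _.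
      case: (obsO w); rewrite /= mul1e mul0e ?adde0 ?add0e /ymean /J.
        by apply: eq_integral => y _; rewrite tilted_treated EFinM muleA.
      apply: ae_eq_integral.
      * exact: measurableT.
      * by apply: emeasurable_funM; [exact: (msecE _ (mg false))|exact: msec].
      * apply: emeasurable_funM; last exact: (msec (X w) mfm).
        exact: (msecE (X w) (mGuo false)).
      * by move: hw; apply: filterS => y hy _; rewrite (tilted_mixture (z := (X w, y)))// EFinM muleA.
  transitivity (\int[Q]_w ((obsO w == true)%:R%:E * g true (X w, outY1 w) +
      ((~~ obsO w && (trtD w == true))%:R%:E * g false (X w, outY1 w) +
       (~~ obsO w && (trtD w == false))%:R%:E * g false (X w, outY0 w)))).
    apply: eq_integral => w _; rewrite /g /observe /outY /tildeY.
    by case: (obsO w); case: (trtD w); rewrite /= ?mul0e ?add0e ?mul1e ?adde0.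
  rewrite ge0_integralD; [|exact: measurableT|by move=> w _; rewrite mule_ge0// lee_fin|
    exact: mXY1|by move=> w _; rewrite adde_ge0// mule_ge0// lee_fin|
    by apply: emeasurable_funD; [exact: (mXY false true _ (@measurable_outY1 R p))|
      exact: (mXY false false _ (@measurable_outY0 R p))]].
  rewrite ge0_integralD; [|exact: measurableT|by move=> w _; rewrite mule_ge0// lee_fin|
    exact: (mXY false true _ (@measurable_outY1 R p))|by move=> w _; rewrite mule_ge0// lee_fin|
    exact: (mXY false false _ (@measurable_outY0 R p))].
  have b0 (b : bool) : 0 <= b%:R%:E :> \bar R by rewrite lee_fin.
  rewrite (HQ1 (fun z => (z.2.1 == true)%:R%:E) (g true) (mO true) (fun=> b0 _) (mg true) (g0 true)).
  rewrite (HQ1 (fun z => (~~ z.2.1 && (z.2.2 == true))%:R%:E) (g false) (mOD true)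
    (fun=> b0 _) (mg false) (g0 false)).
  rewrite (HQ0 (fun z => (~~ z.2.1 && (z.2.2 == false))%:R%:E) (g false) (mOD false)
    (fun=> b0 _) (mg false) (g0 false)).
  have J0 (N : cov * mR -> R) o x : (forall z, (0 <= N z)%R) -> 0 <= J N (g o) x.
    by move=> N_0; apply: J_ge0.
  rewrite (tr_trt tP true (@mfst _ pot _ (mJ N1 false mN1 N10)) (fun z => J0 N1 false z.1 N10)).
  rewrite (tr_trt tP false (@mfst _ pot _ (mJ N0 false mN0 N00)) (fun z => J0 N0 false z.1 N00)).
  rewrite ge0_integralD; [|exact: measurableT|by move=> w _; rewrite mule_ge0 ?J0// lee_fin|
    by apply: emeasurable_funM; [exact: mOw|exact: mJp]|
    by move=> w _; rewrite mule_ge0 ?J0// lee_fin|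
    by apply: emeasurable_funM; [exact: mOw|exact: mJp]].
  congr (_ + _).
  rewrite (tr_obs tP false (@mfst _ pot _ (mJ Nm false mNm Nm0)) (fun z => J0 Nm false z.1 Nm0)).
  have mpe d : measurable_fun setT (fun w : full => (pi false (X w) * e d (X w))%:E).
    apply: (@measurable_fun_covX _ _ _ _ (fun x => (pi false x * e d x)%:E)).
    by apply/measurable_EFinP; exact: measurable_funM.
  have pe0 d x : 0 <= (pi false x * e d x)%:E by rewrite EFinM mule_ge0.
  rewrite -ge0_integralD; [|exact: measurableT|by move=> w _; rewrite mule_ge0 ?J0|
    by apply: emeasurable_funM; [exact: mpe|exact: mJp]|
    by move=> w _; rewrite mule_ge0 ?J0|
    by apply: emeasurable_funM; [exact: mpe|exact: mJp]].
  apply: ae_eq_integral.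
  + exact: measurableT.
  + by apply: emeasurable_funD; apply: emeasurable_funM; [exact: mpe|exact: mJp|exact: mpe|exact: mJp].
  + by apply: emeasurable_funM; [exact: (measurable_fun_covX (mw false))|exact: mJp].
  + have := ae_mixture_ge c0 opi oe mpi me tP dq; apply: filterS => w hw _ /=.
    rewrite !EFinM -!muleA -ge0_muleDr; last 2 first.
    * by rewrite mule_ge0 ?J0.
    * by rewrite mule_ge0 ?J0.
    congr (_ * _); apply: (J_add (N'' := Nm)) => //.
    * by rewrite ltW.
    * by rewrite ltW.
    * by move: hw; apply: filterS => y hy; exact: (N0E (z := (X w, y))).
- pose G2 (z : cov * mR) : \bar R := (z.2 ^+ 2)%:E.
  have mG2 : measurable_fun setT G2.
    by apply/measurable_EFinP; apply: measurable_funX; exact: measurable_snd.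
  have G20 z : 0 <= G2 z by rewrite lee_fin sqr_ge0.
  have mY (Y : full -> mR) (mu : probability full R) : measurable_fun setT Y ->
      measurable_fun setT (fun w : full => (Y w ^+ 2)%:E).
    by move=> mY; apply/measurable_EFinP; exact: measurable_funX.
  have split2 (mu : probability full R) : \int[mu]_w (outY1 w ^+ 2 + outY0 w ^+ 2)%:E =
      \int[mu]_w (outY1 w ^+ 2)%:E + \int[mu]_w (outY0 w ^+ 2)%:E.
    under eq_integral do rewrite EFinD.
    rewrite ge0_integralD//; [by move=> w _; rewrite lee_fin sqr_ge0|
      exact: (mY _ mu (@measurable_outY1 R p))|by move=> w _; rewrite lee_fin sqr_ge0|
      exact: (mY _ mu (@measurable_outY0 R p))].
  rewrite !split2; set A := \int[P]_w (outY1 w ^+ 2)%:E; set B := \int[P]_w (outY0 w ^+ 2)%:E.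
  have A0 : 0 <= A by apply: integral_ge0 => w _; rewrite lee_fin sqr_ge0.
  have B0 : 0 <= B by apply: integral_ge0 => w _; rewrite lee_fin sqr_ge0.
  have m1 := measurable_ymean dq true mG2 G20.
  have m0 := measurable_ymean dq false mG2 G20.
  have y10 x : 0 <= ymean q true G2 x := ymean_ge0 dq true x G20.
  have y00 x : 0 <= ymean q false G2 x := ymean_ge0 dq false x G20.
  have AE : \int[P]_w ymean q true G2 (X w) = A.
    by rewrite -(integral_outY1 c0 opi mpi tP dq mG2 G20).
  have BE : \int[P]_w ymean q false G2 (X w) <= A + B.
    rewrite (integral_outY0 c0 opi oe mpi me tP dq mG2 G20) -AE; apply: leeD.
    + apply: ge0_le_integral.
      * exact: measurableT.
      * by move=> w _; rewrite mule_ge0.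
      * by apply: emeasurable_funM; [exact: (measurable_fun_covX (mv true))|exact: (measurable_fun_covX m1)].
      * exact: (measurable_fun_covX m1).
      * by move=> w _; rewrite gee_pMl ?y10// lee_fin; exact: ow_le1 oe.
    + apply: ge0_le_integral.
      * exact: measurableT.
      * by move=> w _; rewrite mule_ge0// lee_fin sqr_ge0.
      * by apply: emeasurable_funM; [exact: (measurable_fun_covX (mv false))|exact: (mY _ P (@measurable_outY0 R p))].
      * exact: (mY _ P (@measurable_outY0 R p)).
      * by move=> w _; rewrite gee_pMl ?lee_fin ?sqr_ge0//; exact: ow_le1 oe.
  have Q1 : \int[Q]_w (outY1 w ^+ 2)%:E <= 2%:E * A.
    have := HQ1 (cst 1) G2 (@measurable_cst _ _ _ _ _ _) (fun=> lee01) mG2 G20.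
    under eq_integral do rewrite mul1e.
    under [in X in _ = X]eq_integral do rewrite mul1e.
    move=> ->; rewrite -AE -ge0_integralZl_EFin; [|exact: measurableT|by move=> w _; exact: y10|
      exact: (measurable_fun_covX m1)|exact: ler0n].
    apply: ge0_le_integral.
    + exact: measurableT.
    + by move=> w _; exact: J_ge0.
    + exact: (measurable_fun_covX (measurable_J mN1 N10 mG2 G20)).
    + by apply: emeasurable_funM; [exact: measurable_cst|exact: (measurable_fun_covX m1)].
    + move=> w _; rewrite /ymean.
      apply: (@le_trans _ _ (J (fun z => 2 * f1 z + 0 * f1 z)%R G2 (X w))).
        apply: J_le => //.
        - by apply: measurable_funD; exact: measurable_funM.
        - by move=> z; rewrite mul0r addr0; exact: N1_le.
      rewrite -(J_add (N := f1) (N' := f1) (a := 2) (b := 0))//; last 2 first.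
      * by apply: measurable_funD; exact: measurable_funM.
      * by apply: aeW => y.
      by rewrite mul0e adde0.
  have Q0 : \int[Q]_w (outY0 w ^+ 2)%:E <= (2 / c)%:E * (A + B + A).
    have c20 : (0 <= 2 / c)%R by rewrite divr_ge0// ltW.
    have := HQ0 (cst 1) G2 (@measurable_cst _ _ _ _ _ _) (fun=> lee01) mG2 G20.
    under eq_integral do rewrite mul1e.
    under [in X in _ = X]eq_integral do rewrite mul1e.
    move=> ->; apply: (@le_trans _ _ ((2 / c)%:E *
      (\int[P]_w ymean q false G2 (X w) + \int[P]_w ymean q true G2 (X w)))); last first.
      by rewrite lee_wpmul2l ?lee_fin// leeD// AE.
    rewrite -ge0_integralD; [|exact: measurableT|by []|exact: (measurable_fun_covX m0)|
      by []|exact: (measurable_fun_covX m1)].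
    have m01 : measurable_fun setT (fun w : full => ymean q false G2 (X w) + ymean q true G2 (X w)).
      by apply: emeasurable_funD; [exact: (measurable_fun_covX m0)|exact: (measurable_fun_covX m1)].
    rewrite -ge0_integralZl_EFin//; last by move=> w _; rewrite adde_ge0.
    apply: ge0_le_integral.
    + exact: measurableT.
    + by move=> w _; exact: J_ge0.
    + exact: (measurable_fun_covX (measurable_J mN0 N00 mG2 G20)).
    + by apply: emeasurable_funM; [exact: measurable_cst|exact: m01].
    + move=> w _; rewrite /ymean.
      apply: (@le_trans _ _ (J (fun z => (2 / c) * fm z + (2 / c) * f1 z)%R G2 (X w))).
        apply: J_le => //.
        - by apply: measurable_funD; exact: measurable_funM.
      rewrite -(J_add (N := fm) (N' := f1) (a := 2 / c) (b := 2 / c))//; last 2 first.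
      * by apply: measurable_funD; exact: measurable_funM.
      * by apply: aeW => y.
      by rewrite -ge0_muleDr; [|exact: J_ge0|exact: J_ge0].
  apply: (le_trans (leeD Q1 Q0)).
  have -> : (8 / c)%:E * (A + B) = (8 / c)%:E * A + (8 / c)%:E * B by rewrite ge0_muleDr.
  have lin (k : R) (a b : \bar R) : (0 <= k)%R -> 0 <= a -> 0 <= b ->
      2%:E * a + k%:E * (a + b + a) = (2 + (k + k))%:E * a + k%:E * b.
    move=> k0 a0 b0; rewrite (EFinD 2) (EFinD k k) [in RHS]ge0_muleDl ?lee_fin ?addr_ge0//.
    rewrite [in RHS]ge0_muleDl ?lee_fin// [in LHS]ge0_muleDr ?adde_ge0// [in LHS]ge0_muleDr//.
    by rewrite -!addeA; congr (_ + (_ + _)); rewrite addeC.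
  rewrite lin//; last by rewrite divr_ge0// ltW.
  by apply: leeD; rewrite lee_wpmul2r// lee_fin; case: moment_constant.
Qed.

End path_law.

(** * Membership of the tilted laws in the model *)

Section covariate_densities.
Local Open Scope ereal_scope.
Context (R : realType) (p : nat).
Local Notation full := (full_data R p).
Local Notation cov := (covariates R p).
Local Notation X := (@covX R p).
Variables (P Q : probability full R) (den : cov -> R).
Hypotheses (mden : measurable_fun setT den) (den0 : forall x, (0 <= den x)%R).
Hypothesis HQ : forall F : cov * (bool * bool) -> \bar R, measurable_fun setT F ->
  (forall z, 0 <= F z) -> \int[Q]_w F w.1 = \int[P]_w (F w.1 * (den (X w))%:E).

(** Serves twice: for the density of all covariates, with [b] constantly true and [k = 1], and for
    the treatment group, with [b] reading off D and [k] its probability. The tilt is a function of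
    [X], so it passes to Lebesgue measure together with the law of [X] restricted to the event. *)
Lemma tilted_covariate_density (b : bool * bool -> bool) (Xs : set cov) (zeta : cov -> R)
    (k : R) : measurable_fun setT b -> measurable Xs -> measurable_fun Xs zeta ->
  (forall x, Xs x -> (0 <= zeta x)%R) -> (0 <= k)%R ->
  (forall A, measurable A -> P ([set w : full | b w.1.2] `&` X @^-1` A) =
     k%:E * \int[lebesgue_tuple R p]_(x in Xs `&` A) (zeta x)%:E) ->
  forall A, measurable A -> Q ([set w : full | b w.1.2] `&` X @^-1` A) =
     k%:E * \int[lebesgue_tuple R p]_(x in Xs `&` A) (den x * zeta x)%:E.
Proof.
move=> mb mXs mz z0 k0 HP A mA.
have zX0 x : (0 <= (zeta \_ Xs) x)%R.
  by rewrite patchE; case: ifPn => //; rewrite inE; exact: z0.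
have mzX : measurable_fun setT (zeta \_ Xs) by apply/(measurable_restrictT _ mXs).
have mbw : measurable_fun setT (fun w : full => b w.1.2).
  apply: (measurableT_comp mb); exact: measurable_OD.
have mB : measurable [set w : full | b w.1.2] := measurable_bool_set mbw.
have mXA (C : set cov) : measurable C -> measurable (X @^-1` C).
  by move=> mC; rewrite -[Y in measurable Y]setTI; exact: measurable_covX.
have intX (h : cov -> R) (C : set cov) : measurable C -> measurable_fun setT h ->
    (forall x, (0 <= h x)%R) ->
    \int[lebesgue_tuple R p]_(x in C) (k * (h x * (zeta \_ Xs) x))%:E =
    k%:E * \int[lebesgue_tuple R p]_(x in Xs `&` C) (h x * zeta x)%:E.
  move=> mC mh h0; under eq_integral do rewrite EFinM.
  rewrite ge0_integralZl_EFin//; last 2 first.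
  - by move=> x _; rewrite lee_fin mulr_ge0.
  - by apply: measurable_funTS; apply/measurable_EFinP; exact: measurable_funM.
  congr (_ * _); rewrite setIC integral_mkcondr; apply: eq_integral => x _.
  by rewrite !patchE; case: ifP => _; rewrite ?mulr0.
have u0 (w : full) : 0 <= (b w.1.2)%:R%:E :> \bar R by rewrite lee_fin.
have mu : measurable_fun setT (fun w : full => (b w.1.2)%:R%:E : \bar R).
  by apply/measurable_EFinP; exact: measurable_bool_natr.
have mv : measurable_fun setT (fun x => (k * (zeta \_ Xs) x)%:E).
  by apply/measurable_EFinP; exact: measurable_funM.
have v0 x : 0 <= (k * (zeta \_ Xs) x)%:E by rewrite lee_fin mulr_ge0.
have uv C : measurable C -> \int[P]_(w in X @^-1` C) (b w.1.2)%:R%:E =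
    \int[lebesgue_tuple R p]_(x in id @^-1` C) (k * (zeta \_ Xs) x)%:E.
  move=> mC; rewrite preimage_id.
  have := intX (cst 1%R) C mC (@measurable_cst _ _ _ _ _ _) (fun=> ler01).
  under eq_integral do rewrite mul1r.
  under [in X in _ = X -> _]eq_integral do rewrite mul1r.
  move=> ->; rewrite -HP// -[RHS]mul1e -integral_cst; last by apply: measurableI => //; exact: mXA.
  rewrite [LHS]integral_mkcond [RHS]integral_mkcond; apply: eq_integral => w _.
  by rewrite !epatch_indic indicI/= indic_bool mul1e -EFinM.
have mF : measurable_fun setT (fun x => (\1_A x * den x)%:E).
  by apply/measurable_EFinP; apply: measurable_funM.
have F0 x : 0 <= (\1_A x * den x)%:E by rewrite lee_fin mulr_ge0// indicE.
have := ge0_transport (@measurable_covX R p) (@measurable_id _ _ setT) mu mv u0 v0 uv mF F0.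
rewrite -intX// => H.
have mG : measurable_fun setT
    (fun z : cov * (bool * bool) => (\1_A z.1 * (b z.2)%:R)%:E : \bar R).
  apply/measurable_EFinP; apply: measurable_funM.
    by apply: measurableT_comp; [exact: measurable_indic|exact: measurable_fst].
  apply: measurable_bool_natr; apply: (measurableT_comp mb); exact: measurable_snd.
have G0 (z : cov * (bool * bool)) : 0 <= (\1_A z.1 * (b z.2)%:R)%:E :> \bar R.
  by rewrite lee_fin mulr_ge0// indicE.
have HG := HQ mG G0.
transitivity (\int[Q]_w (\1_A w.1.1 * (b w.1.2)%:R)%:E).
  rewrite -[LHS]mul1e -integral_cst; last by apply: measurableI => //; exact: mXA.
  rewrite [LHS]integral_mkcond; apply: eq_integral => w _.
  by rewrite !epatch_indic indicI/= indic_bool mul1e mulrC.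
rewrite HG; transitivity (\int[P]_w ((\1_A (X w) * den (X w))%:E * (b w.1.2)%:R%:E)).
  by apply: eq_integral => w _; rewrite -!EFinM mulrAC.
rewrite H [RHS]integral_mkcond; apply: eq_integral => x _.
by rewrite epatch_indic/= -!EFinM; congr (_%:E); ring.
Qed.

Lemma tilted_null_set (N : set cov) : measurable N ->
  {ae P, forall w, N (X w)} -> {ae Q, forall w, N (X w)}.
Proof.
move=> mN [Z [mZ Z0 sZ]]; exists (X @^-1` (~` N)); split => //.
- by rewrite -[Y in measurable Y]setTI; apply: measurable_covX => //; exact: measurableC.
have mC := measurableC mN.
have mG : measurable_fun setT (fun z : cov * (bool * bool) => (\1_(~` N) z.1)%:E : \bar R).
  apply/measurable_EFinP.
  by apply: measurableT_comp; [exact: measurable_indic|exact: measurable_fst].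
have G0 (z : cov * (bool * bool)) : 0 <= (\1_(~` N) z.1)%:E :> \bar R.
  by rewrite lee_fin indicE.
have HG := HQ mG G0.
transitivity (\int[Q]_w (\1_(~` N) w.1.1)%:E).
  rewrite -[LHS]mul1e -integral_cst; last first.
    by rewrite -[Y in measurable Y]setTI; apply: measurable_covX.
  rewrite [LHS]integral_mkcond; apply: eq_integral => w _.
  by rewrite !epatch_indic/= mul1e.
rewrite HG -[RHS](integral0 P setT); apply: ae_eq_integral.
- exact: measurableT.
- apply: emeasurable_funM; first by apply: (measurableT_comp mG); exact: measurable_fst.
  by apply: (@measurable_fun_covX _ _ _ _ (fun x => (den x)%:E)); exact/measurable_EFinP.
- exact: measurable_cst.
- exists Z; split => // w h; apply: sZ => Nw; apply: h => _.
  by rewrite indicE memNset ?mul0e// => /(_ Nw).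
Qed.
End covariate_densities.

Section smooth_path.
Local Open Scope ereal_scope.
Context (R : realType) (p : nat) (Xs : set (covariates R p)) (P : probability (full_data R p) R).
Local Notation full := (full_data R p).
Local Notation obs := (obs_data R p).
Local Notation cov := (covariates R p).
Local Notation X := (@covX R p).
Variables (zeta zetaT : cov -> R) (pi0 g0 : bool -> cov -> R) (c : R) (q : obs -> R).
Hypotheses (mXs : measurable Xs) (hs : censoring_setting Xs P zeta zetaT pi0 g0).
Hypotheses (hu : unconfounded P) (hc : common_support Xs zeta zetaT pi0 g0 c).
Hypothesis dq : obs_density P q.
Variables (S M : R) (s : obs -> R) (alpha : cov -> R).
Hypotheses (ms : measurable_fun setT s) (malpha : measurable_fun setT alpha).
Hypotheses (sS : forall z, (`|s z| <= S)%R) (alphaS : forall x, (`|alpha x| <= S)%R).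
Hypothesis s_centered : {ae P, forall w, forall o,
  ymean q o (fun z => (S + s (z.1, o, z.2))%:E) (X w) = (S + alpha (X w))%:E}.
Hypothesis alpha_centered : (\int[P]_w alpha (X w))%R = 0%R.
Hypothesis SM : (2 * S <= M * c)%R.

Local Notation pi := (clamp c pi0).
Local Notation e := (clamp c g0).
Local Notation u := (path_score c q M s).

Let c0 : (0 < c)%R. Proof. by case: hc. Qed.
Let c2 : (2 * c < 1)%R := overlap_half mXs hs hc.
Let opi : overlap_weights c pi := overlap_clamp mXs hs hc pi0.
Let oe : overlap_weights c e := overlap_clamp mXs hs hc g0.
Let mpi o : measurable_fun setT (pi o).
Proof. by apply: measurable_clamp; case: (Defs.piP hs true). Qed.
Let mg d : measurable_fun setT (g0 d). Proof. by case: (gP hs d). Qed.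
Let me o : measurable_fun setT (e o). Proof. exact: measurable_clamp. Qed.

Let tP : transfers P pi e := transfers_clamp mXs hs hu hc.

(** O = 1 forces D = 1 and has probability at least [c]. This keeps the normalising constant of the
    treatment-group density away from 0. *)
Lemma treated_mass (Q : probability full R) : transfers Q pi e ->
  c%:E <= Q [set w : full | trtD w].
Proof.
move=> tQ; have mD : measurable [set w : full | trtD w].
  by apply: measurable_bool_set; exact: measurable_trtD.
have := tr_obs tQ true (@measurable_cst _ _ _ _ setT 1) (fun=> lee01) => H.
apply: (@le_trans _ _ (\int[Q]_w ((obsO w == true)%:R%:E * 1))).
  rewrite H; apply: (@le_trans _ _ (\int[Q]_w c%:E)).
    by rewrite integral_cst// [X in _ * X](_ : _ = 1) ?mule1//; exact: probability_setT.
  apply: ge0_le_integral => //.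
  - by move=> w _; rewrite lee_fin ltW.
  - apply: emeasurable_funM => //; apply/measurable_EFinP; exact: measurable_fun_covX.
  - by move=> w _; rewrite mule1 lee_fin (ow_ge opi).
apply: (@le_trans _ _ (\int[Q]_w (\1_[set w : full | trtD w] w)%:E)); last first.
  rewrite -[leRHS]mul1e -integral_cst// [leRHS]integral_mkcond.
  rewrite le_eqVlt; apply/orP; left; apply/eqP; apply: eq_integral => w _.
  by rewrite epatch_indic/= mul1e.
apply: ae_ge0_le_integral => //.
- apply: emeasurable_funM => //; apply: measurable_eqb_fun; exact: measurable_obsO.
- by apply/measurable_EFinP; exact: measurable_indic.
- have := ae_treated tQ; apply: filterS => w h _.
  rewrite mule1 lee_fin indic_bool; move: h; case: (obsO w) => //= h.
  by rewrite h.
Qed.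

Let cc : (c ^+ 2 / 2 < c / 2)%R.
Proof. by have h1 := c0; have h2 := c2; rewrite expr2; nra. Qed.

Let half_lt : (c / 2 < c)%R. Proof. by have := c0; lra. Qed.

Let half_mul (a z : R) : (2^-1 <= a)%R -> (c < z)%R -> (c / 2 < a * z)%R.
Proof. by move=> a2 cz; have := c0; nra. Qed.

Lemma path_model_exists (t : R) : (0 < t)%R -> (t * (S + M / c) <= 2^-1)%R ->
  exists Q : probability full R,
  [/\ transfers Q pi e, censoring_model Xs g0 Q,
   forall G : obs -> \bar R, measurable_fun setT G -> (forall z, 0 <= G z) ->
     \int[Q]_w G (observe w) = \int[P]_w (G (observe w) * (1 + t * u (observe w))%:E),
   obs_density Q (fun z => (1 + t * u z) * q z)%R &
   \int[Q]_w (outY1 w ^+ 2 + outY0 w ^+ 2)%:E <=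
     (8 / c)%:E * \int[P]_w (outY1 w ^+ 2 + outY0 w ^+ 2)%:E].
Proof.
move=> t0 tSM.
have [Q [tQ uQ HX HG HM]] := path_law_exists c0 opi oe mpi me tP dq ms malpha sS alphaS
  s_centered alpha_centered SM t0 tSM.
have mden := measurable_path_den t malpha.
have denb x := path_den_bounds c0 alphaS SM t0 tSM x.
have den0 x : (0 <= path_den t alpha x)%R by have /andP[h _] := denb x; apply: le_trans h.
have bu z := path_density_bounds c0 opi dq sS alphaS SM t0 tSM z.
have mu : measurable_fun setT (fun z => 1 + t * u z)%R.
  apply: measurable_funD => //; apply: measurable_funM => //.
  exact: (measurable_path_score c dq M ms).
have u0 z : (0 <= 1 + t * u z)%R by have /andP[h _] := bu z; apply: le_trans h.
have [mq q0 Hq] := dq.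
have dQ : obs_density Q (fun z => (1 + t * u z) * q z)%R.
  split; [exact: measurable_funM|by move=> z; rewrite mulr_ge0|move=> A mA].
  have mG : measurable_fun setT (fun z : obs => (\1_A z)%:E : \bar R).
    by apply/measurable_EFinP; exact: measurable_indic.
  have G0 (z : obs) : 0 <= (\1_A z)%:E :> \bar R by rewrite lee_fin indicE.
  transitivity (\int[Q]_w (\1_A (observe w))%:E).
    have mOA : measurable (@observe R p @^-1` A).
      by have := @measurable_observeT R p measurableT A mA; rewrite setTI.
    change (Q (@observe R p @^-1` A) = \int[Q]_w (\1_A (observe w))%:E).
    rewrite -[LHS]mul1e -integral_cst//.
    rewrite [LHS]integral_mkcond; apply: eq_integral => w _.
    by rewrite epatch_indic/= mul1e.
  rewrite (HG _ mG G0).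
  rewrite (integral_obs_density dq (F := fun z => (\1_A z)%:E * (1 + t * u z)%:E)); last 2 first.
  - by apply: emeasurable_funM => //; exact/measurable_EFinP.
  - by move=> z; rewrite mule_ge0// lee_fin.
  rewrite obs_referenceE [RHS]integral_mkcond; apply: eq_integral => z _.
  by rewrite epatch_indic/= -!EFinM; congr (_%:E); ring.
have momP : \int[P]_w (outY1 w ^+ 2 + outY0 w ^+ 2)%:E < +oo.
  have := integrableD measurableT (square_integrable1 hs) (square_integrable0 hs).
  move=> /integrableP[_]; apply: le_lt_trans; rewrite le_eqVlt; apply/orP; left; apply/eqP.
  by apply: eq_integral => w _ /=; rewrite ger0_norm// addr_ge0 ?sqr_ge0.
have momQ : \int[Q]_w (outY1 w ^+ 2 + outY0 w ^+ 2)%:E < +oo.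
  apply: le_lt_trans HM _; rewrite lte_mul_pinfty// lee_fin divr_ge0// ltW//.
have sqQ (Y : full -> R) : measurable_fun setT Y ->
    (forall w, (Y w ^+ 2 <= outY1 w ^+ 2 + outY0 w ^+ 2)%R) ->
    Q.-integrable setT (fun w => (Y w ^+ 2)%:E).
  move=> mY Yle; apply/integrableP; split.
    by apply/measurable_EFinP; exact: measurable_funX.
  apply: le_lt_trans momQ; apply: ge0_le_integral => //.
  - by apply/measurable_EFinP; apply: measurableT_comp => //; exact: measurable_funX.
  - by apply/measurable_EFinP; apply: measurable_funD; apply: measurable_funX;
      [exact: measurable_outY1|exact: measurable_outY0].
  - by move=> w _ /=; rewrite lee_fin ger0_norm ?sqr_ge0.
exists Q; split => //.
have mD : measurable [set w : full | trtD w].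
  by apply: measurable_bool_set; exact: measurable_trtD.
have PD := treated_mass tP; have QD := treated_mass tQ.
have PD1 : P [set w : full | trtD w] <= 1 by exact: probability_le1.
have QD1 : Q [set w : full | trtD w] <= 1 by exact: probability_le1.
have fP : P [set w : full | trtD w] = (fine (P [set w : full | trtD w]))%:E.
  by rewrite fineK// fin_num_measure.
have fQ : Q [set w : full | trtD w] = (fine (Q [set w : full | trtD w]))%:E.
  by rewrite fineK// fin_num_measure.
set kP := fine (P _) in fP; set kQ := fine (Q _) in fQ.
rewrite fP lee_fin in PD; rewrite fQ lee_fin in QD.
rewrite fP lee_fin in PD1; rewrite fQ lee_fin in QD1.
have kQ0 : (0 < kQ)%R by exact: lt_le_trans QD.
have kP0 : (0 < kP)%R by exact: lt_le_trans PD.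
have [c_gt0 hX] := hc.
(* The treatment-group density also changes by the ratio of the two treatment probabilities, which
   is at least [c] because [kP >= c] and [kQ <= 1]. With [path_den >= 1/2] the new densities are
   bounded below by [c^2 / 2]. *)
exists (fun x => path_den t alpha x * zeta x)%R.
exists (fun x => kP / kQ * (path_den t alpha x * zetaT x))%R, pi, (c ^+ 2 / 2)%R.
have [mz Hz] := zetaP hs; have [mzT HzT] := zetaTP hs.
have z0 x : Xs x -> (0 <= zeta x)%R by move=> /hX /(_ true)[_ _ _ h]; rewrite ltW// (lt_trans c0).
have zT0 x : Xs x -> (0 <= zetaT x)%R by move=> /hX /(_ true)[_ _ h _]; rewrite ltW// (lt_trans c0).
split => //.
- split.
  + exact: tr_treated tQ.
  + apply: sqQ; first exact: measurable_outY1.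
    by move=> w; rewrite lerDl sqr_ge0.
  + apply: sqQ; first exact: measurable_outY0.
    by move=> w; rewrite lerDr sqr_ge0.
  + by exists (fun z => (1 + t * u z) * q z)%R.
  + split; first by apply: measurable_funM => //; exact: measurable_funTS.
    move=> A mA; have := tilted_covariate_density mden den0 HX (b := fun=> true) (k := 1%R)
      (@measurable_cst _ _ _ _ _ _) mXs mz z0 ler01 _ mA.
    rewrite (_ : [set w : full | true] `&` X @^-1` A = X @^-1` A); last first.
      by apply/seteqP; split => [w []|w].
    rewrite mul1e; apply => C mC; rewrite mul1e -Hz//; congr (P _).
    by apply/seteqP; split => [w []|w].
  + split.
      apply: measurable_funM => //; apply: measurable_funM => //; exact: measurable_funTS.
    move=> A mA.
    have md : measurable_fun setT (fun b : bool * bool => b.2) by exact: measurable_snd.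
    have := tilted_covariate_density mden den0 HX (k := kP) md mXs mzT zT0 (ltW kP0) _ mA.
    move=> ->; last by move=> C mC; rewrite -fP -HzT.
    under [in RHS]eq_integral do rewrite EFinM.
    rewrite ge0_integralZl_EFin//.
    * by rewrite fQ muleA -EFinM mulrCA mulfV ?mulr1// gt_eqF.
    * exact: measurableI.
    * by move=> x [Xx _]; rewrite lee_fin mulr_ge0// zT0.
    * apply/measurable_EFinP; apply: measurable_funM; first exact: measurable_funTS.
      exact: (measurable_funS mXs (@subIsetl _ _ _) mzT).
    * by rewrite divr_ge0// ltW.
  + exact: (cond_prob_of_transfers c0 opi mpi tQ).
  (* The model prescribes [g0] itself and not its clamped form. The two agree almost surely under
     [P], hence under [Q], whose covariate law has a density with respect to that under [P]. *)
  + move=> d; apply: (cond_exp_ae_version (measurable_obsO_set false)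
      (cond_prob_stratum_of_transfers c0 oe me tQ d) (mg d)).
    have : {ae Q, forall w, [set x | e d x = g0 d x] (X w)}.
      apply: (tilted_null_set mden HX); first exact: measurable_eq_set.
      by have := ae_g_clamp mXs hs hc; apply: filterS => w h; rewrite /= (h d).
    by apply: filterS => w + _.
- split; first by rewrite divr_gt0// exprn_gt0.
  move=> x /hX h d; have [h1 h2 h3 h4] := h d.
  have /andP[dx _] := denb x.
  have cz (z : R) : (c < z)%R -> (c / 2 < path_den t alpha x * z)%R by exact: half_mul.
  split.
  + exact: lt_le_trans (lt_trans cc half_lt) (ow_ge opi d x).
  + exact: lt_trans (lt_trans cc half_lt) h2.
  + have := cz _ h3 => h5.
    apply: (@lt_le_trans _ _ (c * (path_den t alpha x * zetaT x))%R).
      by rewrite expr2 -mulrA ltr_pM2l.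
    rewrite ler_wpM2r//; first by rewrite ltW// (le_lt_trans _ h5)// divr_ge0// ltW.
    by rewrite ler_pdivlMr// (le_trans _ PD)// ler_piMr// ltW.
  + exact: lt_trans cc (cz _ h4).
Qed.
End smooth_path.

(** * Differentiability in quadratic mean of linear tilts *)

Section linear_path.
Context (R : realType).

(** With [a = sqrt (1 + x)] one has [a - 1 - x / 2 = - (a - 1)^2 / 2] and [x = (a - 1) (a + 1)],
    where [a + 1 >= 1]. *)
Lemma sqrt_taylor (x : R) : 0 <= 1 + x -> (Num.sqrt (1 + x) - 1 - x / 2) ^+ 2 <= x ^+ 4 / 4.
Proof.
move=> x0; set a := Num.sqrt (1 + x); have a0 : 0 <= a := sqrtr_ge0 _.
have aE : a ^+ 2 = 1 + x by rewrite sqr_sqrtr.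
have xE : x = (a - 1) * (a + 1) by have := aE; rewrite expr2; nra.
have -> : (a - 1 - x / 2) ^+ 2 = (a - 1) ^+ 4 / 4 by rewrite xE; field.
rewrite ler_pM2r ?invr_gt0// xE exprMn ler_peMr//.
  by rewrite (exprM _ 2 2) sqr_ge0.
by rewrite exprn_ege1// lerDr.
Qed.

(** After factoring out [sqrt q], the integrand is [((sqrt (1 + t u) - 1 - t u / 2) / t)^2 q], at
    most [t^2 B^4 q / 4] by [sqrt_taylor]; its integral is of order [t^2]. *)
Lemma dqm_linear_path d (T : measurableType d) (mu : {measure set T -> \bar R})
    (q u : T -> R) (B : R) :
  measurable_fun setT q -> (forall z, 0 <= q z) -> measurable_fun setT u ->
  (forall z, `|u z| <= B) -> rintegrable mu q ->
  (\int[mu]_z (((Num.sqrt ((1 + t * u z) * q z) - Num.sqrt (q z)) / t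
     - u z * Num.sqrt (q z) / 2) ^+ 2)%:E)%E @[t --> 0^'+] --> 0%E.
Proof.
move=> mq q0 mu_ uB iq.
pose h t : \bar R := (t ^+ 2 * (B ^+ 4 / 4 * \int[mu]_z q z))%:E.
apply: (@squeeze_cvge _ _ _ _ (cst 0%E) _ h); last 2 first.
- exact: cvg_cst.
- apply: cvg_at_right_filter; rewrite (_ : 0%E = (0 ^+ 2 * (B ^+ 4 / 4 * \int[mu]_z q z))%:E); last first.
    by rewrite expr0n mul0r.
  apply: cvg_EFin; first by near=> t.
  apply: cvgM; last exact: cvg_cst.
  exact: exprn_continuous.
have B0 : 0 < B + 1.
  by have := uB point; have := normr_ge0 (u point); lra.
near=> t.
have t0 : 0 < t by near: t; exact: nbhs_right_gt.
have tB : t <= (B + 1)^-1 by near: t; apply: nbhs_right_le; rewrite invr_gt0.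
have mg : measurable_fun setT (fun z => ((Num.sqrt ((1 + t * u z) * q z) - Num.sqrt (q z)) / t
     - u z * Num.sqrt (q z) / 2) ^+ 2).
  have ms (f : T -> R) : measurable_fun setT f -> measurable_fun setT (fun z => Num.sqrt (f z)).
    move=> mf; apply: measurableT_comp mf; apply: continuous_measurable_fun; exact: sqrt_continuous.
  apply: measurable_funX; apply: measurable_funB.
    apply: measurable_funM => //; apply: measurable_funB; apply: ms => //.
    apply: measurable_funM => //; apply: measurable_funD => //; exact: measurable_funM.
  by apply: measurable_funM => //; apply: measurable_funM => //; exact: ms.
apply/andP; split; first by apply: integral_ge0 => z _; rewrite lee_fin sqr_ge0.
have B0' : 0 <= B by exact: le_trans (normr_ge0 _) (uB point).
have K0 : 0 <= t ^+ 2 * (B ^+ 4 / 4) by rewrite mulr_ge0 ?sqr_ge0 ?divr_ge0 ?exprn_ge0.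
rewrite /h mulrA EFinM -REintegralE// -ge0_integralZl_EFin//; last 2 first.
- by move=> z _; rewrite lee_fin.
- exact/measurable_EFinP.
apply: ge0_le_integral => //.
- by move=> z _; rewrite lee_fin sqr_ge0.
- exact/measurable_EFinP.
- by apply/measurable_EFinP; exact: measurable_funM.
move=> z _; rewrite -EFinM lee_fin.
have x0 : 0 <= 1 + t * u z.
  have : `|t * u z| <= 1.
    rewrite normrM (gtr0_norm t0); apply: (@le_trans _ _ ((B + 1)^-1 * B)).
      by rewrite ler_pM// ltW.
    by rewrite mulrC ler_pdivrMr// mul1r lerDl.
  by rewrite ler_norml => /andP[? _]; lra.
rewrite sqrtrM//; set a := Num.sqrt (1 + _); set b := Num.sqrt (q z).
have -> : (a * b - b) / t - u z * b / 2 = (a - 1 - (t * u z) / 2) / t * b.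
  by field; rewrite gt_eqF.
rewrite exprMn sqr_sqrtr// ler_wpM2r//.
apply: (@le_trans _ _ (((t * u z) ^+ 4 / 4) / t ^+ 2)).
  by rewrite expr_div_n ler_pM2r ?invr_gt0 ?exprn_gt0// sqrt_taylor.
rewrite (_ : _ / _ = t ^+ 2 * ((u z) ^+ 4 / 4)); last by field; rewrite gt_eqF.
rewrite ler_wpM2l ?sqr_ge0// ler_pM2r ?invr_gt0//.
have -> : u z ^+ 4 = `|u z| ^+ 4 by rewrite -normrX ger0_norm// (exprM _ 2 2) sqr_ge0.
by rewrite lerXn2r// nnegrE.
Unshelve. all: by end_near.
Qed.
End linear_path.

Lemma small_steps (R : realType) (U : R) : 0 <= U ->
  \forall t \near 0^'+, 0 < t /\ t * U <= 2^-1.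
Proof.
move=> U0; near=> t; split; first by near: t; exact: nbhs_right_gt.
have t1 : t <= (2 * (U + 1))^-1.
  by near: t; apply: nbhs_right_le; rewrite invr_gt0; lra.
apply: (@le_trans _ _ ((2 * (U + 1))^-1 * U)); first by rewrite ler_wpM2r.
by rewrite mulrC ler_pdivrMr; lra.
Unshelve. all: by end_near.
Qed.

Section smooth_family.
Local Open Scope ereal_scope.
Context (R : realType) (p : nat) (Xs : set (covariates R p)) (P : probability (full_data R p) R).
Local Notation full := (full_data R p).
Local Notation obs := (obs_data R p).
Local Notation cov := (covariates R p).
Local Notation X := (@covX R p).
Variables (zeta zetaT : cov -> R) (pi0 g0 : bool -> cov -> R) (c : R) (q : obs -> R).
Hypotheses (mXs : measurable Xs) (hs : censoring_setting Xs P zeta zetaT pi0 g0).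
Hypotheses (hu : unconfounded P) (hc : common_support Xs zeta zetaT pi0 g0 c).
Hypothesis dq : obs_density P q.
Variables (S M : R) (s : obs -> R) (alpha : cov -> R).
Hypotheses (ms : measurable_fun setT s) (malpha : measurable_fun setT alpha).
Hypotheses (sS : forall z, (`|s z| <= S)%R) (alphaS : forall x, (`|alpha x| <= S)%R).
Hypothesis s_centered : {ae P, forall w, forall o,
  ymean q o (fun z => (S + s (z.1, o, z.2))%:E) (X w) = (S + alpha (X w))%:E}.
Hypothesis alpha_centered : (\int[P]_w alpha (X w))%R = 0%R.
Hypothesis SM : (2 * S <= M * c)%R.

Local Notation pi := (clamp c pi0).
Local Notation e := (clamp c g0).
Local Notation u := (path_score c q M s).

(** The full-data laws are chosen separately for each admissible [t]; no regularity in [t] is needed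
    beyond that of the observed densities, which are explicit. For all other [t], in particular 0,
    the law is [P]. *)
Lemma smooth_path_exists : exists Q : R -> probability full R,
  smooth_submodel Xs g0 P Q /\
  forall t : R, (0 < t)%R -> (t * (S + M / c) <= 2^-1)%R ->
  [/\ transfers (Q t) pi e, censoring_model Xs g0 (Q t) &
   forall G : obs -> \bar R, measurable_fun setT G -> (forall z, 0 <= G z) ->
     \int[Q t]_w G (observe w) = \int[P]_w (G (observe w) * (1 + t * u (observe w))%:E)].
Proof.
have c0 : (0 < c)%R by case: hc.
have opi := overlap_clamp mXs hs hc pi0.
have uB := path_score_bounded c0 opi dq sS alphaS SM.
have mu := measurable_path_score c dq M ms.
have B0 : (0 <= S + M / c)%R := le_trans (normr_ge0 _) (uB point).
have ex := path_model_exists mXs hs hu hc dq ms malpha sS alphaS s_centered alpha_centered SM.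
pose Q (t : R) : probability full R :=
  match pselect ((0 < t)%R /\ (t * (S + M / c) <= 2^-1)%R) with
  | left h => projT1 (cid (ex t h.1 h.2))
  | right _ => P
  end.
have HQ (t : R) (t0 : (0 < t)%R) (tB : (t * (S + M / c) <= 2^-1)%R) :
  [/\ transfers (Q t) pi e, censoring_model Xs g0 (Q t),
   forall G : obs -> \bar R, measurable_fun setT G -> (forall z, 0 <= G z) ->
     \int[Q t]_w G (observe w) = \int[P]_w (G (observe w) * (1 + t * u (observe w))%:E),
   obs_density (Q t) (fun z => (1 + t * u z) * q z)%R &
   \int[Q t]_w (outY1 w ^+ 2 + outY0 w ^+ 2)%:E <=
     (8 / c)%:E * \int[P]_w (outY1 w ^+ 2 + outY0 w ^+ 2)%:E].
  rewrite /Q; case: pselect => [h|nh]; last by exfalso; apply: nh.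
  exact: (projT2 (cid (ex t h.1 h.2))).
have Q0 : Q 0%R = P by rewrite /Q; case: pselect => [h|//]; exfalso; case: h => + _; rewrite ltxx.
have near_ok := small_steps B0.
exists Q; split; last first.
  by move=> t t0 tB; have [h1 h2 h3 _ _] := HQ t t0 tB; split.
split.
- by move=> A mA; rewrite Q0.
- by move: near_ok; apply: filterS => t [t0 tB]; have [_ h _ _ _] := HQ t t0 tB.
- exists (fine ((8 / c)%:E * \int[P]_w (outY1 w ^+ 2 + outY0 w ^+ 2)%:E)).
  move: near_ok; apply: filterS => t [t0 tB]; have [_ _ _ _ h] := HQ t t0 tB.
  rewrite fineK//; apply: fin_numM => //.
  have := integrableD measurableT (square_integrable1 hs) (square_integrable0 hs).
  move=> /integrable_fin_num; apply => //.
- have [mq q0 Hq] := dq.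
  have E0 z : ((1 + 0 * u z) * q z = q z)%R by rewrite mul0r addr0 mul1r.
  exists (fun t z => ((1 + t * u z) * q z)%R), u; split => //.
  + rewrite Q0 (_ : (fun z => _) = q)//; exact/funext.
  + by move: near_ok; apply: filterS => t [t0 tB]; have [_ _ _ h _] := HQ t t0 tB.
  + have iq : rintegrable (obs_ref R p) q.
      apply/integrableP; split; first exact/measurable_EFinP.
      have := Hq _ measurableT; rewrite obs_referenceE => H.
      apply: (@le_lt_trans _ _ (\int[obs_ref R p]_z (q z)%:E)); last first.
        by rewrite -H (le_lt_trans (probability_le1 _ _))// ltry.
      by rewrite le_eqVlt; apply/orP; left; apply/eqP; apply: eq_integral => z _ /=; rewrite ger0_norm.
    have := dqm_linear_path mq q0 mu uB iq.
    under eq_fun do under eq_integral do rewrite -[in Num.sqrt (q _)]E0.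
    exact.
Qed.
End smooth_family.

(** * Identification of the treatment effect *)

(** Extends an exchange of weights from nonnegative functions to integrable ones; boundedness of
    both weights keeps every product integrable. *)
Lemma signed_reweighting d d' (T : measurableType d) (S : measurableType d') (R : realType)
    (mu : {measure set T -> \bar R}) (a b : T -> R) (phi : T -> S) (B : R) (F : S -> R) :
  measurable_fun setT a -> measurable_fun setT b -> measurable_fun setT phi ->
  (forall x, `|a x| <= B) -> (forall x, `|b x| <= B) ->
  (forall F : S -> \bar R, measurable_fun setT F -> (forall s, 0 <= F s)%E ->
    \int[mu]_x ((a x)%:E * F (phi x)) = \int[mu]_x ((b x)%:E * F (phi x)))%E ->
  measurable_fun setT F -> rintegrable mu (fun x => F (phi x)) ->
  \int[mu]_x (a x * F (phi x)) = \int[mu]_x (b x * F (phi x)).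
Proof.
move=> ma mb mphi aB bB H mF iF.
have key (G : S -> R) : measurable_fun setT G -> (forall s, 0 <= G s) ->
    \int[mu]_x (a x * G (phi x)) = \int[mu]_x (b x * G (phi x)).
  move=> mG G0; rewrite /Rintegral; congr fine.
  under eq_integral do rewrite EFinM.
  under [RHS]eq_integral do rewrite EFinM.
  by apply: (H (EFin \o G)) => [|s]; [exact/measurable_EFinP|rewrite lee_fin].
pose Fp s := Num.max (F s) 0; pose Fn s := Num.max (- F s) 0.
have FE s : F s = Fp s - Fn s.
  by rewrite /Fp /Fn; case: (leP (F s) 0) => h; case: (leP (- F s) 0) => h'; lra.
have Fp0 s : 0 <= Fp s by rewrite le_max lexx orbT.
have Fn0 s : 0 <= Fn s by rewrite le_max lexx orbT.
have mFp : measurable_fun setT Fp by exact: measurable_maxr.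
have mFn : measurable_fun setT Fn by apply: measurable_maxr => //; exact: measurableT_comp.
have iFp : rintegrable mu (fun x => Fp (phi x)).
  apply: (le_rintegrable (g := fun x => `|F (phi x)|)); last exact: integrable_norm.
    exact: measurableT_comp.
  by move=> x; rewrite ger0_norm// /Fp ge_max normr_ge0 ler_norm.
have iFn : rintegrable mu (fun x => Fn (phi x)).
  apply: (le_rintegrable (g := fun x => `|F (phi x)|)); last exact: integrable_norm.
    exact: measurableT_comp.
  by move=> x; rewrite ger0_norm// /Fn ge_max normr_ge0 -normrN ler_norm.
have E (h : T -> R) : measurable_fun setT h -> (forall x, `|h x| <= B) ->
    \int[mu]_x (h x * F (phi x)) =
    \int[mu]_x (h x * Fp (phi x)) - \int[mu]_x (h x * Fn (phi x)).
  move=> mh hB; rewrite -RintegralBE; [|exact: (rintegrableM_bounded mh hB)|exact: (rintegrableM_bounded mh hB)].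
  by apply: eq_RintegralT => x; rewrite FE mulrBr.
by rewrite (E a)// (E b)// !key.
Qed.

Section identification.
Context (R : realType) (p : nat).
Local Notation full := (full_data R p).
Local Notation obs := (obs_data R p).
Local Notation cov := (covariates R p).
Local Notation X := (@covX R p).
Variables (c : R) (pi e : bool -> cov -> R).
Hypotheses (c0 : 0 < c) (opi : overlap_weights c pi) (oe : overlap_weights c e).
Hypotheses (mpi : forall o, measurable_fun setT (pi o)).
Hypotheses (me : forall o, measurable_fun setT (e o)).

(** Weights for which the conditional mean of [ipw] times Y given X is the conditional treatment
    effect: the strata contribute (muT - nu) / e0, where nu = e1 muT + e0 muC is the mean of Y given
    X and O = 0. *)
Definition ipw (x : cov) (o : bool) : R :=
  (if o then (pi true x)^-1 else - (pi false x)^-1) / e false x.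

Let pi_gt0 o x : 0 < pi o x. Proof. exact: weight_gt0 opi. Qed.
Let e_gt0 o x : 0 < e o x. Proof. exact: weight_gt0 oe. Qed.

Let mV (h : cov -> R) : measurable_fun setT h -> measurable_fun setT (fun x => (h x)^-1).
Proof. exact: measurable_fun_inv. Qed.

Lemma measurable_ipw : measurable_fun setT (fun w : full => ipw (X w) (obsO w)).
Proof.
apply: measurable_funM; last by apply: (@measurable_fun_covX _ _ _ _ (fun x => (e false x)^-1)); exact: mV.
apply: measurable_fun_ifT; first exact: measurable_obsO.
  by apply: (@measurable_fun_covX _ _ _ _ (fun x => (pi true x)^-1)); exact: mV.
apply: measurableT_comp => //.
by apply: (@measurable_fun_covX _ _ _ _ (fun x => (pi false x)^-1)); exact: mV.
Qed.

Lemma ipw_bounded x o : `|ipw x o| <= c^-1 * c^-1.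
Proof.
have Vb (m : bool -> cov -> R) d : overlap_weights c m -> `|(m d x)^-1| <= c^-1.
  move=> om; have m0 := weight_gt0 c0 d x om.
  by rewrite gtr0_norm ?invr_gt0// lef_pV2// (ow_ge om).
by rewrite /ipw normrM ler_pM ?Vb//; case: o; rewrite ?normrN Vb.
Qed.

Definition square_moments (Q : probability full R) : Prop :=
  Q.-integrable setT (fun w => (outY1 w ^+ 2)%:E) /\
  Q.-integrable setT (fun w => (outY0 w ^+ 2)%:E).

Lemma sq_integrable_outY1 (Q : probability full R) : square_moments Q -> sq_integrable Q (@outY1 R p).
Proof. by move=> [h _]; split => //; exact: measurable_outY1. Qed.

Lemma sq_integrable_outY0 (Q : probability full R) : square_moments Q -> sq_integrable Q (@outY0 R p).
Proof. by move=> [_ h]; split => //; exact: measurable_outY0. Qed.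

Lemma outY_split (w : full) : outY w =
  (obsO w || trtD w)%:R * outY1 w + (~~ (obsO w || trtD w))%:R * outY0 w :> R.
Proof.
by rewrite /outY /tildeY; case: (obsO w); case: (trtD w); rewrite /= ?mul1r ?mul0r ?addr0 ?add0r.
Qed.

Lemma sq_integrable_outY (Q : probability full R) : square_moments Q -> sq_integrable Q (@outY R p).
Proof.
move=> h; rewrite (_ : @outY R p = fun w => (obsO w || trtD w)%:R * outY1 w +
  (~~ (obsO w || trtD w))%:R * outY0 w :> R); last by apply/funext => w; exact: outY_split.
have mb : measurable_fun setT (fun w : full => obsO w || trtD w).
  by apply: measurable_or; [exact: measurable_obsO|exact: measurable_trtD].
apply: sq_integrableD; apply: (@sq_integrableM_bounded _ _ _ _ 1).
- exact: measurable_bool_natr.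
- by move=> w; case: (_ || _); rewrite ?normr1 ?normr0.
- exact: sq_integrable_outY1.
- by apply: measurable_bool_natr; apply: measurableT_comp => //; exact: mb.
- by move=> w; case: (_ || _); rewrite ?normr1 ?normr0.
- exact: sq_integrable_outY0.
Qed.

(** Given X, the stratum O = 1 contributes Y(1) / e0 and the stratum O = 0 contributes - (e1 Y(1) +
    e0 Y(0)) / e0; since 1 - e1 = e0, the sum is Y(1) - Y(0). The argument rests on [transfers], so
    the same weights serve along the paths. *)
Lemma ate_ipw (Q : probability full R) : transfers Q pi e -> square_moments Q ->
  ate Q = \int[Q]_w (ipw (X w) (obsO w) * outY w).
Proof.
move=> tQ mQ.
have i1 := sq_integrable_rintegrable (sq_integrable_outY1 mQ).
have i0 := sq_integrable_rintegrable (sq_integrable_outY0 mQ).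
have bb (b : bool) : `|b%:R : R| <= 1 by case: b; rewrite ?normr1 ?normr0.
have b1 (m : bool -> cov -> R) d (om : overlap_weights c m) x : `|m d x| <= 1 by exact: (weight_norm_le1 c0 _ _ om).
have mb d : measurable_fun setT (fun w : full => (~~ obsO w && (trtD w == d))%:R : R).
  by apply/measurable_EFinP; exact: measurable_stratum.
have mo o : measurable_fun setT (fun w : full => (obsO w == o)%:R : R).
  by apply/measurable_EFinP; apply: measurable_eqb_fun; exact: measurable_obsO.
have mX (h : cov -> R) : measurable_fun setT h -> measurable_fun setT (fun w : full => h (X w)).
  exact: measurable_fun_covX.
have mE d : measurable_fun setT (fun x => (e d x)^-1) by exact: mV.
have mP o : measurable_fun setT (fun x => (pi o x)^-1) by exact: mV.
have Vb (m : bool -> cov -> R) d x : overlap_weights c m -> `|(m d x)^-1| <= c^-1.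
  move=> om; have m0 := weight_gt0 c0 d x om.
  by rewrite gtr0_norm ?invr_gt0// lef_pV2// (ow_ge om).
pose k o x : R := (pi o x)^-1 / e false x.
have mk o : measurable_fun setT (k o) by exact: measurable_funM.
have kb o x : `|k o x| <= c^-1 * c^-1 by rewrite normrM ler_pM// Vb.
have iK (h : cov -> R) B Y : measurable_fun setT h -> (forall x, `|h x| <= B) ->
    rintegrable Q Y -> rintegrable Q (fun w => h (X w) * Y w).
  by move=> mh hB iY; apply: (rintegrableM_bounded (B := B)) iY => //; exact: mX.
pose G1 o (z : cov * (measurableTypeR R * measurableTypeR R)) : R := k o z.1 * z.2.1.
pose G0 o (z : cov * (measurableTypeR R * measurableTypeR R)) : R := k o z.1 * z.2.2.
have mG1 o : measurable_fun setT (G1 o).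
  apply: measurable_funM; first exact: (measurableT_comp (mk o) measurable_fst).
  exact: (measurableT_comp measurable_fst measurable_snd).
have mG0 o : measurable_fun setT (G0 o).
  apply: measurable_funM; first exact: (measurableT_comp (mk o) measurable_fst).
  exact: (measurableT_comp measurable_snd measurable_snd).
have iG1 o : rintegrable Q (fun w => G1 o (covpot w)) by exact: iK.
have iG0 o : rintegrable Q (fun w => G0 o (covpot w)) by exact: iK.
have mpe d : measurable_fun setT (fun x => pi false x * e d x) by exact: measurable_funM.
have peb d x : `|pi false x * e d x| <= 1.
  by rewrite normrM -[leRHS]mulr1 ler_pM// b1.
have T1 : \int[Q]_w ((obsO w == true)%:R * G1 true (covpot w)) =
    \int[Q]_w (pi true (X w) * G1 true (covpot w)).
  apply: (@signed_reweighting _ _ _ _ _ Q _ _ (@covpot R p) 1 (G1 true)) => //.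
  - exact: mX.
  - exact: measurable_covpot.
  - by move=> w; exact: b1.
  - exact: (tr_obs tQ true).
have T2 d G : measurable_fun setT G -> rintegrable Q (fun w => G (covpot w)) ->
    \int[Q]_w ((~~ obsO w && (trtD w == d))%:R * G (covpot w)) =
    \int[Q]_w (pi false (X w) * e d (X w) * G (covpot w)).
  move=> mG iG; apply: (@signed_reweighting _ _ _ _ _ Q _ _ (@covpot R p) 1 G) => //.
  - exact: (mX (fun x => pi false x * e d x)).
  - exact: measurable_covpot.
  - exact: (tr_trt tQ d).
have iM (h : full -> R) G : measurable_fun setT h -> (forall w, `|h w| <= 1) ->
    rintegrable Q (fun w => G (covpot w)) -> rintegrable Q (fun w => h w * G (covpot w)).
  by move=> mh h1 iG; exact: (rintegrableM_bounded mh h1).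
have -> : ate Q = \int[Q]_w (outY1 w - outY0 w) by rewrite /ate unlock.
transitivity (\int[Q]_w ((obsO w == true)%:R * G1 true (covpot w)) -
  (\int[Q]_w ((~~ obsO w && (trtD w == true))%:R * G1 false (covpot w)) +
   \int[Q]_w ((~~ obsO w && (trtD w == false))%:R * G0 false (covpot w)))); last first.
  rewrite -RintegralDE; [|exact: iM|exact: iM].
  rewrite -RintegralBE; [|exact: iM|by apply: rintegrableD; exact: iM].
  apply: eq_RintegralT => w; rewrite /G1 /G0 /k /ipw outY_split/=.
  by case: (obsO w); case: (trtD w) => /=; ring.
rewrite T1 !T2//.
rewrite -RintegralDE; [|by apply: (iM (fun w => pi false (X w) * e true (X w))) => //; exact: (mX (fun x => pi false x * e true x))|
  by apply: (iM (fun w => pi false (X w) * e false (X w))) => //; exact: (mX (fun x => pi false x * e false x))].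
rewrite -RintegralBE; [|by apply: (iM (fun w => pi true (X w))) => //; [exact: mX|by move=> w; exact: b1]|
  apply: rintegrableD; [by apply: (iM (fun w => pi false (X w) * e true (X w))) => //; exact: (mX (fun x => pi false x * e true x))|
  by apply: (iM (fun w => pi false (X w) * e false (X w))) => //; exact: (mX (fun x => pi false x * e false x))]].
apply: eq_RintegralT => w; rewrite /G1 /G0 /k /=; set x := X w.
have E1 : e true x = 1 - e false x by have := ow_sum oe x; lra.
rewrite E1 /covX/= -/(covX w) -/x; field.
by rewrite !gt_eqF.
Qed.

Lemma ate_tilted (P Q : probability full R) (t B : R) (u : obs -> R) :
  transfers P pi e -> square_moments P -> transfers Q pi e -> square_moments Q ->
  measurable_fun setT u -> (forall z, `|u z| <= B) -> (forall z, 0 <= 1 + t * u z) ->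
  (forall G : obs -> \bar R, measurable_fun setT G -> (forall z, 0 <= G z)%E ->
     \int[Q]_w G (observe w) = \int[P]_w (G (observe w) * (1 + t * u (observe w))%:E))%E ->
  ate Q = ate P + t * \int[P]_w (ipw (X w) (obsO w) * outY w * u (observe w)).
Proof.
move=> tP mP tQ mQ mu uB u0 HQ.
have iY := sq_integrable_rintegrable (sq_integrable_outY mP).
have iW : rintegrable P (fun w => ipw (X w) (obsO w) * outY w).
  apply: (rintegrableM_bounded measurable_ipw _ iY) => w; exact: ipw_bounded.
have muo : measurable_fun setT (fun w : full => u (observe w)).
  by apply: (measurableT_comp mu); exact: measurable_observeT.
have iWu : rintegrable P (fun w => ipw (X w) (obsO w) * outY w * u (observe w)).
  under eq_fun do rewrite mulrC.
  exact: (rintegrableM_bounded muo (fun w => uB _) iW).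
rewrite (ate_ipw tQ mQ) (ate_ipw tP mP).
pose F (z : obs) : R := ipw z.1.1 z.1.2 * z.2.
have mF : measurable_fun setT F.
  apply: measurable_funM; last exact: measurable_snd.
  have m11 : measurable_fun setT (fun z : obs => z.1.1).
    exact: (measurableT_comp measurable_fst measurable_fst).
  apply: measurable_funM; last exact: (measurableT_comp (mV (me false)) m11).
  apply: measurable_fun_ifT; first exact: (measurableT_comp measurable_snd measurable_fst).
    exact: (measurableT_comp (mV (mpi true)) m11).
  apply: measurableT_comp => //; exact: (measurableT_comp (mV (mpi false)) m11).
have E (w : full) : F (observe w) * (1 + t * u (observe w)) =
    ipw (X w) (obsO w) * outY w + t * (ipw (X w) (obsO w) * outY w * u (observe w)).
  by rewrite /F/=; ring.
have [|_ ->] := @signed_transport _ _ _ full full obs R Q P (@observe R p) (@observe R p)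
  (fun w => 1 + t * u (observe w)) (@measurable_observeT R p) (fun w => u0 _) HQ F mF.
  by under eq_fun do rewrite E; apply: rintegrableD => //; exact: rintegrableZ.
rewrite (eq_RintegralT _ E).
by rewrite RintegralDE ?RintegralZE//; exact: rintegrableZ.
Qed.
End identification.

(** * Chi-square divergence between two tilts of the same law *)

Section chi_square.
Context d (T : measurableType d) (R : realType) (P Qa Qb : probability T R).
Variables (ga gb h : T -> R) (k : R).
Hypotheses (mga : measurable_fun setT ga) (mgb : measurable_fun setT gb).
Hypothesis mh : measurable_fun setT h.
Hypotheses (ga_bnd : forall x, 2^-1 <= ga x <= 3 / 2) (gb_bnd : forall x, 2^-1 <= gb x <= 3 / 2).
Hypotheses (gE : forall x, ga x = gb x + h x) (gbk : forall x, 1 <= (1 + k) * gb x).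
Hypotheses (HQa : forall A, measurable A -> Qa A = (\int[P]_(x in A) (ga x)%:E)%E).
Hypotheses (HQb : forall A, measurable A -> Qb A = (\int[P]_(x in A) (gb x)%:E)%E).

Let ga0 x : 0 < ga x. Proof. by have /andP[? _] := ga_bnd x; lra. Qed.
Let gb0 x : 0 < gb x. Proof. by have /andP[? _] := gb_bnd x; lra. Qed.

Lemma measurable_density_ratio : measurable_fun setT (fun x => ga x / gb x).
Proof. by apply: measurable_funM => //; exact: measurable_fun_inv. Qed.

Lemma density_ratio_bounds x : 0 <= ga x / gb x <= 3.
Proof.
rewrite divr_ge0 ?(ltW (ga0 x)) ?(ltW (gb0 x))//= ler_pdivrMr//.
by have /andP[? ?] := ga_bnd x; have /andP[? ?] := gb_bnd x; lra.
Qed.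

Let toP (F : T -> \bar R) : measurable_fun setT F -> (forall x, 0 <= F x)%E ->
  (\int[Qb]_x F x = \int[P]_x (F x * (gb x)%:E))%E.
Proof.
move=> mF F0.
have mg : measurable_fun setT (fun x => (gb x)%:E) by exact/measurable_EFinP.
have g0 x : (0 <= (gb x)%:E)%E by rewrite lee_fin ltW.
exact: (ge0_integral_density mg g0 HQb mF F0).
Qed.

Lemma density_ratioE A : measurable A -> Qa A = (\int[Qb]_(x in A) (ga x / gb x)%:E)%E.
Proof.
move=> mA; rewrite HQa// [LHS]integral_mkcond [RHS]integral_mkcond.
under [RHS]eq_integral do rewrite epatch_indic.
rewrite toP; last 2 first.
- apply: emeasurable_funM; apply/measurable_EFinP; last exact: measurable_indic.
  exact: measurable_density_ratio.
- move=> x; rewrite mule_ge0// lee_fin ?indicE//; have /andP[//] := density_ratio_bounds x.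
apply: eq_integral => x _; rewrite epatch_indic -!EFinM; congr (_%:E).
by field; rewrite gt_eqF.
Qed.

(** With [ga = gb + h], one has [(ga / gb)^2 gb = 2 ga - gb + h^2 / gb]. The first two terms
    integrate to 1, and [1 / gb <= 1 + k]. *)
Lemma chi_square_bound : \int[Qb]_x ((ga x / gb x) ^+ 2) <= 1 + (1 + k) * \int[P]_x (h x ^+ 2).
Proof.
have bd (g : T -> R) : (forall x, 2^-1 <= g x <= 3 / 2) -> forall x, `|g x| <= 3 / 2.
  by move=> gb' x; have /andP[? ?] := gb' x; rewrite ler_norml; apply/andP; split; lra.
have iga := rintegrable_bounded P mga (bd _ ga_bnd).
have igb := rintegrable_bounded P mgb (bd _ gb_bnd).
have hE x : h x = ga x - gb x by rewrite gE; ring.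
have hb x : `|h x| <= 1.
  rewrite hE; have /andP[? ?] := ga_bnd x; have /andP[? ?] := gb_bnd x.
  by rewrite ler_norml; apply/andP; split; lra.
have ih : rintegrable P (fun x => h x ^+ 2).
  apply: (rintegrable_bounded _ (B := 1)); first exact: measurable_funX.
  by move=> x; rewrite normrX -[leRHS](expr1n _ 2) lerXn2r// nnegrE.
have tot (Q : probability T R) (g : T -> R) :
    (forall A, measurable A -> Q A = (\int[P]_(x in A) (g x)%:E)%E) ->
    rintegrable P g -> \int[P]_x g x = 1.
  move=> HQ ig; rewrite /Rintegral -HQ//.
  have -> : Q setT = 1%E by exact: probability_setT.
  by [].
have Ea := tot _ _ HQa iga; have Eb := tot _ _ HQb igb.
have mr := measurable_density_ratio.
have r2b x : `|(ga x / gb x) ^+ 2 * gb x| <= 9 * (3 / 2).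
  have /andP[r0 r3] := density_ratio_bounds x; have /andP[? ?] := gb_bnd x.
  rewrite normrM (ger0_norm (sqr_ge0 _)) (gtr0_norm (gb0 x)) ler_pM ?sqr_ge0 ?(ltW (gb0 x))//.
  by rewrite (_ : 9 = 3 ^+ 2) ?lerXn2r ?nnegrE//; ring.
have ir2 : rintegrable P (fun x => (ga x / gb x) ^+ 2 * gb x).
  apply: (rintegrable_bounded _ _ r2b); apply: measurable_funM => //; exact: measurable_funX.
have -> : \int[Qb]_x ((ga x / gb x) ^+ 2) = \int[P]_x ((ga x / gb x) ^+ 2 * gb x).
  rewrite /Rintegral toP; first by congr fine; apply: eq_integral => x _; rewrite -EFinM.
    by apply/measurable_EFinP; exact: measurable_funX.
  by move=> x; rewrite lee_fin sqr_ge0.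
have i2 := rintegrableZ 2 iga; have i3 := rintegrableB i2 igb.
have i4 := rintegrableZ (1 + k) ih.
have -> : 1 + (1 + k) * \int[P]_x (h x ^+ 2) =
    \int[P]_x (2 * ga x - gb x + (1 + k) * h x ^+ 2).
  by rewrite RintegralDE// RintegralBE// !RintegralZE// Ea Eb; ring.
apply: Rintegral_le => //; first exact: rintegrableD.
move=> x; have g0 := gb0 x.
have -> : (ga x / gb x) ^+ 2 * gb x = 2 * ga x - gb x + h x ^+ 2 / gb x.
  by rewrite gE; field; rewrite gt_eqF.
rewrite lerD2l ler_pdivrMr// mulrAC -[leLHS]mul1r ler_wpM2r ?sqr_ge0//.
Qed.
End chi_square.

Section steps.
Context (R : realType).
Implicit Types t u U k : R.

Lemma tilt_bounds t u U : 0 <= t -> t * U <= 2^-1 -> `|u| <= U -> 2^-1 <= 1 + t * u <= 3 / 2.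
Proof.
move=> t0 tU uU; have : `|t * u| <= 2^-1.
  by rewrite normrM (ger0_norm t0) (le_trans _ tU)// ler_wpM2l.
by rewrite ler_norml => /andP[? ?]; apply/andP; split; lra.
Qed.

(** Supplies the factor [1 + k] of [chi_square_bound]: [1 + t u] is at least [1 - t U], and the
    hypothesis says that [(1 - t U) (1 + k) >= 1]. *)
Lemma inverse_tilt_bound t u U k : 0 <= k -> 0 <= t -> t * U * (1 + k) <= k -> `|u| <= U ->
  1 <= (1 + k) * (1 + t * u).
Proof.
move=> k0 t0 tk uU; have : `|t * u| <= t * U by rewrite normrM (ger0_norm t0) ler_wpM2l.
rewrite ler_norml => /andP[h1 _].
have : (1 + k) * (- (t * U)) <= (1 + k) * (t * u) by rewrite ler_wpM2l//; lra.
by lra.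
Qed.

Lemma root_steps U k : 0 <= U -> 0 < k -> \forall n \near \oo,
  [/\ (0 < n)%N, 0 < (Num.sqrt n%:R)^-1 :> R, (Num.sqrt n%:R)^-1 * U <= 2^-1 &
   (Num.sqrt n%:R)^-1 * U * (1 + k) <= k].
Proof.
(* For [n >= K] the root of [n] exceeds [2 U] and [U (1 + k) / k], which are the last two
   conditions. *)
move=> U0 k0; pose K := Num.max (2 * U) (U * (1 + k) / k) ^+ 2.
have K1 : 0 <= Num.max (2 * U) (U * (1 + k) / k) by rewrite le_max mulr_ge0.
near=> n.
have n0 : (0 < n)%N by near: n; exact: nbhs_infty_gt.
have nK : K <= n%:R by near: n; exact: nbhs_infty_ger.
have sn : Num.max (2 * U) (U * (1 + k) / k) <= Num.sqrt n%:R.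
  by rewrite -(ger0_norm K1) -sqrtr_sqr ler_wsqrtr.
have s0 : 0 < Num.sqrt n%:R :> R by rewrite sqrtr_gt0 ltr0n.
move: sn; rewrite ge_max => /andP[h1 h2]; split => //.
- by rewrite invr_gt0.
- by rewrite mulrC ler_pdivrMr//; lra.
- rewrite -mulrA mulrC ler_pdivrMr//.
  by move: h2; rewrite ler_pdivrMr// (mulrC k).
Unshelve. all: by end_near.
Qed.
End steps.

(** * The variance bound for a bounded score *)

Section regular_lower_bound.
Context (R : realType) (p : nat) (Xs : set (covariates R p)) (P : probability (full_data R p) R).
Local Notation full := (full_data R p).
Local Notation obs := (obs_data R p).
Local Notation cov := (covariates R p).
Local Notation X := (@covX R p).
Variables (zeta zetaT : cov -> R) (pi0 g0 : bool -> cov -> R) (c : R) (q : obs -> R).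
Hypotheses (mXs : measurable Xs) (hs : censoring_setting Xs P zeta zetaT pi0 g0).
Hypotheses (hu : unconfounded P) (hc : common_support Xs zeta zetaT pi0 g0 c).
Hypothesis dq : obs_density P q.
Variables (S : R) (s : obs -> R) (alpha : cov -> R).
Hypotheses (ms : measurable_fun setT s) (malpha : measurable_fun setT alpha).
Hypotheses (sS : forall z, `|s z| <= S) (alphaS : forall x, `|alpha x| <= S).
Hypothesis s_centered : {ae P, forall w, forall o,
  ymean q o (fun z => (S + s (z.1, o, z.2))%:E) (X w) = (S + alpha (X w))%:E}.
Hypothesis alpha_centered : \int[P]_w alpha (X w) = 0.
Variables (T : forall n : nat, n.-tuple obs -> R) (L : probability (measurableTypeR R) R).
Hypothesis hT : regular_estimator Xs g0 P T L.

Local Notation pi := (clamp c pi0).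
Local Notation e := (clamp c g0).
Local Notation M := (2 * S / c).
Local Notation lam := (@lebesgue_measure R).

Let c0 : 0 < c. Proof. by case: hc. Qed.
Let opi : overlap_weights c pi := overlap_clamp mXs hs hc pi0.
Let oe : overlap_weights c e := overlap_clamp mXs hs hc g0.
Let mpi o : measurable_fun setT (pi o).
Proof. by apply: measurable_clamp; case: (Defs.piP hs true). Qed.
Let me o : measurable_fun setT (e o).
Proof. by apply: measurable_clamp; case: (gP hs true). Qed.
Let tP : transfers P pi e := transfers_clamp mXs hs hu hc.
Let S0 : 0 <= S. Proof. exact: le_trans (normr_ge0 _) (sS point). Qed.
Let SM : 2 * S <= M * c. Proof. by rewrite mulfVK// gt_eqF. Qed.

(** [S + k s] is the combination [(1 - k) S + k (S + s)] of two nonnegative functions whose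
    conditional means are known. *)
Let scaled_centered (k : R) : 0 <= k <= 1 -> {ae P, forall w, forall o,
  ymean q o (fun z => (S + k * s (z.1, o, z.2))%:E) (X w) = (S + k * alpha (X w))%:E}.
Proof.
move=> /andP[k0 k1]; have := ae_ymean1 c0 opi mpi tP dq; move: s_centered.
apply: filterS2 => w hs1 h1 o; set x := X w in hs1 h1 *.
have mf : measurable_fun setT (fun y : measurableTypeR R => ydens q (x, o, y)).
  apply: (measurableT_comp (measurable_ydens dq)).
  by apply: measurable_fun_mk_pair => //; exact: measurable_cst.
have msx : measurable_fun setT (fun y : measurableTypeR R => s (x, o, y)).
  by apply: (measurableT_comp ms); apply: measurable_fun_mk_pair => //; exact: measurable_cst.
have f0 y : 0 <= ydens q (x, o, y) by exact: (ydens_ge0 dq).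
have s0 y : 0 <= S + s (x, o, y) by have := sS (x, o, y); rewrite ler_norml => /andP[? ?]; lra.
have a0 : 0 <= (1 - k) * S by rewrite mulr_ge0// subr_ge0.
have m2 : measurable_fun setT (fun y : measurableTypeR R => (S + s (x, o, y)) * ydens q (x, o, y)).
  by apply: measurable_funM => //; exact: measurable_funD.
have E : (\int[lam]_y ((1 - k) * S * ydens q (x, o, y) +
    k * ((S + s (x, o, y)) * ydens q (x, o, y)))%:E =
    ((1 - k) * S)%:E * 1 + k%:E * (S + alpha x)%:E)%E.
  rewrite -(h1 o) -(hs1 o) /ymean.
  under eq_integral do rewrite EFinD.
  rewrite ge0_integralD; last 5 first.
  - exact: measurableT.
  - by move=> y _; rewrite lee_fin mulr_ge0.
  - by apply/measurable_EFinP; exact: measurable_funM.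
  - by move=> y _; rewrite lee_fin; apply: mulr_ge0 => //; apply: mulr_ge0; [exact: s0|exact: f0].
  - by apply/measurable_EFinP; exact: measurable_funM.
  congr (_ + _)%E.
  - under eq_integral do rewrite EFinM.
    rewrite ge0_integralZl_EFin//; [|by move=> y _; rewrite lee_fin|exact/measurable_EFinP].
    by congr (_ * _)%E; apply: eq_integral => y _; rewrite mul1e.
  - under eq_integral do rewrite EFinM.
    rewrite ge0_integralZl_EFin//; last exact/measurable_EFinP.
    by move=> y _; rewrite lee_fin; apply: mulr_ge0; [exact: s0|exact: f0].
move: E; rewrite mule1 -EFinM -EFinD (_ : (1 - k) * S + k * (S + alpha x) = S + k * alpha x); last by ring.
move=> <-; rewrite /ymean; apply: eq_integral => y _.
by rewrite -EFinM; congr (_%:E); rewrite /=; ring.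
Qed.

(** [S] and [M] do not depend on [k], so all these paths share their drift: the scores for [k] and
    for 0 differ by exactly [k s]. *)
Let path (k : R) : 0 <= k <= 1 -> exists Q : R -> probability full R,
  smooth_submodel Xs g0 P Q /\
  forall t : R, 0 < t -> t * (S + M / c) <= 2^-1 ->
  [/\ transfers (Q t) pi e, censoring_model Xs g0 (Q t) &
   forall G : obs -> \bar R, measurable_fun setT G -> (forall z, 0 <= G z)%E ->
     \int[Q t]_w G (observe w) =
     \int[P]_w (G (observe w) * (1 + t * path_score c q M (fun z => k * s z) (observe w))%:E)]%E.
Proof.
move=> k01; have /andP[k0 k1] := k01.
have nk (r : R) : `|r| <= S -> `|k * r| <= S.
  by move=> rS; rewrite normrM (ger0_norm k0) (le_trans _ rS)// ler_piMl.
apply: (smooth_path_exists mXs hs hu hc dq (alpha := fun x => k * alpha x)) => //.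
- exact: measurable_funM.
- exact: measurable_funM.
- by move=> z; exact: nk.
- by move=> x; exact: nk.
- exact: scaled_centered.
- rewrite RintegralZE ?alpha_centered ?mulr0//.
  by apply: (rintegrable_bounded _ (B := S)) => //; exact: measurable_fun_covX.
Qed.

(** Regularity turns the Chapman-Robbins inequality between the sample laws along the paths of scale
    [k] and 0 into an inequality for [L]. At finite [n] the second moment of the likelihood ratio is
    at most [(1 + (1 + k) k^2 J / n)^n], and the exponential bounds this uniformly in [n]. *)
Lemma regular_shift_bound (k : R) (f : R -> R) : 0 < k <= 1 -> continuous f ->
  (exists B, forall x, `|f x| <= B) ->
  let a := \int[P]_w (ipw pi e (X w) (obsO w) * outY w * s (observe w)) in
  let J := \int[P]_w (s (observe w) ^+ 2) in
  is_true ((\int[L]_x f (x + k * a) - \int[L]_x f x) ^+ 2 <=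
  (\int[L]_x (f x ^+ 2)) * (expR (k ^+ 2 * J * (1 + k)) - 1)).
Proof.
move=> /andP[k0 k1] cf [B fB] a J.
have k01 : 0 <= k <= 1 by rewrite (ltW k0).
have z01 : 0 <= (0 : R) <= 1 by apply/andP; split; [exact: lexx|exact: ler01].
have [Qa [sa Ha]] := path k01; have [Qb [sb Hb]] := path z01.
have [mT HT] := hT.
pose ua := path_score c q M (fun z => k * s z).
pose ub := path_score c q M (fun z => 0 * s z).
pose U := S + M / c.
have nk (r v : R) : 0 <= r <= 1 -> `|v| <= S -> `|r * v| <= S.
  by move=> /andP[r0 r1] rS; rewrite normrM (ger0_norm r0) (le_trans _ rS)// ler_piMl.
have mks r : measurable_fun setT (fun z => r * s z) by exact: measurable_funM.
have mua : measurable_fun setT ua by exact: (measurable_path_score c dq M (mks k)).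
have mub : measurable_fun setT ub by exact: (measurable_path_score c dq M (mks 0)).
have uaU z : `|ua z| <= U.
  by apply: (path_score_bounded c0 opi dq _ alphaS SM) => z'; exact: nk.
have ubU z : `|ub z| <= U.
  by apply: (path_score_bounded c0 opi dq _ alphaS SM) => z'; exact: nk.
have uE z : ua z = ub z + k * s z by rewrite /ua /ub /path_score; ring.
have U0 : 0 <= U := le_trans (normr_ge0 _) (uaU point).
pose tn n : R := (Num.sqrt n%:R)^-1.
have tn_ok := root_steps U0 k0.
(* The added [k a] makes [Fa] the same function of the sample as [Fb], by [dA] below, so that their
   integrals differ only in the law of the sample; in the limit it becomes the shift of the argument
   of [f]. *)
pose Fa n (z : n.-tuple obs) : R := f (Num.sqrt n%:R * (T z - ate (Qa (tn n))) + k * a).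
pose Fb n (z : n.-tuple obs) : R := f (Num.sqrt n%:R * (T z - ate (Qb (tn n)))).
have cfa : continuous (fun x => f (x + k * a)).
  move=> x; apply: (@continuous_comp _ _ _ (fun x => x + k * a) f); last exact: cf.
  by apply: cvgD; [exact: cvg_id|exact: cvg_cst].
have cf2 : continuous (fun x => f x ^+ 2).
  by move=> x; apply: (@continuous_comp _ _ _ f (fun y => y ^+ 2)); [exact: cf|exact: exprn_continuous].
have lim (Q : R -> probability full R) (g : R -> R) : smooth_submodel Xs g0 P Q ->
    continuous g -> (exists B, forall x, `|g x| <= B) ->
    \int[iid (obs_law (Q (tn n))) n]_z g (Num.sqrt n%:R * (T z - ate (Q (tn n))))
      @[n --> \oo] --> \int[L]_x g x.
  move=> sQ cg [B' gB'].
  have ig : rintegrable L g.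
    apply: (rintegrable_bounded _ (B := B')) => //; exact: continuous_measurable_fun.
  apply: fine_cvg; rewrite -REintegralE//.
  apply: HT => //; by exists B'.
have [B' fB'] : exists B' : R, forall x, `|f x ^+ 2| <= B'.
  exists (B ^+ 2) => x; rewrite normrX lerXn2r// nnegrE//.
  exact: le_trans (normr_ge0 _) (fB x).
have La := lim Qa (fun x => f (x + k * a)) sa cfa (ex_intro _ B (fun x => fB _)).
have Lb := lim Qb f sb cf (ex_intro _ B fB).
have Lb2 := lim Qb (fun x => f x ^+ 2) sb cf2 (ex_intro _ B' fB').
have C1 : (\int[iid (obs_law (Qa (tn n))) n]_z Fa n z -
    \int[iid (obs_law (Qb (tn n))) n]_z Fb n z) ^+ 2 @[n --> \oo] -->
    (\int[L]_x f (x + k * a) - \int[L]_x f x) ^+ 2.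
  by under eq_fun do rewrite expr2; rewrite expr2; apply: cvgM; exact: (cvgB La Lb).
have C2 : (\int[iid (obs_law (Qb (tn n))) n]_z (Fb n z ^+ 2)) *
    (expR (k ^+ 2 * J * (1 + k)) - 1) @[n --> \oo] -->
    (\int[L]_x (f x ^+ 2)) * (expR (k ^+ 2 * J * (1 + k)) - 1).
  by apply: cvgM; [exact: Lb2|exact: cvg_cst].
(* Both sides converge, so the inequality is needed for large [n] only. *)
apply: (ler_cvg_to C1 C2).
move: tn_ok; apply: filterS => n [n0 t0 tU tk]; set t := tn n in t0 tU tk *.
have [tQa mQa HQa] := Ha t t0 tU; have [tQb mQb HQb] := Hb t t0 tU.
have bnd (u : obs -> R) : (forall z, `|u z| <= U) -> forall z, 2^-1 <= 1 + t * u z <= 3 / 2.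
  by move=> uU z; exact: tilt_bounds (ltW t0) tU (uU z).
have m1 (u : obs -> R) : measurable_fun setT u -> measurable_fun setT (fun z => 1 + t * u z).
  by move=> mu; apply: measurable_funD => //; exact: measurable_funM.
have dens (Q : probability full R) (u : obs -> R) : measurable_fun setT u ->
    (forall z, `|u z| <= U) ->
    (forall G : obs -> \bar R, measurable_fun setT G -> (forall z, 0 <= G z)%E ->
      \int[Q]_w G (observe w) = \int[P]_w (G (observe w) * (1 + t * u (observe w))%:E))%E ->
    forall A, measurable A -> (obs_law Q A = \int[obs_law P]_(z in A) (1 + t * u z)%:E)%E.
  move=> mu uU HQ A mA.
  have mG : measurable_fun setT (fun z : obs => (\1_A z)%:E : \bar R).
    by apply/measurable_EFinP; exact: measurable_indic.
  have G0 (z : obs) : (0 <= (\1_A z)%:E :> \bar R)%E by rewrite lee_fin indicE.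
  have mOA : measurable (@observe R p @^-1` A).
    by have := @measurable_observeT R p measurableT A mA; rewrite setTI.
  transitivity (\int[Q]_w (\1_A (observe w))%:E)%E.
    change (Q (@observe R p @^-1` A) = \int[Q]_w (\1_A (observe w))%:E)%E.
    rewrite -[LHS]mul1e -integral_cst//.
    rewrite [LHS]integral_mkcond; apply: eq_integral => w _.
    by rewrite epatch_indic/= mul1e.
  have mGu : measurable_fun setT (fun z : obs => (\1_A z)%:E * (1 + t * u z)%:E)%E.
    by apply: emeasurable_funM => //; apply/measurable_EFinP; exact: m1.
  have Gu0 z : (0 <= (\1_A z)%:E * (1 + t * u z)%:E)%E.
    by rewrite mule_ge0// lee_fin; have /andP[h _] := bnd u uU z; apply: le_trans h.
  rewrite (HQ _ mG G0) [RHS]integral_mkcond.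
  rewrite -(@ge0_integral_distribution _ _ _ _ _ P (@observe R p) _ mGu Gu0).
  by apply: eq_integral => z _; rewrite epatch_indic muleC.
have tkm z : 1 <= (1 + k) * (1 + t * ub z) by exact: inverse_tilt_bound (ltW k0) (ltW t0) tk (ubU z).
have gE z : 1 + t * ua z = 1 + t * ub z + t * (k * s z) by rewrite uE; ring.
have Da := dens _ _ mua uaU HQa; have Db := dens _ _ mub ubU HQb.
have mts : measurable_fun setT (fun z => t * (k * s z)) by exact: measurable_funM.
have CR := chapman_robbins (n := n) (measurable_density_ratio (m1 _ mua) (m1 _ mub))
  (density_ratio_bounds (bnd _ uaU) (bnd _ ubU))
  (density_ratioE (m1 _ mua) (m1 _ mub) (bnd _ uaU) (bnd _ ubU) Da Db).
have mFb : measurable_fun setT (Fb n).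
  apply: measurableT_comp; first exact: continuous_measurable_fun.
  have mTn := measurable_funB (mT n) (@measurable_cst _ _ _ _ setT (ate (Qb (tn n)))).
  exact: (measurable_funM (@measurable_cst _ _ _ _ setT (Num.sqrt n%:R : R)) mTn).
have {}CR := CR (Fb n) B mFb (fun z => fB _).
have chi := chi_square_bound (m1 _ mua) (m1 _ mub) mts (bnd _ uaU) (bnd _ ubU) gE tkm Da Db.
have sqm (Q : probability full R) : censoring_model Xs g0 Q -> square_moments Q.
  move=> [z1 [z2 [z3 [z4 [hQ _ _]]]]]; split; [exact: square_integrable1 hQ|exact: square_integrable0 hQ].
have mP : square_moments P by split; [exact: square_integrable1 hs|exact: square_integrable0 hs].
have pos (u : obs -> R) : (forall z, `|u z| <= U) -> forall z, 0 <= 1 + t * u z.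
  by move=> uU z; have /andP[h _] := bnd u uU z; apply: le_trans h.
have Aa := ate_tilted c0 opi oe mpi me tP mP tQa (sqm _ mQa) mua uaU (pos _ uaU) HQa.
have Ab := ate_tilted c0 opi oe mpi me tP mP tQb (sqm _ mQb) mub ubU (pos _ ubU) HQb.
have iW : rintegrable P (fun w => ipw pi e (X w) (obsO w) * outY w).
  have iY := sq_integrable_rintegrable (sq_integrable_outY mP).
  by apply: (rintegrableM_bounded (measurable_ipw mpi me) _ iY) => w; exact: (ipw_bounded c0 opi oe).
have iWu (u : obs -> R) K : measurable_fun setT u -> (forall z, `|u z| <= K) ->
    rintegrable P (fun w => ipw pi e (X w) (obsO w) * outY w * u (observe w)).
  move=> mu uK; under eq_fun do rewrite mulrC.
  apply: (rintegrableM_bounded (B := K)) iW => //.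
  by apply: (measurableT_comp mu); exact: measurable_observeT.
have sq0 : 0 < Num.sqrt n%:R :> R by rewrite sqrtr_gt0 ltr0n.
have dA : Num.sqrt n%:R * (ate (Qa t) - ate (Qb t)) = k * a.
  rewrite Aa Ab.
  have -> : \int[P]_w (ipw pi e (X w) (obsO w) * outY w * ua (observe w)) =
      \int[P]_w (ipw pi e (X w) (obsO w) * outY w * ub (observe w)) + k * a.
    rewrite /a -RintegralZE; last exact: (iWu _ S).
    rewrite -RintegralDE; [|exact: (iWu _ U)|by apply: rintegrableZ; exact: (iWu _ S)].
    by apply: eq_RintegralT => w; rewrite uE; ring.
  by rewrite /t /tn; field; rewrite gt_eqF.
have -> : \int[iid (obs_law (Qa t)) n]_z Fa n z = \int[iid (obs_law (Qa t)) n]_z Fb n z.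
  by apply: eq_RintegralT => z; rewrite /Fa /Fb -/t -dA; congr f; ring.
apply: le_trans CR _; rewrite ler_wpM2l//.
  by apply: Rintegral_ge0 => z _; exact: sqr_ge0.
rewrite lerD2r.
have E1 : \int[obs_law P]_z ((t * (k * s z)) ^+ 2) = t ^+ 2 * (k ^+ 2 * J).
  have ms2 : measurable_fun setT (fun z => (t * (k * s z)) ^+ 2) by exact: measurable_funX.
  have -> : \int[obs_law P]_z ((t * (k * s z)) ^+ 2) = \int[P]_w ((t * (k * s (observe w))) ^+ 2).
    rewrite /Rintegral; congr fine.
    have m2 : measurable_fun setT (fun z => ((t * (k * s z)) ^+ 2)%:E) by exact/measurable_EFinP.
    have p2 z : (0 <= ((t * (k * s z)) ^+ 2)%:E)%E by rewrite lee_fin sqr_ge0.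
    by rewrite (@ge0_integral_distribution _ _ _ _ _ P (@observe R p) _ m2 p2).
  rewrite /J -!RintegralZE.
  - by apply: eq_RintegralT => w; ring.
  - apply: rintegrableZ.
    apply: (@sq_integrable_bounded _ _ _ P S (fun w => s (observe w)) _ _).2 => //.
    by apply: (measurableT_comp ms); exact: measurable_observeT.
  - apply: (@sq_integrable_bounded _ _ _ P S (fun w => s (observe w)) _ _).2 => //.
    by apply: (measurableT_comp ms); exact: measurable_observeT.
rewrite E1 in chi.
have t2 : t ^+ 2 = n%:R^-1 by rewrite /t /tn exprVn sqr_sqrtr.
have J0 : 0 <= J by apply: Rintegral_ge0 => w _; exact: sqr_ge0.
set I2 := \int[_]_x _ in chi *.
have I20 : 0 <= I2 by apply: Rintegral_ge0 => z _; exact: sqr_ge0.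
(* Since [t^2 = 1 / n], the inequality [1 + x <= expR x] gives a bound whose [n]-th power no longer
   depends on [n]. *)
have le1 : I2 <= expR (k ^+ 2 * J * (1 + k) / n%:R).
  apply: le_trans chi _; apply: le_trans (expR_ge1Dx _).
  by rewrite t2 lerD2l le_eqVlt; apply/orP; left; apply/eqP; ring.
rewrite -[X in expR X](@divfK _ n%:R) ?pnatr_eq0 -?lt0n// expRM_natr.
by rewrite lerXn2r// nnegrE expR_ge0.
Qed.

Lemma regular_variance_bound :
  ('V_L[idfun] < +oo)%E ->
  (\int[P]_w (ipw pi e (X w) (obsO w) * outY w * s (observe w))) ^+ 2 <=
  fine 'V_L[idfun] * \int[P]_w (s (observe w) ^+ 2).
Proof.
apply: variance_lower_bound; first by apply: Rintegral_ge0 => w _; exact: sqr_ge0.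
by move=> k k01 f cf fB; exact: regular_shift_bound.
Qed.
End regular_lower_bound.

(** * The efficient influence function *)

Section strata.
Context (R : realType) (p : nat) (P : probability (full_data R p) R).
Local Notation full := (full_data R p).
Local Notation cov := (covariates R p).
Local Notation X := (@covX R p).
Variables (c : R) (pi e : bool -> cov -> R).
Hypotheses (c0 : 0 < c) (opi : overlap_weights c pi).
Hypotheses (mpi : forall o, measurable_fun setT (pi o)) (tP : transfers P pi e).
Implicit Type a : bool -> cov -> R.

Lemma measurable_strata a : (forall o, measurable_fun setT (a o)) ->
  measurable_fun setT (fun w : full => a (obsO w) (X w)).
Proof.
move=> ma; rewrite (_ : (fun w => _) =
    fun w => if obsO w then a true (X w) else a false (X w)); last first.
  by apply/funext => w; case: (obsO w).
apply: measurable_fun_ifT; first exact: measurable_obsO.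
  exact: (measurable_fun_covX (ma true)).
exact: (measurable_fun_covX (ma false)).
Qed.

Lemma rintegrable_strata a : (forall o, rintegrable P (fun w => a o (X w))) ->
  (forall o, measurable_fun setT (a o)) ->
  rintegrable P (fun w => a (obsO w) (X w)).
Proof.
move=> ia ma.
apply: (@le_rintegrable _ _ _ P _ (fun w => `|a true (X w)| + `|a false (X w)|)).
- exact: measurable_strata.
- by move=> w; case: (obsO w); rewrite ?lerDl ?lerDr.
- by apply: rintegrableD; [exact: (integrable_norm (ia true))|exact: (integrable_norm (ia false))].
Qed.

Lemma sq_integrable_strata a : (forall o, sq_integrable P (fun w => a o (X w))) ->
  (forall o, measurable_fun setT (a o)) ->
  sq_integrable P (fun w => a (obsO w) (X w)).
Proof.
move=> ia ma; split; first exact: measurable_strata.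
apply: (rintegrable_strata (a := fun o x => a o x ^+ 2)) => o; first by case: (ia o).
exact: measurable_funX.
Qed.

Lemma reweighting_stratum o (G : cov * (measurableTypeR R * measurableTypeR R) -> R) :
  measurable_fun setT G -> rintegrable P (fun w => G (covpot w)) ->
  \int[P]_w ((obsO w == o)%:R * G (covpot w)) = \int[P]_w (pi o (X w) * G (covpot w)).
Proof.
move=> mG iG; apply: (@signed_reweighting _ _ _ _ _ P _ _ (@covpot R p) 1 G) => //.
- by apply/measurable_EFinP; apply: measurable_eqb_fun; exact: measurable_obsO.
- exact: (measurable_fun_covX (mpi o)).
- exact: measurable_covpot.
- by move=> w; case: eqP => _; rewrite ?normr1 ?normr0.
- by move=> w; exact: (weight_norm_le1 c0 _ _ opi).
- exact: (tr_obs tP o).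
Qed.

Lemma reweighting_treatment d (G : cov * (measurableTypeR R * measurableTypeR R) -> R) :
  overlap_weights c e -> measurable_fun setT (e d) ->
  measurable_fun setT G -> rintegrable P (fun w => G (covpot w)) ->
  \int[P]_w ((~~ obsO w && (trtD w == d))%:R * G (covpot w)) =
  \int[P]_w (pi false (X w) * e d (X w) * G (covpot w)).
Proof.
move=> oe me mG iG; apply: (@signed_reweighting _ _ _ _ _ P _ _ (@covpot R p) 1 G) => //.
- by apply/measurable_EFinP; exact: measurable_stratum.
- exact: (measurable_fun_covX (measurable_funM (mpi false) me)).
- exact: measurable_covpot.
- by move=> w; case: (_ && _); rewrite ?normr1 ?normr0.
- move=> w; rewrite normrM -[leRHS]mulr1 ler_pM//.
    exact: (weight_norm_le1 c0 _ _ opi).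
  exact: (weight_norm_le1 c0 _ _ oe).
- exact: (tr_trt tP d).
Qed.

Lemma Rintegral_strata a : (forall o, rintegrable P (fun w => a o (X w))) ->
  (forall o, measurable_fun setT (a o)) ->
  \int[P]_w a (obsO w) (X w) =
  \int[P]_w (pi true (X w) * a true (X w) + pi false (X w) * a false (X w)).
Proof.
move=> ia ma.
have mb o : measurable_fun setT (fun w : full => (obsO w == o)%:R : R).
  by apply/measurable_EFinP; apply: measurable_eqb_fun; exact: measurable_obsO.
have ib o : rintegrable P (fun w => (obsO w == o)%:R * a o (X w)).
  apply: (rintegrableM_bounded (B := 1)) => // w.
  by case: eqP => _; rewrite ?normr1 ?normr0.
have ip o : rintegrable P (fun w => pi o (X w) * a o (X w)).
  apply: (rintegrableM_bounded (B := 1)) => //; first exact: (measurable_fun_covX (mpi o)).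
  by move=> w; exact: (weight_norm_le1 c0 _ _ opi).
rewrite RintegralDE//.
have H o : \int[P]_w (pi o (X w) * a o (X w)) = \int[P]_w ((obsO w == o)%:R * a o (X w)).
  rewrite -(@reweighting_stratum o (fun z => a o z.1))//.
  exact: (measurableT_comp (ma o) measurable_fst).
rewrite !H -RintegralDE//; apply: eq_RintegralT => w.
by case: (obsO w); rewrite mul1r mul0r ?addr0 ?add0r.
Qed.
End strata.

(** * Projection of a bounded function onto the admissible scores *)

Section tangent_projection.
Context (R : realType) (p : nat) (P : probability (full_data R p) R).
Local Notation full := (full_data R p).
Local Notation obs := (obs_data R p).
Local Notation cov := (covariates R p).
Local Notation X := (@covX R p).
Local Notation lam := (@lebesgue_measure R).
Variables (c : R) (pi e : bool -> cov -> R) (q : obs -> R).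
Hypotheses (c0 : 0 < c) (opi : overlap_weights c pi).
Hypotheses (mpi : forall o, measurable_fun setT (pi o)).
Hypotheses (tP : transfers P pi e) (dq : obs_density P q).
Variables (H : R) (h : obs -> R).
Hypotheses (mh : measurable_fun setT h) (hH : forall z, `|h z| <= H).

Let H0 : 0 <= H. Proof. exact: le_trans (normr_ge0 _) (hH point). Qed.

Let Hh0 z : 0 <= H + h z.
Proof. by have := hH z; rewrite ler_norml => /andP[? ?]; lra. Qed.

Let mHh o : measurable_fun setT
  (fun z : cov * measurableTypeR R => (H + h (z.1, o, z.2))%:E).
Proof.
apply/measurable_EFinP; apply: measurable_funD => //; apply: (measurableT_comp mh).
apply: measurable_fun_mk_pair; last exact: measurable_snd.
by apply: measurable_fun_mk_pair => //; exact: measurable_fst.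
Qed.

Let Hh0E o (z : cov * measurableTypeR R) : (0 <= (H + h (z.1, o, z.2))%:E)%E.
Proof. by rewrite lee_fin. Qed.

Let mmean o := fun x => ymean q o (fun z => (H + h (z.1, o, z.2))%:E) x.

(* E[h | X = x, O = o]; adding [H] makes the integrand nonnegative. *)
Definition stratum_mean (o : bool) (x : cov) : R := fine (mmean o x) - H.

Let mmean_ge0 o x : (0 <= mmean o x)%E.
Proof. exact: (ymean_ge0 dq). Qed.

Let mmean_le o x : (mmean o x <= (2 * H)%:E)%E.
Proof.
have H2 : (0 <= 2 * H)%R by rewrite mulr_ge0.
have m1 := @measurable_cst _ _ (cov * measurableTypeR R)%type _ setT (1%E : \bar R).
have E := @ymeanZ _ _ _ _ dq o (cst (2 * H)) (cst 1%E) x m1 (fun=> lee01) H2.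
apply: (@le_trans _ _ ((2 * H)%:E * ymean q o (cst 1) x)%E); last first.
  by rewrite -[leRHS]mule1 lee_wpmul2l ?lee_fin//; exact: (ymean1_le1 dq).
rewrite -E; apply: ge0_le_integral => //.
- by move=> y _; rewrite mule_ge0 ?lee_fin ?Hh0// (ydens_ge0 dq).
- apply: emeasurable_funM.
    by apply: (measurableT_comp (mHh o)); exact: measurable_pair1.
  apply/measurable_EFinP; apply: (measurableT_comp (measurable_ydens dq)).
  by apply: measurable_fun_mk_pair => //; exact: measurable_cst.
- apply: emeasurable_funM; first exact: (@measurable_cst _ _ _ _ setT ((2 * H)%:E * 1)%E).
  apply/measurable_EFinP; apply: (measurableT_comp (measurable_ydens dq)).
  by apply: measurable_fun_mk_pair => //; exact: measurable_cst.
- move=> y _; rewrite lee_wpmul2r ?lee_fin ?(ydens_ge0 dq)// mulr1 mulrDl mul1r lerD2l.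
  by rewrite (le_trans (ler_norm _)).
Qed.

Let mmeanE o x : mmean o x = (H + stratum_mean o x)%:E.
Proof.
rewrite /stratum_mean addrCA subrr addr0 fineK// ge0_fin_numE//.
by rewrite (le_lt_trans (mmean_le o x))// ltry.
Qed.

Lemma measurable_stratum_mean o : measurable_fun setT (stratum_mean o).
Proof.
apply: measurable_funB => //; apply: measurableT_comp => //.
exact: (measurable_ymean dq o (mHh o) (Hh0E o)).
Qed.

Lemma stratum_mean_bounded o x : `|stratum_mean o x| <= H.
Proof.
have := mmean_ge0 o x; have := mmean_le o x; rewrite !mmeanE !lee_fin => h1 h2.
by rewrite ler_norml; apply/andP; split; lra.
Qed.

(** The weights [H + h] and [H + stratum_mean] are nonnegative and, by disintegration, have equal
    integrals against nonnegative functions of (X, O); [signed_reweighting] extends this to [F], and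
    [H] cancels in the difference. *)
Lemma stratum_mean_orthogonal (F : bool -> cov -> R) :
  (forall o, measurable_fun setT (F o)) -> (forall o, rintegrable P (fun w => F o (X w))) ->
  \int[P]_w (F (obsO w) (X w) * (h (observe w) - stratum_mean (obsO w) (X w))) = 0.
Proof.
move=> mF iF; have iFO := rintegrable_strata iF mF.
have mS := measurable_strata measurable_stratum_mean.
have mho : measurable_fun setT (fun w : full => h (observe w)).
  by apply: (measurableT_comp mh); exact: measurable_observeT.
have mXO : measurable_fun setT (fun w : full => (X w, obsO w)).
  by apply: measurable_fun_mk_pair; [exact: measurable_covX|exact: measurable_obsO].
have key : \int[P]_w ((H + h (observe w)) * F (obsO w) (X w)) =
    \int[P]_w ((H + stratum_mean (obsO w) (X w)) * F (obsO w) (X w)).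
  apply: (@signed_reweighting _ _ _ _ _ P _ _ (fun w => (X w, obsO w)) (2 * H)
    (fun z => F z.2 z.1)) => //.
  - by apply: measurable_funD.
  - by apply: measurable_funD.
  - by move=> w; rewrite ger0_norm//; have := hH (observe w); rewrite ler_norml => /andP[? ?]; lra.
  - move=> w; have := stratum_mean_bounded (obsO w) (X w).
    by rewrite !ler_norml => /andP[? ?]; apply/andP; split; lra.
  - move=> G mG G0.
    have mGo : measurable_fun setT (fun z : obs => G z.1).
      exact: (measurableT_comp mG measurable_fst).
    have mHhz : measurable_fun setT (fun z : obs => (H + h z)%:E).
      by apply/measurable_EFinP; exact: measurable_funD.
    have mGH : measurable_fun setT (fun z : obs => (H + h z)%:E * G z.1)%E.
      exact: emeasurable_funM.
    have GH0 (z : obs) : (0 <= (H + h z)%:E * G z.1)%E.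
      by rewrite mule_ge0// lee_fin.
    have := obs_disintegration dq mGH GH0; rewrite /= => ->.
    apply: eq_integral => w _; rewrite -mmeanE /mmean /ymean muleC.
    rewrite -ge0_integralZl//.
    + by apply: eq_integral => y _; rewrite /= muleA (muleC (G _)).
    + apply: emeasurable_funM.
        by apply: (measurableT_comp (mHh (obsO w))); exact: measurable_pair1.
      apply/measurable_EFinP; apply: (measurableT_comp (measurable_ydens dq)).
      by apply: measurable_fun_mk_pair => //; exact: measurable_cst.
    + by move=> y _; rewrite mule_ge0 ?lee_fin ?Hh0// (ydens_ge0 dq).
  - rewrite (_ : (fun z : cov * bool => F z.2 z.1) =
        fun z => if z.2 then F true z.1 else F false z.1); last first.
      by apply/funext => -[x []].
    apply: measurable_fun_ifT; first exact: measurable_snd.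
      exact: (measurableT_comp (mF true) measurable_fst).
    exact: (measurableT_comp (mF false) measurable_fst).
have i1 : rintegrable P (fun w => (H + h (observe w)) * F (obsO w) (X w)).
  apply: (rintegrableM_bounded (B := 2 * H)) => //; first exact: measurable_funD.
  by move=> w; rewrite ger0_norm//; have := hH (observe w); rewrite ler_norml => /andP[? ?]; lra.
have i2 : rintegrable P (fun w => (H + stratum_mean (obsO w) (X w)) * F (obsO w) (X w)).
  apply: (rintegrableM_bounded (B := 2 * H)) => //; first exact: measurable_funD.
  move=> w; have := stratum_mean_bounded (obsO w) (X w).
  by rewrite !ler_norml => /andP[? ?]; apply/andP; split; lra.
transitivity (\int[P]_w ((H + h (observe w)) * F (obsO w) (X w) -
    (H + stratum_mean (obsO w) (X w)) * F (obsO w) (X w))).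
  by apply: eq_RintegralT => w; ring.
by rewrite RintegralBE// key subrr.
Qed.

Let Eh := \int[P]_w h (observe w).

(* [covariate_part] is E[h | X] - E[h]. *)
Definition covariate_part (x : cov) : R :=
  pi true x * stratum_mean true x + pi false x * stratum_mean false x - Eh.

(* The projection of [h] onto the scores of submodels along which the law of O
   given X is constant. *)
Definition projected_score (z : obs) : R :=
  h z - stratum_mean z.1.2 z.1.1 + covariate_part z.1.1.

Lemma measurable_covariate_part : measurable_fun setT covariate_part.
Proof.
apply: measurable_funB => //; apply: measurable_funD; apply: measurable_funM => //;
exact: measurable_stratum_mean.
Qed.

Lemma measurable_projected_score : measurable_fun setT projected_score.
Proof.
have m11 : measurable_fun setT (fun z : obs => z.1.1).
  exact: (measurableT_comp measurable_fst measurable_fst).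
apply: measurable_funD; last exact: (measurableT_comp measurable_covariate_part m11).
apply: measurable_funB => //.
rewrite (_ : (fun z : obs => stratum_mean z.1.2 z.1.1) =
    fun z : obs => if z.1.2 then stratum_mean true z.1.1 else stratum_mean false z.1.1); last first.
  by apply/funext => -[[x []] y].
apply: measurable_fun_ifT; first exact: (measurableT_comp measurable_snd measurable_fst).
  exact: (measurableT_comp (measurable_stratum_mean true) m11).
exact: (measurableT_comp (measurable_stratum_mean false) m11).
Qed.

Let mho : measurable_fun setT (fun w : full => h (observe w)).
Proof. by apply: (measurableT_comp mh); exact: measurable_observeT. Qed.

Let iho : rintegrable P (fun w => h (observe w)).
Proof. exact: (rintegrable_bounded _ mho (fun w => hH _)). Qed.

Let EhH : `|Eh| <= H.
Proof.
have ic (k : R) : rintegrable P (fun=> k) := rintegrable_cst P k.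
rewrite ler_norml; apply/andP; split.
  rewrite -[leLHS](Rintegral_cstE P); apply: Rintegral_le => [//|//|w].
  by have := hH (observe w); rewrite ler_norml => /andP[].
rewrite -[leRHS](Rintegral_cstE P); apply: Rintegral_le => [//|//|w].
by have := hH (observe w); rewrite ler_norml => /andP[].
Qed.

Let mix_bounded x : `|pi true x * stratum_mean true x + pi false x * stratum_mean false x| <= H.
Proof.
have p0 o : 0 <= pi o x by rewrite ltW// (weight_gt0 c0 _ _ opi).
have le o : `|pi o x * stratum_mean o x| <= pi o x * H.
  by rewrite normrM (ger0_norm (p0 o)) ler_wpM2l// stratum_mean_bounded.
rewrite -[leRHS]mul1r -(ow_sum opi x) mulrDl.
exact: le_trans (ler_normD _ _) (lerD (le true) (le false)).
Qed.

Lemma covariate_part_bounded x : `|covariate_part x| <= 4 * H.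
Proof.
apply: le_trans (ler_normB _ _) _; have := mix_bounded x; have := EhH; have := H0.
by move: `|_| `|_| => a b *; lra.
Qed.

(** One [H] for each of [h], its mean given (X, O), its mean given X and its mean. *)
Lemma projected_score_bounded z : `|projected_score z| <= 4 * H.
Proof.
have h1 := hH z; have h2 := stratum_mean_bounded z.1.2 z.1.1; have h3 := EhH.
have h4 := mix_bounded z.1.1; move: h1 h2 h3 h4.
rewrite /projected_score /covariate_part.
set a := h z; set b := stratum_mean _ _; set d := _ + pi false _ * _.
rewrite !ler_norml => /andP[? ?] /andP[? ?] /andP[? ?] /andP[? ?].
by apply/andP; split; lra.
Qed.

Lemma projected_score_centered : {ae P, forall w, forall o,
  ymean q o (fun z => (4 * H + projected_score (z.1, o, z.2))%:E) (X w) =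
  (4 * H + covariate_part (X w))%:E}.
Proof.
have := ae_ymean1 c0 opi mpi tP dq; apply: filterS => w h1 o; set x := X w in h1 *.
have mf : measurable_fun setT (fun y : measurableTypeR R => ydens q (x, o, y)).
  apply: (measurableT_comp (measurable_ydens dq)).
  by apply: measurable_fun_mk_pair => //; exact: measurable_cst.
have mhx : measurable_fun setT (fun y : measurableTypeR R => h (x, o, y)).
  by apply: (measurableT_comp mh); apply: measurable_fun_mk_pair => //; exact: measurable_cst.
have f0 y : 0 <= ydens q (x, o, y) by exact: (ydens_ge0 dq).
(* [4 H + projected_score] is split into [H + h] and a term that depends on [x] and [o] only; both
   are nonnegative. *)
have k0 : 0 <= 3 * H - stratum_mean o x + covariate_part x.
  have h2 := stratum_mean_bounded o x; have h3 := EhH.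
  have h4 := mix_bounded x; move: h2 h3 h4; rewrite /covariate_part.
  set b := stratum_mean o x; set d := _ + pi false _ * _.
  by rewrite !ler_norml => /andP[? ?] /andP[? ?] /andP[? ?]; lra.
have m2 : measurable_fun setT (fun y : measurableTypeR R => (H + h (x, o, y)) * ydens q (x, o, y)).
  by apply: measurable_funM => //; exact: measurable_funD.
have g0 y : 0 <= (H + h (x, o, y)) * ydens q (x, o, y) by rewrite mulr_ge0.
transitivity (\int[lam]_y (((3 * H - stratum_mean o x + covariate_part x)%:E *
    (ydens q (x, o, y))%:E) + ((H + h (x, o, y)) * ydens q (x, o, y))%:E))%E.
  rewrite /ymean; apply: eq_integral => y _; rewrite -!EFinM -EFinD; congr (_%:E).
  by rewrite /projected_score/=; ring.
rewrite ge0_integralD; last 5 first.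
- exact: measurableT.
- by move=> y _; rewrite mule_ge0 ?lee_fin.
- by apply: emeasurable_funM; [exact: measurable_cst|exact/measurable_EFinP].
- by move=> y _; rewrite lee_fin.
- exact/measurable_EFinP.
rewrite ge0_integralZl; last 4 first.
- exact: measurableT.
- exact/measurable_EFinP.
- by move=> y _; rewrite lee_fin.
- by rewrite lee_fin.
have -> : (\int[lam]_y (ydens q (x, o, y))%:E = 1)%E.
  by rewrite -(h1 o); apply: eq_integral => y _; rewrite mul1e.
have -> : (\int[lam]_y ((H + h (x, o, y)) * ydens q (x, o, y))%:E = (H + stratum_mean o x)%:E)%E.
  by rewrite -mmeanE; apply: eq_integral => y _; rewrite EFinM.
by rewrite mule1 -EFinD; congr (_%:E); ring.
Qed.

Let mSM := measurable_stratum_mean.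

Let iX (f : cov -> R) K : measurable_fun setT f -> (forall x, `|f x| <= K) ->
  rintegrable P (fun w => f (X w)).
Proof.
by move=> mf fK; apply: (rintegrable_bounded _ (B := K)) => //; exact: measurable_fun_covX.
Qed.

(* E[t(X) E[h | X, O]] = E[t(X) E[h | X]] *)
Lemma strata_covariate_part (t : cov -> R) : measurable_fun setT t ->
  rintegrable P (fun w => t (X w)) ->
  \int[P]_w (t (X w) * stratum_mean (obsO w) (X w)) =
  \int[P]_w (t (X w) * covariate_part (X w)) + Eh * \int[P]_w t (X w).
Proof.
move=> mt it.
have its o : rintegrable P (fun w => t (X w) * stratum_mean o (X w)).
  under eq_fun do rewrite mulrC.
  apply: (rintegrableM_bounded (B := H)) => //; first exact: (measurable_fun_covX (mSM o)).
  by move=> w; exact: stratum_mean_bounded.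
rewrite (Rintegral_strata c0 opi mpi tP (a := fun o x => t x * stratum_mean o x))//; last first.
  by move=> o; exact: measurable_funM.
have itc : rintegrable P (fun w => t (X w) * covariate_part (X w)).
  under eq_fun do rewrite mulrC.
  apply: (rintegrableM_bounded (B := 4 * H)) => //.
    exact: (measurable_fun_covX measurable_covariate_part).
  by move=> w; exact: covariate_part_bounded.
rewrite -RintegralZE// -RintegralDE//; last exact: rintegrableZ.
apply: eq_RintegralT => w; rewrite /covariate_part; move: Eh (t (X w)) => E tw.
by move: (pi true _) (pi false _) (stratum_mean true _) (stratum_mean false _) => *; ring.
Qed.

Lemma covariate_part_mean0 : \int[P]_w covariate_part (X w) = 0.
Proof.
have m1 : measurable_fun [set: cov] (fun=> 1 : R) by exact: measurable_cst.
have i1 : rintegrable P (fun=> 1 : R) := rintegrable_cst P 1.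
have E1 := strata_covariate_part m1 i1.
have E2 := stratum_mean_orthogonal (F := fun _ _ => 1) (fun=> m1) (fun=> i1).
have iS : rintegrable P (fun w => stratum_mean (obsO w) (X w)).
  by apply: rintegrable_strata => // o; apply: (iX (mSM o)) => x; exact: stratum_mean_bounded.
have E3 : \int[P]_w (h (observe w) - stratum_mean (obsO w) (X w)) = 0.
  by rewrite -[RHS]E2; apply: eq_RintegralT => w; rewrite mul1r.
have E4 : \int[P]_w stratum_mean (obsO w) (X w) = \int[P]_w covariate_part (X w) + Eh.
  move: E1; rewrite Rintegral_cstE mulr1.
  rewrite (eq_RintegralT _ (fun w => mul1r (stratum_mean (obsO w) (X w)))).
  by rewrite (eq_RintegralT _ (fun w => mul1r (covariate_part (X w)))).
by move: E3; rewrite RintegralBE// E4 -/Eh; lra.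
Qed.

Let sE w : projected_score (observe w) =
  (h (observe w) - stratum_mean (obsO w) (X w)) + covariate_part (X w).
Proof. by []. Qed.

(** Pythagoras: [h - projected_score] is the stratum mean minus [covariate_part], a function of (X,
    O) whose conditional mean given X is the constant E[h]. It is orthogonal to [h] minus its
    stratum mean, and to [covariate_part], which has mean 0. *)
Lemma projected_score_norm :
  \int[P]_w (projected_score (observe w) ^+ 2) <= \int[P]_w (h (observe w) ^+ 2).
Proof.
have mS := measurable_strata mSM.
have mC := measurable_fun_covX measurable_covariate_part.
have ms : measurable_fun setT (fun w : full => projected_score (observe w)).
  by apply: (measurableT_comp measurable_projected_score); exact: measurable_observeT.
have bS w : `|stratum_mean (obsO w) (X w)| <= H by exact: stratum_mean_bounded.
have bC w : `|covariate_part (X w)| <= 4 * H by exact: covariate_part_bounded.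
have s2 : sq_integrable P (fun w => projected_score (observe w)).
  by apply: (sq_integrable_bounded _ ms) => w; exact: projected_score_bounded.
have h2 : sq_integrable P (fun w => h (observe w)) by exact: (sq_integrable_bounded _ mho (fun w => hH _)).
have S2 := sq_integrable_bounded P mS bS.
have C2 := sq_integrable_bounded P mC bC.
pose F o x := stratum_mean o x - covariate_part x.
have mF o : measurable_fun setT (F o) by apply: measurable_funB; [exact: mSM|exact: measurable_covariate_part].
have iF o : rintegrable P (fun w => F o (X w)).
  apply: (iX (mF o) (K := H + 4 * H)) => x.
  by rewrite (le_trans (ler_normB _ _))// lerD ?stratum_mean_bounded ?covariate_part_bounded.
have O1 := stratum_mean_orthogonal mF iF.
have iC : rintegrable P (fun w => covariate_part (X w)) := sq_integrable_rintegrable C2.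
have O2 := strata_covariate_part measurable_covariate_part iC.
rewrite covariate_part_mean0 mulr0 addr0 in O2.
have iCS := sq_integrableM C2 S2; have iCC := sq_integrableM C2 C2.
have hS2 := sq_integrableB h2 S2.
have F2 : sq_integrable P (fun w => F (obsO w) (X w)) by exact: sq_integrableB.
have iFh := sq_integrableM F2 hS2.
have cross : \int[P]_w (projected_score (observe w) * (h (observe w) - projected_score (observe w))) = 0.
  transitivity (\int[P]_w (F (obsO w) (X w) * (h (observe w) - stratum_mean (obsO w) (X w)) +
      (covariate_part (X w) * stratum_mean (obsO w) (X w) - covariate_part (X w) * covariate_part (X w)))).
    by apply: eq_RintegralT => w; rewrite sE /F; ring.
  rewrite RintegralDE//; last exact: rintegrableB.
  by rewrite RintegralBE// O1 O2 subrr addr0.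
have d2 := sq_integrableB h2 s2; have id := sq_integrableM s2 d2.
have -> : \int[P]_w (h (observe w) ^+ 2) = \int[P]_w (projected_score (observe w) ^+ 2) +
    (2 * \int[P]_w (projected_score (observe w) * (h (observe w) - projected_score (observe w))) +
     \int[P]_w ((h (observe w) - projected_score (observe w)) ^+ 2)).
  rewrite -RintegralZE// -RintegralDE; [|exact: rintegrableZ|exact: d2.2].
  rewrite -RintegralDE; [|exact: s2.2|by apply: rintegrableD; [exact: rintegrableZ|exact: d2.2]].
  by apply: eq_RintegralT => w; ring.
rewrite cross mulr0 add0r lerDl; apply: Rintegral_ge0 => w _; exact: sqr_ge0.
Qed.

End tangent_projection.

Lemma eq_rintegrable d (T : measurableType d) (R : realType) (mu : {measure set T -> \bar R})
  (f g : T -> R) : f =1 g -> rintegrable mu f -> rintegrable mu g.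
Proof. by move=> /funext ->. Qed.

Lemma eq_sq_integrable d (T : measurableType d) (R : realType) (mu : {measure set T -> \bar R})
  (f g : T -> R) : f =1 g -> sq_integrable mu f -> sq_integrable mu g.
Proof. by move=> /funext ->. Qed.

Section cond_exp_swap.
Context (R : realType) (p : nat) (P : probability (full_data R p) R).
Local Notation full := (full_data R p).
Local Notation X := (@covX R p).

Lemma rintegrable_on (E : set full) (f : full -> R) : measurable E ->
  P.-integrable E (EFin \o f) -> rintegrable P (fun w => \1_E w * f w).
Proof.
move=> mE; rewrite integrable_mkcond// => h; rewrite /rintegrable.
rewrite (_ : EFin \o _ = (EFin \o f) \_ E)//; apply/funext => w.
by rewrite epatch_indic /= -EFinM mulrC.
Qed.

Lemma cond_exp_swap (E : set full) (f : full -> R) (m F : covariates R p -> R) (K : R) :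
  measurable E -> cond_exp P E f m -> measurable_fun setT F -> (forall x, `|F x| <= K) ->
  \int[P]_w (F (X w) * (\1_E w * f w)) = \int[P]_w (F (X w) * (\1_E w * m (X w))).
Proof.
move=> mE fm mF FK; have [mm fi mi _] := fm.
have mFX := measurable_fun_covX mF.
have i1 := rintegrableM_bounded mFX (fun w => FK _) (rintegrable_on mE fi).
have i2 := rintegrableM_bounded mFX (fun w => FK _) (rintegrable_on mE mi).
apply/eqP; rewrite -subr_eq0 -RintegralBE//.
have D w : F (X w) * (\1_E w * f w) - F (X w) * (\1_E w * m (X w)) =
    F (X w) * (\1_E w * (f w - m (X w))) by ring.
rewrite (eq_RintegralT _ D) (cond_exp_orthogonal mE fm mF)//.
exact: eq_rintegrable D (rintegrableB i1 i2).
Qed.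
End cond_exp_swap.

(** * Influence function, covariance with scores, variance decomposition *)

Section influence_function.
Context (R : realType) (p : nat) (P : probability (full_data R p) R).
Local Notation full := (full_data R p).
Local Notation obs := (obs_data R p).
Local Notation cov := (covariates R p).
Local Notation X := (@covX R p).
Local Notation unobs := [set w : full | obsO w = false].
Variables (c : R) (pi e : bool -> cov -> R) (q : obs -> R).
Variables (muT muC nu varT vart : cov -> R).
Hypotheses (c0 : 0 < c) (opi : overlap_weights c pi) (oe : overlap_weights c e).
Hypotheses (mpi : forall o, measurable_fun setT (pi o)).
Hypotheses (me : forall o, measurable_fun setT (e o)).
Hypotheses (tP : transfers P pi e) (mP : square_moments P).
Hypothesis hmuT : cond_exp P setT (@outY1 R p) muT.
Hypothesis hmuC : cond_exp P setT (@outY0 R p) muC.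
Hypothesis hnu : cond_exp P unobs (@tildeY R p) nu.
Hypothesis hvarT : cond_exp P setT (fun w => (outY1 w - muT (X w)) ^+ 2) varT.
Hypothesis hvart : cond_exp P unobs (fun w => (tildeY w - nu (X w)) ^+ 2) vart.

Let pi_gt0 o x : 0 < pi o x. Proof. exact: weight_gt0 opi. Qed.
Let e_gt0 o x : 0 < e o x. Proof. exact: weight_gt0 oe. Qed.
Let munobs : measurable unobs. Proof. exact: measurable_obsO_set. Qed.
Let mmuT : measurable_fun setT muT. Proof. by case: hmuT. Qed.
Let mmuC : measurable_fun setT muC. Proof. by case: hmuC. Qed.
Let mnu : measurable_fun setT nu. Proof. by case: hnu. Qed.
Let mvarT : measurable_fun setT varT. Proof. by case: hvarT. Qed.
Let mvart : measurable_fun setT vart. Proof. by case: hvart. Qed.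
Let mX (f : cov -> R) : measurable_fun setT f -> measurable_fun setT (fun w : full => f (X w)).
Proof. exact: measurable_fun_covX. Qed.

Let Y1_2 := sq_integrable_outY1 mP.
Let Y0_2 := sq_integrable_outY0 mP.
Let Y_2 := sq_integrable_outY mP.
Let Y1_1 := sq_integrable_rintegrable Y1_2.
Let Y0_1 := sq_integrable_rintegrable Y0_2.

Let indE (w : full) : \1_unobs w = (obsO w == false)%:R :> R.
Proof. exact: indic_eqb. Qed.

Let on_unobs (f : full -> R) : P.-integrable unobs (EFin \o f) ->
  rintegrable P (fun w => (obsO w == false)%:R * f w).
Proof. by move=> /(rintegrable_on munobs); apply: eq_rintegrable => w; rewrite indE. Qed.

(** [c] times the integral of [|f(X)|] is at most that of [pi false (X) |f(X)|], which [tr_obs]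
    identifies with the integral over the stratum O = 0. *)
Lemma rintegrable_of_stratum (f : cov -> R) : measurable_fun setT f ->
  rintegrable P (fun w => (obsO w == false)%:R * f (X w)) -> rintegrable P (fun w => f (X w)).
Proof.
move=> mf /integrableP[_ ioo].
apply/integrableP; split; first by apply/measurable_EFinP; exact: mX.
have mfE : measurable_fun setT (fun x => `|f x|%:E) by exact/measurable_EFinP/measurableT_comp.
have mG : measurable_fun setT
    (fun z : cov * (measurableTypeR R * measurableTypeR R) => `|f z.1|%:E).
  exact: (measurableT_comp mfE measurable_fst).
have G0 (z : cov * (measurableTypeR R * measurableTypeR R)) : (0 <= `|f z.1|%:E)%E.
  by rewrite lee_fin.
have mfXE := measurable_fun_covX mfE.
have : (c%:E * \int[P]_w `|f (X w)|%:E < +oo)%E.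
  apply: le_lt_trans ioo; rewrite -ge0_integralZl_EFin//; last exact: (ltW c0).
  apply: (@le_trans _ _ (\int[P]_w ((pi false (X w))%:E * `|f (X w)|%:E)))%E.
    apply: ge0_le_integral => //.
    - by move=> w _; rewrite mule_ge0// lee_fin// ltW.
    - exact: emeasurable_funM.
    - apply: emeasurable_funM => //; apply/measurable_EFinP; exact: mX.
    - by move=> w _; rewrite lee_wpmul2r ?lee_fin// (ow_ge opi).
  rewrite -(tr_obs tP false mG G0) le_eqVlt; apply/orP; left; apply/eqP.
  by apply: eq_integral => w _ /=; rewrite -EFinM normrM (ger0_norm (ler0n _ _)).
by rewrite -lte_pdivlMl// gt0_muley ?lte_fin ?invr_gt0//.
Qed.

(** No conditional Jensen inequality: the residual is square integrable by [hvarT], and [muT(X)] is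
    Y(1) minus the residual. *)
Let muT_2 : sq_integrable P (fun w => muT (X w)).
Proof.
have [_ i _ _] := hvarT.
have r2 : sq_integrable P (fun w => outY1 w - muT (X w)).
  split; last exact: i.
  by apply: measurable_funB; [exact: measurable_outY1|exact: (mX mmuT)].
by apply: eq_sq_integrable (sq_integrableB Y1_2 r2) => w; ring.
Qed.

Let unobs_residual : rintegrable P (fun w =>
  (obsO w == false)%:R * (tildeY w - nu (X w)) ^+ 2).
Proof.
by apply: on_unobs; case: hvart.
Qed.

Let mob o : measurable_fun setT (fun w : full => (obsO w == o)%:R : R).
Proof. by apply/measurable_EFinP; apply: measurable_eqb_fun; exact: measurable_obsO. Qed.

Let nu_2 : sq_integrable P (fun w => nu (X w)).
Proof.
split; first exact: (mX mnu).
apply: (@rintegrable_of_stratum (fun x => nu x ^+ 2)); first exact: measurable_funX.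
apply: (le_rintegrable (g := fun w => 2 * (outY w ^+ 2 + (obsO w == false)%:R * (tildeY w - nu (X w)) ^+ 2))).
- by apply: measurable_funM => //; apply: measurable_funX; exact: (mX mnu).
- move=> w; have := sqr_ge0 (outY w : R).
  rewrite /outY; case: (obsO w) => /= y0.
    by rewrite !mul0r addr0 normr0 mulr_ge0.
  rewrite !mul1r ger0_norm ?sqr_ge0//.
  (* With y for the outcome and n for [nu(X)]: [2 (y^2 + (y - n)^2) - n^2 = (2 y - n)^2]. *)
  by have := sqr_ge0 (2 * (tildeY w : R) - nu (X w)); rewrite !expr2; lra.
- by apply: rintegrableZ; apply: rintegrableD; [exact: (proj2 Y_2)|exact: unobs_residual].
Qed.

(** The regression of Y on X in the stratum O = o. On O = 1 the outcome is Y(1), whose regression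
    there is that of the whole population by unconfoundedness. *)
Definition mu_obs (o : bool) : cov -> R := if o then muT else nu.

Let mmu o : measurable_fun setT (mu_obs o). Proof. by case: o. Qed.
Let mu_2 o : sq_integrable P (fun w => mu_obs o (X w)). Proof. by case: o. Qed.

Definition residual (w : full) : R := outY w - mu_obs (obsO w) (X w).

Lemma sq_integrable_residual : sq_integrable P residual.
Proof. apply: sq_integrableB => //; exact: sq_integrable_strata. Qed.

Let residualE w : residual w =
  (obsO w == true)%:R * (outY1 w - muT (X w)) + (obsO w == false)%:R * (tildeY w - nu (X w)).
Proof.
by rewrite /residual /outY /mu_obs; case: (obsO w); rewrite /= ?mul1r ?mul0r ?addr0 ?add0r.
Qed.

(** On O = 0 this is the definition of [nu]. On O = 1 the indicator is first exchanged for
    [pi true], because [muT] is characterised on the whole population. *)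
Lemma residual_orthogonal (F : bool -> cov -> R) : (forall o, measurable_fun setT (F o)) ->
  (forall o, sq_integrable P (fun w => F o (X w))) ->
  \int[P]_w (F (obsO w) (X w) * residual w) = 0.
Proof.
move=> mF F2.
have r2 : sq_integrable P (fun w => outY1 w - muT (X w)) by exact: sq_integrableB.
have i1 := sq_integrableM (F2 true) r2.
have FX2 := sq_integrableM (sq_integrable_strata F2 mF) sq_integrable_residual.
have b1 o (w : full) : `|(obsO w == o)%:R : R| <= 1 by case: eqP; rewrite ?normr1 ?normr0.
have ia : rintegrable P (fun w => (obsO w == true)%:R * (F true (X w) * (outY1 w - muT (X w)))).
  exact: (rintegrableM_bounded (mob true) (b1 true)).
have ib : rintegrable P (fun w => F false (X w) * (\1_unobs w * (tildeY w - nu (X w)))).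
  apply: eq_rintegrable (rintegrableM_bounded (mob false) (b1 false) FX2) => w.
  rewrite indE residualE; case: (obsO w) => /=; ring.
transitivity (\int[P]_w ((obsO w == true)%:R * (F true (X w) * (outY1 w - muT (X w))) +
    F false (X w) * (\1_unobs w * (tildeY w - nu (X w))))).
  by apply: eq_RintegralT => w; rewrite indE residualE; case: (obsO w) => /=; ring.
rewrite RintegralDE// (cond_exp_orthogonal munobs hnu (mF false) ib) addr0.
pose G (z : cov * (measurableTypeR R * measurableTypeR R)) : R :=
  F true z.1 * (z.2.1 - muT z.1).
have mG : measurable_fun setT G.
  apply: measurable_funM; first exact: (measurableT_comp (mF true) measurable_fst).
  apply: measurable_funB; last exact: (measurableT_comp mmuT measurable_fst).
  exact: (measurableT_comp measurable_fst measurable_snd).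
have := reweighting_stratum c0 opi mpi tP true mG i1; rewrite /G/= => ->.
have E (w : full) : pi true (X w) * (F true (X w) * (outY1 w - muT (X w))) =
    (pi true (X w) * F true (X w)) * (\1_(@setT full) w * (outY1 w - muT (X w))).
  by rewrite indicT/=; ring.
rewrite (eq_RintegralT _ E).
apply: (cond_exp_orthogonal measurableT hmuT (F := fun x => pi true x * F true x)).
  exact: measurable_funM.
exact: eq_rintegrable E (rintegrableM_bounded (mX (mpi true)) (fun w => weight_norm_le1 c0 true _ opi) i1).
Qed.

(** The conditional treatment effect written with regressions of the observed outcome only;
    [effect_ate_ae] identifies it with [muT - muC]. *)
Definition effect (x : cov) : R := (muT x - nu x) / e false x.

Let Vb (m : bool -> cov -> R) d x : overlap_weights c m -> `|(m d x)^-1| <= c^-1.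
Proof.
move=> om; have m0 := weight_gt0 c0 d x om.
by rewrite gtr0_norm ?invr_gt0// lef_pV2// (ow_ge om).
Qed.

Let mV (f : cov -> R) : measurable_fun setT f -> measurable_fun setT (fun x => (f x)^-1).
Proof. exact: measurable_fun_inv. Qed.

Let meffect : measurable_fun setT effect.
Proof. by apply: measurable_funM; [exact: measurable_funB|exact: mV]. Qed.

Let effect_2 : sq_integrable P (fun w => effect (X w)).
Proof.
rewrite /effect; under eq_fun do rewrite mulrC.
apply: (sq_integrableM_bounded (B := c^-1)) => //; first exact: (mX (mV (me false))).
  by move=> w; exact: Vb.
exact: sq_integrableB.
Qed.

Local Notation omega := (ipw pi e).

Let momega o : measurable_fun setT (fun x => omega x o).
Proof.
apply: measurable_funM; last exact: mV.
by case: o; [exact: mV|apply: measurableT_comp => //; exact: mV].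
Qed.

Let omega_b x o : `|omega x o| <= c^-1 * c^-1. Proof. exact: (ipw_bounded c0 opi oe). Qed.
Let mom : measurable_fun setT (fun w : full => omega (X w) (obsO w)).
Proof. exact: (measurable_ipw mpi me). Qed.

Let omega_mu o : sq_integrable P (fun w => omega (X w) o * mu_obs o (X w)).
Proof. exact: (sq_integrableM_bounded (mX (momega o)) (fun w => omega_b _ _) (mu_2 o)). Qed.

Let omega_res_2 : sq_integrable P (fun w => omega (X w) (obsO w) * residual w).
Proof. exact: (sq_integrableM_bounded mom (fun w => omega_b _ _) sq_integrable_residual). Qed.

Let omega_mix x : pi true x * (omega x true * muT x) + pi false x * (omega x false * nu x) = effect x.
Proof. by rewrite /ipw /effect; field; rewrite !gt_eqF. Qed.

Lemma effect_mean : \int[P]_w effect (X w) = ate P.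
Proof.
rewrite (ate_ipw c0 opi oe mpi me tP mP).
have i1 := sq_integrable_rintegrable omega_res_2.
have mom_mu o : measurable_fun setT (fun x => omega x o * mu_obs o x) by exact: measurable_funM.
have i2 : rintegrable P (fun w => omega (X w) (obsO w) * mu_obs (obsO w) (X w)).
  apply: (rintegrable_strata (a := fun o x => omega x o * mu_obs o x)) => // o.
  exact: sq_integrable_rintegrable.
have -> : \int[P]_w (omega (X w) (obsO w) * outY w) =
    \int[P]_w (omega (X w) (obsO w) * residual w) +
    \int[P]_w (omega (X w) (obsO w) * mu_obs (obsO w) (X w)).
  by rewrite -RintegralDE//; apply: eq_RintegralT => w; rewrite /residual; ring.
rewrite (@residual_orthogonal (fun o x => omega x o)) ?add0r//; last first.
  by move=> o; apply: (sq_integrable_bounded _ (mX (momega o))) => w; exact: omega_b.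
rewrite (Rintegral_strata c0 opi mpi tP (a := fun o x => omega x o * mu_obs o x))//; last first.
  by move=> o; exact: sq_integrable_rintegrable.
by apply: eq_RintegralT => w; rewrite /mu_obs omega_mix.
Qed.

(** [Psi_cens] with its terms collected: because [e true + e false = 1], both residual weights are
    values of [ipw], and the terms free of the outcome combine to [effect]. *)
Definition influence (w : full) : R :=
  omega (X w) (obsO w) * residual w + (effect (X w) - ate P).

Let centered_2 : sq_integrable P (fun w => effect (X w) - ate P).
Proof.
apply: sq_integrableB => //; apply: (sq_integrable_bounded _ (B := `|ate P|)) => //.
Qed.

Lemma sq_integrable_influence : sq_integrable P influence.
Proof. exact: sq_integrableD. Qed.

Lemma Psi_cens_influence w :
  Psi_cens muT nu pi e (ate P) (observe w) = influence w.
Proof.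
rewrite /Psi_cens /influence /residual /mu_obs /effect /ipw/= -/(covX w).
have -> : e true (covX w) = 1 - e false (covX w) by have := ow_sum oe (covX w); lra.
by case: (obsO w) => /=; field; rewrite !gt_eqF.
Qed.

Section score_covariance.
Hypothesis dq : obs_density P q.
Variables (H : R) (h : obs -> R).
Hypotheses (mh : measurable_fun setT h) (hH : forall z, `|h z| <= H).

Local Notation sm := (stratum_mean q H h).
Local Notation cp := (covariate_part P pi q H h).

(** Both sides reduce to the integral of [omega residual h] plus that of [effect] times
    [covariate_part]. On the left Y is split into residual and regression: the residual and [h - sm]
    are orthogonal to functions of (X, O), and [omega] times the regression has conditional mean
    [effect] given X. On the right [effect - ate P] is orthogonal to [h - sm], and [covariate_part]
    has mean 0. *)
Lemma score_covariance :
  \int[P]_w (omega (X w) (obsO w) * outY w * projected_score P pi q H h (observe w)) =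
  \int[P]_w (influence w * h (observe w)).
Proof.
have mS := measurable_stratum_mean dq mh hH.
have bS := stratum_mean_bounded dq mh hH.
have mC := measurable_covariate_part mpi dq mh hH.
have bC := covariate_part_bounded c0 opi dq mh hH.
have mho : measurable_fun setT (fun w : full => h (observe w)).
  by apply: (measurableT_comp mh); exact: measurable_observeT.
have h2 : sq_integrable P (fun w => h (observe w)) by exact: (sq_integrable_bounded _ mho (fun w => hH _)).
have S2 : sq_integrable P (fun w => sm (obsO w) (X w)).
  by apply: (sq_integrable_bounded _ (measurable_strata mS)) => w; exact: bS.
have C2 : sq_integrable P (fun w => cp (X w)).
  by apply: (sq_integrable_bounded _ (mX mC)) => w; exact: bC.
have hS2 := sq_integrableB h2 S2.
pose F1 o x := omega x o * (sm o x - cp x).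
have mF1 o : measurable_fun setT (F1 o) by apply: measurable_funM => //; exact: measurable_funB.
have F1_2 o : sq_integrable P (fun w => F1 o (X w)).
  have So2 : sq_integrable P (fun w => sm o (X w)).
    by apply: (sq_integrable_bounded _ (mX (mS o))) => w; exact: bS.
  exact: (sq_integrableM_bounded (mX (momega o)) (fun w => omega_b _ _) (sq_integrableB So2 C2)).
pose F2 o x := omega x o * mu_obs o x.
have mF2 o : measurable_fun setT (F2 o) by exact: measurable_funM.
have F2_2 o : sq_integrable P (fun w => F2 o (X w)) by exact: omega_mu.
have F2_1 o := sq_integrable_rintegrable (F2_2 o).
pose F3 (o : bool) x := effect x - ate P.
have mF3 o : measurable_fun setT (F3 o) by exact: measurable_funB.
have F3_1 o : rintegrable P (fun w => F3 o (X w)) by exact: sq_integrable_rintegrable.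
have R1 := residual_orthogonal mF1 F1_2.
have O2 := stratum_mean_orthogonal dq mh hH mF2 F2_1.
have O3 := stratum_mean_orthogonal dq mh hH mF3 F3_1.
have E3 := strata_covariate_part c0 opi mpi tP dq mh hH (mF3 true) (F3_1 true).
have effect1 := sq_integrable_rintegrable effect_2.
have icst (k : R) : rintegrable P (fun=> k) := rintegrable_cst P k.
have ce0 : \int[P]_w (effect (X w) - ate P) = 0.
  by rewrite RintegralBE// Rintegral_cstE effect_mean subrr.
rewrite ce0 mulr0 addr0 in E3.
have iF1 := sq_integrableM (sq_integrable_strata F1_2 mF1) sq_integrable_residual.
have iF2 := sq_integrableM (sq_integrable_strata F2_2 mF2) hS2.
have iF2C o : rintegrable P (fun w => F2 o (X w) * cp (X w)) by exact: sq_integrableM.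
have E4 : \int[P]_w (F2 (obsO w) (X w) * cp (X w)) = \int[P]_w (effect (X w) * cp (X w)).
  rewrite (Rintegral_strata c0 opi mpi tP (a := fun o x => F2 o x * cp x))//; last first.
    by move=> o; exact: measurable_funM.
  by apply: eq_RintegralT => w; rewrite -omega_mix /F2 /mu_obs; ring.
have iF2C' : rintegrable P (fun w => F2 (obsO w) (X w) * cp (X w)).
  by apply: (rintegrable_strata (a := fun o x => F2 o x * cp x)) => // o; exact: measurable_funM.
have irh := sq_integrableM omega_res_2 h2.
have i3h := sq_integrableM centered_2 h2.
have i3hS := sq_integrableM centered_2 hS2.
have i3S := sq_integrableM centered_2 S2.
have i3C := sq_integrableM centered_2 C2.
have ieC := sq_integrableM effect_2 C2.
have C1 := sq_integrable_rintegrable C2.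
have L : \int[P]_w (omega (X w) (obsO w) * outY w * projected_score P pi q H h (observe w)) =
    \int[P]_w (omega (X w) (obsO w) * residual w * h (observe w)) +
    \int[P]_w (effect (X w) * cp (X w)).
  rewrite -E4 -[X in X + _]subr0 -R1 -RintegralBE// -[X in X + _]addr0 -O2.
  rewrite -RintegralDE//; last exact: rintegrableB.
  rewrite -RintegralDE//; last by apply: rintegrableD => //; exact: rintegrableB.
  apply: eq_RintegralT => w; rewrite /F1 /F2 /residual /projected_score/=.
  by rewrite -/(covX w); ring.
have Rr : \int[P]_w (influence w * h (observe w)) =
    \int[P]_w (omega (X w) (obsO w) * residual w * h (observe w)) +
    \int[P]_w ((effect (X w) - ate P) * h (observe w)).
  by rewrite -RintegralDE//; apply: eq_RintegralT => w; rewrite /influence; ring.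
rewrite L Rr; congr (_ + _).
have -> : \int[P]_w ((effect (X w) - ate P) * h (observe w)) =
    \int[P]_w ((effect (X w) - ate P) * (h (observe w) - sm (obsO w) (X w))) +
    \int[P]_w ((effect (X w) - ate P) * sm (obsO w) (X w)).
  by rewrite -RintegralDE//; apply: eq_RintegralT => w; ring.
rewrite O3 add0r E3 -[LHS]subr0 -[X in _ - X](mulr0 (ate P)).
rewrite -(covariate_part_mean0 c0 opi mpi tP dq mh hH) -RintegralZE// -RintegralBE//; last exact: rintegrableZ.
by apply: eq_RintegralT => w; rewrite /F3; ring.
Qed.
End score_covariance.

(** [e true muT + e false muC] is verified to be a version of E[tildeY | X, O = 0], so it equals
    [nu] almost surely on that stratum and then, by [ae_of_stratum], on the whole population.
    Substituted into [effect], it leaves [muT - muC]. *)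
Lemma effect_ate_ae : {ae P, forall w, effect (X w) = muT (X w) - muC (X w)}.
Proof.
have [_ iT imT HT] := hmuT; have [_ iC imC HC] := hmuC.
have imix : P.-integrable setT (fun w => (e true (X w) * muT (X w) + e false (X w) * muC (X w))%:E).
  have ie d (f : cov -> R) : P.-integrable setT (fun w => (f (X w))%:E) ->
      rintegrable P (fun w => e d (X w) * f (X w)).
    exact: (rintegrableM_bounded (mX (me d)) (fun w => weight_norm_le1 c0 d _ oe)).
  by apply: rintegrableD; exact: ie.
have mmix : measurable_fun setT (fun x => e true x * muT x + e false x * muC x).
  by apply: measurable_funD; exact: measurable_funM.
have hmix : cond_exp P unobs (@tildeY R p) (fun x => e true x * muT x + e false x * muC x).
  have [_ it _ _] := hnu; split => //; first exact: (integrableS measurableT munobs).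
  move=> A mA.
  have mXA : measurable (unobs `&` X @^-1` A).
    apply: measurableI => //; rewrite -[Y in measurable Y]setTI; exact: measurable_covX.
  pose E := unobs `&` X @^-1` A; rewrite -/E in mXA *.
  have iE (w : full) : \1_E w = (obsO w == false)%:R * \1_A (X w) :> R.
    by rewrite indicI/= indE.
  have m1A : measurable_fun setT (\1_A : cov -> R) by exact: measurable_indic.
  have b1A x : `|\1_A x : R| <= 1 by rewrite indicE; case: (_ \in _); rewrite ?normr1 ?normr0.
  have sE : E `<=` unobs by exact: subIsetl.
  have itE := rintegrable_on mXA (integrableS munobs mXA sE it).
  have imE := rintegrable_on mXA (integrableS measurableT mXA (@subsetT _ _) imix).
  rewrite [LHS](Rintegral_setE _ _ mXA) [RHS](Rintegral_setE _ _ mXA).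
  rewrite [LHS](REintegralE itE) [RHS](REintegralE imE); congr (_%:E).
  have mAz : measurable_fun setT (fun z : cov * (measurableTypeR R * measurableTypeR R) => \1_A z.1 : R).
    exact: (measurableT_comp m1A measurable_fst).
  pose G1 (z : cov * (measurableTypeR R * measurableTypeR R)) : R := \1_A z.1 * z.2.1.
  pose G0 (z : cov * (measurableTypeR R * measurableTypeR R)) : R := \1_A z.1 * z.2.2.
  have mG1 : measurable_fun setT G1.
    apply: measurable_funM => //; exact: (measurableT_comp measurable_fst measurable_snd).
  have mG0 : measurable_fun setT G0.
    apply: measurable_funM => //; exact: (measurableT_comp measurable_snd measurable_snd).
  have iG1 : rintegrable P (fun w => G1 (covpot w)).
    exact: (rintegrableM_bounded (mX m1A) (fun w => b1A _) Y1_1).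
  have iG0 : rintegrable P (fun w => G0 (covpot w)).
    exact: (rintegrableM_bounded (mX m1A) (fun w => b1A _) Y0_1).
  have ms d : measurable_fun setT (fun w : full => (~~ obsO w && (trtD w == d))%:R : R).
    by apply/measurable_EFinP; exact: measurable_stratum.
  have bs d (w : full) : `|(~~ obsO w && (trtD w == d))%:R : R| <= 1.
    by case: (_ && _); rewrite ?normr1 ?normr0.
  have is1 := rintegrableM_bounded (ms true) (bs true) iG1.
  have is0 := rintegrableM_bounded (ms false) (bs false) iG0.
  transitivity (\int[P]_w ((~~ obsO w && (trtD w == true))%:R * G1 (covpot w) +
      (~~ obsO w && (trtD w == false))%:R * G0 (covpot w))).
    apply: eq_RintegralT => w; rewrite iE /G1 /G0 /tildeY /=.
    by case: (obsO w); case: (trtD w) => /=; ring.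
  rewrite RintegralDE// (reweighting_treatment c0 opi mpi tP oe (me true) mG1 iG1).
  rewrite (reweighting_treatment c0 opi mpi tP oe (me false) mG0 iG0).
  pose F d x := pi false x * e d x * \1_A x.
  have mF d : measurable_fun setT (F d).
    by apply: measurable_funM => //; exact: measurable_funM.
  have bF d x : `|F d x| <= 1.
    rewrite !normrM -[leRHS]mulr1 ler_pM// -[leRHS]mulr1 ler_pM//.
      exact: (weight_norm_le1 c0 _ _ opi).
    exact: (weight_norm_le1 c0 _ _ oe).
  have E1 : \int[P]_w (pi false (X w) * e true (X w) * G1 (covpot w)) =
      \int[P]_w (F true (X w) * muT (X w)).
    have := cond_exp_swap measurableT hmuT (mF true) (bF true) => H.
    transitivity (\int[P]_w (F true (X w) * (\1_(@setT full) w * outY1 w))).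
      by apply: eq_RintegralT => w; rewrite indicT /F /G1 /=; ring.
    by rewrite H; apply: eq_RintegralT => w; rewrite indicT /= mul1r.
  have E0 : \int[P]_w (pi false (X w) * e false (X w) * G0 (covpot w)) =
      \int[P]_w (F false (X w) * muC (X w)).
    have := cond_exp_swap measurableT hmuC (mF false) (bF false) => H.
    transitivity (\int[P]_w (F false (X w) * (\1_(@setT full) w * outY0 w))).
      by apply: eq_RintegralT => w; rewrite indicT /F /G0 /=; ring.
    by rewrite H; apply: eq_RintegralT => w; rewrite indicT /= mul1r.
  rewrite E1 E0 -RintegralDE; last 2 first.
  - exact: (rintegrableM_bounded (mX (mF true)) (fun w => bF _ _) imT).
  - exact: (rintegrableM_bounded (mX (mF false)) (fun w => bF _ _) imC).
  pose G2 (z : cov * (measurableTypeR R * measurableTypeR R)) : R :=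
    \1_A z.1 * (e true z.1 * muT z.1 + e false z.1 * muC z.1).
  have mG2 : measurable_fun setT G2.
    by apply: measurable_funM => //; exact: (measurableT_comp mmix measurable_fst).
  have iG2 : rintegrable P (fun w => G2 (covpot w)).
    exact: (rintegrableM_bounded (mX m1A) (fun w => b1A _) imix).
  have := reweighting_stratum c0 opi mpi tP false mG2 iG2 => H2.
  transitivity (\int[P]_w (pi false (X w) * G2 (covpot w))).
    by apply: eq_RintegralT => w; rewrite /F /G2 /=; ring.
  by rewrite -H2; apply: eq_RintegralT => w; rewrite iE /G2 /=; ring.
have := cond_exp_unique munobs hnu hmix => h.
have : {ae P, forall w, [set x | nu x = e true x * muT x + e false x * muC x] (X w)}.
  apply: (ae_of_stratum c0 _ (cond_prob_of_transfers c0 opi mpi tP false) (fun x => ow_ge opi false x)).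
    exact: measurable_eq_set.
  exact: h.
apply: filterS => w /= hw; rewrite /effect hw.
have -> : e true (X w) = 1 - e false (X w) by have := ow_sum oe (X w); lra.
by field; rewrite gt_eqF.
Qed.

Let varT_1 : rintegrable P (fun w => varT (X w)). Proof. by case: hvarT. Qed.

Let vart_1 : rintegrable P (fun w => vart (X w)).
Proof.
apply: rintegrable_of_stratum => //; by apply: on_unobs; case: hvart.
Qed.

(** The cross term vanishes by [residual_orthogonal]. In the square of the first term, stratum O = o
    carries the weight [pi o] times the squared [ipw], that is [1 / (pi o * e false ^ 2)], and the
    squared residual is replaced by its conditional mean. *)
Lemma influence_variance :
  \int[P]_w (influence w ^+ 2) =
  \int[P]_w (varT (X w) / (pi true (X w) * e false (X w) ^+ 2) +
             vart (X w) / (e false (X w) ^+ 2 * pi false (X w)) + (effect (X w) - ate P) ^+ 2).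
Proof.
pose V1 x := varT x / (pi true x * e false x ^+ 2).
pose V0 x := vart x / (e false x ^+ 2 * pi false x).
pose k o x := (pi o x)^-1 * ((e false x)^-1 * (e false x)^-1).
have mk o : measurable_fun setT (k o) by apply: measurable_funM; [exact: mV|apply: measurable_funM; exact: mV].
have bk o x : `|k o x| <= c^-1 * (c^-1 * c^-1) by rewrite !normrM !ler_pM// ?mulr_ge0// Vb.
have V1E x : V1 x = k true x * varT x by rewrite /V1 /k; field; rewrite !gt_eqF.
have V0E x : V0 x = k false x * vart x by rewrite /V0 /k; field; rewrite !gt_eqF.
have iV1 : rintegrable P (fun w => V1 (X w)).
  apply: eq_rintegrable (rintegrableM_bounded (mX (mk true)) (fun w => bk _ _) varT_1) => w.
  by rewrite V1E.
have iV0 : rintegrable P (fun w => V0 (X w)).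
  apply: eq_rintegrable (rintegrableM_bounded (mX (mk false)) (fun w => bk _ _) vart_1) => w.
  by rewrite V0E.
pose F o x := omega x o * (effect x - ate P).
have mF o : measurable_fun setT (F o) by apply: measurable_funM => //; exact: measurable_funB.
have F2 o : sq_integrable P (fun w => F o (X w)).
  exact: (sq_integrableM_bounded (mX (momega o)) (fun w => omega_b _ _) centered_2).
have cross := residual_orthogonal mF F2.
have icross := sq_integrableM (sq_integrable_strata F2 mF) sq_integrable_residual.
have main : \int[P]_w ((omega (X w) (obsO w) * residual w) ^+ 2) =
    \int[P]_w (V1 (X w) + V0 (X w)).
  pose K o x := omega x o ^+ 2.
  have mK o : measurable_fun setT (K o) by exact: measurable_funX.
  have bK o x : `|K o x| <= (c^-1 * c^-1) ^+ 2.
    rewrite /K normrX lerXn2r// nnegrE//; exact: le_trans (normr_ge0 _) (omega_b x o).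
  have [_ iT _ _] := hvarT.
  pose G (z : cov * (measurableTypeR R * measurableTypeR R)) : R :=
    K true z.1 * (z.2.1 - muT z.1) ^+ 2.
  have mG : measurable_fun setT G.
    apply: measurable_funM; first exact: (measurableT_comp (mK true) measurable_fst).
    apply: measurable_funX; apply: measurable_funB; last exact: (measurableT_comp mmuT measurable_fst).
    exact: (measurableT_comp measurable_fst measurable_snd).
  have iG : rintegrable P (fun w => G (covpot w)).
    exact: (rintegrableM_bounded (mX (mK true)) (fun w => bK _ _) iT).
  have b1 o (w : full) : `|(obsO w == o)%:R : R| <= 1 by case: eqP; rewrite ?normr1 ?normr0.
  have ia := rintegrableM_bounded (mob true) (b1 true) iG.
  have ib := rintegrableM_bounded (mX (mK false)) (fun w => bK _ _) unobs_residual.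
  transitivity (\int[P]_w ((obsO w == true)%:R * G (covpot w) +
      K false (X w) * ((obsO w == false)%:R * (tildeY w - nu (X w)) ^+ 2))).
    by apply: eq_RintegralT => w; rewrite residualE /G /K; case: (obsO w) => /=; ring.
  rewrite RintegralDE// RintegralDE//; congr (_ + _).
    rewrite (reweighting_stratum c0 opi mpi tP true mG iG).
    have mL : measurable_fun setT (fun x => pi true x * K true x) by exact: measurable_funM.
    have bL x : `|pi true x * K true x| <= 1 * (c^-1 * c^-1) ^+ 2.
      by rewrite normrM ler_pM//; exact: (weight_norm_le1 c0 _ _ opi).
    transitivity (\int[P]_w (pi true (X w) * K true (X w) *
        (\1_(@setT full) w * (outY1 w - muT (X w)) ^+ 2))).
      by apply: eq_RintegralT => w; rewrite indicT /G /=; ring.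
    rewrite (cond_exp_swap measurableT hvarT mL bL); apply: eq_RintegralT => w.
    by rewrite indicT /= V1E /k /K /ipw; field; rewrite !gt_eqF.
  transitivity (\int[P]_w (K false (X w) * (\1_unobs w * (tildeY w - nu (X w)) ^+ 2))).
    by apply: eq_RintegralT => w; rewrite indE.
  rewrite (cond_exp_swap munobs hvart (mK false) (bK false)).
  pose G2 (z : cov * (measurableTypeR R * measurableTypeR R)) : R := K false z.1 * vart z.1.
  have mG2 : measurable_fun setT G2.
    exact: (measurableT_comp (measurable_funM (mK false) mvart) measurable_fst).
  have iG2 : rintegrable P (fun w => G2 (covpot w)).
    exact: (rintegrableM_bounded (mX (mK false)) (fun w => bK _ _) vart_1).
  transitivity (\int[P]_w ((obsO w == false)%:R * G2 (covpot w))).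
    by apply: eq_RintegralT => w; rewrite indE /G2 /=; ring.
  rewrite (reweighting_stratum c0 opi mpi tP false mG2 iG2); apply: eq_RintegralT => w.
  by rewrite /G2 /= V0E /k /K /ipw; field; rewrite !gt_eqF.
have i2 := omega_res_2.2; have i3 := centered_2.2.
have iVV := rintegrableD iV1 iV0.
rewrite RintegralDE// -main -[X in _ = X + _]addr0 -[X in _ + X + _](mulr0 2) -cross.
rewrite -RintegralZE// -RintegralDE//; last exact: rintegrableZ.
rewrite -RintegralDE//; last by apply: rintegrableD => //; exact: rintegrableZ.
by apply: eq_RintegralT => w; rewrite /influence /F; ring.
Qed.

Lemma rintegrable_decomposition : rintegrable P (fun w =>
  varT (X w) / (pi true (X w) * e false (X w) ^+ 2) +
  vart (X w) / (e false (X w) ^+ 2 * pi false (X w)) + (effect (X w) - ate P) ^+ 2).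
Proof.
apply: rintegrableD; last exact: centered_2.2.
have e2 : measurable_fun setT (fun x => e false x ^+ 2) by exact: measurable_funX.
have b2 x : c ^+ 2 <= e false x ^+ 2 by rewrite lerXn2r ?nnegrE ?(ltW c0) ?(ltW (e_gt0 _ _)) ?(ow_ge oe).
have key o x : `|(pi o x * e false x ^+ 2)^-1| <= (c * c ^+ 2)^-1.
  rewrite gtr0_norm ?invr_gt0 ?mulr_gt0 ?exprn_gt0// lef_pV2 ?posrE ?mulr_gt0 ?exprn_gt0//.
  by rewrite ler_pM ?(ltW c0) ?sqr_ge0// (ow_ge opi).
have mk o : measurable_fun setT (fun x => (pi o x * e false x ^+ 2)^-1).
  by apply: mV; exact: measurable_funM.
apply: rintegrableD.
  apply: eq_rintegrable (rintegrableM_bounded (mX (mk true)) (fun w => key _ _) varT_1) => w.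
  by rewrite mulrC.
apply: eq_rintegrable (rintegrableM_bounded (mX (mk false)) (fun w => key _ _) vart_1) => w.
by rewrite mulrC [X in _ / X]mulrC.
Qed.

End influence_function.

Lemma measurable_Psi_cens (R : realType) (p : nat) (muT nu : covariates R p -> R)
    (pi g : bool -> covariates R p -> R) (tau : R) :
  measurable_fun setT muT -> measurable_fun setT nu ->
  (forall o, measurable_fun setT (pi o)) -> (forall d, measurable_fun setT (g d)) ->
  measurable_fun setT (Psi_cens muT nu pi g tau).
Proof.
move=> mmu mnu mpi mg.
have mX (f : covariates R p -> R) : measurable_fun setT f ->
    measurable_fun setT (fun z : obs_data R p => f z.1.1).
  by move=> mf; apply: (measurableT_comp mf); exact: (measurableT_comp measurable_fst measurable_fst).
have mV (f : covariates R p -> R) : measurable_fun setT f ->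
    measurable_fun setT (fun z : obs_data R p => (f z.1.1)^-1).
  by move=> mf; apply: measurable_fun_inv; exact: mX.
have mo : measurable_fun setT (fun z : obs_data R p => z.1.2).
  exact: (measurableT_comp measurable_snd measurable_fst).
have mob : measurable_fun setT (fun z : obs_data R p => z.1.2%:R : R) by exact: measurable_bool_natr.
have mnob : measurable_fun setT (fun z : obs_data R p => (~~ z.1.2)%:R : R).
  by apply: measurable_bool_natr; exact: measurableT_comp.
have my (f : covariates R p -> R) : measurable_fun setT f ->
    measurable_fun setT (fun z : obs_data R p => (z.2 : R) - f z.1.1).
  by move=> mf; apply: measurable_funB; [exact: measurable_snd|exact: mX].
have mgp d o : measurable_fun setT (fun z : obs_data R p => (g d z.1.1 * pi o z.1.1)^-1).
  by apply: measurable_fun_inv; apply: measurable_funM; exact: mX.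
have mmy := my _ mmu; have mny := my _ mnu.
have mg1 := mX _ (mg true); have mg0V := mV _ (mg false); have mp1V := mV _ (mpi true).
have mmX := mX _ mmu; have mnX := mX _ mnu.
apply: measurable_funB; last exact: measurable_cst.
apply: measurable_funD; last by apply: measurable_funM => //; exact: measurable_funM.
apply: measurable_funB; last exact: measurable_funM.
apply: measurable_funD => //.
apply: measurable_funD.
  apply: measurable_funB; apply: measurable_funM => //; exact: measurable_funM.
by apply: measurable_funM => //; apply: measurable_funM => //; exact: measurable_funM.
Qed.

(** * Removal of the truncation and conclusion *)

Section truncation.
Context d (T : measurableType d) (R : realType) (mu : {measure set T -> \bar R}).

(** Monotone convergence. Values beyond [k] are set to 0 and not clipped to [k], so that the product
    of [f] with its truncation is the square of the truncation. *)
Lemma le_integral_truncations (f : T -> R) (v : R) : measurable_fun setT f ->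
  (forall k : nat, (\int[mu]_x ((if `|f x| <= k%:R then f x else 0) ^+ 2)%:E <= v%:E)%E) ->
  (\int[mu]_x (f x ^+ 2)%:E <= v%:E)%E.
Proof.
move=> mf H.
pose g k x : \bar R := ((if `|f x| <= k%:R then f x else 0) ^+ 2)%:E.
have mg k : measurable_fun setT (g k).
  apply/measurable_EFinP; apply: measurable_funX; apply: measurable_fun_ifT => //.
  by apply: measurable_fun_ler => //; exact: measurableT_comp.
have g0 k x : setT x -> (0 <= g k x)%E by move=> _; rewrite lee_fin sqr_ge0.
have ndg x : setT x -> {homo g^~ x : n m / (n <= m)%N >-> (n <= m)%E}.
  move=> _ n m nm; rewrite lee_fin; case: ifPn => [fn|_].
    by rewrite ifT// (le_trans fn)// ler_nat.
  by rewrite expr0n sqr_ge0.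
have limE x : limn (g^~ x) = (f x ^+ 2)%:E.
  apply: cvg_lim => //; apply: cvg_near_cst; near=> k.
  rewrite /g ifT//; near: k; exact: nbhs_infty_ger.
have := @cvg_monotone_convergence _ _ _ mu setT measurableT g mg g0 ndg.
rewrite (eq_integral (fun x => (f x ^+ 2)%:E)); last by move=> x _; exact: limE.
move=> C; apply: (@cvge_to_le _ _ _ _ _ _ _ C); exact: nearW.
Unshelve. all: by end_near.
Qed.
End truncation.

Theorem theorem4p2 (R : realType) (p : nat) (Xs : set (covariates R p))
    (mXs : measurable Xs) (P0 : probability (full_data R p) R)
    (zeta0 zetaT0 : covariates R p -> R)
    (pi0 g0 : bool -> covariates R p -> R)
    (muT0 muC0 nu0 varT0 vartilde0 : covariates R p -> R) (c : R)
    (hsetting : censoring_setting Xs P0 zeta0 zetaT0 pi0 g0)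
    (hunconf : unconfounded P0)
    (hsupport : common_support Xs zeta0 zetaT0 pi0 g0 c)
    (hmuT : cond_exp P0 setT (@outY1 R p) muT0)
    (hmuC : cond_exp P0 setT (@outY0 R p) muC0)
    (hnu : cond_exp P0 [set w | obsO w = false] (@tildeY R p) nu0)
    (hvarT : cond_exp P0 setT
               (fun w => (outY1 w - muT0 (covX w)) ^+ 2) varT0)
    (hvartilde : cond_exp P0 [set w | obsO w = false]
               (fun w => (tildeY w - nu0 (covX w)) ^+ 2) vartilde0) :
  let tau0 : R := ate P0 in
  let Vcens : \bar R :=
    (\int[P0]_w ((Psi_cens muT0 nu0 pi0 g0 tau0 (observe w)) ^+ 2)%:E)%E in
  (forall (T : forall n : nat, n.-tuple (obs_data R p) -> R)
          (L : probability (measurableTypeR R) R),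
     regular_estimator Xs g0 P0 T L -> (Vcens <= 'V_L[idfun])%E) /\
  Vcens =
    (\int[P0]_w
       (var_decomp muT0 muC0 varT0 vartilde0 pi0 g0 tau0 (covX w))%:E)%E.
Proof.
move=> tau0 Vcens.
have [c0 _] := hsupport.
pose pi := clamp c pi0; pose e := clamp c g0.
have mpi0 o : measurable_fun setT (pi0 o) by case: (Defs.piP hsetting o).
have mg0 o : measurable_fun setT (g0 o) by case: (Defs.gP hsetting o).
have mpi o : measurable_fun setT (pi o) := measurable_clamp c o (mpi0 true).
have me o : measurable_fun setT (e o) := measurable_clamp c o (mg0 true).
have opi : overlap_weights c pi := overlap_clamp mXs hsetting hsupport pi0.
have oe : overlap_weights c e := overlap_clamp mXs hsetting hsupport g0.
have tP : transfers P0 pi e := transfers_clamp mXs hsetting hunconf hsupport.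
have mP : square_moments P0.
  by split; [exact: square_integrable1 hsetting|exact: square_integrable0 hsetting].
have [mmuT _ _ _] := hmuT; have [mmuC _ _ _] := hmuC; have [mnu _ _ _] := hnu.
have [mvT _ _ _] := hvarT; have [mvt _ _ _] := hvartilde.
have ae_pi : {ae P0, forall w, forall o, pi0 o (covX w) = pi o (covX w)}.
  exact: ae_pi_clamp mXs hsetting hsupport.
have ae_g : {ae P0, forall w, forall d, g0 d (covX w) = e d (covX w)}.
  exact: ae_g_clamp mXs hsetting hsupport.
have piE : clamp c pi0 = pi by []. have eE : clamp c g0 = e by []. clearbody pi e.
pose psi := Psi_cens muT0 nu0 pi e tau0.
have mpsi : measurable_fun setT psi by exact: measurable_Psi_cens.
have mpsiO : measurable_fun setT (fun w : full_data R p => psi (observe w)).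
  by apply: (measurableT_comp mpsi); exact: measurable_observeT.
have psiE w : psi (observe w) = influence P0 pi e muT0 nu0 w by exact: (Psi_cens_influence P0 muT0 nu0 c0 opi oe w).
have inf2 := sq_integrable_influence c0 opi oe mpi me tP mP hmuT hnu hvarT hvartilde.
have mcov (f : covariates R p -> R) : measurable_fun setT f ->
    measurable_fun setT (fun w : full_data R p => f (covX w)).
  exact: measurable_fun_covX.
(* The given versions agree with the clamped weights only almost surely, which is enough under the
   integral. *)
have VE : Vcens = (\int[P0]_w (psi (observe w) ^+ 2)%:E)%E.
  apply: ae_eq_integral => //.
  - apply/measurable_EFinP; apply: measurable_funX.
    have mPsi := measurable_Psi_cens tau0 mmuT mnu mpi0 mg0.
    by apply: (measurableT_comp mPsi); exact: measurable_observeT.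
  - by apply/measurable_EFinP; exact: measurable_funX.
  - move: ae_pi ae_g; apply: filterS2 => w hpi hg _.
    by rewrite /psi /Psi_cens /= !hpi !hg.
split.
- move=> T L hT; rewrite VE.
  have V0 : (0 <= 'V_L[idfun])%E by exact: variance_ge0.
  have [Voo|] := ltP ('V_L[idfun])%E +oo%E; last by apply: le_trans; rewrite leey.
  have Vfin : ('V_L[idfun])%E = (fine 'V_L[idfun])%:E by rewrite fineK// ge0_fin_numE.
  rewrite Vfin; set v := fine _; have v0 : 0 <= v by exact: fine_ge0.
  have [q dq] := has_obs_density hsetting.
  apply: le_integral_truncations => // k.
  pose h z := if `|psi z| <= k%:R then psi z else 0.
  have mh : measurable_fun setT h.
    apply: measurable_fun_ifT => //.
    by apply: measurable_fun_ler => //; exact: measurableT_comp.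
  have hk z : `|h z| <= k%:R by rewrite /h; case: ifPn => // _; rewrite normr0.
  have mhO : measurable_fun setT (fun w : full_data R p => h (observe w)).
    by apply: (measurableT_comp mh); exact: measurable_observeT.
  have h2 : sq_integrable P0 (fun w => h (observe w)).
    by apply: (sq_integrable_bounded _ mhO) => w; exact: hk.
  rewrite (REintegralE h2.2) lee_fin.
  have cov := score_covariance c0 opi oe mpi me tP mP hmuT hnu hvarT hvartilde dq mh hk.
  have norm := projected_score_norm c0 opi mpi tP dq mh hk.
  have bound := regular_variance_bound mXs hsetting hunconf hsupport dq
    (measurable_projected_score mpi dq mh hk) (measurable_covariate_part mpi dq mh hk)
    (projected_score_bounded c0 opi dq mh hk) (covariate_part_bounded c0 opi dq mh hk)
    (projected_score_centered c0 opi mpi tP dq mh hk)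
    (covariate_part_mean0 c0 opi mpi tP dq mh hk) hT Voo.
  (* [h] is either the influence function or 0, so its covariance with the influence function is its
     own second moment [Vk]. The variance bound then reads [Vk^2 <= v Vk]. *)
  have E : \int[P0]_w (influence P0 pi e muT0 nu0 w * h (observe w)) =
      \int[P0]_w (h (observe w) ^+ 2).
    apply: eq_RintegralT => w; rewrite -psiE /h.
    by case: ifP => _; rewrite ?expr2 ?mulr0// mul0r.
  rewrite piE eE cov E in bound; set Vk := \int[P0]_w (h (observe w) ^+ 2) in norm bound *.
  have Vk0 : 0 <= Vk by apply: Rintegral_ge0 => w _; exact: sqr_ge0.
  have le : Vk ^+ 2 <= v * Vk by apply: le_trans bound _; rewrite ler_wpM2l.
  have [->//|Vkn] := eqVneq Vk 0.
  by rewrite -(ler_pM2r (x := Vk)) ?lt_neqAle 1?eq_sym ?Vkn// -expr2.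
- rewrite VE.
  transitivity (\int[P0]_w (influence P0 pi e muT0 nu0 w ^+ 2)%:E)%E.
    by apply: eq_integral => w _; rewrite psiE.
  rewrite (REintegralE inf2.2).
  rewrite (influence_variance c0 opi oe mpi me tP mP hmuT hnu hvarT hvartilde).
  have idec := rintegrable_decomposition c0 opi oe mpi me tP mP hmuT hnu hvarT hvartilde.
  rewrite -(REintegralE idec); apply: ae_eq_integral => //.
  - by move: idec => /rintegrable_measurable /measurable_EFinP.
  - have mV (f : covariates R p -> R) := @measurable_fun_inv _ _ R f.
    have mvd : measurable_fun setT (var_decomp muT0 muC0 varT0 vartilde0 pi0 g0 tau0).
      apply: measurable_funD; last first.
        by apply: measurable_funX; apply: measurable_funB => //; exact: measurable_funB.
      apply: measurable_funD.
        apply: measurable_funM; last exact: mV.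
        apply: measurable_funM => //; apply: measurable_funX; apply: measurable_funD => //.
        by apply: measurable_funM => //; exact: mV.
      by apply: measurable_funM => //; apply: mV; apply: measurable_funM => //; exact: measurable_funX.
    by apply/measurable_EFinP; exact: mcov.
  - have := effect_ate_ae c0 opi oe mpi me tP mP hmuT hmuC hnu.
    move: ae_pi ae_g; apply: filterS3 => w hpi hg heff _; congr (_%:E).
    rewrite /var_decomp !hpi !hg heff.
    have p1 := weight_gt0 c0 true (covX w) opi; have e0 := weight_gt0 c0 false (covX w) oe.
    have p0 := weight_gt0 c0 false (covX w) opi.
    have se : e true (covX w) = 1 - e false (covX w) by have := ow_sum oe (covX w); lra.
    (* With e1 = 1 - e0 the factor 1 + e1 / e0 is 1 / e0, which matches the first term of
       [influence_variance]; the other two terms agree already. *)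
    rewrite se; congr (_ + _ + _).
    by field; rewrite !gt_eqF.
Qed.
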